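(* Let $\gamma\in(0,1]$ and let $k$ be an admissible kernel which is homogeneous of order $\theta-1$ for some $\theta>0$, i.e. $k(t,ts)=t^{\theta-1}k(1,s)$ for all $t\in(0,\infty)$, $s\in(0,1)$, and whose associated function $\Phi$ satisfies the complete monotonicity assumption (terms defined in the context). Let $\mathcal{A}:=A^{1/\gamma}\eta_1$, where $A$ is a nonnegative random variable with $\mathbb{E}[e^{-\lambda A}]=\Phi(1,-\lambda)$ for all $\lambda\in\mathbb{C}$, $\mathrm{Re}\,\lambda\ge0$, and $(\eta_t)_{t\ge0}$ is a $\gamma$-stable subordinator, $\mathbb{E}[e^{-\lambda\eta_t}]=e^{-t\lambda^\gamma}$ for $\lambda\ge0$, independent of $A$. Assume $w\in\mathbb{R}$, $c\le0$, and that $\sigma\in C^2(\mathbb{R})$ is a bounded function with bounded first and second derivatives. Consider the linear operator $(L_{(\sigma,w)},\mathrm{Dom}(L_{(\sigma,w)}))$ in $C_\infty(\mathbb{R})$ defined by $$L_{(\sigma,w)}\varphi(x):=\frac{\sigma^2(x)}{2}\varphi''(x)+\left(w+\tfrac12\sigma'(x)\right)\sigma(x)\varphi'(x),\qquad \mathrm{Dom}(L_{(\sigma,w)}):=\left\{\varphi\in C^2(\mathbb{R}):\ \varphi,\,L_{(\sigma,w)}\varphi\in C_\infty(\mathbb{R})\right\}.$$ Let $u_0\in\mathrm{Dom}(L_{(\sigma,w)})$ and let $g_\sigma:\mathbb{R}\times\mathbb{R}\to\mathbb{R}$ be the solution to the parametrized family of ODEs $$\frac{\partial}{\partial y}g_\sigma(y,x)=\sigma(g_\sigma(y,x)),\qquad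 g_\sigma(0,x)=x.$$ Let $(B_t)_{t\ge0}$ be a standard one-dimensional Brownian motion independent of $\mathcal{A}$. Let either $X_t:=B_{\mathcal{A}t^{\theta/\gamma}}$, or $X_t:=\sqrt{\mathcal{A}}\,B_{t^{\theta/\gamma}}$, or, if $H:=\frac{\theta}{2\gamma}\in(0,1)$, $X_t:=\sqrt{\mathcal{A}}\,B^H_t$, where $(B^H_t)_{t\ge0}$ is a one-dimensional fractional Brownian motion with Hurst parameter $H$ independent of $\mathcal{A}$. Then $$u(t,x)=\mathbb{E}\left[u_0\left(g_\sigma\left(X_t+w\mathcal{A}t^{\theta/\gamma},x\right)\right)e^{c\mathcal{A}t^{\theta/\gamma}}\right]=\mathbb{E}\left[u_0\left(g_\sigma\left(X_t,x\right)\right)e^{\mathcal{A}t^{\theta/\gamma}\left(c-\frac{w^2}{2}\right)+wX_t}\right]$$ (in particular the two expressions coincide) solves the evolution equation $$u(t,x)=u_0(x)-\int_0^tk(t,s)\left(-L_{(\sigma,w)}-c\right)^\gamma u(s,x)\,ds,\qquad t>0,\ x\in\mathbb{R}.$$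
   Context: Admissible kernel: a Borel-measurable function $k:(0,\infty)\times(0,\infty)\to\mathbb{R}$ for which there exist $\alpha^*\in[0,1)$ and $\varepsilon>0$ such that for each $T>0$ $$\sup_{0<t\le T} t^{\alpha^*-\frac{1}{1+\varepsilon}}\,\|k(t,\cdot)\|_{L^{1+\varepsilon}((0,t))}<\infty .$$ Associated function $\Phi:[0,\infty)\times\mathbb{C}\to\mathbb{C}$: $\Phi(t,\lambda):=\sum_{n=0}^\infty c_n(t)\lambda^n$, where $c_0(t):=1$ for all $t\ge0$ and, for $n\in\mathbb{N}$, $c_n(t):=\int_0^t k(t,s)c_{n-1}(s)\,ds$ for $t>0$ and $c_n(0):=0$. (For an admissible kernel it is known that these integrals exist and that $\Phi(t,\cdot)$ is entire for each $t\ge 0$.) Complete monotonicity assumption: for every $t\ge0$ the function $\lambda\mapsto\Phi(t,-\lambda)$ is completely monotone on $(0,\infty)$; i.e. for each $t\ge0$ there is a nonnegative random variable $A(t)$ whose distribution $\mathcal{P}_{A(t)}$ satisfies $\int_0^\infty e^{-\lambda a}\,\mathcal{P}_{A(t)}(da)=\Phi(t,-\lambda)$ for all $\lambda\in\mathbb{C}$ with $\mathrm{Re}\,\lambda\ge0$. $C_\infty(\mathbb{R})$ is the Banach space (supremum norm) of continuous functions $\mathbb{R}\to\mathbb{R}$ vanishing at infinity. A one-dimensional fractional Brownian motion $(B^H_t)_{t\ge0}$ with Hurst parameter $H\in(0,1)$ is a centered Gaussian process with $\mathbb{E}[B^H_tB^H_s]=\frac12(t^{2H}+s^{2H}-|t-s|^{2H})$.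 Fractional power: let $(T_t)_{t\ge0}$ be the strongly continuous contraction semigroup on $C_\infty(\mathbb{R})$ generated by $L:=L_{(\sigma,w)}+c$ (by its closure, if $L$ is not closed). Then $-(-L_{(\sigma,w)}-c)^\gamma$ denotes the generator of the semigroup $T^{f}_t\varphi:=\int_0^\infty T_s\varphi\,\mathcal{P}_{\eta_t}(ds)$ subordinate to $(T_t)_{t\ge0}$ with Bernstein function $f(\lambda)=\lambda^\gamma$, where $\mathcal{P}_{\eta_t}$ is the distribution of $\eta_t$ with $\mathbb{E}[e^{-\lambda\eta_t}]=e^{-t\lambda^\gamma}$. For $\gamma=1$, $\eta_t=t$ and this is $L_{(\sigma,w)}+c$ itself (its closure); for $\gamma\in(0,1)$ it is the closure of $\varphi\mapsto\frac{\gamma}{\Gamma(1-\gamma)}\int_0^\infty(T_s\varphi-\varphi)s^{-1-\gamma}\,ds$ on the domain of the generator of $(T_t)_{t\ge0}$. ''Solves'' means that $u(t,\cdot)\in C_\infty(\mathbb{R})$ lies in the domain of the operator appearing in the equation, and that the equation holds with the integral understood as a $C_\infty(\mathbb{R})$-valued Bochner integral. *)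

(* Defs.v *)
From HB Require Import structures.
From mathcomp Require Import all_boot all_order all_algebra.
From mathcomp Require Import all_classical all_reals all_analysis.
From mathcomp Require Import complex.

Set Implicit Arguments.
Unset Strict Implicit.
Unset Printing Implicit Defensive.

Import Order.TTheory GRing.Theory Num.Theory.
Import numFieldNormedType.Exports.

Local Open Scope classical_set_scope.
Local Open Scope ring_scope.

Section C0_pred.
Context (R : realType).

Definition C0 : {pred R -> R^o} :=
  mem [set f : R -> R^o | [/\ continuous (f : R -> R),
    (f : R -> R) x @[x --> +oo] --> (0 : R) &
    (f : R -> R) x @[x --> -oo] --> (0 : R)]].

Lemma C0_submod_closed : submod_closed C0.
Proof.
split.
  by rewrite inE; split; [move=> x; exact: cvg_cst|exact: cvg_cst..].
move=> a f g; rewrite !inE => -[fc fp fm] [gc gp gm]; split.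
- by move=> x; apply: cvgD; [apply: cvgZr; exact: fc|exact: gc].
- rewrite -(addr0 0) -{1}(mulr0 a); apply: cvgD => //; exact: cvgZr.
- rewrite -(addr0 0) -{1}(mulr0 a); apply: cvgD => //; exact: cvgZr.
Qed.

HB.instance Definition _ := GRing.isSubmodClosed.Build _ _ C0 C0_submod_closed.

End C0_pred.

(* The space C_oo(R), a subspace of the functions R -> R. *)
Record C0fun (R : realType) := C0Fun {
  C0val :> R -> R ;
  C0valP : C0val \in @C0 R }.

Section C0fun_lmodule.
Context (R : realType).

HB.instance Definition _ := [isSub for @C0val R].
HB.instance Definition _ := [Choice of C0fun R by <:].
HB.instance Definition _ := [SubChoice_isSubLmodule of C0fun R by <:].

End C0fun_lmodule.

Section C0fun_norm.
Context (R : realType).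
Implicit Types f g : C0fun R.

Definition supnorm f : R := sup (range (fun x => `|f x|)).

Lemma C0fun_bounded f : exists M, forall x, `|f x| <= M.
Proof.
have := C0valP f; rewrite inE => -[fc fp fm].
have /fp/= : \forall y \near (0 : R), `|y| < 1.
  by apply/nbhs_ballP; exists 1 => //= y; rewrite /ball/= sub0r normrN.
have /fm/= : \forall y \near (0 : R), `|y| < 1.
  by apply/nbhs_ballP; exists 1 => //= y; rewrite /ball/= sub0r normrN.
move=> [a [_ fa]] [b [_ fb]].
have cK : compact [set` `[Num.min a b - 1, Num.max a b + 1]].
  exact: segment_compact.
have /compact_bounded[N [_ fN]] : compact (f @` `[Num.min a b - 1, Num.max a b + 1]).
  by apply: continuous_compact => //; apply: continuous_subspaceT => x; exact: fc.
exists (`|N| + 1 + 1) => x.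
have [xa|ax] := ltP x a; first by rewrite (le_trans (ltW (fa _ xa)))// lerDr addr_ge0.
have [bx|xb] := ltP b x; first by rewrite (le_trans (ltW (fb _ bx)))// lerDr addr_ge0.
apply: (@le_trans _ _ (`|N| + 1)); last by rewrite lerDl.
apply: fN; first by rewrite ltr_pwDr// ler_norm.
exists x => //=; rewrite in_itv/=; apply/andP; split.
  by rewrite lerBlDr ge_min (le_trans ax)// lerDl.
by rewrite (le_trans xb)// (le_trans (_ : _ <= Num.max a b)) ?le_max ?lexx ?orbT// lerDl.
Qed.

Lemma supnorm_has_sup f : has_sup (range (fun x => `|f x|)).
Proof.
split; first by exists `|f 0|, 0.
by have [M fM] := C0fun_bounded f; exists M => _ [x _ <-]; exact: fM.
Qed.

Lemma supnorm_ub f x : `|f x| <= supnorm f.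
Proof.
by apply: ub_le_sup; [have [] := supnorm_has_sup f|exists x].
Qed.

Lemma supnorm_le f M : (forall x, `|f x| <= M) -> supnorm f <= M.
Proof.
move=> fM; apply: ge_sup; first by have [] := supnorm_has_sup f.
by move=> _ [x _ <-].
Qed.

Lemma supnormD f g : supnorm (f + g) <= supnorm f + supnorm g.
Proof.
apply: supnorm_le => x; apply: (le_trans (ler_normD (f x) (g x))).
by rewrite lerD// supnorm_ub.
Qed.

Lemma supnormZ (a : R) f : supnorm (a *: f) = `|a| * supnorm f.
Proof.
have le b h : supnorm (b *: h) <= `|b| * supnorm h.
  apply: supnorm_le => x.
  have -> : (b *: h) x = b * h x by [].
  by rewrite normrM ler_wpM2l// supnorm_ub.
apply/eqP; rewrite eq_le le/=.
have [->|a0] := eqVneq a 0.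
  by rewrite normr0 mul0r (le_trans _ (supnorm_ub _ 0)).
rewrite -ler_pdivlMl ?normr_gt0// -normfV.
by apply: le_trans (le _ _); rewrite scalerA mulVf// scale1r.
Qed.

Lemma supnorm0_eq0 f : supnorm f = 0 -> f = 0.
Proof.
move=> f0; apply/val_inj/funext => x; apply/eqP.
by rewrite -normr_le0 -f0; exact: supnorm_ub.
Qed.

HB.instance Definition _ :=
  @Lmodule_isNormed.Build R (C0fun R) supnorm supnormD supnormZ supnorm0_eq0.

End C0fun_norm.

Section bochner.
Context d (T : measurableType d) (R : realType) (E : normedModType R).
Variable mu : {measure set T -> \bar R}.

(* The list [:: (A_1, e_1); ...; (A_n, e_n)] encodes the simple function
   \1_(A_1) e_1 + ... + \1_(A_n) e_n. *)
Definition simple_data (D : set T) (s : seq (set T * E)) : Prop :=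
  forall p, p \in s -> measurable p.1 /\ (mu (p.1 `&` D) < +oo)%E.

Definition simple_eval (s : seq (set T * E)) (x : T) : E :=
  \sum_(p <- s) (\1_(p.1) x : R) *: p.2.

Definition simple_integral (D : set T) (s : seq (set T * E)) : E :=
  \sum_(p <- s) fine (mu (p.1 `&` D)) *: p.2.

(* f is Bochner integrable on D with integral I. *)
Definition is_bochner (D : set T) (f : T -> E) (I : E) : Prop :=
  exists s : nat -> seq (set T * E),
  [/\ forall n, simple_data D (s n),
      {ae mu, forall x, D x -> simple_eval (s n) x @[n --> \oo] --> f x},
      (\int[mu]_(x in D) `|f x - simple_eval (s n) x|%:E)%E
        @[n --> \oo] --> 0%E &
      simple_integral D (s n) @[n --> \oo] --> I].

End bochner.

Section semigroups.
Context (R : realType) (E : normedModType R).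

Definition contraction_semigroup (T : R -> E -> E) : Prop :=
  [/\ forall t, 0 <= t -> linear (T t),
      forall t phi, 0 <= t -> `|T t phi| <= `|phi|,
      forall phi, T 0 phi = phi,
      forall s t phi, 0 <= s -> 0 <= t -> T (s + t) phi = T s (T t phi) &
      forall phi, T t phi @[t --> 0^'+] --> phi].

(* Unbounded operators on E are represented by their graphs. *)
Definition generator (T : R -> E -> E) : set (E * E) :=
  [set p | h^-1 *: (T h p.1 - p.1) @[h --> 0^'+] --> p.2].

Definition stable_laws (gamma : R) (nu : R -> probability R R) : Prop :=
  forall t, 0 <= t -> nu t `[0, +oo[%classic = 1%E /\
    forall lam, 0 <= lam ->
      (\int[nu t]_(s in `[0%R, +oo[) (expR (- (lam * s)))%:E
       = (expR (- (t * lam `^ gamma)))%:E)%E.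

Definition subordinate (nu : R -> probability R R) (T S : R -> E -> E) : Prop :=
  forall t phi, 0 <= t -> is_bochner (nu t) `[0, +oo[ (T ^~ phi) (S t phi).

(* The graph of (-G)^gamma: T is the semigroup generated by the closure of G,
   S the semigroup subordinate to T with Bernstein function lam `^ gamma, and
   -(-G)^gamma is the generator of S. T, nu and S are unique where they are
   used (nonnegative times), so that the existential quantifiers amount to a
   definite description; the graph is empty if the closure of G generates no
   strongly continuous contraction semigroup. *)
Definition frac_power (gamma : R) (G : set (E * E)) : set (E * E) :=
  [set p | exists T nu S,
    [/\ contraction_semigroup T, generator T = closure G,
        stable_laws gamma nu, subordinate nu T S &
        generator S (p.1, - p.2)]].

End semigroups.

Section kernels.
Context (R : realType).
Implicit Types k : R -> R -> R.
Local Notation leb := (@lebesgue_measure R).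

Definition kernel_norm k (p t : R) : \bar R :=
  ('N[leb]_(p%:E)[EFin \o (k t \_ `]0%R, t[%classic)])%E.

(* k t s matters only for 0 < s and 0 < t *)
Definition admissible k : Prop :=
  measurable_fun [set p : R * R | 0 < p.1 /\ 0 < p.2] (fun p => k p.1 p.2) /\
  exists alpha eps, [/\ 0 <= alpha, alpha < 1, 0 < eps &
    forall T, 0 < T ->
      (ereal_sup [set (t `^ (alpha - (1 + eps)^-1))%:E * kernel_norm k (1 + eps) t
                 | t in `]0%R, T]%classic] < +oo)%E].

Definition homogeneous (r : R) k : Prop :=
  forall t s, 0 < t -> 0 < s -> s < 1 -> k t (t * s) = t `^ r * k 1 s.

Fixpoint coef k (n : nat) (t : R) : R :=
  if n is m.+1 then
    if 0 < t then \int[leb]_(s in `]0, t[) (k t s * coef k m s) else 0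
  else 1.

Definition Phi k (t : R) (lam : R[i]) : R[i] :=
  limn (series (fun n => (coef k n t)%:C%C * lam ^+ n)
        : nat -> (R[i] : numFieldType)).

Definition completely_monotone (f : R -> R) : Prop :=
  forall (n : nat) (x : R), 0 < x ->
    derivable (derive1n n f) x 1 /\ 0 <= (- 1) ^+ n * (derive1n n f) x.

(* The coefficients of Phi k t are real, hence so is its restriction to R. *)
Definition cm_assumption k : Prop :=
  forall t, 0 <= t ->
    completely_monotone (fun lam : R => complex.Re (Phi k t (- lam%:C%C))).

End kernels.

Section probability_defs.
Context d (Om : measurableType d) (R : realType) (P : probability Om R).

Definition cexp (z : R[i]) : R[i] :=
  ((expR (complex.Re z) * cos (complex.Im z))
   +i* (expR (complex.Re z) * sin (complex.Im z)))%C.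

Definition cexpectation (Z : Om -> R[i]) : R[i] :=
  (fine 'E_P[(fun w => complex.Re (Z w))%R]%E +i*
   fine 'E_P[(fun w => complex.Im (Z w))%R]%E)%C.

Definition sigma_gen I (D : set I) (X : I -> Om -> R) : set (set Om) :=
  <<s [set F | exists i Y, [/\ D i, measurable Y & F = X i @^-1` Y]] >>.

Definition independent_sigma (F1 F2 : set (set Om)) : Prop :=
  forall A B, F1 A -> F2 B -> P (A `&` B) = (P A * P B)%E.

(* independence of the process (X_t)_(t >= 0) and the random variable Z *)
Definition process_indep_rv (X : R -> Om -> R) (Z : Om -> R) : Prop :=
  independent_sigma (sigma_gen `[0, +oo[ X)
                    (sigma_gen [set: unit] (fun=> Z)).

Definition independent_increments (X : R -> Om -> R) : Prop :=
  forall (n : nat) (t : nat -> R) (Y : nat -> set R),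
    0 <= t 0%N -> (forall i, t i <= t i.+1) -> (forall i, measurable (Y i)) ->
    P (\bigcap_(i < n) (X (t i.+1) \- X (t i)) @^-1` Y i)
    = (\prod_(i < n) P ((X (t i.+1) \- X (t i))%R @^-1` Y i))%E.

Definition stable_subordinator (gamma : R) (eta : R -> {RV P >-> R}) : Prop :=
  [/\ {ae P, forall w, [/\ eta 0 w = 0,
        forall s t, 0 <= s -> s <= t -> eta s w <= eta t w &
        forall t, 0 <= t -> eta s w @[s --> t^'+] --> eta t w]},
      independent_increments eta,
      forall s h Y, 0 <= s -> 0 <= h -> measurable Y ->
        P ((eta (s + h) \- eta s) @^-1` Y) = P (eta h @^-1` Y) &
      forall t lam, 0 <= t -> 0 <= lam ->
        'E_P[(fun w => expR (- (lam * eta t w)))%R]%E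
        = (expR (- (t * lam `^ gamma)))%:E].

(* N(0, v), including the degenerate case v = 0 *)
Definition gaussian_law (v : R) (Y : set R) : \bar R :=
  if v == 0 then \d_(0 : R) Y else normal_prob 0 (Num.sqrt v) Y.

Definition brownian_motion (B : R -> {RV P >-> R}) : Prop :=
  [/\ {ae P, forall w, B 0 w = 0 /\ {within `[0, +oo[, continuous (B ^~ w)}},
      independent_increments B &
      forall s t Y, 0 <= s -> s <= t -> measurable Y ->
        P ((B t \- B s) @^-1` Y) = gaussian_law (t - s) Y].

Definition centered_gaussian_process (X : R -> {RV P >-> R}) : Prop :=
  forall (n : nat) (t a : 'I_n -> R), (forall i, 0 <= t i) ->
    exists2 v, 0 <= v & forall Y, measurable Y ->
      P ((fun w => \sum_(i < n) a i * X (t i) w) @^-1` Y) = gaussian_law v Y.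

Definition fractional_brownian_motion (H : R) (B : R -> {RV P >-> R}) : Prop :=
  centered_gaussian_process B /\
  forall s t, 0 <= s -> 0 <= t ->
    'E_P[(fun w => B t w * B s w)%R]%E
    = (2^-1 * (t `^ (2 * H) + s `^ (2 * H) - `|t - s| `^ (2 * H)))%:E.

End probability_defs.

Section operator.
Context (R : realType).

Definition C2 (f : R -> R) : Prop :=
  [/\ forall x, derivable f x 1, forall x, derivable (derive1 f) x 1 &
      continuous (derive1n 2 f)].

Definition L_fun (sigma : R -> R) (w : R) (phi : R -> R) (x : R) : R :=
  sigma x ^+ 2 / 2 * derive1n 2 phi x
  + (w + 2^-1 * derive1 sigma x) * sigma x * derive1 phi x.

Definition L_dom (sigma : R -> R) (w : R) : set (R -> R) :=
  [set phi | [/\ C2 phi, phi \in @C0 R & L_fun sigma w phi \in @C0 R]].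

(* graph of L_(sigma, w) + c on L_dom sigma w *)
Definition L_graph (sigma : R -> R) (w c : R) : set (C0fun R * C0fun R) :=
  [set p : C0fun R * C0fun R | L_dom sigma w p.1 /\
           forall x, p.2 x = L_fun sigma w p.1 x + c * p.1 x].

(* u solves u(t) = u0 - \int_0^t k(t, s) Op u(s) ds for t > 0, where Op is a
   (single-valued) operator given by its graph and v(s) = Op u(s). *)
Definition solves (k : R -> R -> R) (Op : set (C0fun R * C0fun R))
    (u0 : C0fun R) (u : R -> C0fun R) : Prop :=
  exists v : R -> C0fun R,
    (forall t, 0 < t -> Op (u t, v t)) /\
    forall t, 0 < t -> exists2 I : C0fun R,
      is_bochner (@lebesgue_measure R) `]0, t[ (fun s => k t s *: v s) I &
      forall x, u t x = u0 x - I x.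

End operator.

(* Main.v *)
(* The semigroup T generated by the closure of L + c is the explicit Gaussian
   mean T_s f(x) = e^(cs) E f(g(sqrt s N + w s, x)), N standard normal: the flow
   property of g gives the semigroup law, a Taylor expansion along the flow
   shows that L + c is contained in the generator, and a two-point random walk
   along the flow solves the resolvent equation up to a small error, so that
   L + c is a core. Conditionally on the time change, each of the three choices
   of X is such a Gaussian variable of variance a = cA t^(theta/gamma), which
   gives the first expression u(t) = E T_a u0, and the Cameron-Martin formula
   gives the second one.

   Let S be the semigroup subordinate to T, and v0 the image of u0 under its
   generator. Then u(t) = E S_(A t^theta) u0, and
     S_q u0 = u0 + \int_0^q S_r v0 dr.
   Homogeneity of k reduces the evolution equation to the identity
     E \int_0^(A t^theta) h(r) dr = \int_0^t k(t, s) E h(A s^theta) ds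
   for bounded continuous h. For h(r) = e^(- lam r) it is the power series
   identity Phi(1, mu) = 1 + mu \int_0^1 k(1, r) Phi(1, mu r^theta) dr, and
   both sides are determined by their values on exponentials: after damping, a
   bounded continuous function is uniformly approximated by combinations of
   exponentials (Bernstein). The same principle gives the semigroup law of S
   and the fact that domains of generators are preserved by subordination. *)
From HB Require Import structures.
From mathcomp Require Import all_boot all_order all_algebra.
From mathcomp Require Import all_classical all_reals all_analysis.
From mathcomp Require Import measurable_realfun.
From mathcomp Require Import complex.
From mathcomp Require Import ring lra.
Require Import Defs.

Set Implicit Arguments.
Unset Strict Implicit.
Unset Printing Implicit Defensive.

Import Order.TTheory GRing.Theory Num.Theory.
Import numFieldNormedType.Exports.

Local Open Scope classical_set_scope.
Local Open Scope ring_scope.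

(** * Integrals and the space of continuous functions vanishing at infinity *)

(** Two domain questions shape the proof. First, u0 lies in the domain of the generator of T, and
    h^-1 (S_h u0 - u0) must converge. No Levy measure enters: (T_s u0 - u0) / (1 - e^(-s)) is
    bounded and continuous on the half line, the measures h^-1 (1 - e^(-s)) nu_h(ds) have Laplace
    transforms tending to (lam + 1)^gamma - lam^gamma, and approximation of the damped function by
    exponentials with coefficients in C_oo makes the quotients Cauchy. This treats gamma = 1 and
    gamma < 1 alike. Second, a function f in the domain of L only has f and L f bounded; nothing
    controls f' and f'' where sigma vanishes. With D = sigma d/dx one has L = D^2 / 2 + w D, so all
    estimates are made along the flow of sigma, in terms of D f and D^2 f. The walk with two points
    is used for the resolvent because it is a finite combination of flow maps, which preserve the
    graph of L. The processes enter only at one fixed time: the joint law of X_t and the time change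
    is all that matters, and the stable laws of all times are rescaled copies of the law of
    eta_1. *)

Section integrals.
Context d (T : measurableType d) (R : realType) (mu : {measure set T -> \bar R}).
Implicit Types (D : set T) (f g : T -> R).

Lemma integrable_le D f g : measurable D -> measurable_fun D f ->
  mu.-integrable D (EFin \o g) -> (forall x, D x -> `|f x| <= g x) ->
  mu.-integrable D (EFin \o f).
Proof.
move=> mD mf ig fg; apply: (le_integrable mD _ _ ig).
  exact/measurable_EFinP.
by move=> x Dx /=; rewrite lee_fin (le_trans (fg _ Dx))// ler_norm.
Qed.

Lemma integrable_EFinD D f g : measurable D -> mu.-integrable D (EFin \o f) ->
  mu.-integrable D (EFin \o g) -> mu.-integrable D (EFin \o (fun x => f x + g x)).
Proof. by move=> mD jf jg; apply: eq_integrable (integrableD mD jf jg). Qed.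

Lemma integrable_EFinB D f g : measurable D -> mu.-integrable D (EFin \o f) ->
  mu.-integrable D (EFin \o g) -> mu.-integrable D (EFin \o (fun x => f x - g x)).
Proof. by move=> mD jf jg; apply: eq_integrable (integrableB mD jf jg). Qed.

Lemma integrable_EFinZl D f (r : R) : measurable D -> mu.-integrable D (EFin \o f) ->
  mu.-integrable D (EFin \o (fun x => r * f x)).
Proof. by move=> mD jf; apply: eq_integrable (integrableZl mD r jf). Qed.

Lemma Rintegral_cvg D (f_ : nat -> T -> R) f g : measurable D ->
  (forall n, measurable_fun D (f_ n)) ->
  (forall x, D x -> f_ n x @[n --> \oo] --> f x) ->
  mu.-integrable D (EFin \o g) ->
  (forall n x, D x -> `|f_ n x| <= g x) ->
  mu.-integrable D (EFin \o f) /\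
  \int[mu]_(x in D) f_ n x @[n --> \oo] --> \int[mu]_(x in D) f x.
Proof.
move=> mD mf ff ig fg.
have mf' : measurable_fun D f by exact: (measurable_fun_cvg (fun n => mf n) ff).
have [] := @dominated_convergence _ _ _ mu D mD (fun n => EFin \o f_ n)
  (EFin \o f) (EFin \o g).
- by move=> n; exact/measurable_EFinP.
- exact/measurable_EFinP.
- by apply: aeW => x Dx /=; apply: cvg_EFin; [exact: nearW|exact: ff].
- exact: ig.
- by apply: aeW => x n Dx /=; rewrite lee_fin fg.
move=> if_ _ cf; split => //.
apply: fine_cvg; rewrite fineK; first exact: cf.
exact: integrable_fin_num.
Qed.

Lemma Rintegral_bound D f (M : R) : measurable D -> mu.-integrable D (EFin \o f) ->
  mu.-integrable D (EFin \o cst M) ->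
  (forall x, D x -> `|f x| <= M) -> `|\int[mu]_(x in D) f x| <= M * fine (mu D).
Proof.
move=> mD jf jM fM; apply: le_trans (le_normr_Rintegral mD jf) _.
rewrite -Rintegral_cst//; apply: le_Rintegral => //.
exact: integrable_norm.
Qed.

End integrals.

(** Only [x] is confined to the segment, [y] may leave it: compactness in its near-covering form
    makes the radius uniform over neighbourhoods. [C0_unif_continuous] needs this freedom at the
    ends of its segment. *)
Lemma segment_unif_continuous (R : realType) (E : normedModType R) (f : R -> E)
    (a b e : R) : continuous f -> 0 < e ->
  exists2 dl : R, 0 < dl &
    forall x y, a <= x <= b -> `|x - y| <= dl -> `|f x - f y| <= e.
Proof.
move=> cf e0; have e20 : 0 < e / 2 by lra.
have /compact_near_coveringP/(_ R (0:R)^'+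
  (fun dl x => forall y, `|x - y| <= dl -> `|f x - f y| <= e))
  := @segment_compact R a b.
have H x : [set` `[a, b]] x -> 
    \forall x' \near x & dl \near (0:R)^'+,
      forall y, `|x' - y| <= dl -> `|f x' - f y| <= e.
  move=> _; have /cvgrPdist_le/(_ _ e20)/nbhs_ballP[r /= r0 Hr] := cf x.
  exists (ball x (r / 2), [set dl | dl < r / 2]); first split => /=.
  - by apply: nbhsx_ballx; lra.
  - by apply: nbhs_right_lt; lra.
  case=> x' dl /= [xx' dlr] y x'y.
  have r1 : ball x r x' by rewrite /ball/=; move: xx'; rewrite /ball/=; lra.
  have r2 : ball x r y.
    rewrite /ball/=; move: xx'; rewrite /ball/= => xx'.
    have -> : x - y = (x - x') + (x' - y) by ring.
    by rewrite (le_lt_trans (ler_normD _ _))//; lra.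
  have -> : f x' - f y = (f x - f y) - (f x - f x').
    by rewrite opprB [RHS]addrC addrA subrK.
  rewrite (le_trans (ler_normB _ _))//.
  by have := Hr _ r1; have := Hr _ r2; lra.
move=> /(_ _ H)[r /= r0 Hr].
exists (r / 2); first lra.
move=> x y xab xyr.
by apply: (Hr (r / 2)) => //=; [rewrite sub0r normrN gtr0_norm; lra|lra].
Qed.

Section C0fun_basics.
Context (R : realType).
Implicit Types f g : C0fun R.

Lemma C0_ler_norm f x : `|f x| <= `|f|.
Proof. exact: supnorm_ub. Qed.

Lemma C0_norm_le f (M : R) : (forall x, `|f x| <= M) -> `|f| <= M.
Proof. exact: supnorm_le. Qed.

Lemma C0_addE f g x : (f + g) x = f x + g x. Proof. by []. Qed.
Lemma C0_oppE f x : (- f) x = - f x. Proof. by []. Qed.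
Lemma C0_subE f g x : (f - g) x = f x - g x. Proof. by []. Qed.
Lemma C0_scaleE (a : R) f x : (a *: f) x = a * f x. Proof. by []. Qed.
Lemma C0_0E x : (0 : C0fun R) x = 0. Proof. by []. Qed.

Lemma C0_sumE (I : Type) (s : seq I) (P : pred I) (F : I -> C0fun R) x :
  (\sum_(i <- s | P i) F i) x = \sum_(i <- s | P i) F i x.
Proof. by elim/big_rec2: _ => // i a b _ <-. Qed.

Definition C0E := (C0_addE, C0_subE, C0_oppE, C0_scaleE, C0_0E, C0_sumE).

Lemma C0_ext f g : (forall x, f x = g x) -> f = g.
Proof. by move=> fg; apply/val_inj/funext. Qed.

Lemma C0P (h : R -> R) : h \in @C0 R <-> [/\ continuous h,
  h x @[x --> +oo] --> 0 & h x @[x --> -oo] --> 0].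
Proof. by rewrite inE. Qed.

Lemma C0_continuous f : continuous f.
Proof. by have /C0P[] := C0valP f. Qed.

Lemma C0_pinfty f : f x @[x --> +oo] --> 0.
Proof. by have /C0P[] := C0valP f. Qed.

Lemma C0_ninfty f : f x @[x --> -oo] --> 0.
Proof. by have /C0P[] := C0valP f. Qed.

(* The value is [0] if [h] is not in [C0 R]. *)
Definition mkC0 (h : R -> R) : C0fun R := insubd 0 h.

Lemma mkC0E h x : h \in @C0 R -> mkC0 h x = h x.
Proof. by move=> hC; rewrite /mkC0 -[C0val _]/(val _) insubdK. Qed.

Lemma C0_cvg_eval (T : Type) (F : set_system T) {FF : Filter F} (u : T -> C0fun R) (l : C0fun R) x :
  u t @[t --> F] --> l -> u t x @[t --> F] --> l x.
Proof.
move=> /cvgrPdist_le ul; apply/cvgrPdist_le => e e0.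
apply: filterS (ul e e0) => t; apply: le_trans.
by rewrite -C0_subE C0_ler_norm.
Qed.

Lemma C0_norm_cvg (T : Type) (F : set_system T) {FF : Filter F} (u : T -> C0fun R)
   (l : C0fun R) (b : T -> R) :
  (forall t, `|l - u t| <= b t) -> b t @[t --> F] --> 0 -> u t @[t --> F] --> l.
Proof.
move=> ub /cvgrPdist_le b0; apply/cvgrPdist_le => e e0.
apply: filterS (b0 e e0) => t; rewrite sub0r normrN => /(le_trans (ler_norm _)).
exact: le_trans.
Qed.

(** The Cauchy bound at a fixed point survives the passage to the limit, so the pointwise limit is
    uniform and keeps continuity and the limits at infinity. This provides the limit of difference
    quotients in [subordinate_generator]. *)
Lemma C0_complete (u : nat -> C0fun R) :
  (forall e : R, 0 < e -> exists N : nat, forall m n : nat, (N <= m)%N -> (N <= n)%N ->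
     `|u m - u n| <= e) ->
  exists l : C0fun R, u n @[n --> \oo] --> l.
Proof.
move=> uC.
have cvgx x : cvgn (fun n => u n x).
  apply/cauchy_cvgP/cauchy_exP => e e0.
  have [N HN] := uC (e / 2) (divr_gt0 e0 (ltr0n _ 2)).
  exists (u N x); exists N => // n /= Nn.
  rewrite /ball/= -C0_subE (le_lt_trans (C0_ler_norm _ _))//.
  by apply: (@le_lt_trans _ _ (e / 2)); [exact: HN|lra].
pose l x := limn (fun n => u n x).
have ul e : 0 < e -> exists N, forall n, (N <= n)%N -> forall x, `|l x - u n x| <= e.
  move=> e0; have [N HN] := uC e e0; exists N => n Nn x.
  apply: (@closed_cvg _ _ _ eventually_filter (fun m => `|u m x - u n x|)
    [set r | r <= e]).
  - exact: closed_le.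
  - exists N => // m /= Nm.
    by rewrite -C0_subE (le_trans (C0_ler_norm _ _))// HN.
  - by apply: cvg_norm; apply: cvgB; [exact: cvgx|exact: cvg_cst].
have lC : l \in @C0 R.
  have lim0 (F : set_system R) : ProperFilter F ->
      (forall n, u n x @[x --> F] --> 0) -> l x @[x --> F] --> 0.
    move=> FF u0; apply/cvgrPdist_le => e e0.
    have [N HN] := ul (e / 2) (divr_gt0 e0 (ltr0n _ 2)).
    have /cvgrPdist_le/(_ (e / 2) (divr_gt0 e0 (ltr0n _ 2))) := u0 N.
    apply: filterS => x; rewrite !sub0r !normrN => ux.
    rewrite -(subrK (u N x) (l x)) (le_trans (ler_normD _ _))//.
    have := HN N (leqnn _) x; lra.
  apply/C0P; split; [|by apply: lim0 => n; exact: C0_pinfty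
                     |by apply: lim0 => n; exact: C0_ninfty].
  move=> x; apply/cvgrPdist_le => e e0.
  have e30 : 0 < e / 3 by lra.
  have [N HN] := ul _ e30.
  have /cvgrPdist_le/(_ _ e30) := @C0_continuous (u N) x.
  apply: filterS => y uxy.
  have -> : l x - l y = (l x - u N x) + (u N x - u N y) - (l y - u N y) by ring.
  rewrite (le_trans (ler_normB _ _))// (@le_trans _ _ (e / 3 + e / 3 + e / 3))//; last lra.
  by rewrite lerD ?HN// (le_trans (ler_normD _ _))// lerD ?HN.
exists (mkC0 l); apply/cvgrPdist_le => e e0.
have [N HN] := ul e e0; exists N => // n /= Nn.
by apply: C0_norm_le => x; rewrite C0_subE mkC0E// HN.
Qed.

Lemma C0_tail f (e : R) : 0 < e -> exists2 M : R, 0 < M & forall x, M <= `|x| -> `|f x| <= e.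
Proof.
move=> e0.
have /cvgrPdist_le/(_ e e0)[a [ar Ha]] := @C0_pinfty f.
have /cvgrPdist_le/(_ e e0)[b [br Hb]] := @C0_ninfty f.
exists (`|a| + `|b| + 1) => [|x]; first by rewrite ltr_wpDl// addr_ge0.
rewrite ler_normr => /orP[|] xM.
  have /Ha/= : a < x.
    by have := ler_norm a; have := normr_ge0 b; lra.
  by rewrite sub0r normrN.
have /Hb/= : x < b.
  by have := ler_norm (- b); rewrite normrN; have := normr_ge0 a; lra.
by rewrite sub0r normrN.
Qed.

Lemma C0_unif_continuous f (e : R) : 0 < e ->
  exists2 dl : R, 0 < dl & forall x y, `|x - y| <= dl -> `|f x - f y| <= e.
Proof.
move=> e0; have e20 : 0 < e / 2 by lra.
have [M M0 HM] := C0_tail f e20.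
have [r r0 Hr] := @segment_unif_continuous R R^o f (- (M + 1)) (M + 1) e
  (@C0_continuous f) e0.
(* The cap 1 serves points [x] outside the segment: [y] then still has absolute value at least [M],
   and both values are at most [e / 2]. *)
exists (Num.min r 1); first by rewrite lt_min r0 ltr01.
move=> x y; rewrite le_min => /andP[xyr xy1].
have [xM|xM] := lerP `|x| (M + 1); first by apply: Hr => //; rewrite -ler_norml.
have yM : M <= `|y|.
  by have := ler_dist_dist x y; have := ler_norm (`|x| - `|y|); lra.
rewrite (le_trans (ler_normB _ _))//.
by have := HM _ yM; have := HM x; lra.
Qed.

End C0fun_basics.
Arguments C0_cvg_eval {R T F FF u l} x _.

Section norm_measurable.
Context d (T : measurableType d) (R : realType).

(** By uniform continuity the norm is the supremum over the rationals, hence a countable supremum of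
    measurable functions. *)
Lemma measurable_C0_norm (D : set T) (F : T -> C0fun R) : measurable D ->
  (forall x, measurable_fun D (fun t => F t x)) ->
  measurable_fun D (fun t => `|F t|).
Proof.
move=> mD mF.
(* An enumeration of the rationals; integers that encode no rational are sent to 0, which leaves the
   supremum unchanged. *)
pose q (m : nat) : R := ratr (odflt 0 (unpickle m : option rat)).
have -> : (fun t => `|F t|) = (fun t => sups (fun m => `|F t (q m)|) 0%N).
  apply/funext => t; apply/eqP; rewrite eq_le; apply/andP; split.
    have hs : has_sup (sdrop (fun m => `|F t (q m)|) 0%N).
      split; first by exists `|F t (q 0%N)|, 0%N.
      by exists `|F t| => _ [m _ <-]; exact: C0_ler_norm.
    apply: C0_norm_le => x; apply/ler_addgt0Pr => e e0.
    have [dl dl0 Hdl] := C0_unif_continuous (F t) e0.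
    have [r qx] : exists r : rat, `|x - ratr r| <= dl.
      have : (x - dl < x + dl) by lra.
      by move=> /rat_in_itvoo[r]; rewrite in_itv/= => /andP[q1 q2]; exists r;
         rewrite ler_norml; lra.
    rewrite -(subrK (F t (ratr r)) (F t x)) (le_trans (ler_normD _ _))// addrC lerD//.
      by apply: ub_le_sup; [exact: hs.2|exists (pickle r) => //; rewrite /q pickleK].
    exact: Hdl.
  apply: ge_sup; first by exists `|F t (q 0%N)|, 0%N.
  by move=> _ [m _ <-]; exact: C0_ler_norm.
apply: measurable_fun_sups.
  by move=> t _; exists `|F t| => _ [m _ <-]; exact: C0_ler_norm.
by move=> m; apply: measurableT_comp => //; exact: mF.
Qed.
End norm_measurable.

Section mix.
Context d (T : measurableType d) (R : realType) (mu : {measure set T -> \bar R}).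
Variables (D : set T) (kap : T -> R) (F : T -> C0fun R) (M : R).
Hypothesis mD : measurable D.
Hypothesis ikap : mu.-integrable D (EFin \o kap).
Hypothesis mF : forall x, measurable_fun D (fun t => F t x).
Hypothesis FM : forall t, D t -> `|F t| <= M.

(** Candidate for a Bochner integral, built from its values at points. [bochner_exists] shows that
    it is one, for [F] continuous from the right on a set of finite measure. *)
Definition mix := mkC0 (fun x => \int[mu]_(t in D) (kap t * F t x)).

Let mkap : measurable_fun D kap.
Proof. exact/measurable_EFinP/(measurable_int mu). Qed.

Lemma mix_C0 : (fun x => \int[mu]_(t in D) (kap t * F t x)) \in @C0 R.
Proof.
(* Continuity and both limits at infinity are tested on sequences, so that dominated convergence
   with a multiple of |kap| applies. *)
have H (u : nat -> R) (l : T -> R) : (forall t, D t -> F t (u n) @[n --> \oo] --> l t) ->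
  \int[mu]_(t in D) (kap t * F t (u n)) @[n --> \oo] -->
  \int[mu]_(t in D) (kap t * l t).
  move=> ul.
  have [] := @Rintegral_cvg _ _ _ mu D (fun n t => kap t * F t (u n))
    (fun t => kap t * l t) (fun t => M * `|kap t|) mD.
  - by move=> n; exact: measurable_funM.
  - by move=> t Dt; apply: cvgM; [exact: cvg_cst|exact: ul].
  - by apply: integrable_EFinZl => //; exact: integrable_norm.
  - move=> n t Dt; rewrite normrM mulrC ler_wpM2r//.
    by rewrite (le_trans (C0_ler_norm _ _))// FM.
  by [].
have H0 : \int[mu]_(t in D) (kap t * 0) = 0.
  by under eq_Rintegral do rewrite mulr0; rewrite Rintegral_cst// mul0r.
apply/C0P; split.
- move=> x; apply/(@cvg_nbhsP _ R^o) => u ux; apply: H => t _.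
  exact: (cvg_comp _ _ ux (@C0_continuous _ (F t) x)).
- apply/cvg_pinftyP => u ux; rewrite -[X in _ --> X]H0; apply: H => t _.
  exact: (cvg_comp _ _ ux (@C0_pinfty _ (F t))).
- apply/cvg_ninftyP => u ux; rewrite -[X in _ --> X]H0; apply: H => t _.
  exact: (cvg_comp _ _ ux (@C0_ninfty _ (F t))).
Qed.

Lemma mixE x : mix x = \int[mu]_(t in D) (kap t * F t x).
Proof. by rewrite mkC0E//; exact: mix_C0. Qed.

End mix.

(** * Bochner integrals in the space vanishing at infinity *)

Section bochner_C0.
Context d (T : measurableType d) (R : realType) (mu : {measure set T -> \bar R}).
Implicit Types (D : set T) (s : seq (set T * C0fun R)).

Lemma simple_evalE s t x :
  simple_eval s t x = \sum_(p <- s) (\1_(p.1) t : R) * p.2 x.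
Proof. by rewrite /simple_eval C0_sumE. Qed.

Lemma simple_integrable D s x : measurable D -> simple_data mu D s ->
  mu.-integrable D (EFin \o (fun t => simple_eval s t x)) /\
  \int[mu]_(t in D) (simple_eval s t x) = simple_integral mu D s x.
Proof.
move=> mD; elim: s => [|[A e] s IH] sd.
  split.
    apply: (eq_integrable mD (cst 0%E)); last exact: integrable0.
    by move=> t _; rewrite /= simple_evalE big_nil.
  rewrite /simple_integral big_nil C0E; under eq_Rintegral do rewrite simple_evalE big_nil.
  by rewrite Rintegral_cst// mul0r.
have [|i1 i2] := IH; first by move=> p ps; apply: sd; rewrite in_cons ps orbT.
have /= [mA muA] := sd (A, e) (mem_head _ _).
have iA : mu.-integrable D (EFin \o (fun t => \1_A t : R)).
  apply/integrableP; split; first exact/measurable_EFinP/measurable_indic.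
  rewrite (eq_integral (fun t => (\1_A t)%:E)); last first.
    by move=> t _ /=; rewrite ger0_norm.
  by rewrite integral_indic.
have iAe : mu.-integrable D (EFin \o (fun t => (\1_A t : R) * e x)).
  apply: (eq_integrable mD (fun t => (e x)%:E * (\1_A t)%:E)%E).
    by move=> t _; rewrite /= mulrC.
  exact: integrableZl.
have E t : simple_eval ((A, e) :: s) t x = \1_A t * e x + simple_eval s t x.
  by rewrite !simple_evalE big_cons.
split.
  by apply: eq_integrable (integrable_EFinD mD iAe i1) => // t _; rewrite /= E.
under eq_Rintegral do rewrite E.
have -> : simple_integral mu D ((A, e) :: s) x =
    fine (mu (A `&` D)) * e x + simple_integral mu D s x.
  by rewrite /simple_integral big_cons.
rewrite RintegralD// i2 RintegralZr//.
by congr (_ * _ + _); rewrite /Rintegral integral_indic.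
Qed.

Lemma simple_eval_measurable D s x : measurable D -> simple_data mu D s ->
  measurable_fun D (fun t => simple_eval s t x).
Proof.
move=> mD sd; apply/measurable_EFinP/(measurable_int mu).
exact: (simple_integrable x mD sd).1.
Qed.

Variables (D : set T) (f : T -> C0fun R) (g : T -> R).
Hypothesis mD : measurable D.
Hypothesis mf : forall x, measurable_fun D (fun t => f t x).
Hypothesis ig : mu.-integrable D (EFin \o g).
Hypothesis fg : forall t, D t -> `|f t| <= g t.

Lemma C0_eval_integrable x : mu.-integrable D (EFin \o (fun t => f t x)).
Proof.
apply: integrable_le ig _ => // t Dt.
by rewrite (le_trans (C0_ler_norm _ _))// fg.
Qed.

Lemma simple_integral_dist s x : simple_data mu D s ->
  ((`|\int[mu]_(t in D) f t x - simple_integral mu D s x|)%:E <=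
   \int[mu]_(t in D) (`|f t - simple_eval s t|)%:E)%E.
Proof.
move=> sd; have [jA <-] := simple_integrable x mD sd.
rewrite -RintegralB//; last exact: C0_eval_integrable.
have iB : mu.-integrable D (EFin \o (fun t => f t x - simple_eval s t x)).
  by apply: integrable_EFinB => //; exact: C0_eval_integrable.
rewrite EFin_normr_Rintegral//.
apply: le_trans (le_abse_integral _ _ (measurable_int mu iB)) _ => //.
apply: ge0_le_integral => //.
- exact/measurableT_comp/(measurable_int mu iB).
- apply/measurable_EFinP/measurable_C0_norm => // y.
  apply: (measurable_funB (mf y)); exact: simple_eval_measurable.
- by move=> t Dt; rewrite lee_fin (le_trans _ (C0_ler_norm _ x)).
Qed.

(** Evaluation at a point is a bounded functional and passes through the limit of the simple
    integrals. In particular the Bochner integral is unique and can be computed point by point. *)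
Lemma bochner_eval I x : is_bochner mu D f I ->
  I x = \int[mu]_(t in D) f t x.
Proof.
move=> [s [sd _ s0 sI]].
have cI : simple_integral mu D (s n) x @[n --> \oo] --> I x by exact: C0_cvg_eval.
apply: (cvg_unique _ cI) => //.
apply/cvgrPdist_le => e e0.
have /fine_cvgP[sfin /cvgrPdist_le/(_ e e0)] := s0.
apply: filterS2 sfin => n fn /=; rewrite sub0r normrN.
have := simple_integral_dist x (sd n).
rewrite -(fineK fn) lee_fin => H1 H2; apply: le_trans H1 _.
exact: le_trans (ler_norm _) H2.
Qed.

(** Applying [L] to the coefficients of the approximating simple functions gives simple functions
    for [L \o f]; a contraction increases none of the distances involved. *)
Lemma bochner_linear (L : C0fun R -> C0fun R) I : linear L ->
  (forall h, `|L h| <= `|h|) ->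
  (forall x, measurable_fun D (fun t => L (f t) x)) ->
  is_bochner mu D f I -> is_bochner mu D (L \o f) (L I).
Proof.
move=> linL Lle mLf [s [sd sae s0 sI]].
have L0 : L 0 = 0.
  by have := linL (-1) 0 0; rewrite scaler0 addr0 scaleN1r addNr.
have LZ a h : L (a *: h) = a *: L h by rewrite -[a *: h]addr0 linL L0 addr0.
have LD h k : L (h + k) = L h + L k by rewrite -[h in LHS]scale1r linL scale1r.
have LB h k : L (h - k) = L h - L k by rewrite LD -scaleN1r LZ scaleN1r.
pose s' n := [seq (p.1, L p.2) | p <- s n].
have Lsum (I' : Type) (r : seq I') (F : I' -> C0fun R) :
    L (\sum_(i <- r) F i) = \sum_(i <- r) L (F i).
  by elim: r => [|i r IH]; rewrite ?big_nil// !big_cons LD IH.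
have evalE n t : simple_eval (s' n) t = L (simple_eval (s n) t).
  by rewrite /simple_eval /s' big_map Lsum; apply: eq_bigr => p _; rewrite LZ.
have intE n : simple_integral mu D (s' n) = L (simple_integral mu D (s n)).
  by rewrite /simple_integral /s' big_map Lsum; apply: eq_bigr => p _; rewrite LZ.
have sd' n : simple_data mu D (s' n).
  by move=> p /mapP[q qs ->]; exact: sd qs.
have Lcvg (F : set_system nat) (FF : ProperFilter F) (u : nat -> C0fun R) (l : C0fun R) :
    u n @[n --> F] --> l -> L (u n) @[n --> F] --> L l.
  move=> /cvgrPdist_le ul; apply/cvgrPdist_le => e e0.
  by apply: filterS (ul e e0) => n; rewrite -LB; exact: le_trans.
exists s'; split; [exact: sd'| | |].
- apply: filterS sae => t H Dt; have /Lcvg := H Dt.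
  by rewrite -(funext (fun n => evalE n t)).
- apply: (@squeeze_cvge _ _ _ _ (cst 0%E) _
    (fun n => \int[mu]_(x in D) `|f x - simple_eval (s n) x|%:E)%E) s0.
  + apply: nearW => n; rewrite integral_ge0//=.
    apply: ge0_le_integral => //.
    * apply/measurable_EFinP/measurable_C0_norm => // y.
      apply: (measurable_funB (mLf y)); exact: simple_eval_measurable.
    * apply/measurable_EFinP/measurable_C0_norm => // y.
      apply: (measurable_funB (mf y)); exact: simple_eval_measurable.
    * by move=> t Dt; rewrite lee_fin evalE -LB.
  + exact: cvg_cst.
- rewrite (_ : (fun n => _) = (fun n => L (simple_integral mu D (s n)))).
    exact: Lcvg.
  by apply/funext => n; exact: intE.
Qed.

End bochner_C0.

Arguments simple_integral_dist {d T R mu D f g} mD mf ig fg {s} x sd.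

Section bochner_exists.
Context dX (X : measurableType dX) (R : realType) (mu : {measure set X -> \bar R}).
Variables (tau : X -> R) (D : set X) (kap : X -> R) (F : R -> C0fun R) (M : R).
Hypothesis mtau : measurable_fun D tau.
Hypothesis mD : measurable D.
Hypothesis D0 : forall s, D s -> 0 <= tau s.
Hypothesis muD : (mu D < +oo)%E.
Hypothesis ikap : mu.-integrable D (EFin \o kap).
Hypothesis mF : forall x, measurable_fun D (fun t => F (tau t) x).
Hypothesis FM : forall t : R, 0 < t -> `|F t| <= M.
Hypothesis Frc : forall t, D t -> F s @[s --> (tau t)^'+] --> F (tau t).

(* The grid of mesh [1/n] with [n^2] cells on the half line for the time
   variable, and [2n^2] cells for the values of [kap]. *)
Let cell (n : nat) (h : X -> R) (z : int) : set X :=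
  D `&` [set s | Num.floor (n.+1%:R * h s) = z].

Let mcell n h z : measurable_fun D h -> measurable (cell n h z).
Proof.
move=> mh; have -> : cell n h z = D `&` (fun s => n.+1%:R * h s) @^-1` `[z%:~R, (z + 1)%:~R[.
  rewrite /cell; congr (_ `&` _); apply/seteqP; split=> s /=; rewrite in_itv/=.
    by move=> <-; rewrite floor_le floorD1_gt.
  by move=> H; apply/floor_def.
by apply: measurable_funM.
Qed.

Let idx (n : nat) : Type := ('I_(2 * n.+1 ^ 2) * 'I_(n.+1 ^ 2))%type.
Let a (n : nat) (z : int) : R := z%:~R / n.+1%:R.
Let off (n : nat) (i : 'I_(2 * n.+1 ^ 2)) : int := Posz i - Posz (n.+1 ^ 2)%N.
Let A n (p : idx n) : set X := cell n kap (off p.1) `&` cell n tau (Posz p.2).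
(** The time variable is taken at the right end of its cell, because [F] is only continuous from the
    right; this end is positive, so the bound [M] applies to it. *)
Let e n (p : idx n) : C0fun R := a n (off p.1) *: F (a n ((Posz p.2) + 1)).
Let sn n : seq (set X * C0fun R) := [seq (A p, e p) | p : idx n].

Let mkap : measurable_fun D kap.
Proof. by apply/measurable_EFinP; exact: (measurable_int mu ikap). Qed.

Let sdn n : simple_data mu D (sn n).
Proof.
move=> q /mapP[p _ ->] /=.
have mA : measurable (A p).
  by apply: measurableI; apply: mcell.
split => //; apply: le_lt_trans muD; apply: le_measure; rewrite ?inE//.
by apply: measurableI.
Qed.

Let snE n t : simple_eval (sn n) t = \sum_(p : idx n) (\1_(A p) t : R) *: e p.
Proof. by rewrite /simple_eval /sn big_map big_enum. Qed.

(** A cell fixes two floors, so the cells are disjoint and at most one term of the sum survives. A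
    point missed by all cells has a value of size at least [n.+1], which for a given point concerns
    finitely many [n] only. *)
Let sn_val n t : D t ->
  (exists2 p : idx n, A p t & simple_eval (sn n) t = e p) \/
  ((n.+1%:R <= `|kap t| \/ n.+1%:R <= tau t) /\ simple_eval (sn n) t = 0).
Proof.
move=> Dt; rewrite snE.
have [[p Ap]|nA] := pselect (exists p : idx n, A p t).
  left; exists p => //; rewrite (bigD1 p)//= indicE mem_set// scale1r.
  rewrite big1 ?addr0// => q qp; rewrite indicE memNset ?scale0r//.
  move=> Aq; move/eqP : qp; apply.
  case: Ap Aq => -[_ /= p1] [_ /= p2] [[_ /= q1] [_ /= q2]].
  case: p q p1 p2 q1 q2 => [p1 p2] [q1 q2] /= -> -> /eqP.
  rewrite /off (inj_eq (addIr _)) => /eqP[/ord_inj ->].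
  by move=> [/ord_inj ->].
right; split; last first.
  by apply: big1 => p _; rewrite indicE memNset ?scale0r// => Ap; apply: nA; exists p.
have [|kn] := lerP n.+1%:R `|kap t|; first by left.
have [|tn] := lerP n.+1%:R (tau t); first by right.
exfalso; apply: nA.
have n0 : (0 : R) < n.+1%:R by rewrite ltr0n.
have /gez0_abs jE : (0 <= Num.floor (n.+1%:R * tau t))%R.
  by rewrite floor_ge0 mulr_ge0// D0.
have jn : (`|Num.floor (n.+1%:R * tau t)| < n.+1 ^ 2)%N.
  rewrite -ltz_nat jE floor_lt_int -pmulrn natrX expr2 ltr_pM2l//.
have /gez0_abs iE : (0 <= Num.floor (n.+1%:R * kap t) + Posz (n.+1 ^ 2)%N)%R.
  rewrite -lerBlDr sub0r floor_ge_int mulrNz -pmulrn natrX expr2 -mulrN ler_pM2l//.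
  by move: kn; rewrite ltr_norml => /andP[/ltW].
have jn' : (`|(Num.floor (n.+1%:R * kap t) + Posz (n.+1 ^ 2)%N)%R| < 2 * n.+1 ^ 2)%N.
  rewrite -ltz_nat iE mul2n -addnn PoszD ltrD2r floor_lt_int -pmulrn natrX expr2 ltr_pM2l//.
  by move: kn; rewrite ltr_norml => /andP[].
exists (Ordinal jn', Ordinal jn); split; split => //=.
by rewrite /off /= iE addrK.
Qed.

Let M0 : 0 <= M.
Proof. exact: le_trans (normr_ge0 _) (FM ltr01). Qed.

Let A_val n t (p : idx n) : A p t ->
  [/\ D t, `|kap t - a n (off p.1)| <= n.+1%:R^-1, tau t < a n (Posz p.2 + 1) &
      a n (Posz p.2 + 1) <= tau t + n.+1%:R^-1].
Proof.
have n0 : (0 : R) < n.+1%:R by rewrite ltr0n.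
move=> [[Dt /= Ek] [_ /= Et]]; split => //.
- have -> : kap t - a n (off p.1) = (n.+1%:R * kap t - (off p.1)%:~R) / n.+1%:R.
    by rewrite /a; field.
  rewrite normf_div [`|n.+1%:R|]gtr0_norm// ler_pdivrMr// mulVf ?gt_eqF//.
  rewrite -Ek ger0_norm ?subr_ge0 ?floor_le// lerBlDr addrC.
  by have := floorD1_gt (n.+1%:R * kap t); rewrite intrD => /ltW.
- rewrite /a -Et ltr_pdivlMr// mulrC; exact: floorD1_gt.
- have -> : tau t + n.+1%:R^-1 = (n.+1%:R * tau t + 1) / n.+1%:R by field.
  by rewrite /a -Et ler_pM2r ?invr_gt0// intrD lerD2r floor_le.
Qed.

Let fsn n t := `|kap t *: F (tau t) - simple_eval (sn n) t|.

Let fsn_meas n : measurable_fun D (fsn n).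
Proof.
apply: measurable_C0_norm => // x.
apply: (@measurable_funB _ _ _ D (fun t => kap t * F (tau t) x)
  (fun t => simple_eval (sn n) t x)).
  by apply: measurable_funM => //; exact: mF.
exact: simple_eval_measurable.
Qed.

Let FMD t : D t -> `|F (tau t)| <= M.
Proof.
move=> Dt; apply: (@closed_cvg _ _ _ (at_right_proper_filter (tau t)) (fun s => `|F s|)
  [set r | r <= M]).
- exact: closed_le.
- near=> s => /=; apply: FM; apply: le_lt_trans (D0 Dt) _; near: s.
  exact: nbhs_right_gt.
- by apply: cvg_norm; exact: Frc.
Unshelve. all: by end_near. Qed.

Let fsn_le n t : D t -> fsn n t <= 2 * M * `|kap t| + M.
Proof.
move=> Dt; apply: le_trans (ler_normB _ _) _; rewrite normrZ.
have H1 : `|kap t| * `|F (tau t)| <= M * `|kap t| by rewrite mulrC ler_wpM2r// FMD.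
suff H2 : `|simple_eval (sn n) t| <= M * (`|kap t| + 1) by lra.
have [[p Ap ->]|[_ ->]] := sn_val n Dt; last by rewrite normr0 mulr_ge0// addr_ge0.
have [_ ka ta _] := A_val Ap.
rewrite normrZ mulrC ler_pM//.
  by apply: FM; apply: le_lt_trans ta; exact: D0.
have n1 : (n.+1%:R : R)^-1 <= 1 by rewrite invf_le1 ?ler1n ?ltr0n.
have := ler_normD (kap t) (a n (off p.1) - kap t).
rewrite subrKC (distrC (a n _)) => H; apply: le_trans H _.
by rewrite lerD2l (le_trans ka).
Qed.

Let fsn_cvg t : D t -> fsn n t @[n --> \oo] --> (0 : R).
Proof.
move=> Dt; apply/cvgrPdist_le => /= eps eps0.
(* Replacing [F] costs |kap t| e1 and replacing [kap t] costs e1 M; the denominator absorbs both and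
   is positive even for M = 0. *)
pose e1 : R := eps / (2 * (`|kap t| + 1) + M).
have K0 : 0 < 2 * (`|kap t| + 1) + M.
  by rewrite ltr_pwDl// mulr_gt0// ltr_wpDl.
have e10 : 0 < e1 by rewrite divr_gt0.
have /cvgrPdist_le/(_ e1 e10)[dl /= dl0 Hdl] := Frc Dt.
have e20 : (0 : R) < Num.min dl (Num.min e1 1) by rewrite !lt_min dl0 e10 ltr01.
near=> n; rewrite sub0r normrN /fsn normr_id.
have n1 : (n.+1%:R : R)^-1 < Num.min dl (Num.min e1 1).
  by near: n; exact: (near_infty_natSinv_lt (PosNum e20)).
have kn : `|kap t| < n.+1%:R.
  apply: (@lt_trans _ _ n%:R); last by rewrite ltr_nat.
  by near: n; exact: nbhs_infty_gtr.
have tn : tau t < n.+1%:R.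
  apply: (@lt_trans _ _ n%:R); last by rewrite ltr_nat.
  by near: n; exact: nbhs_infty_gtr.
have [[p Ap ->]|[[]]] := sn_val n Dt; [|by rewrite leNgt kn|by rewrite leNgt tn].
have [_ ka ta ta'] := A_val Ap.
move: n1; rewrite !lt_min => /and3P[n1 n2 n3].
have Fp : `|F (tau t) - F (a n (Posz p.2 + 1))| <= e1.
  apply: Hdl => //=; rewrite ltr0_norm ?subr_lt0// opprB.
  by rewrite (le_lt_trans _ n1)// lerBlDl.
have -> : kap t *: F (tau t) - e p = kap t *: (F (tau t) - F (a n (Posz p.2 + 1))) +
    (kap t - a n (off p.1)) *: F (a n (Posz p.2 + 1)).
  by rewrite /e scalerBr scalerBl addrA subrK.
rewrite (le_trans (ler_normD _ _))// !normrZ.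
have H1 : `|kap t| * `|F (tau t) - F (a n (Posz p.2 + 1))| <= `|kap t| * e1 by rewrite ler_wpM2l.
have H2 : `|kap t - a n (off p.1)| * `|F (a n (Posz p.2 + 1))| <= e1 * M.
  apply: ler_pM => //; first by rewrite (le_trans ka)// ltW.
  by apply: FM; apply: le_lt_trans ta; exact: D0.
apply: le_trans (lerD H1 H2) _.
have -> : eps = e1 * (2 * (`|kap t| + 1) + M) by rewrite /e1 divfK// gt_eqF.
have := normr_ge0 (kap t); nra.
Unshelve. all: by end_near. Qed.

Lemma bochner_exists : is_bochner mu D (fun t => kap t *: F (tau t)) (mix mu D kap (fun t => F (tau t))).
Proof.
have ig : mu.-integrable D (EFin \o (fun t => 2 * M * `|kap t| + M)).
  apply: integrable_EFinD => //.
    by apply: integrable_EFinZl => //; exact: integrable_norm.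
  apply: measurable_bounded_integrable => //; exact: bounded_cst.
have cI : (\int[mu]_(x in D) `|kap x *: F (tau x) - simple_eval (sn n) x|%:E)%E
    @[n --> \oo] --> 0%E.
  have := @dominated_cvg _ _ _ mu D mD (fun n => EFin \o fsn n) (cst 0%E)
    (EFin \o (fun t => 2 * M * `|kap t| + M)).
  rewrite integral0; apply => //.
  - by move=> n; exact/measurable_EFinP.
  - by move=> t Dt; apply: cvg_EFin; [exact: nearW|exact: fsn_cvg].
  - by move=> n t Dt /=; rewrite lee_fin normr_id fsn_le.
exists sn; split => //.
- apply: aeW => t Dt; apply/cvgrPdist_le => eps eps0.
  have /cvgrPdist_le/(_ eps eps0) := fsn_cvg Dt.
  by apply: filterS => n; rewrite sub0r normrN normr_id.
- apply/cvgrPdist_le => eps eps0.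
  have /fine_cvgP[sfin /cvgrPdist_le/(_ eps eps0)] := cI.
  apply: filterS2 sfin => n fn /=; rewrite sub0r normrN => H2.
  apply: C0_norm_le => x.
  have ik : mu.-integrable D (EFin \o (fun t => M * `|kap t|)).
    by apply: integrable_EFinZl => //; exact: integrable_norm.
  have mKF y : measurable_fun D (fun t => (kap t *: F (tau t)) y).
    exact: (@measurable_funM _ _ _ D kap (fun t => F (tau t) y)).
  have bKF t : D t -> `|kap t *: F (tau t)| <= M * `|kap t|.
    by move=> Dt; rewrite normrZ mulrC ler_wpM2r// FMD.
  have := simple_integral_dist mD mKF ik bKF x (@sdn n).
  rewrite C0_subE (mixE mD ikap mF FMD) -(fineK fn) lee_fin => H1.
  by apply: le_trans H1 _; exact: le_trans (ler_norm _) H2.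
Qed.

End bochner_exists.
Arguments bochner_exists {dX X R mu tau D kap F M}.

(** * Functionals determined by their Laplace transform *)

Section bernstein.
Context (R : realType) (E : normedModType R).

(* The mean of [f] under the binomial distribution with parameters [n], [z]. *)
Fixpoint binmean (z : R) (n : nat) (f : nat -> E) : E :=
  if n is m.+1 then (1 - z) *: binmean z m f + z *: binmean z m (f \o S) else f 0%N.

(** The constant coefficient is singled out because [exp_approx] needs polynomials without constant
    term, that is, combinations of decaying exponentials. *)
Lemma binmean_poly n (f : nat -> E) : exists2 c : nat -> E, c 0%N = f 0%N &
  forall z, binmean z n f = \sum_(j < n.+1) z ^+ j *: c j.
Proof.
elim: n f => [|n IH] f.
  by exists f => // z; rewrite big_ord_recl big_ord0 expr0 scale1r addr0.
have [c c0 Hc] := IH f; have [c' c'0 Hc'] := IH (f \o S).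
(* Nothing is known of [c] beyond index [n]; cutting it off there makes the recursion for the
   coefficients correct in the top degree too. *)
pose cn j := if (j <= n)%N then c j else 0.
exists (fun j => if j is i.+1 then cn i.+1 - c i + c' i else c 0%N) => // z.
rewrite [LHS]/= Hc Hc' scalerBl scale1r.
rewrite [RHS]big_ord_recl /= expr0 scale1r.
have -> : \sum_(i < n.+1) z ^+ bump 0 i *: (cn (bump 0 i) - c i + c' i) =
    \sum_(i < n.+1) z ^+ i.+1 *: cn i.+1 - z *: \sum_(i < n.+1) z ^+ i *: c i +
    z *: \sum_(i < n.+1) z ^+ i *: c' i.
  rewrite !scaler_sumr -sumrN -!big_split /=; apply: eq_bigr => i _.
  by rewrite /bump /= add1n !scalerDr scalerN !scalerA exprS.
rewrite !addrA; congr (_ - _ + _).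
rewrite big_ord_recl expr0 scale1r; congr (_ + _).
rewrite [RHS]big_ord_recr /= {2}/cn ltnn scaler0 addr0.
by apply: eq_bigr => i _; rewrite /bump /= add1n /cn ltn_ord.
Qed.

Lemma binmeanB z n (f g : nat -> E) :
  binmean z n (fun k => f k - g k) = binmean z n f - binmean z n g.
Proof.
elim: n f g => //= n IH f g; rewrite IH (IH (f \o S) (g \o S)).
by rewrite !scalerBr opprD addrACA.
Qed.

Lemma binmean_cst z n (e : E) : binmean z n (fun=> e) = e.
Proof.
elim: n => //= n IH.
by rewrite -[(fun=> e) \o S]/(fun=> e) IH -scalerDl subrK scale1r.
Qed.

End bernstein.

Lemma binmean_norm (R : realType) (E : normedModType R) (z : R) n (f : nat -> E)
    (h : nat -> R) : 0 <= z <= 1 -> (forall k, (k <= n)%N -> `|f k| <= h k) ->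
  `|binmean z n f| <= @binmean R R^o z n h.
Proof.
move=> /andP[z0 z1]; elim: n f h => [|n IH] f h fh /=; first exact: fh.
rewrite (le_trans (ler_normD _ _))// !normrZ ger0_norm ?subr_ge0// (ger0_norm z0).
apply: lerD; apply: ler_wpM2l; rewrite ?subr_ge0//; apply: IH => k kn.
  by apply: fh; exact: leqW.
exact: fh.
Qed.

(** The centre [c] has to be arbitrary: conditioning on a success of the first trial moves it to
    [c - 1]. *)
Lemma binmean_var (R : realType) (z c : R) n :
  @binmean R R^o z n (fun k => (k%:R - c) ^+ 2) =
  (n%:R * z - c) ^+ 2 + n%:R * (z * (1 - z)).
Proof.
elim: n c => [|n IH] c /=; first by rewrite !mul0r addr0.
rewrite IH.
have -> : (fun k : nat => (k%:R - c) ^+ 2) \o S =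
    (fun k : nat => (k%:R - (c - 1)) ^+ 2 : R).
  by apply/funext => k /=; rewrite -natr1; congr (_ ^+ 2); ring.
rewrite IH -natr1 -![_ *: _]/(_ * _); ring.
Qed.

(** Bernstein's theorem through Chebyshev's inequality, with values in a normed space, so that it
    applies to orbits of a semigroup. *)
Lemma binmean_approx (R : realType) (E : normedModType R) (q : R -> E) (e : R) :
  continuous q -> 0 < e ->
  exists n, forall z : R, 0 <= z <= 1 ->
    `|q z - binmean z n (fun k => q (k%:R / n%:R))| <= e.
Proof.
move=> cq e0.
have [M HM] : exists M : R, forall z : R, 0 <= z <= 1 -> `|q z| <= M.
  have := @continuous_compact _ _ q `[0, 1] _ (@segment_compact R 0 1).
  move=> /(_ (continuous_subspaceT cq))/compact_bounded[M [_ HM]].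
  exists (`|M| + 1) => z z01; apply: HM; first by rewrite ltr_pwDr// ler_norm.
  by exists z => //=; rewrite in_itv.
have M0 : 0 <= M by apply: le_trans (HM 0 _); rewrite // lexx ler01.
have [dl dl0 Hdl] := segment_unif_continuous 0 1 cq (ltac:(lra) : 0 < e / 2).
have [n [n0 Hn]] : exists n, (0 < n)%N /\ M / dl ^+ 2 / n%:R <= e.
  near \oo => n; exists n; split; first by near: n; exact: nbhs_infty_gt.
  rewrite ler_pdivrMr; last by rewrite ltr0n; near: n; exact: nbhs_infty_gt.
  rewrite -ler_pdivrMl//.
  by apply/ltW; near: n; exact: nbhs_infty_gtr.
have nR : (0 : R) < n%:R by rewrite ltr0n.
exists n => z z01; rewrite -{1}(binmean_cst z n (q z)) -binmeanB.
(* A common majorant: [e / 2] covers the points [k / n] near [z], the quadratic term exceeds 2 M for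
   the distant ones. Its mean is e / 2 + 2 (M / (dl^2 n)) z (1 - z), at most [e] because z (1 - z)
   <= 1/4. *)
pose h (k : nat) : R := e / 2 + 2 * M / dl ^+ 2 / n%:R ^+ 2 * (k%:R - n%:R * z) ^+ 2.
apply: (@le_trans _ _ (@binmean R R^o z n h)).
  apply: binmean_norm => // k kn.
  have k01 : 0 <= (k%:R / n%:R : R) <= 1.
    by rewrite divr_ge0//= ler_pdivrMr// mul1r ler_nat.
  have K0 : 0 <= 2 * M / dl ^+ 2 by rewrite divr_ge0 ?sqr_ge0// mulr_ge0.
  have Ek : 2 * M / dl ^+ 2 / n%:R ^+ 2 * (k%:R - n%:R * z) ^+ 2 =
    2 * M / dl ^+ 2 * (z - k%:R / n%:R) ^+ 2 by field; rewrite !gt_eqF.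
  have [zk|zk] := lerP `|z - k%:R / n%:R| dl.
    apply: le_trans (Hdl _ _ z01 zk) _; rewrite /h lerDl Ek.
    by rewrite mulr_ge0// sqr_ge0.
  apply: (@le_trans _ _ (2 * M)).
    by rewrite (le_trans (ler_normB _ _))//; have := HM _ z01; have := HM _ k01; lra.
  rewrite /h Ek -[leLHS]add0r lerD//; first lra.
  rewrite -[leLHS](@divfK _ (dl ^+ 2)) ?expf_neq0 ?gt_eqF// ler_wpM2l//.
  by rewrite -[leRHS]real_normK ?num_real// ler_pXn2r ?nnegrE ?(ltW dl0) ?(ltW zk).
have -> : h = (fun k => e / 2 - (- (2 * M / dl ^+ 2 / n%:R ^+ 2) * (k%:R - n%:R * z) ^+ 2)).
  by apply/funext => k; rewrite /h mulNr opprK.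
rewrite (@binmeanB R R^o) binmean_cst.
have Hz (a : R) m (f : nat -> R) : @binmean R R^o z m (fun k => a * f k) = a * @binmean R R^o z m f.
  elim: m f => //= m IH f; rewrite IH (IH (f \o S)) -![_ *: _]/(_ * _); ring.
rewrite Hz binmean_var subrr expr0n add0r.
have zz : z * (1 - z) <= 1 / 4 by have := sqr_ge0 (z - 1 / 2); nra.
have -> : e / 2 - - (2 * M / dl ^+ 2 / n%:R ^+ 2) * (n%:R * (z * (1 - z))) =
  e / 2 + 2 * (M / dl ^+ 2 / n%:R) * (z * (1 - z)) by field; rewrite !gt_eqF.
have K0 : 0 <= M / dl ^+ 2 / n%:R by rewrite !divr_ge0// sqr_ge0.
by nra.
Unshelve. all: by end_near. Qed.

Section laplace.
Context (R : realType).

Lemma expRN_le1 (x : R) : 0 <= x -> expR (- x) <= 1.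
Proof. by move=> x0; rewrite -expR0 ler_expR oppr_le0. Qed.

(** Functions on the half line are represented by functions on the whole line composed with [pos],
    so that continuity need not be relativised. *)
Definition pos (s : R) : R := Num.max 0 s.

Lemma pos_ge0 s : 0 <= pos s. Proof. by rewrite le_max lexx. Qed.
Lemma pos_id s : 0 <= s -> pos s = s. Proof. exact: max_r. Qed.
Lemma posK s : pos (pos s) = pos s. Proof. by rewrite pos_id// pos_ge0. Qed.

Lemma posE s : pos s = (s + `|s|) / 2.
Proof.
rewrite /pos; case: (lerP 0 s) => s0; first by rewrite ger0_norm//; field.
by rewrite ltr0_norm// subrr mul0r.
Qed.

Lemma continuous_pos : continuous pos.
Proof.
have -> : pos = (fun s => (s + `|s|) / 2) by apply/funext => s; exact: posE.
move=> s; apply: cvgMl; apply: cvgD; first exact: cvg_id.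
exact: norm_continuous.
Qed.

(** The substitution z = e^(-dl s) maps the half line onto (0, 1], and the damping factor makes z
    Q(- ln z / dl) continuous at 0 although [Q] may have no limit at infinity. Its Bernstein
    polynomial is a combination of exponentials. *)
Lemma exp_approx (E : normedModType R) (Q : R -> E) (M dl e : R) :
  continuous Q -> (forall s, 0 <= s -> `|Q s| <= M) -> 0 < dl -> 0 < e ->
  exists n (c : nat -> E), forall s, 0 <= s ->
    `|expR (- (dl * s)) *: Q s - \sum_(j < n) expR (- (j.+1%:R * dl * s)) *: c j| <= e.
Proof.
move=> cQ QM dl0 e0.
have M0 : 0 <= M by apply: le_trans (QM 0 _).
(* This is min(1, z): the logarithm stays nonpositive, and [Q] is only evaluated on the half line,
   where it is bounded. *)
pose cl (z : R) : R := 1 - pos (1 - z).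
have cl_id z : z <= 1 -> cl z = z by move=> z1; rewrite /cl pos_id ?subr_ge0// subKr.
have cl_gt0 z : 0 < z -> 0 < cl z.
  by move=> z0; rewrite /cl subr_gt0 /pos gt_max ltr01/= ltrBlDr ltrDl.
have cl_le1 z : cl z <= 1 by rewrite /cl lerBlDr lerDl pos_ge0.
pose q (z : R) : E := pos z *: Q (- ln (cl z) / dl).
have qM z : `|q z| <= M * pos z.
  rewrite /q normrZ (ger0_norm (pos_ge0 _)) mulrC ler_wpM2r ?pos_ge0//.
  by apply: QM; rewrite divr_ge0 ?(ltW dl0)// oppr_ge0 ln_le0.
have cq : continuous q.
  move=> z; have [z0|z0] := lerP z 0.
    have pz : pos z = 0 by rewrite /pos max_l.
    rewrite /continuous_at {2}/q pz scale0r; apply/cvgrPdist_le => r r0.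
    have : M * pos y @[y --> z] --> M * pos z.
      by apply: cvgMr; exact: continuous_pos.
    rewrite pz mulr0 => /cvgrPdist_le/(_ r r0).
    apply: filterS => y; rewrite !sub0r !normrN => /(le_trans (ler_norm _)).
    exact/le_trans/qM.
  apply: cvgZ; first exact: continuous_pos.
  apply: (cvg_comp (fun y => - ln (cl y) / dl) Q); last exact: cQ.
  apply: cvgMl; apply: cvgN.
  apply: (cvg_comp cl (@ln R)); last exact/continuous_ln/cl_gt0.
  apply: cvgB; first exact: cvg_cst.
  apply: (cvg_comp (fun y => 1 - y) pos); last exact: continuous_pos.
  by apply: cvgB; [exact: cvg_cst|exact: cvg_id].
have [n Hn] := binmean_approx cq e0.
have [c c0 Hc] := binmean_poly n (fun k => q (k%:R / n%:R)).
exists n, (fun j => c j.+1) => s s0.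
have z0 := expR_gt0 (- (dl * s)).
have z1 : expR (- (dl * s)) <= 1 by rewrite expRN_le1// mulr_ge0// ltW.
have := Hn (expR (- (dl * s))); rewrite z1 (ltW z0) => /(_ isT).
(* The constant coefficient is q(0) = 0, so the sum starts with the exponent [dl]. *)
rewrite Hc big_ord_recl c0 mul0r {2}/q pos_id// scale0r scaler0 add0r.
rewrite /q pos_id ?(ltW z0)// cl_id// expRK.
have -> : - - (dl * s) / dl = s by rewrite opprK mulrC mulKf// gt_eqF.
set A := \sum_(_ < n) _; set B := \sum_(_ < n) _; suff -> : A = B by [].
by apply: eq_bigr => j _; rewrite -expRM_natl lift0 mulrN mulrA.
Qed.

Definition BC (h : R -> R) := continuous h /\ exists K : R, forall s, `|h s| <= K.

(** For each damping rate [exp_approx] puts the damped function close to a combination of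
    exponentials, on which [Lam] vanishes; the rate then tends to 0. The invariance of [h] under
    [pos] extends the estimate from the half line to the whole line, where boundedness of [Lam] is
    stated. *)
Lemma laplace_functional (Lam : (R -> R) -> R) :
  (forall a h1 h2, BC h1 -> BC h2 ->
     Lam (fun s => a * h1 s + h2 s) = a * Lam h1 + Lam h2) ->
  (exists C : R, forall h (K : R), continuous h -> (forall s, `|h s| <= K) -> `|Lam h| <= C * K) ->
  (forall h, BC h -> Lam (fun s => expR (- (n.+1%:R^-1 * pos s)) * h s) @[n --> \oo] --> Lam h) ->
  (forall lam : R, 0 < lam -> Lam (fun s => expR (- (lam * pos s))) = 0) ->
  forall h, BC h -> (forall s, h (pos s) = h s) -> Lam h = 0.
Proof.
move=> lin [C HC] dc ex h bch hpos.
have [ch [K hK]] := bch.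
have cex a : continuous (fun s => expR (- (a * pos s))).
  move=> s; apply: (cvg_comp (fun s => - (a * pos s)) (@expR R)); last exact: continuous_expR.
  by apply: cvgN; apply: cvgMr; exact: continuous_pos.
have bex a : 0 <= a -> BC (fun s => expR (- (a * pos s))).
  move=> a0; split => //; exists 1 => s; rewrite ger0_norm ?expR_ge0//.
  by rewrite expRN_le1// mulr_ge0// pos_ge0.
have lin0 : Lam (fun=> 0) = 0.
  have b0 : BC (fun=> 0 : R) by split; [move=> ?; exact: cvg_cst|exists 0 => s; rewrite normr0].
  have := lin (-1) (fun=> 0) (fun=> 0) b0 b0.
  have -> : (fun=> -1 * 0 + 0) = (fun=> 0) :> (R -> R).
    by apply/funext => s; rewrite mulr0 addr0.
  by rewrite mulN1r addNr.
have bsum n (c : nat -> R) (dl : R) : 0 < dl ->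
    BC (fun s => \sum_(j < n) expR (- (j.+1%:R * dl * pos s)) * c j) /\
    Lam (fun s => \sum_(j < n) expR (- (j.+1%:R * dl * pos s)) * c j) = 0.
  move=> dl0; elim: n => [|n [[c1 [K1 IH1]] IH2]].
    rewrite (_ : (fun s => _) = (fun=> 0)); last by apply/funext => s; rewrite big_ord0.
    split => //; split; first by move=> ?; exact: cvg_cst.
    by exists 0 => s; rewrite normr0.
  rewrite (_ : (fun s => _) = (fun s => c n * expR (- (n.+1%:R * dl * pos s)) +
      \sum_(j < n) expR (- (j.+1%:R * dl * pos s)) * c j)); last first.
    by apply/funext => s; rewrite big_ord_recr /= addrC mulrC.
  have nd : 0 < n.+1%:R * dl by rewrite mulr_gt0.
  split; last first.
    rewrite lin//; [by rewrite IH2 ex// mulr0 addr0|exact/bex/ltW|].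
    by split => //; exists K1.
  split.
    by move=> s; apply: cvgD; [apply: cvgMr; exact: cex|exact: c1].
  exists (`|c n| + K1) => s; rewrite (le_trans (ler_normD _ _))// lerD//.
  rewrite normrM ler_piMr// ger0_norm ?expR_ge0//.
  by rewrite expRN_le1// mulr_ge0 ?pos_ge0// ltW.
have H0 (dl : R) : 0 < dl -> Lam (fun s => expR (- (dl * pos s)) * h s) = 0.
  move=> dl0; apply/eqP; rewrite -normr_le0; apply/ler_addgt0Pr => e e0.
  have C1 : 0 < `|C| + 1 by rewrite ltr_wpDl.
  have [n [c Hc]] := @exp_approx R^o h K dl (e / (`|C| + 1)) ch
    (fun s _ => hK s) dl0 (divr_gt0 e0 C1).
  have [[sc [K1 sK]] s0] := bsum n c dl dl0.
  have bh1 : BC (fun s => expR (- (dl * pos s)) * h s).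
    split; first by move=> s; apply: cvgM; [exact: cex|exact: ch].
    exists K => s; rewrite normrM -[leRHS]mul1r ler_pM//.
    rewrite ger0_norm ?expR_ge0//.
    by rewrite expRN_le1// mulr_ge0 ?pos_ge0// ltW.
  have := lin (-1) _ _ (conj sc (ex_intro _ K1 sK)) bh1.
  rewrite s0 mulr0 add0r add0r => <-.
  apply: (@le_trans _ _ (C * (e / (`|C| + 1)))).
    apply: HC.
      move=> s; apply: cvgD; first by apply: cvgMr; exact: sc.
      exact: bh1.1.
    move=> s; rewrite mulN1r addrC -(hpos s).
    exact: Hc (pos_ge0 s).
  apply: (@le_trans _ _ ((`|C| + 1) * (e / (`|C| + 1)))).
    have K2 : 0 <= e / (`|C| + 1) by rewrite divr_ge0 ?(ltW C1)// ltW.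
    by rewrite ler_wpM2r// (le_trans (ler_norm _))// lerDl.
  by rewrite mulrC divfK// gt_eqF.
have := dc h bch.
rewrite (_ : (fun n => _) = (fun=> 0)); last first.
  by apply/funext => n; rewrite H0// invr_gt0.
by move=> /(cvg_unique _ (cvg_cst _)) <-.
Qed.

End laplace.

(** * Contraction semigroups and their generators *)

Section semigroup.
Context (R : realType) (E : normedModType R) (T : R -> E -> E).
Hypothesis hT : contraction_semigroup T.

Let lin (t : R) : 0 <= t -> linear (T t). Proof. by case: hT => + _ _ _ _; apply. Qed.

Lemma sg_norm (t : R) p : 0 <= t -> `|T t p| <= `|p|.
Proof. by case: hT => _ + _ _ _; apply. Qed.
Lemma sg_0 p : T 0 p = p. Proof. by case: hT. Qed.
Lemma sg_add (s t : R) p : 0 <= s -> 0 <= t -> T (s + t) p = T s (T t p).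
Proof. by case: hT => _ _ _ + _; apply. Qed.
Lemma sg_comm (s t : R) p : 0 <= s -> 0 <= t -> T s (T t p) = T t (T s p).
Proof. by move=> s0 t0; rewrite -!sg_add// addrC. Qed.
Lemma sg_cvg p : T t p @[t --> 0^'+] --> p. Proof. by case: hT. Qed.

Lemma linear_fun0 (L : E -> E) : linear L -> L 0 = 0.
Proof. by move=> h; have := h (-1) 0 0; rewrite scaler0 addr0 scaleN1r addNr. Qed.
Lemma linear_funD (L : E -> E) p q : linear L -> L (p + q) = L p + L q.
Proof. by move=> h; rewrite -[p in LHS]scale1r h scale1r. Qed.
Lemma linear_funZ (L : E -> E) (a : R) p : linear L -> L (a *: p) = a *: L p.
Proof. by move=> h; rewrite -[a *: p]addr0 h linear_fun0// addr0. Qed.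
Lemma linear_funB (L : E -> E) p q : linear L -> L (p - q) = L p - L q.
Proof. by move=> h; rewrite linear_funD// -scaleN1r linear_funZ// scaleN1r. Qed.

Lemma sg_D (t : R) p q : 0 <= t -> T t (p + q) = T t p + T t q.
Proof. by move=> t0; exact/linear_funD/lin. Qed.
Lemma sg_Z (t a : R) p : 0 <= t -> T t (a *: p) = a *: T t p.
Proof. by move=> t0; exact/linear_funZ/lin. Qed.
Lemma sg_B (t : R) p q : 0 <= t -> T t (p - q) = T t p - T t q.
Proof. by move=> t0; exact/linear_funB/lin. Qed.

(** A discrete Taylor formula: T(n h) p - p is the telescoping sum of the T(i h) (T h p - p). It
    replaces the integral of T_s q over [0, t] in the estimates below. *)
Lemma sg_telescope (h : R) n (p q : E) : 0 <= h ->
  T (n%:R * h) p - p - (n%:R * h) *: q =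
  \sum_(i < n) T (i%:R * h) (T h p - p - h *: q) +
  h *: \sum_(i < n) (T (i%:R * h) q - q).
Proof.
move=> h0; elim: n => [|n IH].
  by rewrite !big_ord0 mul0r sg_0 subrr scale0r subr0 scaler0 addr0.
have nh : 0 <= n%:R * h by rewrite mulr_ge0.
rewrite !big_ord_recr /= scalerDr addrACA -IH -natr1 mulrDl mul1r sg_add//.
rewrite !sg_B// sg_Z// scalerDl scalerBr subrKA.
by rewrite opprD !addrA [RHS](ACl (4*2*3*6*1*5))%AC /= addrK.
Qed.

(** A subdivision of [0, t] so fine that the errors of the single steps sum to at most [t * e]; for
    t = 0 it is empty. *)
Lemma sg_small (t : R) (p d : E) (e : R) : 0 <= t -> 0 < e ->
  h^-1 *: (T h p - p) @[h --> 0^'+] --> d ->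
  exists n h, [/\ 0 <= h, n%:R * h = t & n%:R * `|T h p - p - h *: d| <= t * e].
Proof.
move=> t0 e0 cd; have [->|tn0] := eqVneq t 0.
  by exists 0%N, 0; rewrite lexx !mul0r.
have tp : 0 < t by rewrite lt_neqAle eq_sym tn0.
move/cvgrPdist_le/(_ e e0) : cd => [r /= r0 Hr].
have [n n0 Hn] : exists2 n, (0 < n)%N & t / n%:R < r.
  near \oo => n; exists n; first by near: n; exact: nbhs_infty_gt.
  have n0 : (0 : R) < n%:R by rewrite ltr0n; near: n; exact: nbhs_infty_gt.
  rewrite ltr_pdivrMr// -ltr_pdivrMl//.
  by near: n; exact: nbhs_infty_gtr.
have nR : (0 : R) < n%:R by rewrite ltr0n.
have h0 : 0 < t / n%:R by rewrite divr_gt0.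
exists n, (t / n%:R); split; [exact: ltW|by rewrite mulrC divfK// gt_eqF|].
have /= := Hr (t / n%:R); rewrite sub0r normrN gtr0_norm// => /(_ Hn h0) H.
apply: (@le_trans _ _ (n%:R * (t / n%:R * e))); last first.
  by rewrite mulrA [n%:R * _]mulrC divfK// gt_eqF.
rewrite ler_wpM2l// -normrN opprB.
have -> : t / n%:R *: d - (T (t / n%:R) p - p) =
    (t / n%:R) *: (d - (t / n%:R)^-1 *: (T (t / n%:R) p - p)).
  by rewrite scalerBr scalerA divff ?gt_eqF// scale1r.
by rewrite normrZ gtr0_norm// ler_wpM2l// (ltW h0).
Unshelve. all: by end_near. Qed.

(** In [sg_telescope] the first sum is negligible by [sg_small], and each term of the second is at
    most [K]. The denominator [t + 1] used in the proof avoids a separate case t = 0. *)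
Lemma generator_taylor (t : R) (p q : E) (K : R) : 0 <= t -> generator T (p, q) ->
  (forall s, 0 <= s <= t -> `|T s q - q| <= K) -> `|T t p - p - t *: q| <= t * K.
Proof.
move=> t0 gT HK; apply/ler_addgt0Pr => e e0.
have [n [h [h0 nh Hh]]] := sg_small t0 (divr_gt0 e0 (ltr_wpDl t0 ltr01)) gT.
rewrite -nh sg_telescope// (le_trans (ler_normD _ _))// addrC lerD//.
  apply: (@le_trans _ _ (h * (n%:R * K))); last by rewrite mulrA (mulrC h).
  rewrite normrZ ger0_norm// ler_wpM2l//.
  rewrite (le_trans (ler_norm_sum _ _ _))// mulr_natl.
  rewrite -[in leRHS](card_ord n) -sumr_const; apply: ler_sum => i _; apply: HK.
  by rewrite mulr_ge0//= -nh ler_wpM2r// ler_nat ltnW.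
apply: (@le_trans _ _ (n%:R * `|T h p - p - h *: q|)).
  rewrite (le_trans (ler_norm_sum _ _ _))// mulr_natl.
  rewrite -[in leRHS](card_ord n) -sumr_const; apply: ler_sum => i _.
  by apply: sg_norm; rewrite mulr_ge0.
apply: le_trans Hh _; rewrite mulrC mulrAC ler_pdivrMr ?ltr_wpDl//.
by rewrite ler_wpM2l ?(ltW e0)// lerDl.
Qed.

Lemma generator_lipschitz (t : R) (p q : E) : 0 <= t -> generator T (p, q) ->
  `|T t p - p| <= t * `|q|.
Proof.
move=> t0 gT; apply/ler_addgt0Pr => e e0.
have [n [h [h0 nh Hh]]] := sg_small t0 (divr_gt0 e0 (ltr_wpDl t0 ltr01)) gT.
have te : t * (e / (t + 1)) <= e.
  rewrite mulrC mulrAC ler_pdivrMr ?ltr_wpDl//.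
  by rewrite ler_wpM2l ?(ltW e0)// lerDl.
have H1 : `|T h p - p| <= `|T h p - p - h *: q| + h * `|q|.
  have <- : `|h *: q| = h * `|q| by rewrite normrZ ger0_norm.
  by rewrite -[X in `|X| <= _](subrK (h *: q)) ler_normD.
(* With q = 0 the formula reduces to the plain telescoping sum of n terms of norm at most |T h p -
   p|. *)
have := sg_telescope n p 0 h0; rewrite !scaler0 !subr0.
rewrite [X in _ *: X]big1 ?scaler0 ?addr0; last first.
  by move=> i _; rewrite linear_fun0 ?subr0//; apply: lin; rewrite mulr_ge0.
rewrite nh => ->; apply: (@le_trans _ _ (n%:R * `|T h p - p|)).
  rewrite (le_trans (ler_norm_sum _ _ _))// mulr_natl.
  rewrite -[in leRHS](card_ord n) -sumr_const; apply: ler_sum => i _.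
  by rewrite sg_norm// mulr_ge0.
rewrite (le_trans (ler_wpM2l _ H1))// mulrDr addrC mulrA nh lerD2l.
exact: le_trans Hh te.
Qed.

Lemma generator_lin (a : R) (p q p' q' : E) : generator T (p, q) ->
  generator T (p', q') -> generator T (a *: p + p', a *: q + q').
Proof.
move=> g1 g2; rewrite /generator /=.
have H := cvgD (cvgZl_tmp (k := a) g1) g2.
have F0 : Filter (0^'+ : set_system R) by typeclasses eauto.
apply: cvg_trans (H F0 F0); apply: near_eq_cvg; near=> h.
have h0 : 0 <= h by apply: ltW; near: h; exact: nbhs_right_gt.
by rewrite /= sg_D// sg_Z// opprD addrACA -scalerBr [RHS]scalerDr scalerA mulrC -scalerA.
Unshelve. all: by end_near. Qed.

(** With q replaced by its difference quotient, (lam + 1/h) p equals lam p - q plus T_h p / h;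
    contractivity of T_h cancels 1/h on both sides. *)
Lemma generator_dissipative (lam : R) (p q : E) : 0 < lam -> generator T (p, q) ->
  lam * `|p| <= `|lam *: p - q|.
Proof.
move=> l0 gT; apply/ler_addgt0Pr => e e0.
move/cvgrPdist_le/(_ e e0) : gT => [r /= r0 Hr].
pose h := r / 2; have h0 : 0 < h by rewrite divr_gt0.
have := Hr h; rewrite /= sub0r normrN gtr0_norm// => /(_ _ h0) H.
have {}H : `|q - h^-1 *: (T h p - p)| <= e by apply: H; rewrite /h; lra.
have E1 : (lam + h^-1) *: p = (lam *: p - q) + (q - h^-1 *: (T h p - p)) + h^-1 *: T h p.
  by rewrite addrA subrK scalerBr opprB addrA addrNK scalerDl.
have H2 : (lam + h^-1) * `|p| <= `|lam *: p - q| + e + h^-1 * `|p|.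
  have c0 : 0 <= lam + h^-1 by rewrite addr_ge0 ?invr_ge0 ?(ltW l0) ?(ltW h0).
  rewrite -{1}(ger0_norm c0) -normrZ E1 (le_trans (ler_normD _ _))//.
  apply: lerD; first by rewrite (le_trans (ler_normD _ _))// lerD2l.
  have hV : 0 <= h^-1 by rewrite invr_ge0 ltW.
  by rewrite normrZ (ger0_norm hV) ler_wpM2l// sg_norm// ltW.
by move: H2; rewrite mulrDl lerD2r.
Qed.

(** For s <= t the contraction T_s reduces the difference to T_(t - s) p - p, so continuity at 0
    gives continuity everywhere. *)
Lemma sg_continuous p : continuous (fun t => T (pos t) p).
Proof.
have mono s t : 0 <= s -> s <= t -> `|T s p - T t p| <= `|T (t - s) p - p|.
  move=> s0 st; rewrite -{1}(subrKC s t) sg_add// ?subr_ge0// distrC -sg_B//.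
  by rewrite sg_norm.
move=> t; apply/cvgrPdist_le => e e0.
have /cvgrPdist_le/(_ e e0)[r /= r0 Hr] := @sg_cvg p.
have Hr' (u : R) : 0 <= u -> u < r -> `|T u p - p| <= e.
  move=> u0 ur; have [->|un] := eqVneq u 0; first by rewrite sg_0 subrr normr0 ltW.
  rewrite distrC; apply: Hr; rewrite /= ?sub0r ?normrN ?ger0_norm//.
  by rewrite lt_neqAle eq_sym un.
have /cvgrPdist_lt/(_ r r0) := @continuous_pos R t.
apply: filterS => s ts.
have [st|st] := lerP (pos s) (pos t).
  rewrite distrC (le_trans (mono _ _ (pos_ge0 _) st))// Hr' ?subr_ge0//.
  exact: le_lt_trans (ler_norm _) ts.
rewrite (le_trans (mono _ _ (pos_ge0 _) (ltW st)))// Hr' ?subr_ge0 ?ltW//.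
by rewrite -opprB (le_lt_trans (ler_norm _))// normrN.
Qed.

Lemma closure_pairP (G : set (E * E)) (p q : E) : closure G (p, q) <->
  forall e : R, 0 < e -> exists p' q', [/\ G (p', q'), `|p - p'| <= e & `|q - q'| <= e].
Proof.
split=> [cG e e0|H].
  have [|[p' q'] [Gp [/= b1 b2]]] := cG (ball (p, q) e); first exact: nbhsx_ballx.
  by exists p', q'; split => //; apply: ltW; move: b1 b2; rewrite -!ball_normE.
move=> B /nbhs_ballP[e /= e0 eB].
have [|p' [q' [Gp b1 b2]]] := H (e / 2); first by rewrite divr_gt0.
exists (p', q'); split => //; apply: eB.
have e2 : e / 2 < e by rewrite ltr_pdivrMr// ltr_pMr// ltr1n.
by split; rewrite /= -ball_normE /=; exact: le_lt_trans e2.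
Qed.

(** The Taylor estimate of [generator_taylor] passes to limits in the graph, and together with the
    continuity of T_s q it returns membership in the generator. *)
Lemma generator_closed (G : set (E * E)) :
  G `<=` generator T -> closure G `<=` generator T.
Proof.
move=> GT [p q] /closure_pairP cG.
have key (t K : R) : 0 <= t -> (forall s, 0 <= s <= t -> `|T s q - q| <= K) ->
    `|T t p - p - t *: q| <= t * K.
  move=> t0 HK; apply/ler_addgt0Pr => e e0.
  (* The modulus [K] grows by 2 d, which costs 2 d t; the change of [p] costs 2 d and that of [q]
     costs d t. *)
  have d0 : 0 < e / (2 + 3 * t) by rewrite divr_gt0// ltr_pwDl// mulr_ge0.
  have [p' [q' [Gp b1 b2]]] := cG _ d0; set d := e / _ in d0 b1 b2.
  have HK' s : 0 <= s <= t -> `|T s q' - q'| <= K + 2 * d.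
    move=> st; have s0 : 0 <= s by case/andP : st.
    have -> : T s q' - q' = (T s q - q) + (T s (q' - q) + (q - q')).
      rewrite sg_B// addrACA (addrC _ (T s q' - _)) subrK; congr (_ + _).
      by rewrite addrA addNr add0r.
    rewrite (le_trans (ler_normD _ _))// lerD ?HK//.
    rewrite (le_trans (ler_normD _ _))// mulrDl mul1r lerD//.
    by rewrite (le_trans (sg_norm _ s0))// distrC.
  have := generator_taylor t0 (GT _ Gp) HK'.
  have -> : T t p - p - t *: q = (T t p' - p' - t *: q') +
      (T t (p - p') - (p - p') - t *: (q - q')).
    rewrite sg_B// scalerBr !opprD !opprK !addrA.
    by rewrite [RHS](ACl (4*6*8*1*5*7*2*9*3))%AC /= !addrK.
  move=> H; rewrite (le_trans (ler_normD _ _))//.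
  have H2 : `|T t (p - p') - (p - p') - t *: (q - q')| <= 2 * d + t * d.
    rewrite (le_trans (ler_normB _ _))// lerD//.
      rewrite (le_trans (ler_normB _ _))// mulrDl mul1r lerD//.
      by rewrite (le_trans (sg_norm _ t0)).
    by rewrite normrZ ger0_norm// ler_wpM2l.
  have Ed : e = d * (2 + 3 * t).
    by rewrite /d divfK// gt_eqF// ltr_pwDl// mulr_ge0.
  apply: le_trans (lerD H H2) _; rewrite [in leRHS]Ed; lra.
rewrite /generator /=; apply/cvgrPdist_le => e e0.
have /cvgrPdist_le/(_ e e0) := @sg_continuous q 0.
rewrite pos_id// sg_0 => /nbhs_ballP[r /= r0 Hr].
near=> h; have h0 : 0 < h by near: h; exact: nbhs_right_gt.
have -> : q - h^-1 *: (T h p - p) = - (h^-1 *: (T h p - p - h *: q)).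
  by rewrite [in RHS]scalerBr scalerA mulVf ?gt_eqF// scale1r [RHS]opprB.
rewrite normrN normrZ gtr0_norm ?invr_gt0// ler_pdivrMl//.
apply: key; first exact: ltW.
move=> s /andP[s0 sh]; rewrite distrC -{1}(pos_id s0); apply: Hr.
rewrite /ball /= sub0r normrN ger0_norm// (le_lt_trans sh)//.
Unshelve. all: by end_near. Qed.

(** If lam - G has dense range, lam p - q is nearly attained on [G], and dissipativity of the
    difference turns this into closeness in the graph norm. *)
Lemma generator_core (G : set (E * E)) (lam : R) : 0 < lam ->
  G `<=` generator T ->
  (forall f (e : R), 0 < e -> exists p q, G (p, q) /\ `|f - (lam *: p - q)| <= e) ->
  generator T = closure G.
Proof.
move=> l0 GT dG; apply/seteqP; split; last exact: generator_closed.
move=> [p q] gpq; apply/closure_pairP => e e0.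
(* The first bound gives |p - p'| <= e after division by [lam]; the second serves [q], where the
   defect counts twice. *)
have d0 : 0 < Num.min (lam * e) (e / 2).
  by rewrite lt_min mulr_gt0// divr_gt0.
have [p' [q' [Gp Hd]]] := dG (lam *: p - q) _ d0.
move: Hd; rewrite le_min => /andP[Hd1 Hd2].
have g2 : generator T (p - p', q - q').
  have := @generator_lin (-1) _ _ _ _ (GT _ Gp) gpq.
  by rewrite !scaleN1r ![- _ + _]addrC.
have := generator_dissipative l0 g2.
have E1 : lam *: (p - p') - (q - q') = (lam *: p - q) - (lam *: p' - q').
  by rewrite scalerBr !opprD !opprK !addrA [LHS](ACl (1*3*2*4))%AC.
rewrite E1 => H; exists p', q'; split => //.
  by rewrite -(ler_pM2l l0) (le_trans H).
have -> : q - q' = lam *: (p - p') - ((lam *: p - q) - (lam *: p' - q')).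
  by rewrite -E1 subKr.
rewrite (le_trans (ler_normB _ _))// normrZ gtr0_norm//.
by have := le_trans H Hd2; lra.
Qed.

End semigroup.

Section nice_functionals.
Context (R : realType).

(* The condition on the multiplication by [exp (- s / n)] replaces countable
   additivity, which is what makes Laplace transforms determining. *)
Definition nice (C : R) (Lam : (R -> R) -> R) :=
  [/\ forall a h1 h2, BC h1 -> BC h2 ->
        Lam (fun s => a * h1 s + h2 s) = a * Lam h1 + Lam h2,
      forall h (K : R), continuous h -> (forall s, `|h s| <= K) -> `|Lam h| <= C * K &
      forall h, BC h ->
        Lam (fun s => expR (- (n.+1%:R^-1 * pos s)) * h s) @[n --> \oo] --> Lam h].

Lemma BC_damp (h : R -> R) (a : R) : 0 <= a -> BC h ->
  BC (fun s => expR (- (a * pos s)) * h s).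
Proof.
move=> a0 [ch [K hK]]; split.
  move=> s; apply: cvgM; last exact: ch.
  apply: (cvg_comp (fun s => - (a * pos s)) (@expR R)); last exact: continuous_expR.
  by apply: cvgN; apply: cvgMr; exact: continuous_pos.
exists K => s; rewrite normrM -[leRHS]mul1r ler_pM// ger0_norm ?expR_ge0//.
by rewrite expRN_le1// mulr_ge0 ?pos_ge0.
Qed.

Lemma BC_lin a (h1 h2 : R -> R) : BC h1 -> BC h2 -> BC (fun s => a * h1 s + h2 s).
Proof.
move=> [c1 [K1 b1]] [c2 [K2 b2]]; split.
  by move=> s; apply: cvgD; [apply: cvgMr; exact: c1|exact: c2].
exists (`|a| * K1 + K2) => s; rewrite (le_trans (ler_normD _ _))// lerD//.
by rewrite normrM ler_wpM2l.
Qed.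

Lemma BC_exp (a : R) : 0 <= a -> BC (fun s => expR (- (a * pos s))).
Proof.
move=> a0; rewrite (_ : (fun s => _) = (fun s => expR (- (a * pos s)) * 1)).
  apply: BC_damp => //; split; first by move=> ?; exact: cvg_cst.
  by exists 1 => s; rewrite normr1.
by apply/funext => s; rewrite mulr1.
Qed.

Lemma nice_eq (C1 C2 : R) (L1 L2 : (R -> R) -> R) : nice C1 L1 -> nice C2 L2 ->
  (forall lam, 0 < lam ->
     L1 (fun s => expR (- (lam * pos s))) = L2 (fun s => expR (- (lam * pos s)))) ->
  forall h, BC h -> (forall s, h (pos s) = h s) -> L1 h = L2 h.
Proof.
move=> [lin1 bd1 dc1] [lin2 bd2 dc2] ex h bh hp; apply/eqP; rewrite -subr_eq0; apply/eqP.
apply: (@laplace_functional _ (fun h => L1 h - L2 h)) bh hp.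
- by move=> a h1 h2 b1 b2; rewrite lin1// lin2//; ring.
- exists (C1 + C2) => f K cf fK; rewrite (le_trans (ler_normB _ _))// mulrDl.
  by rewrite lerD ?bd1 ?bd2.
- by move=> f bf; apply: cvgB; [exact: dc1|exact: dc2].
- by move=> lam l0; rewrite ex// subrr.
Qed.

Lemma nice_point (a x : R) : nice `|a| (fun h => a * h x).
Proof.
split=> [b h1 h2 _ _|h K _ hK|h _]; first by ring.
  by rewrite normrM ler_wpM2l.
apply: cvgMr; rewrite -[X in _ --> X]mul1r; apply: cvgMl.
rewrite -[X in _ --> X](@expR0 R) -oppr0 -(mul0r (pos x)).
apply: (cvg_comp (fun n : nat => - (n.+1%:R^-1 * pos x)) (@expR R)); last exact: continuous_expR.
by apply: cvgN; apply: cvgMl; exact: cvg_harmonic.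
Qed.

(** Iterating this makes nested averages nice, so that an identity between iterated integrals has to
    be checked on exponentials only. *)
Lemma nice_int d (T : measurableType d) (mu : {measure set T -> \bar R})
    (D : set T) (C : T -> R) (Lam : T -> (R -> R) -> R) :
  measurable D -> mu.-integrable D (EFin \o C) ->
  (forall t, D t -> nice (C t) (Lam t)) ->
  (forall h, BC h -> measurable_fun D (fun t => Lam t h)) ->
  nice (\int[mu]_(t in D) C t) (fun h => \int[mu]_(t in D) Lam t h).
Proof.
move=> mD iC nL mL.
have iL h : BC h -> mu.-integrable D (EFin \o (fun t => Lam t h)).
  move=> bh; have [ch [K hK]] := bh.
  apply: (@integrable_le _ _ _ _ _ _ (fun t => K * C t)) => //.
  - exact: mL.
  - exact: integrable_EFinZl.
  - by move=> t Dt; rewrite mulrC; have [_ bd _] := nL t Dt; exact: bd.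
split=> [a h1 h2 b1 b2|h K ch hK|h bh].
- have b12 := BC_lin a b1 b2.
  transitivity (\int[mu]_(t in D) (a * Lam t h1 + Lam t h2)).
    by apply: eq_Rintegral => t /set_mem Dt; have [lin _ _] := nL t Dt; exact: lin.
  rewrite RintegralD//; [|by apply: integrable_EFinZl => //; exact: iL|exact: iL].
  by rewrite RintegralZl//; exact: iL.
- have bh : BC h by split=> //; exists K.
  rewrite (le_trans (le_normr_Rintegral mD (iL h bh)))// mulrC -RintegralZl//.
  apply: le_Rintegral => //; [exact/integrable_norm/iL|exact: integrable_EFinZl|].
  by move=> t Dt; rewrite mulrC; have [_ bd _] := nL t Dt; exact: bd.
- have [ch [K hK]] := bh.
  have bn n : BC (fun s => expR (- (n.+1%:R^-1 * pos s)) * h s) by apply: BC_damp.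
  have [] := @Rintegral_cvg _ _ _ mu D
    (fun n t => Lam t (fun s => expR (- (n.+1%:R^-1 * pos s)) * h s))
    (fun t => Lam t h) (fun t => K * C t) mD.
  + by move=> n; exact: mL.
  + by move=> t Dt; have [_ _ dc] := nL t Dt; exact: dc.
  + exact: integrable_EFinZl.
  + move=> n t Dt; rewrite mulrC; have [_ bd _] := nL t Dt; apply: bd.
      exact: (bn n).1.
    move=> s; rewrite normrM -[leRHS]mul1r ler_pM// ger0_norm ?expR_ge0//.
    by rewrite expRN_le1// mulr_ge0 ?pos_ge0.
  + by [].
Qed.

End nice_functionals.

(** * Subordination *)

Section average.
Context (R : realType) (T : R -> C0fun R -> C0fun R).
Hypothesis hT : contraction_semigroup T.
Implicit Types mu : {measure set R -> \bar R}.
Local Notation D := (`[0, +oo[%classic : set R).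

Definition avg mu p := mix mu D (cst 1) (fun s => T (pos s) p).

Let mD : measurable D. Proof. by []. Qed.

Lemma sg_eval_continuous p x : continuous (fun s => T (pos s) p x).
Proof. by move=> s; apply: (C0_cvg_eval x); exact: (sg_continuous hT). Qed.

Let mT p x : measurable_fun D (fun s => T (pos s) p x).
Proof. by apply: measurable_funTS; apply: continuous_measurable_fun; exact: sg_eval_continuous. Qed.

Let bT p (s : R) : D s -> `|T (pos s) p| <= `|p|.
Proof. by move=> _; apply: (sg_norm hT); exact: pos_ge0. Qed.

Section avg.
Variable mu : {measure set R -> \bar R}.
Hypothesis mufin : (mu D < +oo)%E.

Lemma integrable_bounded (f : R -> R) (K : R) :
  measurable_fun D f ->
  (forall s, 0 <= s -> `|f s| <= K) -> mu.-integrable D (EFin \o f).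
Proof.
move=> mf fK; apply: measurable_bounded_integrable => //.
exists K; split; first exact: num_real.
by move=> M KM s /=; rewrite in_itv/= andbT => s0; rewrite (le_trans (fK s s0))// ltW.
Qed.

Let i1 : mu.-integrable D (EFin \o cst (1 : R)).
Proof.
apply: (@integrable_bounded _ 1) => [|s _]; first exact: measurable_cst.
by rewrite normr1.
Qed.

Lemma avgE p x : avg mu p x = \int[mu]_(s in D) T (pos s) p x.
Proof.
rewrite /avg (mixE mD i1 (mT p) (bT p)).
by apply: eq_Rintegral => s _; rewrite mul1r.
Qed.

Lemma avg_integrable p x : mu.-integrable D (EFin \o (fun s => T (pos s) p x)).
Proof.
apply: (@integrable_bounded _ `|p|); first exact: mT.
move=> s s0; rewrite (le_trans (C0_ler_norm _ _))//.
by apply: (sg_norm hT); exact: pos_ge0.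
Qed.

Lemma avg_bochner p : is_bochner mu D (fun s => T (pos s) p) (avg mu p).
Proof.
have -> : (fun s => T (pos s) p) = (fun s => (cst 1 : R -> R) s *: T (pos s) p).
  by apply/funext => s; rewrite scale1r.
apply: (@bochner_exists _ _ _ mu id D (cst 1) (fun s => T (pos s) p) `|p|) => //.
- by move=> s /=; rewrite in_itv/= andbT.
- by move=> t _; apply: (sg_norm hT); exact: pos_ge0.
- by move=> t _; apply: cvg_at_right_filter; exact: (sg_continuous hT).
Qed.

Lemma avg_norm p : `|avg mu p| <= fine (mu D) * `|p|.
Proof.
apply: C0_norm_le => x; rewrite avgE mulrC.
apply: Rintegral_bound => //; first exact: avg_integrable.
  by apply: (@integrable_bounded _ `|p|) => // s _; rewrite normr_id.
by move=> s Ds; rewrite (le_trans (C0_ler_norm _ _))// bT.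
Qed.

Lemma avg_linear : linear (avg mu).
Proof.
move=> a p q; apply: C0_ext => x.
have -> : (a *: avg mu p + avg mu q) x = a * avg mu p x + avg mu q x by [].
rewrite !avgE -RintegralZl//; last exact: avg_integrable.
rewrite -RintegralD//; last exact: avg_integrable.
  apply: eq_Rintegral => s _; rewrite (sg_D hT) ?pos_ge0// (sg_Z hT) ?pos_ge0//.
by apply: integrable_EFinZl => //; exact: avg_integrable.
Qed.

(** Evaluation at a point does not commute with [L], so the average has to be used as a Bochner
    integral: [bochner_linear] moves [L] inside, and [bochner_eval] returns to values. *)
Lemma avg_comm (L : C0fun R -> C0fun R) p : linear L ->
  (forall q, `|L q| <= `|q|) ->
  (forall s q, 0 <= s -> L (T s q) = T s (L q)) ->
  L (avg mu p) = avg mu (L p).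
Proof.
move=> linL Lle LT; apply: C0_ext => x.
have LTE : L \o (fun s => T (pos s) p) = (fun s => T (pos s) (L p)).
  by apply/funext => s /=; rewrite LT// pos_ge0.

have ipL : mu.-integrable D (EFin \o cst `|L p|).
  by apply: (@integrable_bounded _ `|L p|) => // s _; rewrite normr_id.
have mL y : measurable_fun D (fun s => L (T (pos s) p) y).
  rewrite (_ : (fun s => _) = (fun s => T (pos s) (L p) y)) //.
  by apply/funext => s; rewrite LT// pos_ge0.
have B : is_bochner mu D (fun s => T (pos s) (L p)) (L (avg mu p)).
  by rewrite -LTE; exact: (bochner_linear mD (mT p) linL Lle mL (avg_bochner p)).
by rewrite (bochner_eval mD (mT (L p)) ipL (bT (L p)) x B) avgE.
Qed.

End avg.
End average.

Lemma continuous_Rintegral d (T : measurableType d) (R : realType)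
    (mu : {measure set T -> \bar R}) (D : set T) (k : R -> T -> R) (g : T -> R) :
  measurable D -> mu.-integrable D (EFin \o g) ->
  (forall a, measurable_fun D (k a)) ->
  (forall t, D t -> continuous (k^~ t)) ->
  (forall a t, D t -> `|k a t| <= g t) ->
  continuous (fun a => \int[mu]_(t in D) k a t).
Proof.
move=> mD ig mk ck kg a; apply/(@cvg_nbhsP _ R^o) => u ua.
have [] := @Rintegral_cvg _ _ _ mu D (fun n => k (u n)) (k a) g mD.
- by move=> n; exact: mk.
- by move=> t Dt; apply: (cvg_comp u (k^~ t) ua); exact: ck.
- exact: ig.
- by move=> n t Dt; exact: kg.
- by [].
Qed.

Lemma sub_bound (R : realFieldType) (x y z a b e : R) :
  - b <= y - z -> x - 1 <= a -> 1 - e <= z -> x - y <= e + (a + b).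
Proof. lra. Qed.

Lemma add_bound (R : realFieldType) (x y z e m a b d : R) :
  0 < e -> x <= m + (a + b) -> y <= e / 4 + d -> m <= e / 4 -> a + b + d + z <= e / 4 ->
  x + y + z <= e.
Proof. lra. Qed.

Section subordination.
Context (R : realType) (T : R -> C0fun R -> C0fun R).
Hypothesis hT : contraction_semigroup T.
Variables (gam : R) (nu : R -> probability R R).
Hypothesis gam0 : 0 < gam.
Hypothesis hnu : stable_laws gam nu.
Local Notation D := (`[0, +oo[%classic : set R).
Local Notation S := (fun t => avg T (nu t)).

Let mD : measurable D. Proof. by []. Qed.

Let nuD t : 0 <= t -> nu t `[0%R, +oo[%classic = 1%E. Proof. by move=> t0; have [] := hnu t0. Qed.
Let nufin t : (nu t D < +oo)%E.
Proof. by rewrite (le_lt_trans (probability_le1 _ _))// ltry. Qed.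

Lemma stable_laplace (t lam : R) : 0 <= t -> 0 <= lam ->
  \int[nu t]_(s in D) expR (- (lam * pos s)) = expR (- (t * lam `^ gam)).
Proof.
move=> t0 l0; have [_ /(_ lam l0) E] := hnu t0.
rewrite -[RHS]/(fine (expR (- (t * lam `^ gam)))%:E) -E.
apply: eq_Rintegral => s; rewrite inE/= in_itv/= andbT => s0.
by rewrite pos_id.
Qed.

Lemma subordinate_comm t (s : R) p : 0 <= s -> S t (T s p) = T s (S t p).
Proof.
move=> s0; rewrite (avg_comm hT (nufin t))//.
- by case: hT => + _ _ _ _; apply.
- by move=> q; exact: (sg_norm hT).
- by move=> r q r0; exact: (sg_comm hT).
Qed.

(** Since [stable_laws] prescribes Laplace transforms only, the convolution property has to be
    derived. Both sides average one orbit, against nu_(r + h) and against the sum of two independent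
    times; these functionals are nice and agree on exponentials. *)
Lemma subordinate_add (r h : R) p : 0 <= r -> 0 <= h -> S (r + h) p = S r (S h p).
Proof.
move=> r0 h0; apply: C0_ext => x; rewrite !(avgE hT) ?nufin//.
pose f s := T (pos s) p x.
transitivity (\int[nu r]_(a in D) \int[nu h]_(b in D) f (pos a + pos b)); last first.
  apply: eq_Rintegral => a _.
  (* T_a is moved inside S_h, so that the composition becomes a double integral of a single orbit at
     time a + b. *)
  rewrite -(@subordinate_comm h) ?pos_ge0// (avgE hT) ?nufin//.
  apply: eq_Rintegral => b _; rewrite /f pos_id ?addr_ge0 ?pos_ge0//.
  by rewrite addrC (sg_add hT) ?pos_ge0.
have nice1 (a b : R) : nice 1 (fun g : R -> R => g (pos a + pos b)).
  have := nice_point 1 (pos a + pos b); rewrite normr1.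
  by congr (nice _ _); apply/funext => g; rewrite mul1r.
have fin1 (mu : probability R R) : mu.-integrable D (EFin \o cst (1 : R)).
  apply: (@integrable_bounded _ mu _ _ 1) => [||s _]; rewrite ?normr1//.
  by rewrite (le_lt_trans (probability_le1 _ _))// ltry.
have cf (g : R -> R) : BC g -> forall a, continuous (fun b => g (pos a + pos b)).
  move=> [cg _] a b; apply: (cvg_comp (fun b => pos a + pos b) g); last exact: cg.
  by apply: cvgD; [exact: cvg_cst|exact: continuous_pos].
have cf' (g : R -> R) : BC g -> forall b, continuous (fun a => g (pos a + pos b)).
  move=> bg b; have := cf g bg b.
  by rewrite (_ : (fun b0 => _) = (fun a => g (pos a + pos b)))//; apply/funext => a; rewrite addrC.
have nice2 a : nice (\int[nu h]_(b in D) (cst 1 b)) (fun g => \int[nu h]_(b in D) g (pos a + pos b)).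
  apply: (@nice_int _ _ _ (nu h) D (cst 1) (fun b g => g (pos a + pos b))) => //.
    exact: fin1.
  move=> g bg; apply: measurable_funTS.
  apply: continuous_measurable_fun; exact: cf.
have nice3 : nice (\int[nu r]_(a in D) (cst (\int[nu h]_(b in D) (cst 1 b)) a))
    (fun g => \int[nu r]_(a in D) \int[nu h]_(b in D) g (pos a + pos b)).
  apply: nice_int => //.
    by apply: (@integrable_bounded _ (nu r) (nufin r) _ `|\int[nu h]_(b in D) (cst 1 b)|).
  move=> g bg; have [cg [K gK]] := bg; apply: measurable_funTS.
  apply: continuous_measurable_fun.
  apply: (@continuous_Rintegral _ _ _ (nu h) D (fun a b => g (pos a + pos b)) (cst K)) => //.
  + by apply: (@integrable_bounded _ (nu h) (nufin h) _ `|K|).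
  + by move=> a; apply: measurable_funTS; apply: continuous_measurable_fun; exact: cf.
  + by move=> b _; exact: cf'.
have nice4 : nice (\int[nu (r + h)]_(a in D) (cst 1 a)) (fun g => \int[nu (r + h)]_(a in D) g a).
  apply: (@nice_int _ _ _ (nu (r + h)) D (cst 1) (fun a g => g a)) => //.
  - exact: fin1.
  - move=> a _; have := nice_point 1 a; rewrite normr1.
    by congr (nice _ _); apply/funext => g; rewrite mul1r.
  - by move=> g [cg _]; apply: measurable_funTS; exact: continuous_measurable_fun.
apply: (nice_eq nice4 nice3) => //.
- move=> lam l0; rewrite (stable_laplace (addr_ge0 r0 h0) (ltW l0)).
  transitivity (\int[nu r]_(a in D) (expR (- (lam * pos a)) * expR (- (h * lam `^ gam)))).
    rewrite RintegralZr//.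
      by rewrite (stable_laplace r0 (ltW l0)) -expRD mulrDl opprD.
    apply: (@integrable_bounded _ (nu r) _ _ 1) => [||s s0]; rewrite ?nufin//.
      apply: measurable_funTS; apply: continuous_measurable_fun.
      by have [] := BC_exp (ltW l0).
    by rewrite ger0_norm ?expR_ge0// expRN_le1// mulr_ge0 ?pos_ge0// ltW.
  apply: eq_Rintegral => a _; rewrite -(stable_laplace h0 (ltW l0)) -RintegralZl//.
    apply: eq_Rintegral => b _; rewrite -expRD (pos_id (addr_ge0 (pos_ge0 a) (pos_ge0 b))).
    by rewrite -opprD -mulrDr.
  apply: (@integrable_bounded _ (nu h) _ _ 1) => [||s s0]; rewrite ?nufin//.
    apply: measurable_funTS; apply: continuous_measurable_fun.
    by have [] := BC_exp (ltW l0).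
  by rewrite ger0_norm ?expR_ge0// expRN_le1// mulr_ge0 ?pos_ge0// ltW.
- split; first exact: (sg_eval_continuous hT).
  exists `|p| => s; rewrite (le_trans (C0_ler_norm _ _))//.
  by apply: (sg_norm hT); exact: pos_ge0.
- by move=> s; rewrite posK.
Qed.

(** * The domain of the subordinate generator *)

Section subordinate_generator.
Variables (p0 psi : C0fun R).
Hypothesis g0 : generator T (p0, psi).

(** A weight equivalent to s at 0, bounded at infinity, and a difference of two exponentials, so
    that its integrals against stable laws are explicit. *)
Let w (s : R) : R := 1 - expR (- pos s).
(** The increment of the orbit divided by the weight. The value [psi] at 0 makes it continuous, by
    the Taylor estimate for the generator. *)
Let Q (s : R) : C0fun R := if s <= 0 then psi else (w s)^-1 *: (T (pos s) p0 - p0).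

Let expR_bounds (x : R) : 0 <= x -> x - x ^+ 2 <= 1 - expR (- x) <= x.
Proof.
move=> x0; apply/andP; split; last first.
  by have := expR_ge1Dx (- x); lra.
have H := expR_ge1Dx x; have H1 : 0 < 1 + x by lra.
suff : expR (- x) <= 1 - x + x ^+ 2 by lra.
rewrite expRN; apply: (@le_trans _ _ (1 + x)^-1).
  by rewrite lef_pV2 ?posrE ?expR_gt0//.
rewrite -[leRHS]mul1r -[leLHS]mul1r ler_pdivrMr// mul1r.
have -> : (1 - x + x ^+ 2) * (1 + x) = 1 + x ^+ 3 by ring.
by rewrite lerDl exprn_ge0.
Qed.

Let w_ge0 s : 0 <= w s.
Proof. by rewrite /w subr_ge0 expRN_le1// pos_ge0. Qed.

Let w_gt0 s : 0 < s -> 0 < w s.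
Proof. by move=> s0; rewrite /w subr_gt0 expR_lt1 oppr_lt0 pos_id// ltW. Qed.

Let wQ s : w s *: Q s = T (pos s) p0 - p0.
Proof.
rewrite /Q; case: ifPn => [s0|]; last first.
  by rewrite -ltNge => s0; rewrite scalerA divff ?scale1r// gt_eqF// w_gt0.
by rewrite /w /pos max_l// oppr0 expR0 subrr scale0r (sg_0 hT) subrr.
Qed.

Let w_lb (s : R) : 0 <= s -> s <= 1 / 2 -> s / 2 <= w s.
Proof.
move=> s0 s2; have /andP[H _] := expR_bounds s0; rewrite /w pos_id//.
by apply: le_trans H; nra.
Qed.

Let cw : continuous w.
Proof.
move=> s; apply: cvgB; first exact: cvg_cst.
apply: (cvg_comp (fun s => - pos s) (@expR R)); last exact: continuous_expR.
by apply: cvgN; exact: continuous_pos.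
Qed.

Let cQ : continuous Q.
Proof.
move=> s; have [s0|s0] := lerP s 0; last first.
  have H : (w y)^-1 *: (T (pos y) p0 - p0) @[y --> s] --> Q s.
    rewrite /Q leNgt s0 /=; apply: cvgZ.
      by apply: cvgV; [rewrite gt_eqF// w_gt0|exact: cw].
    by apply: cvgB; [exact: (sg_continuous hT)|exact: cvg_cst].
  apply: cvg_trans H; apply: near_eq_cvg; near=> y.
  rewrite /Q leNgt; have -> : 0 < y by near: y; first [exact: lt_nbhsr|exact: lt_nbhsl].
  by [].
have Qs : Q s = psi by rewrite /Q s0.
rewrite /continuous_at Qs; apply/cvgrPdist_le => e e0.
have e40 : 0 < e / 4 by lra.
have /cvgrPdist_le/(_ _ e40)/nbhs_ballP[r /= r0 Hr] := @sg_continuous _ _ _ hT psi 0.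
(* The Taylor error is at most y e / 4, and |y - w y| |psi| <= y^2 |psi| <= y e / 4. Since w y >= y
   / 2 for y <= 1/2, division by w y leaves at most [e]. *)
pose r' := Num.min (Num.min r (1 / 2)) (e / (4 * (`|psi| + 1))).
have P1 : 0 < `|psi| + 1 by rewrite ltr_wpDl.
have r'0 : 0 < r' by rewrite !lt_min r0 divr_gt0// divr_gt0// mulr_gt0.
have /cvgrPdist_lt/(_ _ r'0) := @continuous_pos R s.
apply: filterS => y; rewrite {1}/pos max_l// sub0r normrN ger0_norm ?pos_ge0//.
rewrite !lt_min => /andP[/andP[yr y12] ye].
rewrite /Q; case: ifPn => [_|]; first by rewrite subrr normr0 ltW.
rewrite -ltNge => y0; rewrite !pos_id ?(ltW y0)// in yr y12 ye *.
have w0 := w_gt0 y0.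
have -> : psi - (w y)^-1 *: (T y p0 - p0) =
    - ((w y)^-1 *: ((T y p0 - p0 - y *: psi) + (y - w y) *: psi)).
  have -> : T y p0 - p0 - y *: psi + (y - w y) *: psi = T y p0 - p0 - w y *: psi.
    by rewrite scalerBl addrA subrK.
  by rewrite [in RHS]scalerBr scalerA mulVf ?gt_eqF// scale1r opprB.
rewrite normrN normrZ gtr0_norm ?invr_gt0// ler_pdivrMl//.
have H1 : `|T y p0 - p0 - y *: psi| <= y * (e / 4).
  apply: (generator_taylor hT) => //; first exact: ltW.
  move=> t /andP[t0 ty]; rewrite distrC -{1}(sg_0 hT psi) -{1}(pos_id t0).
  rewrite -[X in T X psi - _](pos_id (lexx 0)); apply: Hr.
  by rewrite /ball /= sub0r normrN ger0_norm// (le_lt_trans ty).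
have /andP[wb1 wb2] := expR_bounds (ltW y0).
have ew : w y = 1 - expR (- y) by rewrite /w pos_id// ltW.
have H2 : `|(y - w y) *: psi| <= y ^+ 2 * `|psi|.
  by rewrite normrZ ler_wpM2r// ger0_norm ew; lra.
have H3 : y * (4 * (`|psi| + 1)) <= e.
  by rewrite -ler_pdivlMr ?mulr_gt0//; exact: ltW.
have H4 := w_lb (ltW y0) (ltW y12).
apply: le_trans (ler_normD _ _) _; apply: le_trans (lerD H1 H2) _.
apply: (@le_trans _ _ (y / 2 * e)); last by rewrite ler_wpM2r// ltW.
have := normr_ge0 psi; nra.
Unshelve. all: by end_near. Qed.

(** For s <= 1/2 the increment is at most s |psi| and the weight at least s / 2; beyond, the
    increment is at most 2 |p0| and the weight at least 1/4. *)
Let M := 2 * `|psi| + 8 * `|p0|.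

Let QM s : 0 <= s -> `|Q s| <= M.
Proof.
move=> s0; rewrite /Q /M; case: ifPn => [_|].
  by have := normr_ge0 psi; have := normr_ge0 p0; lra.
rewrite -ltNge => sp; rewrite normrZ gtr0_norm ?invr_gt0 ?w_gt0//.
rewrite ler_pdivrMl ?w_gt0//.
have [s2|s2] := lerP s (1 / 2).
  have H := generator_lipschitz hT s0 g0.
  rewrite pos_id//; apply: le_trans H _.
  have := w_lb s0 s2; have := normr_ge0 psi; have := normr_ge0 p0; nra.
have w4 : 1 / 4 <= w s.
  have /w_lb : (0 : R) <= 1 / 2 by lra.
  move=> /(_ (lexx _)) H; apply: (@le_trans _ _ (w (1 / 2))); first by lra.
  rewrite /w lerB// ler_expR lerN2 !pos_id//; lra.
have H : `|T (pos s) p0 - p0| <= 2 * `|p0|.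
  rewrite (le_trans (ler_normB _ _))// mulrDl mul1r lerD2r.
  by apply: (sg_norm hT); exact: pos_ge0.
apply: le_trans H _; have := normr_ge0 psi; have := normr_ge0 p0; nra.
Qed.

(** Laplace transform of the measure h^-1 (1 - e^(-s)) nu_h(ds), which replaces the Levy measure. *)
Let G (h lam : R) : R := h^-1 * \int[nu h]_(s in D) (w s * expR (- (lam * pos s))).

Let iexp (h lam : R) : 0 <= lam ->
  (nu h).-integrable D (EFin \o (fun s => expR (- (lam * pos s)))).
Proof.
move=> l0; apply: (@integrable_bounded _ (nu h) _ _ 1) => [||s s0].
- by rewrite (le_lt_trans (probability_le1 _ _))// ltry.
- apply: measurable_funTS; apply: continuous_measurable_fun.
  by have [] := BC_exp l0.
- by rewrite ger0_norm ?expR_ge0// expRN_le1// mulr_ge0 ?pos_ge0.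
Qed.

Let wexp (lam s : R) : w s * expR (- (lam * pos s)) =
  expR (- (lam * pos s)) - expR (- ((lam + 1) * pos s)).
Proof. by rewrite /w mulrBl mul1r -expRD; congr (_ - expR _); ring. Qed.

Let iwexp (h lam : R) : 0 <= lam ->
  (nu h).-integrable D (EFin \o (fun s => w s * expR (- (lam * pos s)))).
Proof.
move=> l0; rewrite (_ : (fun s => _) = (fun s => expR (- (lam * pos s)) - expR (- ((lam + 1) * pos s)))).
  by apply: integrable_EFinB => //; apply: iexp; rewrite ?addr_ge0.
by apply/funext => s; exact: wexp.
Qed.

(** [stable_laplace] gives G exactly as a difference of two values of e^(-h x) divided by h, and
    [expR_bounds] expands both to first order. *)
Let GE (h lam : R) : 0 < h -> 0 <= lam ->
  `|G h lam - ((lam + 1) `^ gam - lam `^ gam)| <=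
  h * (((lam + 1) `^ gam) ^+ 2 + (lam `^ gam) ^+ 2).
Proof.
move=> h0 l0; have l1 : 0 <= lam + 1 by rewrite addr_ge0.
have -> : G h lam = h^-1 * (expR (- (h * lam `^ gam)) - expR (- (h * (lam + 1) `^ gam))).
  rewrite /G; congr (_ * _); under eq_Rintegral do rewrite wexp.
  by rewrite RintegralB ?stable_laplace ?(ltW h0)//; exact: iexp.
have := expR_bounds (mulr_ge0 (ltW h0) (powR_ge0 lam gam)).
have := expR_bounds (mulr_ge0 (ltW h0) (powR_ge0 (lam + 1) gam)).
set a := lam `^ gam; set b := (lam + 1) `^ gam.
set ea := expR _; set eb := expR _ => /andP[B1 B2] /andP[A1 A2].
have -> : h^-1 * (eb - ea) - (b - a) = (eb - ea - h * (b - a)) / h.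
  by rewrite mulrBl [h * _]mulrC mulfK ?gt_eqF// mulrC.
rewrite normrM [`|h^-1|]gtr0_norm ?invr_gt0// ler_pdivrMr//.
by rewrite ler_norml; apply/andP; split; nra.
Qed.

(** By [wQ] the quotient integrates [Q] against the measure with Laplace transform [G h]. Undoing
    the damping costs M (1 - e^(-dl s)), of integral M (G h 0 - G h dl), and the approximation costs
    [e] times the total mass G h 0. *)
Let approx (h dl e : R) n (c : nat -> C0fun R) : 0 < h -> 0 < dl ->
  (forall s, 0 <= s -> `|expR (- (dl * s)) *: Q s -
     \sum_(j < n) expR (- (j.+1%:R * dl * s)) *: c j| <= e) ->
  `|h^-1 *: (S h p0 - p0) - \sum_(j < n) G h (j.+1%:R * dl) *: c j| <=
  M * (G h 0 - G h dl) + e * G h 0.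
Proof.
move=> h0 dl0 He; have lj (j : nat) : 0 <= j.+1%:R * dl by rewrite mulr_ge0 ?ltW.
have iw0 : (nu h).-integrable D (EFin \o w).
  have := @iwexp h 0 (lexx 0); congr (_.-integrable _ _).
  by apply/funext => s /=; rewrite mul0r oppr0 expR0 mulr1.
pose Pp x (s : R) := \sum_(j < n) expR (- (j.+1%:R * dl * pos s)) * c j x.
have iwP x : (nu h).-integrable D (EFin \o (fun s => w s * Pp x s)) /\
    \int[nu h]_(s in D) (w s * Pp x s) = h * \sum_(j < n) G h (j.+1%:R * dl) * c j x.
  rewrite /Pp; elim: n {He Pp} => [|n [IH1 IH2]].
    split; last first.
      rewrite big_ord0 mulr0 -[RHS](mul0r (fine (nu h D))) -Rintegral_cst//.
      by apply: eq_Rintegral => s _; rewrite big_ord0 mulr0.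
    apply: (eq_integrable mD (EFin \o (fun s => 0 * w s))).
      by move=> s _; rewrite /= big_ord0 mulr0 mul0r.
    exact: integrable_EFinZl.
  have E s : w s * \sum_(j < n.+1) expR (- (j.+1%:R * dl * pos s)) * c j x =
      w s * \sum_(j < n) expR (- (j.+1%:R * dl * pos s)) * c j x +
      c n x * (w s * expR (- (n.+1%:R * dl * pos s))).
    by rewrite big_ord_recr /=; ring.
  have i2 := integrable_EFinZl (c n x) mD (@iwexp h _ (lj n)).
  split.
    by apply: eq_integrable (integrable_EFinD mD IH1 i2) => // s _; rewrite /= E.
  under eq_Rintegral do rewrite E.
  rewrite RintegralD// IH2 RintegralZl//; last exact: iwexp.
  rewrite big_ord_recr /= mulrDr; congr (_ + _).
  by rewrite /G mulrA mulrA divff ?gt_eqF// mul1r mulrC.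
apply: C0_norm_le => x.
have iT := avg_integrable hT (nufin h) p0 x.
have fin1 : (nu h).-integrable D (EFin \o cst (p0 x)).
  by apply: (@integrable_bounded _ (nu h) (nufin h) _ `|p0 x|).
have E1 : S h p0 x - p0 x = \int[nu h]_(s in D) (w s * Q s x).
  rewrite (avgE hT (nufin h)).
  have -> : p0 x = \int[nu h]_(s in D) p0 x.
    have E : p0 x * fine (nu h `[0%R, +oo[%classic) = p0 x.
      by rewrite nuD ?(ltW h0)//= mulr1.
    by rewrite Rintegral_cst//; exact/esym/E.
  rewrite -(RintegralB mD iT fin1); apply: eq_Rintegral => s _.
  by rewrite -C0_scaleE wQ.
have iwQ : (nu h).-integrable D (EFin \o (fun s => w s * Q s x)).
  apply: eq_integrable (integrable_EFinB mD iT fin1) => // s _.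
  by rewrite /= -C0_scaleE wQ.
have [i2 E2] := iwP x.
have -> : (h^-1 *: (S h p0 - p0) - \sum_(j < n) G h (j.+1%:R * dl) *: c j) x =
    h^-1 * \int[nu h]_(s in D) (w s * Q s x - w s * Pp x s).
  rewrite RintegralB// E2 -E1 mulrBr mulrA mulVf ?gt_eqF// mul1r.
  by rewrite C0_subE C0_scaleE C0_sumE.
rewrite normrM gtr0_norm ?invr_gt0//.
have -> : M * (G h 0 - G h dl) + e * G h 0 =
    h^-1 * \int[nu h]_(s in D) (M * (w s * expR (- (0 * pos s)) -
       w s * expR (- (dl * pos s))) + e * (w s * expR (- (0 * pos s)))).
  have i3 := @iwexp h 0 (lexx 0); have i4 := @iwexp h dl (ltW dl0).
  have i5 := integrable_EFinB mD i3 i4.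
  rewrite RintegralD//; [|exact: integrable_EFinZl|exact: integrable_EFinZl].
  rewrite !RintegralZl// RintegralB// /G; ring.
rewrite ler_wpM2l ?invr_ge0 ?(ltW h0)//.
have i6 := integrable_EFinB mD iwQ i2.
apply: le_trans (le_normr_Rintegral mD i6) _; apply: le_Rintegral => //.
- exact: integrable_norm.
- have i3 := @iwexp h 0 (lexx 0); have i4 := @iwexp h dl (ltW dl0).
  apply: integrable_EFinD => //; last exact: integrable_EFinZl.
  by apply: integrable_EFinZl => //; exact: integrable_EFinB.
move=> s; rewrite /= in_itv/= andbT => s0.
rewrite mul0r oppr0 expR0 mulr1 -mulrBr normrM ger0_norm//.
rewrite [X in M * X](_ : _ = w s * (1 - expR (- (dl * pos s)))); last by ring.
have -> : M * (w s * (1 - expR (- (dl * pos s)))) + e * w s =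
  w s * (M * (1 - expR (- (dl * pos s))) + e) by ring.
rewrite ler_wpM2l// pos_id//.
have -> : Q s x - Pp x s = (1 - expR (- (dl * s))) * Q s x +
    (expR (- (dl * s)) *: Q s - \sum_(j < n) expR (- (j.+1%:R * dl * s)) *: c j) x.
  rewrite C0_subE C0_scaleE C0_sumE /Pp pos_id//; ring.
rewrite (le_trans (ler_normD _ _))// lerD//; last first.
  by rewrite (le_trans (C0_ler_norm _ _))// He.
rewrite normrM mulrC ler_pM//.
  by rewrite (le_trans (C0_ler_norm _ _))// QM.
by rewrite ger0_norm// subr_ge0 expRN_le1// mulr_ge0// (ltW dl0).
Qed.

(** As h tends to 0, the combination of exponentials in [approx] has an explicit limit J, within [e]
    of all quotients of small step. The quotients along h = 1/(n + 1) are therefore Cauchy; the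
    limit is not identified, only its existence is used. *)
Lemma subordinate_generator : exists v, generator S (p0, v).
Proof.
have M0 : 0 <= M by apply: le_trans (QM (lexx 0)).
have claim (e : R) : 0 < e -> exists (J : C0fun R) (r : R), 0 < r /\
    forall h, 0 < h -> h < r -> `|h^-1 *: (S h p0 - p0) - J| <= e.
  move=> e0.
  pose eta := e / (4 * (M + 1)).
  have M1 : 0 < M + 1 by rewrite ltr_wpDl.
  have eta0 : 0 < eta by rewrite divr_gt0// mulr_gt0.
  (* With dl^gam = eta the limit of the damping error is at most M eta <= e / 4, as (1 + dl)^gam >=
     1. *)
  pose dl := eta `^ gam^-1.
  have dl0 : 0 < dl by rewrite powR_gt0.
  have dlg : dl `^ gam = eta by rewrite -powRrM mulVf ?gt_eqF// powRr1// ltW.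
  have e40 : 0 < e / 4 by lra.
  have [n [c Hc]] := exp_approx cQ QM dl0 e40.
  pose g lam := (lam + 1) `^ gam - lam `^ gam.
  pose q lam := ((lam + 1) `^ gam) ^+ 2 + (lam `^ gam) ^+ 2.
  have q0 lam : 0 <= q lam by rewrite addr_ge0// sqr_ge0.
  have lj (j : nat) : 0 <= j.+1%:R * dl by rewrite mulr_ge0 ?ltW.
  exists (\sum_(j < n) g (j.+1%:R * dl) *: c j).
  (* All errors of order h from [GE] are collected here; the range of h below keeps h B under
     [e / 4]. *)
  pose B := M * (q 0 + q dl) + e / 4 * q 0 + \sum_(j < n) q (j.+1%:R * dl) * `|c j|.
  have B0 : 0 <= B.
    rewrite !addr_ge0//; first by rewrite mulr_ge0// addr_ge0.
      by rewrite mulr_ge0// ltW.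
    by apply: sumr_ge0 => j _; rewrite mulr_ge0.
  exists (e / (4 * (B + 1))); split; first by rewrite divr_gt0// mulr_gt0// ltr_wpDl.
  move=> h h0 hr.
  have hB : h * B <= e / 4.
    apply: (@le_trans _ _ (h * (B + 1))); first by rewrite ler_wpM2l ?ltW// ltrDl.
    by move: hr; rewrite ltr_pdivlMr ?mulr_gt0// ?ltr_wpDl//; lra.
  have A1 := approx h0 dl0 Hc.
  have A2 : `|\sum_(j < n) G h (j.+1%:R * dl) *: c j - \sum_(j < n) g (j.+1%:R * dl) *: c j|
      <= h * \sum_(j < n) q (j.+1%:R * dl) * `|c j|.
    rewrite -sumrB mulr_sumr (le_trans (ler_norm_sum _ _ _))//.
    apply: ler_sum => j _; rewrite -scalerBl normrZ mulrA ler_wpM2r//.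
    exact: GE.
  have := GE h0 (lexx 0); have := GE h0 (ltW dl0).
  rewrite -/(g dl) -/(g 0) -/(q dl) -/(q 0) !ler_norml => /andP[D1 D2] /andP[D3 D4].
  have g00 : g 0 = 1 by rewrite /g add0r powR1 powR0 ?subr0// gt_eqF.
  have gdl : 1 - eta <= g dl.
    rewrite /g dlg lerD2r -[leLHS](congr1 (fun f : R -> R => f gam) (powR1 R)) ge0_ler_powR ?nnegrE ?(ltW gam0)//.
      by rewrite addr_ge0// ltW.
    by rewrite lerDr ltW.
  have E3 : M * (G h 0 - G h dl) <= M * (eta + h * (q 0 + q dl)).
    apply: ler_wpM2l => //; move: D1 D4 gdl; rewrite g00 [h * (q 0 + q dl)]mulrDr.
    exact: sub_bound.
  have E4 : e / 4 * G h 0 <= e / 4 * (1 + h * q 0).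
    apply: ler_wpM2l; first exact: ltW.
    by move: D4; rewrite g00 lerBlDl.
  have E5 : M * eta <= e / 4.
    have : (M + 1) * eta = e / 4 by rewrite /eta; field; rewrite gt_eqF.
    by move=> <-; rewrite [leRHS]mulrDl lerDl mul1r ltW.
  rewrite -(subrKA (\sum_(j < n) G h (j.+1%:R * dl) *: c j)).
  rewrite (le_trans (ler_normD _ _))//; apply: le_trans (lerD A1 A2) _.
  have hB' : h * B = M * (h * (q 0 + q dl)) + e / 4 * (h * q 0) +
    h * \sum_(j < n) q (j.+1%:R * dl) * `|c j| by rewrite /B; ring.
  move: E3 E4 E5 hB; rewrite hB' !mulrDr !mulr1.
  exact: (add_bound e0).
have [v Hv] : exists v : C0fun R,
    (n.+1%:R^-1)^-1 *: (S n.+1%:R^-1 p0 - p0) @[n --> \oo] --> v.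
  apply: C0_complete => e e0.
  have [J [r [r0 HJ]]] := claim _ (divr_gt0 e0 (ltr0n R 2)).
  have [N _ HN] := near_infty_natSinv_lt (PosNum r0).
  exists N => m n /HN/= Nm /HN/= Nn.
  have pos_inv (k : nat) : (0 : R) < k.+1%:R^-1 by rewrite invr_gt0.
  have H1 := HJ _ (pos_inv n) Nn; have H2 := HJ _ (pos_inv m) Nm.
  rewrite -(subrKA J) (le_trans (ler_normD _ _))// (splitr e) lerD// distrC//.
exists v; rewrite /generator/=; apply/cvgrPdist_le => e e0.
have [J [r [r0 HJ]]] := claim _ (divr_gt0 e0 (ltr0n R 2)).
have vJ : `|v - J| <= e / 2.
  apply: (@closed_cvg _ _ _ eventually_filter
    (fun n : nat => `|(n.+1%:R^-1)^-1 *: (S n.+1%:R^-1 p0 - p0) - J|) [set x | x <= e / 2]).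
  - exact: closed_le.
  - have := near_infty_natSinv_lt (PosNum r0); apply: filterS => n /= nr.
    by apply: HJ; rewrite ?invr_gt0.
  - by apply: cvg_norm; apply: cvgB => //; exact: cvg_cst.
near=> h; rewrite -(subrKA J) (le_trans (ler_normD _ _))// (splitr e) lerD// distrC.
apply: HJ; first by near: h; exact: nbhs_right_gt.
by near: h; exact: nbhs_right_lt.
Unshelve. all: by end_near. Qed.

End subordinate_generator.

End subordination.

(** * Homogeneous kernels *)

Lemma bounded_integrable d (T : measurableType d) (R : realType)
    (mu : {measure set T -> \bar R}) (D : set T) (f : T -> R) (K : R) :
  measurable D -> (mu D < +oo)%E -> measurable_fun D f ->
  (forall s, D s -> `|f s| <= K) -> mu.-integrable D (EFin \o f).
Proof.
move=> mD muD mf fK; apply: measurable_bounded_integrable => //.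
exists K; split; first exact: num_real.
by move=> M KM s Ds /=; rewrite (le_trans (fK s Ds))// ltW.
Qed.

(** * Affine substitution in Lebesgue integrals *)

Section lebesgue_affine.
Context (R : realType).
Local Notation leb := (@lebesgue_measure R).
Variables (a b : R).
Hypothesis a0 : 0 < a.

Let phi (x : R) : R := a * x + b.

Let mphi : measurable_fun setT phi.
Proof. by apply: measurable_funD => //; exact: measurable_funM. Qed.

Let M0 : {measure set (measurableTypeR R) -> \bar R} :=
  @measure_function_pushforward__canonical__measure_function_Measure _ _ _
    (measurableTypeR R) _ leb phi mphi.
Let M : {measure set (measurableTypeR R) -> \bar R} := mscale (NngNum (ltW a0)) M0.

(** The image of Lebesgue measure under x |-> a x + b divides lengths of intervals by [a]; after
    multiplication by [a] it agrees with Lebesgue measure on intervals, hence everywhere. *)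
Let lebesgue_affine_measure A : measurable A -> leb A = M A.
Proof.
apply: lebesgue_measure_unique => _ [[x y] _ <-].
rewrite /M/= /mscale/= /M0/= /pushforward.
have -> : phi @^-1` `]x, y] = `](x - b) / a, (y - b) / a]%classic.
  apply/seteqP; split => z /=; rewrite !in_itv/= /phi ltr_pdivrMr// ler_pdivlMr//.
    by rewrite mulrC ltrBlDr lerBrDr.
  by rewrite mulrC ltrBlDr lerBrDr.
rewrite !lebesgue_measure_itv/= !lte_fin ltr_pM2r ?invr_gt0// ltrD2r.
case: ifPn => _; last by rewrite mule0.
rewrite -!EFinB -EFinM; congr EFin; rewrite -mulrBl; field.
by rewrite gt_eqF.
Qed.

Lemma ge0_integral_affine (f : R -> \bar R) : measurable_fun setT f ->
  (forall x, 0 <= f x)%E ->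
  (\int[leb]_x f x = a%:E * \int[leb]_x f (a * x + b)%R)%E.
Proof.
move=> mf f0; rewrite (eq_measure_integral M); last first.
  by move=> A mA _; exact: lebesgue_affine_measure.
by rewrite ge0_integral_mscale// ge0_integral_pushforward.
Qed.

Lemma integrable_affine (f : R -> R) : leb.-integrable setT (EFin \o f) ->
  leb.-integrable setT (EFin \o (fun x => f (a * x + b))).
Proof.
move=> /integrableP[mf fi]; apply/integrableP; split.
  exact: (measurableT_comp mf mphi).
move: fi; rewrite (ge0_integral_affine (f := fun x => `|(EFin \o f) x|%E))//; last first.
  exact: measurableT_comp.
rewrite /= => h; rewrite ltNge leye_eq; apply/negP => /eqP E.
by move: h; rewrite E gt0_muley// ltxx.
Qed.

Lemma Rintegral_affine (f : R -> R) : leb.-integrable setT (EFin \o f) ->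
  \int[leb]_x f x = a * \int[leb]_x f (a * x + b).
Proof.
move=> fi; have mf := measurable_int _ fi.
have fi' := integrable_affine fi.
rewrite /Rintegral -[X in X * fine _]/(fine a%:E) -fineM//; last exact: integrable_fin_num fi'.
congr fine; rewrite integralE [in RHS]integralE.
rewrite muleBr//; last first.
  apply: fin_num_adde_defr.
  by apply: (integrable_fin_num measurableT (integrable_funepos measurableT fi')).
congr (_ - _)%E; rewrite ge0_integral_affine//.
- congr (_ * _)%E; apply: eq_integral => x _.
  by rewrite -[LHS]/(((EFin \o f)^\+%E \o (fun x => a * x + b)) x) -funepos_comp.
- exact: (measurable_funepos mf).
- congr (_ * _)%E; apply: eq_integral => x _.
  by rewrite -[LHS]/(((EFin \o f)^\-%E \o (fun x => a * x + b)) x) -funeneg_comp.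
- exact: (measurable_funeneg mf).
Qed.
End lebesgue_affine.

(** * Moments of a homogeneous kernel and the power series Phi(1, x) *)

Section kernel.
Context (R : realType).
Variables (k : R -> R -> R) (theta : R).
Hypothesis theta0 : 0 < theta.
Hypothesis hk : admissible k.
Hypothesis kh : homogeneous (theta - 1) k.
Local Notation leb := (@lebesgue_measure R).
Local Notation D := (`[0, +oo[%classic : set R).

Lemma lebesgue_itv_fin (t : R) : (leb `]0%R, t[%classic < +oo)%E.
Proof. by rewrite lebesgue_measure_itv/=; case: ifPn => _; rewrite ?ltry. Qed.

Lemma kernel_measurable (t : R) : 0 < t -> measurable_fun `]0, t[ (k t).
Proof.
move=> t0; case: hk => mk _.
have mQ : measurable [set p : R * R | 0 < p.1 /\ 0 < p.2].
  rewrite (_ : [set _ | _] = `]0, +oo[%classic `*` `]0, +oo[%classic).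
    by apply: measurableX.
  by apply/seteqP; split => -[x y] /=; rewrite !in_itv/= !andbT.
apply: (@measurable_comp _ _ _ _ _ _ _ (fun p => k p.1 p.2) _ (fun s => (t, s)) mQ) => //.
  by move=> _ [s /= + <-]; rewrite in_itv/= => /andP[s0 _].
by apply/measurable_funTS/measurable_fun_pair => //.
Qed.

(** The supremum in [admissible], at T = t, bounds the norm of [k t] of exponent 1 + eps; on a
    bounded interval |k| <= 1 + |k|^(1 + eps) then gives integrability. *)
Lemma kernel_integrable (t : R) : 0 < t -> leb.-integrable `]0, t[ (EFin \o k t).
Proof.
move=> t0; case: (hk) => _ [al [eps [_ _ eps0 /(_ t t0) bd]]].
have p0 : 0 < 1 + eps by lra.
have nfin : (kernel_norm k (1 + eps) t < +oo)%E.
  rewrite ltNge leye_eq; apply/negP => /eqP E.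
  move: bd; rewrite ltNge => /negP; apply; rewrite leye_eq; apply/eqP.
  apply/eqP; rewrite -leye_eq; apply: ereal_sup_ge; exists +oo%E => //.
  exists t => /=; first by rewrite in_itv/= t0 lexx.
  by rewrite E gt0_muley// lte_fin powR_gt0.
have : (kernel_norm k (1 + eps) t `^ (1 + eps) < +oo)%E by rewrite poweR_lty.
rewrite /kernel_norm powR_Lnorm ?gt_eqF// => pfin.
have mk := kernel_measurable t0.
have mk' : measurable_fun setT (k t \_ `]0, t[) by exact/(measurable_restrictT _ _).1.
have iP : leb.-integrable setT (EFin \o (fun x => `|(k t \_ `]0%R, t[) x| `^ (1 + eps))).
  apply/integrableP; split.
    apply/measurable_EFinP; apply: (measurableT_comp (measurable_powR (1 + eps))) => //.
    exact: measurableT_comp.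
  under eq_integral do rewrite /= ger0_norm ?powR_ge0//.
  exact: pfin.
apply: (@integrable_le _ _ _ leb _ _ (fun s : R => 1 + `|(k t \_ `]0%R, t[) s| `^ (1 + eps))) => //.
  apply: integrable_EFinD => //.
    apply: (@bounded_integrable _ _ _ _ _ _ 1) => //.
      exact: lebesgue_itv_fin.
    by move=> s _; rewrite normr1.
  exact: integrableS iP.
move=> s st; rewrite /patch mem_set//.
have [k1|k1] := leP `|k t s| 1; first by rewrite (le_trans k1)// lerDl powR_ge0.
apply: (@le_trans _ _ (`|k t s| `^ (1 + eps))); last by rewrite lerDr.
rewrite -[leLHS]powRr1//; apply: ler_powR; [exact: ltW|lra].
Qed.

(* Homogeneity gives [k t (t r) = t^(theta - 1) k 1 r], and [ds = t dr]. *)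
Lemma kernel_scale (t : R) (H : R -> R) (K : R) : 0 < t ->
  measurable_fun `]0, t[ H -> (forall s, `]0, t[%classic s -> `|H s| <= K) ->
  \int[leb]_(s in `]0, t[) (k t s * H s) =
  t `^ theta * \int[leb]_(r in `]0, 1[) (k 1 r * H (t * r)).
Proof.
move=> t0 mH HK.
have iG : leb.-integrable `]0, t[ (EFin \o (fun s => k t s * H s)).
  apply: (@integrable_le _ _ _ leb _ _ (fun s : R => K * `|k t s|)) => //.
  - by apply: measurable_funM => //; exact: kernel_measurable.
  - by apply: integrable_EFinZl => //; exact/integrable_norm/kernel_integrable.
  - by move=> s st; rewrite normrM mulrC ler_wpM2r// HK.
have iG' : leb.-integrable setT (EFin \o ((fun s => k t s * H s) \_ `]0, t[)).
  rewrite -restrict_EFin; exact: ((integrable_mkcond _ _).1 iG).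
rewrite Rintegral_mkcond (Rintegral_affine 0 t0 iG').
rewrite -[X in t `^ X](subrK 1) powRD; last by rewrite (gt_eqF t0) implybT.
rewrite powRr1 ?(ltW t0)// -mulrA mulrCA; congr (t * _).
rewrite -RintegralZl; last 2 first.
- by [].
- have i1 := kernel_integrable (@ltr01 R).
  apply: (@integrable_le _ _ _ leb _ _ (fun s : R => K * `|k 1 s|)) => //.
  + apply: measurable_funM => //; first exact: kernel_measurable.
    apply: (@measurable_comp _ _ _ _ _ _ `]0, t[) => //.
      move=> _ [s + <-] /=; rewrite !in_itv/= => /andP[s0 s1].
      by rewrite mulr_gt0// gtr_pMr.
  + by apply: integrable_EFinZl => //; exact/integrable_norm.
  + move=> s /=; rewrite in_itv/= => /andP[s0 s1]; rewrite normrM mulrC ler_wpM2r// HK//=.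
    by rewrite in_itv/= mulr_gt0// gtr_pMr.
rewrite [RHS]Rintegral_mkcond; apply: eq_Rintegral => s _.
rewrite addr0 /patch.
have E : (t * s \in `]0, t[%classic) = (s \in `]0, 1[%classic).
  apply/idP/idP; rewrite !inE/= !in_itv/=.
    by rewrite pmulr_rgt0// gtr_pMr.
  by rewrite pmulr_rgt0// gtr_pMr.
rewrite E; case: ifPn => //; rewrite inE/= in_itv/= => /andP[s0 s1].
by rewrite kh// mulrA.
Qed.

Local Notation I01 := (`]0, 1[%classic : set R).

Let ik : leb.-integrable I01 (EFin \o k 1) := kernel_integrable ltr01.
Let mk : measurable_fun I01 (k 1) := kernel_measurable ltr01.

Definition kernel_moment (a : R) := \int[leb]_(r in I01) (k 1 r * r `^ a).

Let powR_le1 (r a : R) : 0 <= a -> 0 < r -> r < 1 -> r `^ a <= 1.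
Proof.
move=> a0 r0 r1; rewrite -(congr1 (fun f => f a) (@powR1 R)).
by apply: ge0_ler_powR => //; rewrite ?nnegrE ?ler01// ltW.
Qed.

Lemma kernel_weight_integrable (H : R -> R) (K : R) : measurable_fun I01 H ->
  (forall r, 0 < r -> r < 1 -> `|H r| <= K) ->
  leb.-integrable I01 (EFin \o (fun r => k 1 r * H r)).
Proof.
move=> mH HK; apply: (@integrable_le _ _ _ leb _ _ (fun s : R => K * `|k 1 s|)) => //.
- exact: measurable_funM.
- by apply: integrable_EFinZl => //; exact/integrable_norm.
- by move=> s /=; rewrite in_itv/= => /andP[s0 s1]; rewrite normrM mulrC ler_wpM2r// HK.
Qed.

(** The kernel maps powers to powers: by [kernel_scale] it sends s^a to t^(a + theta) times
    [kernel_moment a], and the coefficients iterate it from the constant 1. *)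
Lemma coef_scale n (t : R) : 0 < t ->
  coef k n t = t `^ (theta * n%:R) * \prod_(j < n) kernel_moment (theta * j%:R).
Proof.
elim: n t => [|n IH] t t0 /=; first by rewrite mulr0 powRr0 big_ord0 mulr1.
rewrite t0.
under eq_Rintegral => s do (rewrite inE/= in_itv/= => /andP[s0 _]; rewrite (IH _ s0)).
have tn0 : 0 <= theta * n%:R by rewrite mulr_ge0// (ltW theta0).
rewrite (@kernel_scale t _
  (t `^ (theta * n%:R) * `|\prod_(j < n) kernel_moment (theta * j%:R)|)) //; last 2 first.
- by apply: measurable_funM => //; apply: measurable_funTS; exact: measurable_powR.
- move=> s /=; rewrite in_itv/= => /andP[s0 st].
  rewrite normrM ler_wpM2r// ger0_norm ?powR_ge0//.
  by apply: ge0_ler_powR; rewrite ?nnegrE ?(ltW s0) ?(ltW st) ?(ltW t0).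
rewrite big_ord_recr/= -natr1 mulrDr mulr1 addrC powRD; last by rewrite (gt_eqF t0) implybT.
rewrite -!mulrA; congr (_ * _).
rewrite /kernel_moment mulrA -RintegralZl//; last first.
  apply: (@kernel_weight_integrable _ 1).
    by apply: measurable_funTS; exact: measurable_powR.
  by move=> r r0 r1; rewrite ger0_norm ?powR_ge0// powR_le1.
apply: eq_Rintegral => s; rewrite inE/= in_itv/= => /andP[s0 s1].
by rewrite powRM ?(ltW s0) ?(ltW t0)//; ring.
Qed.

(** r^(theta n) tends to 0 on (0, 1) and is dominated by 1. Vanishing moments give an infinite
    radius of convergence by the ratio test. *)
Lemma kernel_moment_cvg : kernel_moment (theta * n%:R) @[n --> \oo] --> 0.
Proof.
have [] := @Rintegral_cvg _ _ _ leb I01 (fun n r => k 1 r * r `^ (theta * n%:R))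
  (fun=> 0) (fun r => `|k 1 r|).
- by [].
- move=> n; apply: measurable_funM => //.
  by apply: measurable_funTS; exact: measurable_powR.
- move=> r /=; rewrite in_itv/= => /andP[r0 r1].
  rewrite -[X in _ --> X](mulr0 (k 1 r)); apply: cvgMr.
  under eq_fun do rewrite powRrM powR_mulrn ?powR_ge0//.
  apply: cvg_expr; rewrite ger0_norm ?powR_ge0//.
  rewrite -(congr1 (fun f => f theta) (@powR1 R)).
  by apply: gt0_ltr_powR => //; rewrite ?nnegrE ?ler01// ltW.
- exact/integrable_norm.
- move=> n r /=; rewrite in_itv/= => /andP[r0 r1].
  rewrite normrM -[leRHS]mulr1 ler_wpM2l// ger0_norm ?powR_ge0// powR_le1//.
  by rewrite mulr_ge0// (ltW theta0).
by move=> _; rewrite Rintegral_cst// mul0r.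
Qed.

Local Notation c_ n := (\prod_(j < n) kernel_moment (theta * j%:R)).

Lemma kernel_coef1 n : coef k n 1 = c_ n.
Proof. by rewrite coef_scale// powR1 mul1r. Qed.

Lemma kernel_series_cvg (x : R) : cvgn (series (fun n => `|c_ n| * `|x| ^+ n)).
Proof.
(* The factor 2^n turns the ratio test into boundedness: once a moment is below 1 / (2 (|x| + 1))
   the sequence [e] decreases, and the series is dominated by a geometric one of ratio 1/2. *)
pose e n := `|c_ n| * `|x| ^+ n * 2 ^+ n.
have e0 n : 0 <= e n by rewrite !mulr_ge0// exprn_ge0.
have [N NP] : exists N, forall n, (N <= n)%N -> e n.+1 <= e n.
  have x20 : 0 < (2 * (`|x| + 1))^-1 :> R by rewrite invr_gt0 mulr_gt0// ltr_wpDl.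
  have /cvgrPdist_lt/(_ _ x20)[N _ NP] := kernel_moment_cvg.
  exists N => n Nn; have := NP _ Nn; rewrite sub0r normrN => /ltW h.
  rewrite /e big_ord_recr/= normrM !exprS.
  rewrite [leLHS](_ : _ = e n * (`|kernel_moment (theta * n%:R)| * (2 * `|x|))); last by rewrite /e; ring.
  rewrite -[leRHS]mulr1 ler_wpM2l// (le_trans (ler_wpM2r _ h))//.
  rewrite mulrC ler_pdivrMr ?mulr_gt0 ?ltr_wpDl// mul1r ler_wpM2l//.
  by rewrite lerDl.
have eN m : e (N + m)%N <= e N.
  by elim: m => [|m IH]; rewrite ?addn0// addnS (le_trans (NP _ _))// leq_addr.
pose C := \sum_(i < N.+1) e i.
have eC n : e n <= C.
  have eiC i : (i <= N)%N -> e i <= C.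
    move=> iN; rewrite /C (bigD1 (Ordinal (iN : (i < N.+1)%N)))//= lerDl sumr_ge0//.
  have [/eiC//|Nn] := leqP n N.
  by rewrite -(subnKC (ltnW Nn)) (le_trans (eN _))// eiC.
apply: (@series_le_cvg _ _ (geometric C (2^-1))).
- by move=> n; rewrite mulr_ge0// exprn_ge0.
- by move=> n; rewrite /geometric/= mulr_ge0// ?exprn_ge0// (le_trans (e0 0%N)).
- move=> n; rewrite /geometric/= exprVn ler_pdivlMr ?exprn_gt0//; exact: eC.
- apply: is_cvg_geometric_series; rewrite ger0_norm ?invr_ge0// invf_lt1// ltr1n //.
Qed.
Lemma kernel_cvg (x : R) : cvgn (series (fun n => c_ n * x ^+ n)).
Proof.
apply: normed_cvg; rewrite (_ : [normed _] = series (fun n => `|c_ n| * `|x| ^+ n)).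
  exact: kernel_series_cvg.
by congr series; apply/funext => n /=; rewrite normrM normrX.
Qed.

Definition kernel_fun (x : R) : R := limn (series (fun n => c_ n * x ^+ n)).

Lemma kernel_partial_bound (x y : R) n : `|y| <= `|x| ->
  `|series (fun n => c_ n * y ^+ n) n| <= limn (series (fun n => `|c_ n| * `|x| ^+ n)).
Proof.
move=> yx; rewrite (@le_trans _ _ (series (fun n => `|c_ n| * `|x| ^+ n) n))//.
  rewrite (le_trans (ler_norm_sum _ _ _))//; apply: ler_sum => i _.
  by rewrite normrM normrX ler_wpM2l// lerXn2r ?nnegrE.
apply: nondecreasing_cvgn_le; last exact: kernel_series_cvg.
by apply: nondecreasing_series => i _ _; rewrite mulr_ge0// exprn_ge0.
Qed.

Lemma Phi_real (x : R) : complex.Re (Phi k 1 x%:C%C) = kernel_fun x.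
Proof.
have E n : series (fun n => (coef k n 1)%:C%C * x%:C%C ^+ n) n
           = (series (fun n => c_ n * x ^+ n) n)%:C%C.
  rewrite /series/= rmorph_sum/=; apply: eq_bigr => i _.
  by rewrite kernel_coef1 rmorphM rmorphXn.
suff H : series (fun n => (coef k n 1)%:C%C * x%:C%C ^+ n : (R[i] : numFieldType)) n @[n --> \oo]
    --> ((kernel_fun x)%:C%C : (R[i] : numFieldType)).
  by rewrite /Phi; have := cvg_lim (@norm_hausdorff _ _) H => /= ->.
apply/cvgrPdist_lt => e e0.
have er : e = (complex.Re e)%:C%C.
  by case: e e0 => a b; rewrite ltcE/= => /andP[/eqP -> _].
have e0' : 0 < complex.Re e by move: e0; rewrite er ltcR.
have /cvgrPdist_lt/(_ _ e0') := @kernel_cvg x.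
apply: filterS => n; rewrite E er -rmorphB/= normc_def/= expr0n/= addr0 sqrtr_sqr.
by rewrite ltcR.
Qed.

(* Termwise integration of the power series, dominated by its value at [mu]. *)
Lemma kernel_fun_eq (mu : R) :
  kernel_fun mu = 1 + mu * \int[leb]_(r in I01) (k 1 r * kernel_fun (mu * r `^ theta)).
Proof.
have mp a : measurable_fun I01 (fun r : R => r `^ a).
  by apply: measurable_funTS; exact: measurable_powR.
pose S n (r : R) := series (fun n => c_ n * (mu * r `^ theta) ^+ n) n.
have mS n : measurable_fun I01 (S n).
  apply: measurable_sum => i; apply: measurable_funM => //.
  by apply: measurable_funX; apply: measurable_funM.
have cS r : S ^~ r @ \oo --> kernel_fun (mu * r `^ theta) by exact: kernel_cvg.
pose B := limn (series (fun n => `|c_ n| * `|mu| ^+ n)).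
have SB n r : 0 < r -> r < 1 -> `|S n r| <= B.
  move=> r0 r1; apply: kernel_partial_bound.
  by rewrite normrM -[leRHS]mulr1 ler_wpM2l// ger0_norm ?powR_ge0// powR_le1// ltW.
have [] := @Rintegral_cvg _ _ _ leb I01 (fun n r => k 1 r * S n r)
  (fun r => k 1 r * kernel_fun (mu * r `^ theta)) (fun r => B * `|k 1 r|).
- by [].
- by move=> n; apply: (@measurable_funM _ _ _ _ (k 1) (S n)) => //; exact: mS.
- by move=> r _; apply: cvgMr; exact: cS.
- by apply: integrable_EFinZl => //; exact/integrable_norm.
- move=> n r /=; rewrite in_itv/= => /andP[r0 r1].
  by rewrite normrM mulrC ler_wpM2r// SB.
move=> _ cI.
(* The recursion c_(n+1) = c_n times the n-th moment shifts the index: partial sums of length n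
   under the integral produce those of length n + 1 outside. *)
have E n : series (fun n => c_ n * mu ^+ n) n.+1 = 1 + mu * \int[leb]_(r in I01) (k 1 r * S n r).
  elim: n => [|n IH].
    rewrite /series/= big_nat1 big_ord0 expr0 mulr1 -[LHS]addr0; congr (_ + _).
    rewrite (eq_Rintegral _ _ (g := fun=> 0)) ?Rintegral_cst// ?mul0r ?mulr0//.
    by move=> r _; rewrite /S /series/= big_geq// mulr0.
  move: IH; rewrite /series/= => IH; rewrite big_nat_recr//= IH -addrA; congr (_ + _).
  have iS m : leb.-integrable I01 (EFin \o (fun r => k 1 r * S m r)).
    by apply: (@kernel_weight_integrable _ B) => // r r0 r1; exact: SB.
  have iP : leb.-integrable I01 (EFin \o (fun r => k 1 r * r `^ (theta * n%:R))).
    apply: (@kernel_weight_integrable _ 1) => // r r0 r1.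
    by rewrite ger0_norm ?powR_ge0// powR_le1// mulr_ge0// (ltW theta0).
  rewrite exprS mulrCA -mulrDr; congr (_ * _).
  rewrite big_ord_recr/= {2}/kernel_moment mulrAC -RintegralZl// -RintegralD//; last first.
    exact: integrable_EFinZl.
  apply: eq_Rintegral => r; rewrite inE/= in_itv/= => /andP[r0 r1].
  rewrite /S /series/= big_nat_recr//= mulrDr; congr (_ + _).
  by rewrite exprMn powRrM powR_mulrn ?powR_ge0//; ring.
have c1 : series (fun n => c_ n * mu ^+ n) n.+1 @[n --> \oo] --> kernel_fun mu.
  by rewrite cvg_shiftS; exact: kernel_cvg.
rewrite (funext E) in c1.
apply: (cvg_unique _ c1) => //.
by apply: cvgD; [exact: cvg_cst|apply: cvgMr].
Qed.

End kernel.

Lemma FTC01 (R : realType) (f h : R -> R) : continuous f -> continuous h ->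
  (forall x : R, 0 < x -> x < 1 -> is_derive x 1 f (h x)) ->
  \int[lebesgue_measure]_(r in `[0, 1]) h r = f 1 - f 0.
Proof.
move=> cf ch fh; rewrite /Rintegral (@continuous_FTC2 _ h f 0 1 ltr01)//.
- exact: continuous_subspaceT.
- split.
  + by move=> x; rewrite in_itv/= => /andP[x0 x1]; have [] := fh _ x0 x1.
  + by apply: cvg_at_right_filter; exact: cf.
  + by apply: cvg_at_left_filter; exact: cf.
- move=> x; rewrite in_itv/= => /andP[x0 x1].
  by rewrite derive1E; have [_ ->] := fh _ x0 x1.
Qed.

Lemma expR_onem_bounds (R : realType) (x : R) : 0 <= x ->
  x * (1 + x)^-1 <= 1 - expR (- x) <= x.
Proof.
move=> x0; have x1 : 0 < 1 + x by rewrite ltr_wpDr.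
apply/andP; split; last by have := expR_ge1Dx (- x); lra.
rewrite expRN lerBrDr -lerBrDl.
rewrite (le_trans (_ : _ <= (1 + x)^-1))//.
  by rewrite lef_pV2 ?posrE ?expR_gt0// expR_ge1Dx.
rewrite lerBrDr -[X in X + _]mul1r -mulrDl mulfV// gt_eqF//.
Qed.

(** * The resolvent identity for the law of A *)

Section resolvent.
Context (R : realType).
Variables (k : R -> R -> R) (theta : R).
Hypothesis theta0 : 0 < theta.
Hypothesis hk : admissible k.
Hypothesis kh : homogeneous (theta - 1) k.
Local Notation leb := (@lebesgue_measure R).
Local Notation D := (`[0, +oo[%classic : set R).
Local Notation I01 := (`]0, 1[%classic : set R).
Variable alpha : probability R R.
Hypothesis alphaD : alpha D = 1%E.
Local Notation L lam := (\int[alpha]_(a in D) expR (- (lam * pos a))).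
Hypothesis alphaL : forall lam, 0 <= lam -> L lam = kernel_fun k theta (- lam).

Let aint (c : R) : \int[alpha]_(a in D) c = c.
Proof. by rewrite Rintegral_cst// [X in fine X](_ : _ = 1%E) ?mulr1//; exact: alphaD. Qed.
Let afin : (alpha D < +oo)%E. Proof. by rewrite (le_lt_trans (probability_le1 _ _))// ltry. Qed.

Let mexp (lam : R) : measurable_fun D (fun a => expR (- (lam * pos a))).
Proof.
apply: measurable_funTS; apply: continuous_measurable_fun => a.
apply: (cvg_comp (fun a => - (lam * pos a)) (@expR R)); last exact: continuous_expR.
by apply: cvgN; apply: cvgMr; exact: continuous_pos.
Qed.

Let iexp (lam : R) : 0 <= lam -> alpha.-integrable D (EFin \o (fun a => expR (- (lam * pos a)))).
Proof.
move=> l0; apply: (@bounded_integrable _ _ _ _ _ _ 1) => // s _.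
by rewrite ger0_norm ?expR_ge0// expRN_le1// mulr_ge0// pos_ge0.
Qed.

Let L01 (lam : R) : 0 <= lam -> 0 <= L lam <= 1.
Proof.
move=> l0; apply/andP; split; first by apply: Rintegral_ge0 => // *; exact: expR_ge0.
rewrite (@le_trans _ _ (\int[alpha]_(a in D) 1))//.
  apply: le_Rintegral => //; first exact: iexp.
    by apply: (@bounded_integrable _ _ _ _ _ _ 1) => // s _; rewrite normr1.
  by move=> a _; rewrite expRN_le1// mulr_ge0// pos_ge0.
by rewrite aint.
Qed.

Let avgA (h : R -> R) : BC h -> continuous (fun b : R => \int[alpha]_(a in D) h (b * pos a)).
Proof.
move=> [ch [K hK]]; apply: (@continuous_Rintegral _ _ _ alpha _ (fun b a => h (b * pos a)) (fun=> K)).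
- by [].
- by apply: (@bounded_integrable _ _ _ _ _ _ `|K|).
- move=> b; apply: measurable_funTS; apply: continuous_measurable_fun => a.
  apply: (cvg_comp (fun a => b * pos a) h); last exact: ch.
  by apply: cvgMr; exact: continuous_pos.
- move=> a _ b; apply: (cvg_comp (fun b => b * pos a) h); last exact: ch.
  by apply: mulrr_continuous.
- by [].
Qed.

Let mavgA (h : R -> R) (E : set R) (lam : R) : BC h -> measurable E ->
  measurable_fun E (fun s : R => \int[alpha]_(a in D) h (lam * s `^ theta * pos a)).
Proof.
move=> bh mE.
apply: (measurableT_comp (f := fun b : R => \int[alpha]_(a in D) h (b * pos a))).
  by apply: continuous_measurable_fun; exact: avgA.
by apply: measurable_funM => //; apply: measurable_funTS; exact: measurable_powR.
Qed.

Let Lpos (lam : R) : 0 <= lam -> L lam = \int[alpha]_(a in D) expR (- (pos (lam * pos a))).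
Proof.
by move=> l0; apply: eq_Rintegral => a _; rewrite [in RHS]pos_id// mulr_ge0// pos_ge0.
Qed.

Let measL (E : set R) (lam : R) : 0 <= lam -> measurable E -> measurable_fun E (fun r => L (lam * r `^ theta)).
Proof.
move=> l0 mE.
have := @mavgA (fun s => expR (- (1 * pos s))) E lam (BC_exp ler01) mE.
congr (measurable_fun _ _); apply/funext => r.
by rewrite Lpos ?mulr_ge0 ?powR_ge0//; apply: eq_Rintegral => a _; rewrite mul1r.
Qed.

Lemma laplace_resolvent (lam : R) : 0 <= lam ->
  1 - L lam = lam * \int[leb]_(r in I01) (k 1 r * L (lam * r `^ theta)).
Proof.
move=> l0; rewrite alphaL// (kernel_fun_eq theta0 hk) opprD addrA subrr add0r mulNr opprK.
congr (_ * _); apply: eq_Rintegral => r _.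
by rewrite alphaL ?mulr_ge0 ?powR_ge0// mulNr.
Qed.

(** Finiteness of E A is extracted from the resolvent equation: 1 - L(lam) <= lam K with K the
    integral of |k(1, r)|. Hence n (1 - e^(-a/n)), which tends to a, has integral at most K, and
    Fatou's lemma concludes. It dominates the left-hand side of [resolvent_identity]. *)
Lemma laplace_integrable : alpha.-integrable D (EFin \o @pos R).
Proof.
have ik := kernel_integrable hk (@ltr01 R).
have mp : measurable_fun D (@pos R).
  by apply: measurable_funTS; apply: continuous_measurable_fun; exact: continuous_pos.
pose K := \int[leb]_(r in I01) `|k 1 r|.
have lK (lam : R) : 0 <= lam -> 1 - L lam <= lam * K.
  move=> l0; rewrite laplace_resolvent// ler_wpM2l//.
  have iF : leb.-integrable I01 (EFin \o (fun r => k 1 r * L (lam * r `^ theta))).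
    apply: (@kernel_weight_integrable _ _ hk _ 1); first by apply: measL.
    move=> r r0 r1; have /andP[h0 h1] : 0 <= L (lam * r `^ theta) <= 1.
      by rewrite L01// mulr_ge0// powR_ge0.
    by rewrite ger0_norm.
  apply: le_Rintegral => //; first exact: integrable_norm.
  move=> r _; rewrite (le_trans (ler_norm _))// normrM -[leRHS]mulr1 ler_wpM2l//.
  have /andP[h0 h1] : 0 <= L (lam * r `^ theta) <= 1 by rewrite L01// mulr_ge0// powR_ge0.
  by rewrite ger0_norm.
apply/integrableP; split; first exact/measurable_EFinP.
pose f n (a : R) : \bar R := (n.+1%:R * (1 - expR (- (n.+1%:R^-1 * pos a))))%:E.
have f0 n a : D a -> (0 <= f n a)%E.
  by move=> _; rewrite lee_fin mulr_ge0// subr_ge0 expRN_le1// mulr_ge0// pos_ge0.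
have mf n : measurable_fun D (f n).
  apply/measurable_EFinP; apply: measurable_funM => //.
  by apply: measurable_funB => //; exact: mexp.
have fcvg a : f n a @[n --> \oo] --> `|(pos a)%:E|%E.
  rewrite gee0_abs ?lee_fin ?pos_ge0//; apply: cvg_EFin; first exact: nearW.
  have pa := pos_ge0 a; set p := pos a in pa *.
  apply: (@squeeze_cvgr _ _ _ _ (fun n => p * (1 + n.+1%:R^-1 * p)^-1) (fun=> p)).
  - apply: nearW => n; have n0 : (0 : R) < n.+1%:R by [].
    have x0 : 0 <= n.+1%:R^-1 * p by rewrite mulr_ge0// invr_ge0.
    have x1 : 0 < 1 + n.+1%:R^-1 * p by rewrite ltr_wpDr.
    have /andP[h1 h2] := expR_onem_bounds x0.
    have pn : p = n.+1%:R * (n.+1%:R^-1 * p) by rewrite mulrA mulfV ?mul1r// gt_eqF.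
    by apply/andP; split; rewrite ?[X in X * _ <= _]pn ?[X in _ <= X]pn -?mulrA ler_wpM2l// mulrA.
  - rewrite -[X in _ --> X]mulr1; apply: cvgMr; rewrite -[X in _ --> X]invr1; apply: cvgV => //.
    rewrite -[X in _ --> X]addr0; apply: cvgD; first exact: cvg_cst.
    by rewrite -[X in _ --> X](mul0r p); apply: cvgMl; exact: cvg_harmonic.
  - exact: cvg_cst.
rewrite (_ : (fun x => _) = (fun a => limn_einf (f ^~ a))); last first.
  by apply/funext => a; rewrite (cvg_limn_einf_sup (fcvg a)).1.
apply: le_lt_trans (fatou _ _ mf f0) _ => //.
rewrite limn_einf_lim; apply: (@le_lt_trans _ _ K%:E); last by rewrite ltry.
apply: lime_le; first exact: is_cvg_einfs.
apply: nearW => n; apply: (@le_trans _ _ (\int[alpha]_(a in D) f n a)%E).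
  by apply: ereal_inf_lbound; exists n => /=.
rewrite /f; have n0 : (0 : R) <= n.+1%:R^-1 by rewrite invr_ge0.
have i1 : alpha.-integrable D (EFin \o (fun a => n.+1%:R * (1 - expR (- (n.+1%:R^-1 * pos a))))).
  apply: integrable_EFinZl => //; apply: integrable_EFinB => //; last exact: iexp.
  by apply: (@bounded_integrable _ _ _ _ _ _ 1) => // s _; rewrite normr1.
rewrite -[leLHS]fineK; last exact: integrable_fin_num i1.
rewrite lee_fin -/(Rintegral _ _ _) RintegralZl//; last first.
  apply: integrable_EFinB => //; last exact: iexp.
  by apply: (@bounded_integrable _ _ _ _ _ _ 1) => // s _; rewrite normr1.
rewrite RintegralB//; [|by apply: (@bounded_integrable _ _ _ _ _ _ 1) => // s _; rewrite normr1|exact: iexp].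
rewrite aint mulrC -ler_pdivlMr// mulrC.
exact: lK.
Qed.

Let bcomp (h : R -> R) (b : R) : BC h -> continuous (fun r => h (b * r)).
Proof. by move=> [ch _] r; apply: (cvg_comp (fun r => b * r) h); [exact: mulrl_continuous|exact: ch]. Qed.

Let avg01 (h : R -> R) : BC h -> continuous (fun b : R => \int[leb]_(r in `[0, 1]) h (b * r)).
Proof.
move=> [ch [K hK]]; apply: (@continuous_Rintegral _ _ _ leb _ (fun b r => h (b * r)) (fun=> K)).
- by [].
- apply: (@bounded_integrable _ _ _ _ _ _ `|K|) => //.
  by rewrite /= lebesgue_measure_itv/= lte_fin ltr01 ltry.
- move=> b; apply: measurable_funTS; apply: continuous_measurable_fun.
  by apply: bcomp; split => //; exists K.
- move=> r _ b; apply: (cvg_comp (fun b => b * r) h); last exact: ch.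
  by apply: mulrr_continuous.
- by [].
Qed.

Let i01 : leb.-integrable `[0%R, 1%R] (EFin \o cst (1 : R)).
Proof.
apply: (@bounded_integrable _ _ _ _ _ _ 1) => //.
  by rewrite /= lebesgue_measure_itv/= lte_fin ltr01 ltry.
by move=> s _; rewrite normr1.
Qed.

Let nice_scale (a C : R) (Lam : (R -> R) -> R) : nice C Lam ->
  nice (`|a| * C) (fun h => a * Lam h).
Proof.
move=> [lin bd dc]; split=> [b h1 h2 b1 b2|h K ch hK|h bh].
- by rewrite lin//; ring.
- by rewrite normrM -mulrA ler_wpM2l// bd.
- by apply: cvgMr; exact: dc.
Qed.

Let nice01 (b : R) : 0 <= b -> nice b (fun h => b * \int[leb]_(r in `[0, 1]) h (b * r)).
Proof.
move=> b0.
suff : nice (\int[leb]_(r in `[0, 1]) 1) (fun h => \int[leb]_(r in `[0, 1]) h (b * r)).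
  move=> /(@nice_scale b).
  by rewrite Rintegral_cst//= lebesgue_measure_itv/= lte_fin ltr01 sube0/= !mulr1 ger0_norm.
apply: nice_int => //.
- move=> r _; have := nice_point 1 (b * r).
  rewrite normr1; congr nice; by apply/funext => h; rewrite mul1r.
- by move=> h bh; apply: measurable_funTS; apply: continuous_measurable_fun; exact: bcomp.
Qed.

Let niceA (b : R) : nice 1 (fun h => \int[alpha]_(a in D) h (b * pos a)).
Proof.
rewrite -[1](aint 1).
apply: nice_int => //.
- by apply: (@bounded_integrable _ _ _ _ _ _ 1) => // s _; rewrite normr1.
- move=> a _; have := nice_point 1 (b * pos a).
  rewrite normr1; congr nice; by apply/funext => h; rewrite mul1r.
- move=> h bh; apply: measurable_funTS; apply: continuous_measurable_fun => a.
  apply: (cvg_comp (fun a => b * pos a) h); last exact: bh.1.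
  by apply: cvgMr; exact: continuous_pos.
Qed.

(** The integral of h over [0, Q] is written with the fixed domain [0, 1], which makes it continuous
    in Q. On e^(-lam s) the left side is (1 - L(lam t^theta)) / lam; [laplace_resolvent] and then
    [kernel_scale], read backwards, give the right side. *)
Lemma resolvent_identity (h : R -> R) (t : R) : 0 < t -> BC h -> (forall s, h (pos s) = h s) ->
  \int[alpha]_(a in D) (t `^ theta * pos a * \int[leb]_(r in `[0, 1]) h (t `^ theta * pos a * r))
  = \int[leb]_(s in `]0, t[) (k t s * \int[alpha]_(a in D) h (s `^ theta * pos a)).
Proof.
move=> t0; move: h.
have tt0 : 0 <= t `^ theta by exact: powR_ge0.
have ta0 a : 0 <= t `^ theta * pos a by rewrite mulr_ge0// pos_ge0.
apply: (@nice_eq _ (\int[alpha]_(a in D) (t `^ theta * pos a))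
   (\int[leb]_(s in `]0, t[) (`|k t s| * 1))).
- apply: (@nice_int _ _ _ alpha D (fun a : R => t `^ theta * pos a)
    (fun (a : R) (h : R -> R) => t `^ theta * pos a * \int[leb]_(r in `[0, 1]) h (t `^ theta * pos a * r))) => //.
  + by apply: integrable_EFinZl => //; exact: laplace_integrable.
  + by move=> a _; exact: nice01.
  + move=> h bh; apply: measurable_funTS; apply: continuous_measurable_fun => a.
    have ct : t `^ theta * pos x @[x --> a] --> t `^ theta * pos a.
      by apply: cvgMr; exact: continuous_pos.
    have c2 : (\int[leb]_(r in `[0, 1]) h (t `^ theta * pos x * r)) @[x --> a] -->
        \int[leb]_(r in `[0, 1]) h (t `^ theta * pos a * r).
      by apply: (cvg_comp (fun x => t `^ theta * pos x) (fun b : R => \int[leb]_(r in `[0, 1]) h (b * r)) ct); exact: avg01.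
    exact: (cvgM ct c2).
- apply: (@nice_int _ _ _ leb `]0, t[ (fun s : R => `|k t s| * 1)
    (fun (s : R) (h : R -> R) => k t s * \int[alpha]_(a in D) h (s `^ theta * pos a))).
  + by [].
  + rewrite (_ : (fun s => _) = (fun s => `|k t s|)); last by apply/funext => s; rewrite mulr1.
    by apply: integrable_norm; exact: kernel_integrable.
  + by move=> s _; apply: nice_scale; exact: niceA.
  + move=> h bh; apply: (@measurable_funM _ _ _ _ (k t)); first exact: kernel_measurable.
    have := @mavgA h `]0, t[ 1 bh; under [X in measurable_fun _ X]eq_fun do under eq_Rintegral do rewrite mul1r.
    exact.
move=> lam l0; have l0' := ltW l0.
have E1 (b : R) : 0 <= b ->
    b * \int[leb]_(r in `[0, 1]) expR (- (lam * pos (b * r))) = lam^-1 * (1 - expR (- (lam * b))).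
  move=> b0; have ce : continuous (fun r : R => expR (- (lam * b * r))).
    move=> r; apply: (cvg_comp (fun r => - (lam * b * r)) (@expR R)); last exact: continuous_expR.
    by apply: cvgN; exact: mulrl_continuous.
  have c1 (c : R) : continuous (fun r : R => c * expR (- (lam * b * r))).
    by move=> r; apply: cvgMr; exact: ce.
  have := @FTC01 _ (fun r => - lam^-1 * expR (- (lam * b * r))) (fun r => b * expR (- (lam * b * r))).
  move=> /(_ (c1 _) (c1 _)) H.
  have iI : leb.-integrable `[0%R, 1%R] (EFin \o (fun r => expR (- (lam * b * r)))).
    apply: (@bounded_integrable _ _ _ _ _ _ 1) => //.
    + by rewrite /= lebesgue_measure_itv/= lte_fin ltr01 ltry.
    + by apply: measurable_funTS; apply: continuous_measurable_fun; exact: ce.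
    + move=> r; rewrite /= in_itv/= => /andP[r0 _].
      by rewrite ger0_norm ?expR_ge0// expRN_le1// !mulr_ge0.
  transitivity (\int[leb]_(r in `[0, 1]) (b * expR (- (lam * b * r)))).
    rewrite (RintegralZl b _ iI); last by [].
    apply/congr1; apply: eq_Rintegral => r.
    rewrite inE/= in_itv/= => /andP[r0 _].
    by rewrite pos_id; [rewrite mulrA|exact: mulr_ge0].
  suff dd (r : R) : is_derive r (1 : R) (fun r : R => - lam^-1 * expR (- (lam * b * r))) (b * expR (- (lam * b * r))).
    by rewrite (H (fun r _ _ => dd r)) mulr0 oppr0 expR0 !mulr1; ring.
  have E : b * expR (- (lam * b * r)) = - lam^-1 *: (expR (- (lam * b * r)) * (- (lam * b))).
    by rewrite /GRing.scale/=; field; rewrite gt_eqF.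
  rewrite E; apply: is_deriveZ.
  apply: is_derive1_comp.
  have -> : - (lam * b) = - ((lam * b) *: 1) by rewrite /GRing.scale/= mulr1.
  by apply: is_deriveN.
under eq_Rintegral => a _ do rewrite E1// mulrA.
have E2 (s : R) : \int[alpha]_(a in D) expR (- (lam * pos (s `^ theta * pos a))) = L (lam * s `^ theta).
  by apply: eq_Rintegral => a _; rewrite pos_id ?mulrA// mulr_ge0 ?powR_ge0 ?pos_ge0.
under [in RHS]eq_Rintegral => s _ do rewrite E2.
have i1 : alpha.-integrable D (EFin \o cst (1 : R)).
  by apply: (@bounded_integrable _ _ _ _ _ _ 1) => // s _; rewrite normr1.
have lt0 : 0 <= lam * t `^ theta by rewrite mulr_ge0.
have iB : alpha.-integrable D (EFin \o (fun a : R => 1 - expR (- (lam * t `^ theta * pos a)))).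
  by apply: integrable_EFinB => //; exact: iexp.
rewrite (RintegralZl _ _ iB)// (RintegralB _ i1 (iexp lt0))//.
rewrite aint laplace_resolvent// 2!mulrA mulVf ?gt_eqF// mul1r.
rewrite (@kernel_scale _ _ _ hk kh t _ 1 t0); last 2 first.
- exact: measL.
- move=> s _; have /andP[h0 h1] : 0 <= L (lam * s `^ theta) <= 1 by rewrite L01// mulr_ge0// powR_ge0.
  by rewrite ger0_norm.
apply/congr1; apply: eq_Rintegral => r; rewrite inE/= in_itv/= => /andP[r0 r1].
by rewrite powRM; [rewrite mulrA|exact: ltW..].
Qed.

End resolvent.

(** * The flow *)

Lemma is_derive_continuous (R : realType) (f : R -> R) (x d : R) :
  is_derive x 1 f d -> {for x, continuous f}.
Proof. by move=> [df _]; apply: differentiable_continuous; exact/derivable1_diffP. Qed.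

(** Differentiability is tested on sequences of increments, so that dominated convergence can prove
    it for integrals. *)
Lemma is_derive_seq (R : realType) (f : R -> R) (x d : R) :
  (forall u : nat -> R, (forall n, u n != 0) -> u n @[n --> \oo] --> 0 ->
     (f (x + u n) - f x) / u n @[n --> \oo] --> d) -> is_derive x 1 f d.
Proof.
move=> H.
have cd : h^-1 *: (f (h + x) - f x) @[h --> 0^'] --> d.
  apply/cvgr_dnbhsP => u [u0 cu].
  rewrite (_ : (fun n => _) = (fun n => (f (x + u n) - f x) / u n)); first exact: H.
  by apply/funext => n; rewrite /GRing.scale/= mulrC [X in f X](addrC).
have E : (fun h : R => h^-1 *: (f (h + x) - f x)) = (fun h : R => h^-1 *: ((f \o shift x) (h *: (1 : R)) - f x)).
  by apply/funext => h; rewrite /= /GRing.scale/= mulr1.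
split; first by rewrite /derivable -E; apply/cvg_ex; exists d.
by rewrite /derive -E; apply: cvg_lim.
Qed.

Lemma is_derive_quotient (R : realType) (f : R -> R) (x d : R) (u : nat -> R) :
  is_derive x 1 f d -> (forall n, u n != 0) -> u n @[n --> \oo] --> 0 ->
  (f (x + u n) - f x) / u n @[n --> \oo] --> d.
Proof.
move=> [df dE] u0 cu.
have H : h^-1 *: ((f \o shift x) (h *: (1 : R)) - f x) @[h --> 0^'] --> d by rewrite -dE.
have /cvgr_dnbhsP/(_ u (conj u0 cu)) := H.
rewrite (_ : (fun n => _) = (fun n => (f (x + u n) - f x) / u n))//.
by apply/funext => n; rewrite /= /GRing.scale/= mulr1 mulrC [u n + x]addrC.
Qed.

(** The intermediate point is parametrised by [0, 1]: the order of [a] and [b] is then irrelevant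
    and a = b is allowed. *)
Lemma mvt_segment (R : realType) (f df : R -> R) (a b : R) :
  (forall r, 0 <= r <= 1 -> is_derive (a + r * (b - a)) 1 f (df (a + r * (b - a)))) ->
  exists2 r, 0 <= r <= 1 & f b - f a = df (a + r * (b - a)) * (b - a).
Proof.
move=> H; pose p (r : R) := a + r * (b - a).
have dp (r : R) : is_derive r 1 p (b - a).
  by rewrite /p; apply: is_derive_eq; rewrite /GRing.scale/=; ring.
have dh (r : R) : 0 <= r <= 1 -> is_derive r 1 (f \o p) (df (p r) * (b - a)).
  by move=> r01; apply: is_derive1_comp; exact: H.
have [] := @MVT _ (f \o p) (fun r => df (p r) * (b - a)) 0 1 ltr01.
- move=> r; rewrite in_itv/= => /andP[r0 r1]; apply: dh; by rewrite (ltW r0) (ltW r1).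
- apply: derivable_within_continuous => r; rewrite in_itv/= => r01.
  by have [] := dh r r01.
move=> r; rewrite in_itv/= => /andP[r0 r1]; rewrite /= subr0 mulr1 /p mul1r mul0r addr0 subrKC => E.
by exists r => //; rewrite (ltW r0) (ltW r1).
Qed.

Lemma mvt (R : realType) (f df : R -> R) (a b : R) :
  (forall x : R, is_derive x 1 f (df x)) ->
  exists2 r, 0 <= r <= 1 & f b - f a = df (a + r * (b - a)) * (b - a).
Proof. by move=> H; apply: mvt_segment. Qed.

Lemma mvt_bound (R : realType) (f df : R -> R) (a b K : R) :
  (forall x : R, is_derive x 1 f (df x)) -> (forall x, `|df x| <= K) ->
  `|f b - f a| <= K * `|b - a|.
Proof. by move=> H HK; have [r _ ->] := mvt a b H; rewrite normrM ler_wpM2r. Qed.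

Section flow.
Context (R : realType) (s s1 s2 : R -> R) (K0 K1 K2 : R) (g : R -> R -> R).
Local Notation leb := (@lebesgue_measure R).
Hypothesis ds : forall x : R, is_derive x 1 s (s1 x).
Hypothesis ds1 : forall x : R, is_derive x 1 s1 (s2 x).
Hypothesis cs2 : continuous s2.
Hypothesis b0 : forall x, `|s x| <= K0.
Hypothesis b1 : forall x, `|s1 x| <= K1.
Hypothesis b2 : forall x, `|s2 x| <= K2.
Hypothesis gd : forall y x : R, is_derive y 1 (g ^~ x) (s (g y x)).
Hypothesis g0 : forall x, g 0 x = x.

Lemma flow_dist y x : `|g y x - x| <= K0 * `|y|.
Proof.
have := @mvt_bound _ (g ^~ x) (fun y => s (g y x)) 0 y K0.
by rewrite g0 subr0; apply => // z; exact: b0.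
Qed.

(** The squared difference of two solutions, run at speed y over [0, 1] and multiplied by e^(-2 c r)
    with c = K1 |y|, has a nonpositive derivative. The square avoids differentiating an absolute
    value, and the scaling treats both signs of y. *)
Lemma ode_gronwall (p q : R -> R) y :
  (forall z : R, is_derive z 1 p (s (p z))) -> (forall z : R, is_derive z 1 q (s (q z))) ->
  `|p y - q y| <= expR (K1 * `|y|) * `|p 0 - q 0|.
Proof.
move=> dp dq.
pose D r := p (y * r) - q (y * r); pose c := K1 * `|y|.
have dD (r : R) : is_derive r 1 D (y * (s (p (y * r)) - s (q (y * r)))).
  have dy : is_derive r 1 (fun r => y * r) y by apply: is_derive_eq; rewrite /GRing.scale/= mulr1.
  have hp : is_derive r 1 (fun r => p (y * r)) (s (p (y * r)) * y).
    exact: (@is_derive1_comp _ p (fun r => y * r)).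
  have hq : is_derive r 1 (fun r => q (y * r)) (s (q (y * r)) * y).
    exact: (@is_derive1_comp _ q (fun r => y * r)).
  by apply: is_derive_eq; rewrite -mulrBl mulrC.
have dE (r : R) : is_derive r 1 (fun r => expR (- (2 * c * r)) * (D r * D r))
    (expR (- (2 * c * r)) * (2 * (D r * (y * (s (p (y * r)) - s (q (y * r))))) - 2 * c * (D r * D r))).
  have de : is_derive r 1 (fun r => expR (- (2 * c * r))) (expR (- (2 * c * r)) * (- (2 * c))).
    apply: (@is_derive1_comp _ expR (fun r => - (2 * c * r))).
    by apply: is_derive_eq; rewrite /GRing.scale/= mulr1.
  by apply: is_derive_eq; rewrite /GRing.scale/=; ring.
have [r _] := mvt 0 1 dE.
rewrite subr0 !mulr1 !add0r mulr0 oppr0 expR0 !mul1r => E.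
have : expR (- (2 * c)) * (D 1 * D 1) <= D 0 * D 0.
  rewrite -subr_le0 E pmulr_rle0 ?expR_gt0// subr_le0.
  rewrite -mulrA ler_wpM2l// (le_trans (ler_norm _))// !normrM.
  have -> : c * (D r * D r) = `|D r| * (`|y| * (K1 * `|D r|)).
    by rewrite /c -expr2 -(real_normK (num_real (D r))); ring.
  by rewrite ler_wpM2l// ler_wpM2l//; apply: mvt_bound b1.
rewrite -(ler_pM2l (expR_gt0 (2 * c))) [leLHS]mulrA -expRD subrr expR0 mul1r /D mulr0 mulr1.
rewrite (_ : 2 * c = c + c); last by ring.
rewrite expRD (_ : _ * _ * _ = (expR c * `|p 0 - q 0|) ^+ 2); last first.
  by rewrite exprMn real_normK ?num_real//; ring.
rewrite -expr2 -real_normK ?num_real// ler_pXn2r// nnegrE mulr_ge0// expR_ge0.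
Qed.

Lemma ode_unique (p q : R -> R) :
  (forall z : R, is_derive z 1 p (s (p z))) -> (forall z : R, is_derive z 1 q (s (q z))) ->
  p 0 = q 0 -> forall y, p y = q y.
Proof.
move=> dp dq E y; have := ode_gronwall y dp dq.
by rewrite E subrr normr0 mulr0 normr_le0 subr_eq0 => /eqP.
Qed.

Lemma flow_add y z x : g (y + z) x = g y (g z x).
Proof.
apply: (@ode_unique (fun y => g (y + z) x) (g ^~ (g z x))) => //; last by rewrite add0r g0.
move=> t; rewrite -[X in is_derive _ _ _ X]mulr1.
by apply: (@is_derive1_comp _ (g ^~ x) (fun y => y + z)); apply: is_derive_eq; rewrite addr0.
Qed.

Lemma flow_lip y x x' : `|g y x - g y x'| <= expR (K1 * `|y|) * `|x - x'|.
Proof. by have := ode_gronwall y (gd ^~ x) (gd ^~ x'); rewrite !g0. Qed.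

Lemma flow_continuous y : continuous (g y).
Proof.
move=> x; apply/cvgrPdist_le => e e0.
have c0 : 0 < expR (K1 * `|y|) by exact: expR_gt0.
near=> x'.
rewrite (le_trans (flow_lip _ _ _))// -ler_pdivlMl//.
near: x'; apply: cvgr_dist_le => //; rewrite mulr_gt0// invr_gt0//.
Unshelve. all: by end_near. Qed.

Lemma flow_time_continuous x : continuous (g ^~ x).
Proof. by move=> y; exact: (is_derive_continuous (gd y x)). Qed.

Lemma flow_inj y x x' : g y x = g y x' -> x = x'.
Proof. by move=> /(congr1 (g (- y))); rewrite -!flow_add addNr !g0. Qed.

(** If the order were reversed at time [y], the two trajectories would meet in between by the
    intermediate value theorem, against [flow_inj]. Monotonicity makes the quotients in
    [flow_quotient] positive, so that their logarithm exists. *)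
Lemma flow_lt y x x' : x < x' -> g y x < g y x'.
Proof.
move=> xx; rewrite ltNge; apply/negP => h.
pose D r := g (y * r) x' - g (y * r) x.
have cD : continuous D.
  have cg z : continuous (fun r => g (y * r) z).
    move=> r; apply: (cvg_comp (fun r => y * r) (g ^~ z)); first exact: mulrl_continuous.
    exact: flow_time_continuous.
  by move=> r; apply: cvgB; exact: cg.
have [|r _] := @IVT _ D 0 1 0 ler01 (continuous_subspaceT cD).
  by rewrite /D mulr0 mulr1 !g0 ge_min le_max !subr_le0 !subr_ge0 h orbT/= (ltW xx).
by move/eqP; rewrite subr_eq0 => /eqP/flow_inj E; rewrite E ltxx in xx.
Qed.

Let c1 : continuous s1.
Proof. by move=> x; exact: (is_derive_continuous (ds1 x)). Qed.

Let cgy (y x : R) : continuous (fun r : R => g (y * r) x).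
Proof.
move=> r; apply: (cvg_comp (fun r => y * r) (g ^~ x)); first exact: mulrl_continuous.
exact: flow_time_continuous.
Qed.

Let i01 (K : R) : leb.-integrable `[0%R, 1%R] (EFin \o cst K).
Proof.
apply: (@bounded_integrable _ _ _ _ _ _ `|K|) => //.
by rewrite /= lebesgue_measure_itv/= lte_fin ltr01 ltry.
Qed.

Let cint (h : R -> R) (y x : R) : continuous h -> measurable_fun (`[0, 1] : set R) (fun r : R => h (g (y * r) x)).
Proof.
move=> ch; apply: measurable_funTS; apply: continuous_measurable_fun => r.
by apply: (cvg_comp (fun r => g (y * r) x) h); [exact: cgy|exact: ch].
Qed.

(** The solution of the variational equation J' = s1(g) J with J = 1 at time 0; the integral over
    [0, y] is rescaled to [0, 1]. *)
Definition flow_jac y x := expR (y * \int[leb]_(r in `[0, 1]) s1 (g (y * r) x)).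

Let slope x h z := (s (g z (x + h)) - s (g z x)) / (g z (x + h) - g z x).

Let dn0 (x h z : R) : h != 0 -> g z (x + h) - g z x != 0.
Proof.
move=> h0; rewrite subr_eq0; apply: contra_neq h0 => /flow_inj /eqP.
by rewrite -subr_eq0 addrC addKr => /eqP.
Qed.

Let cslope (y x h : R) : h != 0 -> continuous (fun r => slope x h (y * r)).
Proof.
move=> h0 r; apply: cvgM; last first.
  by apply: cvgV; [exact: dn0|apply: cvgB; exact: cgy].
have csg z : s (g (y * t) z) @[t --> r] --> s (g (y * r) z).
  apply: (cvg_comp (fun r => g (y * r) z) s); first exact: cgy.
  exact: (is_derive_continuous (ds _)).
by apply: cvgB; exact: csg.
Qed.

Let slope_le (x h z : R) : `|slope x h z| <= K1.
Proof.
rewrite /slope normrM normfV.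
have [->|d0] := eqVneq (g z (x + h) - g z x) 0.
  by rewrite normr0 invr0 mulr0 (le_trans _ (b1 0)).
by rewrite ler_pdivrMr ?normr_gt0//; apply: mvt_bound b1.
Qed.

Let mslope (y x h : R) : h != 0 -> measurable_fun (`[0, 1] : set R) (fun r => slope x h (y * r)).
Proof. by move=> h0; apply: measurable_funTS; apply: continuous_measurable_fun; exact: cslope. Qed.

Let is1 (y x : R) : leb.-integrable `[0%R, 1%R] (EFin \o (fun r => s1 (g (y * r) x))).
Proof.
apply: (@bounded_integrable _ _ _ _ _ _ K1) => //; last exact: cint.
by rewrite /= lebesgue_measure_itv/= lte_fin ltr01 ltry.
Qed.

(* The difference quotient q of the flow in x satisfies q' = slope * q along the
   flow, so it is the exponential of an integral of [slope], which tends to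
   [s1]. *)
Lemma flow_quotient (y x h : R) : h != 0 ->
  (g y (x + h) - g y x) / h = expR (y * \int[leb]_(r in `[0, 1]) slope x h (y * r)).
Proof.
move=> h0.
have q0 z : 0 < (g z (x + h) - g z x) / h.
  have [hn|hp] := ltP h 0.
    by rewrite nmulr_lgt0 ?invr_lt0// subr_lt0 flow_lt// gtrDl.
  by rewrite divr_gt0 ?subr_gt0 ?flow_lt ?ltrDl// lt_neqAle eq_sym h0.

rewrite -[LHS]lnK ?posrE//; congr expR.
have dq (r : R) : is_derive r 1 (fun r => ln ((g (y * r) (x + h) - g (y * r) x) / h)) (y * slope x h (y * r)).
  have dg z : is_derive r 1 (fun r => g (y * r) z) (s (g (y * r) z) * y).
    apply: (@is_derive1_comp _ (g ^~ z) (fun r => y * r)).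
    by apply: is_derive_eq; rewrite /GRing.scale/= mulr1.
  have dl := is_derive1_ln (q0 (y * r)).
  rewrite [X in is_derive _ _ _ X](_ : _ = ((g (y * r) (x + h) - g (y * r) x) / h)^-1 *
    ((s (g (y * r) (x + h)) * y - s (g (y * r) x) * y) / h)).
    apply: (@is_derive1_comp _ (@ln R) (fun r => (g (y * r) (x + h) - g (y * r) x) / h)).
    apply: is_derive_eq; rewrite /GRing.scale/=; ring.
  by rewrite /slope; field; rewrite h0 dn0//.
have cy : continuous (fun r : R => y * slope x h (y * r)) by move=> r; apply: cvgMr; exact: cslope.
have cl : continuous (fun r => ln ((g (y * r) (x + h) - g (y * r) x) / h)).
  by move=> r; exact: (is_derive_continuous (dq r)).
have := FTC01 cl cy (fun r _ _ => dq r).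
rewrite mulr0 !g0 [x + h]addrC addrK mulfV// ln1 subr0 mulr1 addrC => <-.
rewrite RintegralZl//.
apply: (@bounded_integrable _ _ _ _ _ _ K1) => //.
- by rewrite /= lebesgue_measure_itv/= lte_fin ltr01 ltry.
- exact: mslope.
Qed.

(** The limit of [flow_quotient] as the increment tends to 0: the slopes are bounded by [K1] and
    tend to [s1] along the trajectory. *)
Lemma flow_is_derive (y x : R) : is_derive x 1 (g y) (flow_jac y x).
Proof.
apply: is_derive_seq => u u0 cu.
under eq_fun do rewrite flow_quotient//.
apply: (cvg_comp _ (@expR R)); last exact: continuous_expR.
apply: cvgMr.
have [] := @Rintegral_cvg _ _ _ leb `[0%R, 1%R] (fun n r => slope x (u n) (y * r))
  (fun r => s1 (g (y * r) x)) (fun=> K1) => //.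
- by move=> n; apply: mslope.
- move=> r _; rewrite /slope.
  have E : (fun n => (s (g (y * r) (x + u n)) - s (g (y * r) x)) / (g (y * r) (x + u n) - g (y * r) x))
     = (fun n => (s (g (y * r) x + (g (y * r) (x + u n) - g (y * r) x)) - s (g (y * r) x)) / (g (y * r) (x + u n) - g (y * r) x)).
    by apply/funext => n; rewrite subrKC.
  rewrite E; apply: is_derive_quotient => //; first by move=> n; exact: dn0.
  rewrite -(subrr (g (y * r) x)); apply: cvgB; last exact: cvg_cst.
  apply: (cvg_comp (fun n => x + u n) (g (y * r))); last exact: flow_continuous.
  have ca : x + u n @[n --> \oo] --> x + 0 by apply: cvgD => //; exact: cvg_cst.
  by rewrite addr0 in ca.
- exact: i01.
Qed.

Lemma flow_jac_le (y x : R) : `|flow_jac y x| <= expR (K1 * `|y|).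
Proof.
rewrite ger0_norm ?expR_ge0// ler_expR (le_trans (ler_norm _))// normrM mulrC ler_wpM2r//.
rewrite (le_trans (le_normr_Rintegral _ (is1 _ _)))//.
have E : \int[leb]_(r in `[0, 1]) K1 = K1.
  by rewrite Rintegral_cst//= lebesgue_measure_itv/= lte_fin ltr01 sube0/= mulr1.
rewrite -[leRHS]E; apply: le_Rintegral => //; last exact: i01.
by apply: integrable_norm; exact: is1.
Qed.

Let cjac_time (x : R) : continuous (flow_jac ^~ x).
Proof.
move=> y; apply: (cvg_comp _ (@expR R)); last exact: continuous_expR.
apply: cvgM => //.
suff : continuous (fun y : R => \int[leb]_(r in `[0, 1]) s1 (g (y * r) x)) by apply.
apply: (@continuous_Rintegral _ _ _ leb _ (fun y r => s1 (g (y * r) x)) (fun=> K1)) => //.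
- exact: i01.
- by move=> z; exact: cint.
- move=> r _ z; apply: (cvg_comp (fun z => g (z * r) x) s1); last exact: c1.
  apply: (cvg_comp (fun z => z * r) (g ^~ x)); first exact: mulrr_continuous.
  exact: flow_time_continuous.
Qed.

Let k2 (y x r : R) := s2 (g (y * r) x) * flow_jac (y * r) x.

Let k2_le (y x r : R) : 0 <= r <= 1 -> `|k2 y x r| <= K2 * expR (K1 * `|y|).
Proof.
move=> /andP[r0 r1]; rewrite normrM ler_pM// (le_trans (flow_jac_le _ _))// ler_expR.
rewrite ler_wpM2l ?(le_trans _ (b1 0))// normrM -[leRHS]mulr1 ler_wpM2l//.
by rewrite ger0_norm.
Qed.

Let mk2 (y x : R) : measurable_fun (`[0, 1] : set R) (k2 y x).
Proof.
apply: measurable_funM; first exact: cint.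
apply: measurable_funTS; apply: continuous_measurable_fun => r.
apply: (cvg_comp (fun r => y * r) (flow_jac ^~ x)); first exact: mulrl_continuous.
exact: cjac_time.
Qed.

Definition flow_jac' (y x : R) := flow_jac y x * (y * \int[leb]_(r in `[0, 1]) k2 y x r).

(** Differentiation of the exponent under the integral; the quotients are dominated because [s1] has
    Lipschitz constant [K2] and the flow has Lipschitz constant e^(K1 |y|). *)
Lemma flow_jac_is_derive (y x : R) : is_derive x 1 (flow_jac y) (flow_jac' y x).
Proof.
apply: (@is_derive1_comp _ expR (fun x => y * \int[leb]_(r in `[0, 1]) s1 (g (y * r) x))).
rewrite -[y * \int[_]_(_ in _) _]/(y *: _).
apply: (@is_deriveZ _ _ _ (fun x : R => \int[leb]_(r in `[0, 1]) s1 (g (y * r) x))).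
apply: is_derive_seq => u u0 cu.
have E n : (\int[leb]_(r in `[0, 1]) s1 (g (y * r) (x + u n)) - \int[leb]_(r in `[0, 1]) s1 (g (y * r) x)) / u n
   = \int[leb]_(r in `[0, 1]) ((u n)^-1 * (s1 (g (y * r) (x + u n)) - s1 (g (y * r) x))).
  rewrite RintegralZl//; last by apply: integrable_EFinB; first by []; exact: is1.
  by rewrite (RintegralB _ (is1 _ _) (is1 _ _))// mulrC.
rewrite (funext E).
have [] := @Rintegral_cvg _ _ _ leb `[0%R, 1%R]
  (fun n r => (u n)^-1 * (s1 (g (y * r) (x + u n)) - s1 (g (y * r) x)))
  (k2 y x) (fun=> K2 * expR (K1 * `|y|)) => //.
- move=> n; apply: measurable_funM => //; apply: measurable_funB; exact: cint.
- move=> r _.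
  under eq_fun do rewrite mulrC.
  apply: (@is_derive_quotient _ (fun x => s1 (g (y * r) x)) x (k2 y x r) u) => //.
  exact: (is_derive1_comp (ds1 _) (flow_is_derive _ _)).
- exact: i01.
- move=> n r; rewrite /= in_itv/= => /andP[r0 r1].
  rewrite normrM normfV mulrC ler_pdivrMr ?normr_gt0//.
  apply: (le_trans (mvt_bound _ _ ds1 b2)); rewrite -mulrA ler_wpM2l ?(le_trans _ (b2 0))//.
  rewrite (le_trans (flow_lip _ _ _))// addrC addKr ler_wpM2r// ler_expR.
  rewrite ler_wpM2l ?(le_trans _ (b1 0))// normrM -[leRHS]mulr1 ler_wpM2l//.
  by rewrite ger0_norm.
Qed.

Lemma flow_jac'_continuous y : continuous (flow_jac' y).
Proof.
move=> x; apply: cvgM; first exact: (is_derive_continuous (flow_jac_is_derive y x)).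
apply: cvgMr.
suff : continuous (fun x : R => \int[leb]_(r in `[0, 1]) k2 y x r) by apply.
apply: (@continuous_Rintegral _ _ _ leb _ (k2 y) (fun=> K2 * expR (K1 * `|y|))) => //.
- exact: i01.
- by move=> z; exact: mk2.
- move=> r _ z; apply: cvgM.
    apply: (cvg_comp (g (y * r)) s2); [exact: flow_continuous|exact: cs2].
  exact: (is_derive_continuous (flow_jac_is_derive _ _)).
- by move=> z r; rewrite /= in_itv/= => r01; exact: k2_le.
Qed.

(** The derivative of g_y(g_z(x)) at z = 0, computed by the chain rule and, after exchanging the two
    times, by the differential equation. *)
Lemma flow_jacE (y x : R) : flow_jac y x * s x = s (g y x).
Proof.
have d1 : is_derive (0 : R) 1 (fun z => g y (g z x)) (flow_jac y (g 0 x) * s (g 0 x)).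
  exact: (is_derive1_comp (flow_is_derive _ _) (gd 0 x)).
have d2 : is_derive (0 : R) 1 (fun z => g y (g z x)) (s (g y x)).
  rewrite (_ : (fun z => _) = (fun z => g (z + y) x)); last first.
    by apply/funext => z; rewrite addrC flow_add.
  rewrite -[X in is_derive _ _ _ X]mulr1 -{2}[y]add0r.
  by apply: (@is_derive1_comp _ (g ^~ x) (fun z => z + y)); apply: is_derive_eq; rewrite addr0.
rewrite !g0 in d1.
by have [_ <-] := d1; have [_ <-] := d2.
Qed.

End flow.

Section L_operator.
Context (R : realType).

Lemma C2_is_derive (f f1 f2 : R -> R) : (forall x : R, is_derive x 1 f (f1 x)) ->
  (forall x : R, is_derive x 1 f1 (f2 x)) -> continuous f2 ->
  [/\ C2 f, derive1 f = f1 & derive1n 2 f = f2].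
Proof.
move=> d1 d2 c2.
have E1 : derive1 f = f1 by apply/funext => x; rewrite derive1E; have [_ ->] := d1 x.
have E2 : derive1n 2 f = f2.
  by rewrite /= E1; apply/funext => x; rewrite derive1E; have [_ ->] := d2 x.
by split=> //; split; rewrite ?E1 ?E2.
Qed.

Lemma is_derive_C2 (f : R -> R) : C2 f ->
  [/\ forall x : R, is_derive x 1 f (derive1 f x),
      forall x : R, is_derive x 1 (derive1 f) (derive1n 2 f x) & continuous (derive1n 2 f)].
Proof.
move=> [d1 d2 c2]; split; last exact: c2.
- by move=> x; rewrite derive1E; apply: derivableP; exact: d1.
- move=> x; rewrite (_ : derive1n 2 f x = 'D_1 (derive1 f) x); last exact: derive1E.
  by apply: derivableP; exact: d2.
Qed.

End L_operator.

(** * Gaussian integrals *)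

Section density.
Local Open Scope ereal_scope.
Context d (T : measurableType d) (R : realType).
Variables (mu nu : {measure set T -> \bar R}) (p : T -> R).
Hypothesis p0 : forall x, (0 <= p x)%R.
Hypothesis mp : measurable_fun setT p.
Hypothesis nuE : forall A, measurable A -> nu A = \int[mu]_(x in A) (p x)%:E.
Import HBNNSimple.

Lemma ge0_integral_density (f : T -> \bar R) : measurable_fun setT f -> (forall x, 0 <= f x) ->
  \int[nu]_x f x = \int[mu]_x (f x * (p x)%:E).
Proof.
move=> mf f0.
have mp' : measurable_fun setT (EFin \o p) by exact/measurable_EFinP.
have ind (A : set T) (r : R) : measurable A -> (0 <= r)%R ->
    \int[nu]_x (r * \1_A x)%:E = \int[mu]_x ((r * \1_A x)%:E * (p x)%:E).
  move=> mA r0; under eq_integral do rewrite EFinM.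
  rewrite ge0_integralZl//; last exact/measurable_EFinP.
  rewrite integral_indic// setIT nuE// -ge0_integralZl//.
  - rewrite integral_mkcond; apply: eq_integral => x _; rewrite patchE indicE.
    by case: ifPn => xA; rewrite ?mulr1// mulr0 mul0e.
  - exact: measurable_funTS.
  - by move=> x _; rewrite lee_fin.
have sf (h : {nnsfun T >-> R}) : \int[nu]_x (h x)%:E = \int[mu]_x ((h x)%:E * (p x)%:E).
  under eq_integral do rewrite fimfunE -fsumEFin//.
  rewrite ge0_integral_fsum//; last 2 first.
  - by move=> y; exact/measurable_EFinP/measurable_funM.
  - by move=> y x _; rewrite nnfun_muleindic_ge0.
  under [RHS]eq_integral => x _ do (rewrite fimfunE -fsumEFin// ge0_mule_fsuml; last by move=> r; rewrite nnfun_muleindic_ge0).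
  rewrite ge0_integral_fsum//.
  - apply: eq_fsbigr => r; rewrite inE/= => -[x _ <-]; apply: ind => //.
  - by move=> r; apply: emeasurable_funM => //; exact/measurable_EFinP/measurable_funM.
  - move=> r x _; rewrite mule_ge0 ?lee_fin//.
    by have := nnfun_muleindic_ge0 h r x; rewrite lee_fin.
pose f_ := nnsfun_approx measurableT mf.
have cf x : (f_ n x)%:E @[n --> \oo] --> f x by apply: cvg_nnsfun_approx.
transitivity (limn (fun n => \int[nu]_x (f_ n x)%:E)).
  rewrite -monotone_convergence//.
  - by apply: eq_integral => x _; apply/esym/cvg_lim => //; exact: cf.
  - by move=> n; exact/measurable_EFinP/measurable_funP.
  - by move=> n x _; rewrite lee_fin.
  - by move=> x _ m n mn; rewrite lee_fin; exact/lefP/nd_nnsfun_approx.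
under eq_fun do rewrite sf.
rewrite -monotone_convergence//.
- apply: eq_integral => x _; apply/cvg_lim => //.
  by apply: cvgeZr => //; exact: cf.
- by move=> n; apply: emeasurable_funM => //; exact/measurable_EFinP/measurable_funP.
- by move=> n x _; rewrite mule_ge0 ?lee_fin.
- move=> x _ m n mn; rewrite lee_wpmul2r ?lee_fin//; exact/lefP/nd_nnsfun_approx.
Qed.

End density.

Lemma is_derive_under d (T : measurableType d) (R : realType) (mu : {measure set T -> \bar R})
    (B : set T) (f df : R -> T -> R) (G : T -> R) (u v a : R) : measurable B ->
  u < a < v ->
  (forall x, u < x < v -> mu.-integrable B (EFin \o f x)) ->
  (forall (x : R) y, u < x < v -> B y -> is_derive x 1 (f ^~ y) (df x y)) ->
  (forall y, 0 <= G y) -> mu.-integrable B (EFin \o G) ->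
  (forall x y, u < x < v -> B y -> `|df x y| <= G y) ->
  is_derive a 1 (fun x => \int[mu]_(y in B) f x y) (\int[mu]_(y in B) df a y).
Proof.
move=> mB uav intf dff G0 iG dG.
have Ia : `]u, v[%classic a by rewrite /= in_itv.
have E x y : u < x < v -> B y -> partial1of2 f x y = df x y.
  by move=> uxv By; rewrite partial1of2E; have [_ ->] := dff x y uxv By.
have h1 x : `]u, v[%classic x -> mu.-integrable B (EFin \o f x).
  by rewrite /= in_itv/=; exact: intf.
have h2 x y : `]u, v[%classic x -> B y -> derivable (f ^~ y) x 1.
  by rewrite /= in_itv/= => uxv By; have [] := dff x y uxv By.
have h3 x y : `]u, v[%classic x -> B y -> `|partial1of2 f x y| <= G y.
  by rewrite /= in_itv/= => uxv By; rewrite E// dG.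
split; first exact: (derivable_under_integral mB Ia h1 h2 G0 iG h3).
rewrite -derive1E (differentiation_under_integral mB Ia h1 h2 G0 iG h3).
by apply: eq_Rintegral => y /set_mem By; exact: E.
Qed.

Section gaussian.
Context (R : realType).
Local Notation leb := (@lebesgue_measure R).
Local Notation N := (@normal_prob R 0 1).
Local Notation n_ := (normal_pdf (0 : R) 1).

Lemma ge0_integral_normal (m v : R) (f : R -> \bar R) : measurable_fun setT f ->
  (forall x, 0 <= f x)%E ->
  (\int[normal_prob m v]_x f x = \int[leb]_x (f x * (normal_pdf m v x)%:E))%E.
Proof.
move=> mf f0; apply: ge0_integral_density => //.
- by move=> x; exact: normal_pdf_ge0.
- exact: measurable_normal_pdf.
Qed.

Local Opaque normal_prob normal_pdf expR.

Let pdfE (m v x : R) : v != 0 -> normal_pdf m v x = normal_peak v * expR (- (x - m) ^+ 2 / (v ^+ 2 * 2)).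
Proof. by move=> v0; rewrite normal_pdfE// /normal_fun mulr_natr. Qed.

Let peakM (v : R) : 0 < v -> v * normal_peak v = normal_peak 1.
Proof.
move=> v0; rewrite /normal_peak expr1n mul1r -mulrnAr sqrtrM ?sqr_ge0// sqrtr_sqr gtr0_norm//.
by rewrite invfM mulrA mulfV ?mul1r// gt_eqF.
Qed.

Let peakV (v : R) : 0 < v -> normal_peak v = normal_peak 1 / v.
Proof. by move=> v0; rewrite -(peakM v0) mulrAC mulfV ?mul1r// gt_eqF. Qed.

Lemma ge0_integral_normal_affine (m v : R) (f : R -> \bar R) : 0 < v -> measurable_fun setT f ->
  (forall x, 0 <= f x)%E ->
  (\int[normal_prob m v]_x f x = \int[N]_z f (v * z + m)%R)%E.
Proof.
move=> v0 mf f0; have v1 : v != 0 by rewrite gt_eqF.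
have mfa : measurable_fun setT (fun z => f (v * z + m)).
  by apply: (measurableT_comp mf); apply: measurable_funD => //; exact: measurable_funM.
rewrite (ge0_integral_normal m v mf f0) (ge0_integral_normal 0 1 mfa); last by [].
have mpdf : measurable_fun setT (fun x => (normal_pdf m v x)%:E).
  by apply/measurable_EFinP; exact: measurable_normal_pdf.
have mnp : measurable_fun setT (fun x => f x * (normal_pdf m v x)%:E)%E.
  by apply: emeasurable_funM.
have fp0 x : (0 <= f x * (normal_pdf m v x)%:E)%E by rewrite mule_ge0// lee_fin normal_pdf_ge0.
rewrite (ge0_integral_affine m v0 mnp fp0) -ge0_integralZl//.
- apply: eq_integral => z _; rewrite muleCA -EFinM; congr (_ * _%:E)%E.
  rewrite !pdfE// mulrA peakM// addrK subr0; congr (_ * expR _).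
  by field; rewrite v1.
- apply: (measurableT_comp mnp).
  by apply: measurable_funD => //; exact: measurable_funM.
- by rewrite lee_fin ltW.
Qed.

(** The weight is the density of N(l, 1) with respect to N(0, 1). *)
Lemma ge0_integral_normal_shift (l : R) (f : R -> \bar R) : measurable_fun setT f ->
  (forall x, 0 <= f x)%E ->
  (\int[N]_z (f z * (expR (l * z - l ^+ 2 / 2))%:E) = \int[N]_z f (z + l)%R)%E.
Proof.
move=> mf f0.
have me : measurable_fun setT (fun z : R => (expR (l * z - l ^+ 2 / 2))%:E).
  by apply/measurable_EFinP; apply: measurableT_comp => //; apply: measurable_funB => //; exact: measurable_funM.
transitivity (\int[normal_prob l 1]_z f z)%E; last first.
  by rewrite (ge0_integral_normal_affine _ ltr01)//; under eq_integral do rewrite mul1r.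
rewrite (ge0_integral_normal l 1 mf f0) ge0_integral_normal; first last.
- by move=> z; rewrite mule_ge0// lee_fin expR_ge0.
- by apply: emeasurable_funM.
- apply: eq_integral => z _; rewrite -muleA -EFinM; congr (_ * _%:E)%E.
  by rewrite !pdfE// mulrCA -expRD subr0 expr1n; congr (_ * expR _); field.
Qed.

(** The shift formula with the constant function 1, whose right-hand side is the total mass. *)
Lemma normal_laplace (l : R) : (\int[N]_z (expR (l * z))%:E = (expR (l ^+ 2 / 2))%:E)%E.
Proof.
have := @ge0_integral_normal_shift l (cst 1%E) (measurable_cst _) (fun=> lee01).
rewrite integral_cst// [X in (_ = _ * X)%E](_ : _ = 1%E); last exact: probability_setT.
under eq_integral do rewrite mul1e expRB EFinM.
move=> E.
have me : measurable_fun setT (fun z : R => (expR (l * z))%:E).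
  by apply/measurable_EFinP; apply: measurableT_comp => //; exact: measurable_funM.
have e0 : expR (l ^+ 2 / 2) != 0 by rewrite gt_eqF ?expR_gt0.
move: E; rewrite ge0_integralZr; [|by []|by []|by move=> z _; rewrite lee_fin expR_ge0|by rewrite lee_fin invr_ge0 expR_ge0].
rewrite mule1 => /(congr1 (fun x => x * (expR (l ^+ 2 / 2))%:E)%E).
by rewrite -muleA -EFinM mulVf// mule1 mul1e.
Qed.

(** After Tonelli, completing the square splits the joint density into the density of the sum and a
    normal density in z, whose integral is 1. *)
Lemma ge0_integral_normal_conv (a b : R) (f : R -> \bar R) : 0 < a -> 0 < b ->
  measurable_fun setT f -> (forall x, 0 <= f x)%E ->
  (\int[N]_z \int[N]_y f (a * z + b * y)%R = \int[N]_z f (Num.sqrt (a ^+ 2 + b ^+ 2) * z)%R)%E.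
Proof.
move=> a0 b0 mf f0; pose rho := Num.sqrt (a ^+ 2 + b ^+ 2).
have ab0 : 0 < a ^+ 2 + b ^+ 2 by rewrite addr_gt0// exprn_gt0.
have rho0 : 0 < rho by rewrite sqrtr_gt0.
have rhoE : rho ^+ 2 = a ^+ 2 + b ^+ 2 by rewrite sqr_sqrtr// ltW.
have b1 : b != 0 by rewrite gt_eqF.
have br0 : 0 < b / rho by rewrite divr_gt0.
pose h (q : R * R) : \bar R := (f q.2 * (normal_pdf (a * q.1) b q.2)%:E)%E.
have h0 q : (0 <= h q)%E by rewrite mule_ge0// lee_fin normal_pdf_ge0.
have mq : measurable_fun setT (fun q : R * R => normal_pdf (a * q.1) b q.2).
  rewrite (_ : (fun q => _) = (fun q : R * R => normal_peak b * expR (- (q.2 - a * q.1) ^+ 2 / (b ^+ 2 * 2)))).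
    apply: measurable_funM => //; apply: measurableT_comp => //; apply: measurable_funM => //.
    apply: measurableT_comp => //; apply: measurable_funX; apply: measurable_funB => //.
    exact: measurable_funM.
  by apply/funext => q; rewrite pdfE.
have mh : measurable_fun setT h.
  apply: emeasurable_funM; first exact: (measurableT_comp mf).
  exact/measurable_EFinP.
transitivity (\int[N]_z \int[leb]_x h (z, x))%E.
  apply: eq_integral => z _.
  transitivity (\int[normal_prob (a * z)%R b]_x f x)%E; last exact: ge0_integral_normal.
  rewrite (ge0_integral_normal_affine (a * z) b0 mf f0).
  by apply: eq_integral => y _; rewrite addrC.
rewrite (@fubini_tonelli _ _ _ _ _ N leb h mh h0)/=.
transitivity (\int[normal_prob 0 rho]_x f x)%E; last first.
  by rewrite (ge0_integral_normal_affine 0 rho0 mf f0); apply: eq_integral => z _; rewrite addr0.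
rewrite (ge0_integral_normal 0 rho mf f0); apply: eq_integral => x _.
have mx : measurable_fun setT (fun z : R => (normal_pdf (a * z) b x)%:E).
  rewrite (_ : (fun z => _) = (fun z : R => (normal_peak b * expR (- (x - a * z) ^+ 2 / (b ^+ 2 * 2)))%:E)).
    apply/measurable_EFinP; apply: measurable_funM => //; apply: measurableT_comp => //; apply: measurable_funM => //.
    by apply: measurableT_comp => //; apply: measurable_funX; apply: measurable_funB => //.
  by apply/funext => z; rewrite pdfE.
rewrite /h/= ge0_integralZl; [|by []|exact: mx|by move=> z _; rewrite lee_fin normal_pdf_ge0|by []].
congr (_ * _)%E; rewrite (ge0_integral_normal 0 1 mx); last by move=> z; rewrite lee_fin normal_pdf_ge0.
(* The second factor is the law of z given a z + b y = x: mean a x / rho^2 and standard deviation b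
   / rho. *)
transitivity (\int[leb]_z ((normal_pdf 0 rho x)%:E * (normal_pdf (a * x / rho ^+ 2) (b / rho) z)%:E))%E.
  apply: eq_integral => z _; rewrite -!EFinM; congr EFin.
  have r1 : rho != 0 by rewrite gt_eqF.
  rewrite (pdfE _ _ b1) (pdfE _ _ (oner_neq0 R)) (pdfE _ _ r1) pdfE ?gt_eqF//.
  rewrite (peakV b0) (peakV rho0) (peakV br0).
  rewrite mulrACA -expRD [RHS]mulrACA -expRD; congr (_ * expR _).
    by field; rewrite r1 b1.
  rewrite expr_div_n rhoE; field; rewrite b1/=.
  by rewrite -?rhoE ?gt_eqF// -?rhoE exprn_gt0.
rewrite ge0_integralZl.
- by rewrite integral_normal_pdf mule1.
- by [].
- by apply/measurable_EFinP; exact: measurable_normal_pdf.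
- by move=> z _; rewrite lee_fin normal_pdf_ge0.
- by rewrite lee_fin normal_pdf_ge0.
Qed.

Lemma normal_exp_integrable (l : R) : N.-integrable setT (EFin \o (fun z => expR (l * `|z|))).
Proof.
have me (a : R) : measurable_fun setT (fun z : R => expR (a * z)).
  by apply: measurableT_comp => //; exact: measurable_funM.
have i1 (a : R) : N.-integrable setT (EFin \o (fun z => expR (a * z))).
  apply/integrableP; split; first by apply/measurable_EFinP; exact: me.
  under eq_integral => z _ do rewrite /= ger0_norm ?expR_ge0//.
  by rewrite normal_laplace ltry.
apply: (@integrable_le _ _ _ N _ _ (fun z : R => expR (l * z) + expR (- l * z))) => //.
- by apply: measurableT_comp => //; apply: measurable_funM.
- by apply: integrable_EFinD.
- move=> z _; rewrite ger0_norm ?expR_ge0//.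
  have [z0|z0] := leP 0 z; first by rewrite ger0_norm// lerDl expR_ge0.
  by rewrite ltr0_norm// mulrN mulNr lerDr expR_ge0.
Qed.

Let sq_le_exp (u : R) : 0 <= u -> u ^+ 2 <= 2 * expR u.
Proof.
move=> u0; have := expR_ge1Dxn 1 u0; rewrite (_ : 2`! = 2)%N//.
set e := expR u; set x := u ^+ 2; lra.
Qed.

Let abs_le_exp (u : R) : 0 <= u -> u <= expR u.
Proof. by move=> u0; have := expR_ge1Dx u; set e := expR u; lra. Qed.

Let is_derive_expM (z l : R) : is_derive l 1 (fun l : R => expR (l * z)) (z * expR (l * z)).
Proof.
rewrite mulrC; apply: (@is_derive1_comp _ expR (fun l => l * z)).
by apply: is_derive_eq; rewrite /GRing.scale/= mulr0 add0r mulr1.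
Qed.

Let mexp (l : R) : measurable_fun setT (fun z : R => expR (l * z)).
Proof. by apply: measurableT_comp => //; exact: measurable_funM. Qed.

Let fnorm1 (l z : R) : expR (l * z) <= expR (`|l| * `|z|).
Proof. by rewrite ler_expR (le_trans (ler_norm _))// normrM. Qed.

Let int1 (l : R) : N.-integrable setT (EFin \o (fun z => z * expR (l * z))).
Proof.
apply: (@integrable_le _ _ _ N _ _ (fun z : R => expR ((1 + `|l|) * `|z|))) => //.
- by apply: measurable_funM => //; exact: mexp.
- exact: normal_exp_integrable.
- move=> z _; rewrite normrM mulrDl mul1r expRD ler_pM//; first exact: abs_le_exp.
  by rewrite ger0_norm ?expR_ge0.
Qed.

Let F0 (l : R) : \int[N]_z expR (l * z) = expR (l ^+ 2 / 2).
Proof. by rewrite /Rintegral normal_laplace. Qed.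

Let F1 (l : R) : \int[N]_z (z * expR (l * z)) = l * expR (l ^+ 2 / 2).
Proof.
have d1 : is_derive l 1 (fun l => \int[N]_z expR (l * z)) (\int[N]_z (z * expR (l * z))).
  apply: (@is_derive_under _ _ _ N setT (fun l z => expR (l * z)) (fun l z => z * expR (l * z))
    (fun z => expR ((1 + (`|l| + 1)) * `|z|)) (l - 1) (l + 1)) => //.
  - by rewrite ltrDl ltr01 ltrBlDr ltrDl ltr01.
  - move=> x _; apply: (@integrable_le _ _ _ N _ _ (fun z : R => expR (`|x| * `|z|))) => //.
    + exact: mexp.
    + exact: normal_exp_integrable.
    + by move=> z _; rewrite ger0_norm ?expR_ge0.
  - exact: normal_exp_integrable.
  - move=> x z /andP[x1 x2] _; rewrite normrM mulrDl mul1r expRD ler_pM//; first exact: abs_le_exp.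
    rewrite ger0_norm ?expR_ge0// (le_trans (fnorm1 _ _))// ler_expR ler_wpM2r//.
    rewrite -[x](subrKC l) (le_trans (ler_normD _ _))// lerD2l ler_norml; lra.
have d2 : is_derive l 1 (fun l : R => \int[N]_z expR (l * z)) (l * expR (l ^+ 2 / 2)).
  rewrite (funext F0) mulrC; apply: (@is_derive1_comp _ expR (fun l => l ^+ 2 / 2)).
  by apply: is_derive_eq; rewrite /GRing.scale/=; field.
by have [_ <-] := d1; have [_ <-] := d2.
Qed.

(** Mean and variance come from differentiating the Laplace transform under the integral at 0; of
    the fourth moment only the finiteness matters. *)
Lemma normal_moments : [/\ N.-integrable setT (EFin \o (fun z : R => z)),
  N.-integrable setT (EFin \o (fun z : R => z ^+ 2)),
  N.-integrable setT (EFin \o (fun z : R => z ^+ 4)),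
  \int[N]_z z = 0 & \int[N]_z (z ^+ 2) = 1].
Proof.
have i1 : N.-integrable setT (EFin \o (fun z : R => z)).
  by have := int1 0; congr (_.-integrable _ _); apply/funext => z /=; rewrite mul0r expR0 mulr1.
have i2 : N.-integrable setT (EFin \o (fun z : R => z ^+ 2)).
  apply: (@integrable_le _ _ _ N _ _ (fun z : R => 2 * expR (1 * `|z|))) => //.
  - by apply: integrable_EFinZl => //; exact: normal_exp_integrable.
  - by move=> z _; rewrite normrX mul1r sq_le_exp.
have i4 : N.-integrable setT (EFin \o (fun z : R => z ^+ 4)).
  apply: (@integrable_le _ _ _ N _ _ (fun z : R => 4 * expR (2 * `|z|))) => //.
  - by apply: integrable_EFinZl => //; exact: normal_exp_integrable.
  - move=> z _; rewrite normrX (_ : `|z| ^+ 4 = (`|z| ^+ 2) ^+ 2); last by rewrite -exprM.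
    have h := sq_le_exp (normr_ge0 z).
    rewrite (_ : 4 * expR (2 * `|z|) = (2 * expR `|z|) ^+ 2); last first.
      by rewrite exprMn -expRM_natl; congr (_ * _); rewrite -natrX.
    by rewrite lerXn2r ?nnegrE// ?exprn_ge0// mulr_ge0 ?expR_ge0.
split => //.
- transitivity (\int[N]_z (z * expR (0 * z))); last by rewrite F1 mul0r.
  by apply: eq_Rintegral => z _; rewrite mul0r expR0 mulr1.
- have d1 : is_derive (0 : R) 1 (fun l => \int[N]_z (z * expR (l * z))) (\int[N]_z (z * (z * expR (0 * z)))).
    apply: (@is_derive_under _ _ _ N setT (fun l z => z * expR (l * z)) (fun l z => z * (z * expR (l * z)))
      (fun z => 2 * expR (2 * `|z|)) (-1) 1) => //.
    + by rewrite ltrN10 ltr01.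
    + by move=> x z _ _; apply: is_derive_eq; rewrite /GRing.scale/=; ring.
    + by apply: integrable_EFinZl => //; exact: normal_exp_integrable.
    + move=> x z /andP[x1 x2] _; rewrite mulrA -expr2 normrM normrX (_ : 2 * `|z| = `|z| + `|z|).
        rewrite expRD mulrA ler_pM ?exprn_ge0 ?sq_le_exp// ger0_norm ?expR_ge0//.
        rewrite (le_trans (fnorm1 _ _))// ler_expR -[leRHS]mul1r ler_wpM2r//.
        by rewrite ler_norml; lra.
      by ring.
  have d2 : is_derive (0 : R) 1 (fun l : R => \int[N]_z (z * expR (l * z))) 1.
    rewrite (funext F1).
    have de : is_derive (0 : R) 1 (fun l : R => expR (l ^+ 2 / 2)) (expR (0 ^+ 2 / 2) * 0).
      apply: (@is_derive1_comp _ expR (fun l => l ^+ 2 / 2)).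
      by apply: is_derive_eq; rewrite /GRing.scale/=; ring.
    have E0 : expR (0 ^+ 2 / 2) = 1 :> R by rewrite expr0n mul0r expR0.
    by apply: is_derive_eq; rewrite /GRing.scale/= E0; ring.
  have [_ E1] := d1; have [_ E2] := d2; apply: etrans (etrans (esym E1) E2).
  by apply: eq_Rintegral => z _; rewrite mul0r expR0 mulr1 expr2.
Qed.

End gaussian.

Lemma C0_intro (R : realType) (h : R -> R) : continuous h ->
  (forall e : R, 0 < e -> exists M, forall x, M <= `|x| -> `|h x| <= e) -> h \in @C0 R.
Proof.
move=> ch H; apply/C0P; split => //.
- apply/cvgrPdist_le => e e0; have [M HM] := H _ e0.
  near=> x; rewrite sub0r normrN; apply: HM.
  have Mx : M <= x by near: x; apply: nbhs_pinfty_ge; exact: num_real.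
  by rewrite (le_trans Mx)// ler_norm.
- apply/cvgrPdist_le => e e0; have [M HM] := H _ e0.
  near=> x; rewrite sub0r normrN; apply: HM.
  have Mx : x <= - M by near: x; apply: nbhs_ninfty_le; exact: num_real.
  by rewrite -normrN (le_trans _ (ler_norm _))// lerNr.
Unshelve. all: by end_near. Qed.

(** * Primitives and smoothing by moving averages *)

Section primitive.
Context (R : realType).

Lemma local_primitive (f : R -> R) (n : R) : continuous f -> 0 < n ->
  exists2 F : R -> R, F 0 = 0 & forall x : R, `|x| < n -> is_derive x 1 F (f x).
Proof.
move=> cf n0.
pose I (x : R) := \int[lebesgue_measure]_(t in `[- n, x]) f t.
exists (fun x => I x - I 0); first by rewrite subrr.
move=> x; rewrite ltr_norml => /andP[nx xn].
have iI : lebesgue_measure.-integrable [set` Interval (BLeft (- n)) (BRight n)] (EFin \o f).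
  apply: continuous_compact_integrable; first exact: segment_compact.
  exact: continuous_subspaceT.
have [] := @continuous_FTC1 R f (BLeft (- n)) x n xn iI.
- by rewrite /= lte_fin.
- exact: cf.
move=> dI; rewrite derive1E => EI.
have H : is_derive x 1 I (f x) by split.
by apply: is_derive_eq; rewrite subr0.
Qed.

(** Primitives on the intervals (-n, n), normalised at 0, agree on overlaps by the mean value
    theorem; the glued function uses at x the first interval known to contain x. *)
Lemma primitive_exists (f : R -> R) : continuous f ->
  exists F : R -> R, forall x : R, is_derive x 1 F (f x).
Proof.
move=> cf.
have /choice[F HF] n : exists F : R -> R, F 0 = 0 /\ forall x : R, `|x| < n.+1%:R -> is_derive x 1 F (f x).
  by have [F F0 dF] := local_primitive cf (ltr0Sn R n); exists F.
have FE m n x : (m <= n)%N -> `|x| < m.+1%:R -> F m x = F n x.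
  move=> mn xm; apply/eqP; rewrite -subr_eq0; apply/eqP.
  have dD r : 0 <= r <= 1 -> is_derive (0 + r * (x - 0)) 1 (fun x => F m x - F n x) ((fun=> 0) (0 + r * (x - 0))).
    move=> /andP[r0 r1]; have h : `|0 + r * (x - 0)| < m.+1%:R.
      by rewrite add0r subr0 normrM (ger0_norm r0) (le_lt_trans _ xm)// ler_piMl.
    have dm := (HF m).2 _ h.
    have hmn : m.+1%:R <= n.+1%:R :> R by rewrite ler_nat.
    have dn := (HF n).2 _ (lt_le_trans h hmn).
    by apply: is_derive_eq; rewrite subrr.
  have [r _] := @mvt_segment _ (fun x => F m x - F n x) (fun=> 0) 0 x dD.
  by rewrite (HF m).1 (HF n).1 subrr subr0 mul0r.
pose N (x : R) := Num.truncn `|x|.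
have xN x : `|x| < (N x).+1%:R by exact: truncnS_gt.
exists (fun x => F (N x) x) => x.
have dF := (HF (N x)).2 x (xN x).
apply: near_eq_is_derive dF; near=> y.
have yx : `|y| < (N x).+1%:R.
  near: y; apply: (cvgr_lt `|x|) => //; exact: norm_continuous.
have [h|h] := leqP (N y) (N x); first by rewrite (FE _ _ _ h).
by rewrite (FE _ _ _ (ltnW h)).
Unshelve. all: by end_near. Qed.

Lemma C0_shift (f : C0fun R) (a : R) : (fun x => f (x + a)) \in @C0 R.
Proof.
apply: C0_intro => [x|e e0].
  apply: (@continuous_comp _ _ _ (fun x : R => x + a) f); last exact: C0_continuous.
  by apply: cvgD; [exact: cvg_id|exact: cvg_cst].
have [M _ HM] := C0_tail f e0; exists (M + `|a|) => x Mx; apply: HM.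
by have := ler_normB (x + a) a; rewrite addrK; lra.
Qed.

Lemma C0_mulb (b : R -> R) (K : R) (f : C0fun R) : continuous b -> (forall x, `|b x| <= K) ->
  (fun x => b x * f x) \in @C0 R.
Proof.
move=> cb bK; have K0 : 0 <= K by rewrite (le_trans _ (bK 0)).
apply: C0_intro => [x|e e0]; first by apply: cvgM; [exact: cb|exact: C0_continuous].
have e1 : 0 < e / (K + 1) by rewrite divr_gt0// ltr_wpDl.
have [M _ HM] := C0_tail f e1; exists M => x /HM h.
rewrite normrM (le_trans (ler_pM _ _ (bK x) h))// mulrCA ger_pMr// ler_pdivrMr ?ltr_wpDl//.
by rewrite mul1r lerDl.
Qed.

Lemma is_derive_shift (F : R -> R) (x a d : R) :
  is_derive (x + a) 1 F d -> is_derive x 1 (fun y : R => F (y + a)) d.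
Proof.
move=> dF; rewrite -[d]mulr1; apply: (@is_derive1_comp _ F (fun y : R => y + a)).
by have := is_derive_id x (1 : R) => h; apply: is_derive_eq; rewrite addr0.
Qed.

(** The mean over [x, x + a] is a difference quotient of a primitive: it gains one derivative, and
    uniform continuity keeps it close to [f]. *)
Lemma box_average (f : C0fun R) (e : R) : 0 < e -> exists (h : C0fun R) (a : R),
  [/\ 0 < a, forall x : R, is_derive x 1 h (a^-1 * (f (x + a) - f x)) & `|f - h| <= e].
Proof.
move=> e0; have [a a0 Ha] := C0_unif_continuous f e0.
have [F dF] := primitive_exists (@C0_continuous _ f).
pose m (x : R) := a^-1 * (F (x + a) - F x).
have dm (x : R) : is_derive x 1 m (a^-1 * (f (x + a) - f x)).
  have d1 := dF x; have d2 := dF (x + a).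
  have d3 : is_derive x (1 : R) (fun y => F (y + a)) (f (x + a)).
    exact: is_derive_shift.
  by apply: is_derive_eq; rewrite /GRing.scale/=; ring.
have mE (x : R) : exists2 r, 0 <= r <= 1 & m x = f (x + r * a).
  have [r r01 E] := @mvt _ F f x (x + a) dF; exists r => //.
  rewrite /m E (_ : x + a - x = a); last by ring.
  by rewrite mulrC mulfK// gt_eqF.
have ra r : 0 <= r <= 1 -> `|r * a| <= a.
  by move=> /andP[r0 r1]; rewrite normrM !ger0_norm// ?ler_piMl// ltW.
have mC : m \in @C0 R.
  apply: C0_intro => [x|e' e'0]; first exact: is_derive_continuous (dm x).
  have [M _ HM] := C0_tail f e'0; exists (M + a) => x Mx.
  have [r r01 ->] := mE x; apply: HM; have := ra r r01.
  by have := ler_normB (x + r * a) (r * a); rewrite addrK; lra.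
exists (mkC0 m), a; split => //.
  move=> x; have -> : (mkC0 m : R -> R) = m by apply/funext => y; rewrite mkC0E.
  exact: dm.
apply: C0_norm_le => x; rewrite !C0E mkC0E//; have [r r01 ->] := mE x.
by apply: Ha; rewrite opprD addNKr normrN ra.
Qed.

End primitive.

(** * The semigroup of Gaussian means along the flow *)

Lemma pow4_le (R : realFieldType) (p q : R) : (p + q) ^+ 4 <= 8 * (p ^+ 4 + q ^+ 4).
Proof.
have h1 : 0 <= (p - q) ^+ 2 by rewrite sqr_ge0.
have h2 : 0 <= (p ^+ 2 - q ^+ 2) ^+ 2 by rewrite sqr_ge0.
have h3 : 0 <= (p - q) ^+ 2 * (6 * (p - q) ^+ 2 + (p + q) ^+ 2 * 8).
  by rewrite mulr_ge0// addr_ge0// mulr_ge0// sqr_ge0.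
nra.
Qed.

Section gaussian_mean.
Context (R : realType).
Local Notation N := (@normal_prob R 0 1).

Lemma normal_integrable_bounded (F : R -> R) (K : R) : measurable_fun setT F ->
  (forall x, `|F x| <= K) -> N.-integrable setT (EFin \o F).
Proof.
move=> mF FK; apply: (@bounded_integrable _ _ _ N _ _ K) => //.
by rewrite (le_lt_trans (probability_le1 N measurableT))// ltry.
Qed.

Lemma normal_cst (K : R) : \int[N]_z K = K.
Proof. by rewrite Rintegral_cst// [X in fine X](_ : _ = 1%E) ?mulr1//; exact: probability_setT. Qed.

Lemma normal_le (F : R -> R) (K : R) : N.-integrable setT (EFin \o F) ->
  (forall x, `|F x| <= K) -> `|\int[N]_z F z| <= K.
Proof.
move=> iF FK; rewrite -[leRHS]normal_cst (le_trans (le_normr_Rintegral _ iF))//.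
apply: le_Rintegral => //; first exact: integrable_norm.
by apply: (@normal_integrable_bounded _ `|K|).
Qed.

(** Adding the bound [K] reduces to nonnegative functions; zero coefficients are treated apart, as
    they give no density. *)
Lemma normal_conv (a b : R) (F : R -> R) (K : R) : 0 <= a -> 0 <= b -> continuous F ->
  (forall x, `|F x| <= K) ->
  \int[N]_z \int[N]_y F (a * z + b * y) = \int[N]_z F (Num.sqrt (a ^+ 2 + b ^+ 2) * z).
Proof.
move=> a0 b0 cF FK.
have mF (h : R -> R) : continuous h -> measurable_fun setT (fun y => F (h y)).
  move=> ch; apply: continuous_measurable_fun => y.
  by apply: (cvg_comp h F); [exact: ch|exact: cF].
have clin (p q : R) : continuous (fun y : R => p * y + q).
  by move=> y; apply: cvgD; [exact: mulrl_continuous|exact: cvg_cst].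
have clin' (p q : R) : continuous (fun y : R => p + q * y).
  by move=> y; apply: cvgD; [exact: cvg_cst|exact: mulrl_continuous].
have [->|a1] := eqVneq a 0.
  rewrite expr0n/= add0r sqrtr_sqr ger0_norm//.
  by under [LHS]eq_Rintegral => z _ do (under eq_Rintegral => y _ do rewrite mul0r add0r); rewrite normal_cst.
have [->|b1] := eqVneq b 0.
  rewrite expr0n/= addr0 sqrtr_sqr ger0_norm//.
  apply: eq_Rintegral => z _.
  by under eq_Rintegral => y _ do rewrite mul0r addr0; rewrite normal_cst.
have {}a0 : 0 < a by rewrite lt_neqAle eq_sym a1.
have {}b0 : 0 < b by rewrite lt_neqAle eq_sym b1.
have FK0 x : 0 <= F x + K by rewrite -lerBlDr sub0r; have := FK x; rewrite ler_norml => /andP[].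
have iF (h : R -> R) : continuous h -> N.-integrable setT (EFin \o (fun y => F (h y))).
  by move=> ch; apply: (@normal_integrable_bounded _ K) => //; exact: mF.
have iK : N.-integrable setT (EFin \o cst K) by apply: (@normal_integrable_bounded _ `|K|).
have EK (h : R -> R) : continuous h ->
    (\int[N]_y (F (h y) + K)%:E = (\int[N]_y F (h y) + K)%:E)%E.
  move=> ch; rewrite -[in RHS](normal_cst K) -RintegralD//; last exact: iF.
  rewrite /Rintegral fineK//; apply: integrable_fin_num => //.
  by apply: integrable_EFinD => //; exact: iF.
have mFK : measurable_fun setT (fun x : R => (F x + K)%:E).
  apply/measurable_EFinP; apply: measurable_funD => //.
  by apply: (mF (fun x => x)) => x; exact: cvg_id.
have mI : measurable_fun setT (fun z => \int[N]_y F (a * z + b * y)).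
  apply: continuous_measurable_fun.
  apply: (@continuous_Rintegral _ _ _ N _ (fun z y => F (a * z + b * y)) (fun=> K)) => //.
  - by move=> z; apply: mF.
  - by move=> y _ z; apply: (cvg_comp (fun z => a * z + b * y) F); [exact: clin|exact: cF].
have iI : N.-integrable setT (EFin \o (fun z => \int[N]_y F (a * z + b * y))).
  apply: (@normal_integrable_bounded _ K) => // z.
  by apply: normal_le => //; exact: iF.
have := ge0_integral_normal_conv a0 b0 mFK (fun x => FK0 x).
under [X in X = _ -> _]eq_integral => z _ do rewrite EK//.
rewrite (EK (fun z => Num.sqrt (a ^+ 2 + b ^+ 2) * z)); last exact: mulrl_continuous.
move=> /(congr1 fine) /= E.
apply: (@addIr _ K); rewrite -E -[in LHS](normal_cst K) -RintegralD//.
Qed.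

Lemma normal_affine_moments (u w : R) : 0 <= u ->
  [/\ N.-integrable setT (EFin \o (fun z => Num.sqrt u * z + w * u)),
      N.-integrable setT (EFin \o (fun z => (Num.sqrt u * z + w * u) ^+ 2)),
      N.-integrable setT (EFin \o (fun z => (Num.sqrt u * z + w * u) ^+ 4)),
      \int[N]_z (Num.sqrt u * z + w * u) = w * u &
      \int[N]_z ((Num.sqrt u * z + w * u) ^+ 2) = u + w ^+ 2 * u ^+ 2] /\
      \int[N]_z ((Num.sqrt u * z + w * u) ^+ 4) <=
        8 * (\int[N]_z (z ^+ 4) * u ^+ 2 + w ^+ 4 * u ^+ 4).
Proof.
move=> u0; have [i1 i2 i4 m1 m2] := normal_moments R.
have iK (K : R) : N.-integrable setT (EFin \o cst K) by apply: (@normal_integrable_bounded _ `|K|).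
have su : Num.sqrt u ^+ 2 = u by rewrite sqr_sqrtr.
have j1 : N.-integrable setT (EFin \o (fun z => Num.sqrt u * z + w * u)).
  by apply: integrable_EFinD => //; [exact: integrable_EFinZl|exact: iK].
have E2 : (fun z => (Num.sqrt u * z + w * u) ^+ 2) =
    (fun z => u * z ^+ 2 + (2 * Num.sqrt u * (w * u) * z + (w * u) ^+ 2)).
  by apply/funext => z; rewrite sqrrD exprMn su; ring.
have j2' : N.-integrable setT (EFin \o (fun z => 2 * Num.sqrt u * (w * u) * z + (w * u) ^+ 2)).
  by apply: integrable_EFinD => //; [exact: integrable_EFinZl|exact: iK].
have j2 : N.-integrable setT (EFin \o (fun z => (Num.sqrt u * z + w * u) ^+ 2)).
  by rewrite E2; apply: integrable_EFinD => //; exact: integrable_EFinZl.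
have b4 (z : R) : (Num.sqrt u * z + w * u) ^+ 4 <= 8 * (z ^+ 4 * u ^+ 2 + w ^+ 4 * u ^+ 4).
  rewrite -[u in z ^+ 4 * u ^+ 2]su -exprM [X in _ <= 8 * (_ + X)](_ : _ = (w * u) ^+ 4); last by ring.
  by rewrite -exprMn mulrC; exact: pow4_le.
have i8 : N.-integrable setT (EFin \o (fun z => 8 * (z ^+ 4 * u ^+ 2 + w ^+ 4 * u ^+ 4))).
  apply: integrable_EFinZl => //; apply: integrable_EFinD => //; last exact: iK.
  by under [X in _.-integrable _ (EFin \o X)]eq_fun do rewrite mulrC; exact: integrable_EFinZl.
have j4 : N.-integrable setT (EFin \o (fun z => (Num.sqrt u * z + w * u) ^+ 4)).
  apply: (@integrable_le _ _ _ N _ _ (fun z => 8 * (z ^+ 4 * u ^+ 2 + w ^+ 4 * u ^+ 4))) => //.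
    apply: measurable_funX; apply: measurable_funD => //; exact: measurable_funM.
  by move=> z _; rewrite ger0_norm//; have := sqr_ge0 ((Num.sqrt u * z + w * u) ^+ 2); rewrite -exprM.
split; [split=> //|].
- rewrite RintegralD//; [|exact: integrable_EFinZl|exact: iK].
  by rewrite (RintegralZl _ _ i1)// m1 mulr0 add0r normal_cst.
- rewrite E2 RintegralD//; last exact: integrable_EFinZl.
  rewrite (RintegralZl _ _ i2)// m2 mulr1 RintegralD//; [|exact: integrable_EFinZl|exact: iK].
  by rewrite (RintegralZl _ _ i1)// m1 mulr0 add0r normal_cst exprMn.
- apply: (@le_trans _ _ (\int[N]_z (8 * (z ^+ 4 * u ^+ 2 + w ^+ 4 * u ^+ 4)))).
    by apply: le_Rintegral => // z _; exact: b4.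
  rewrite RintegralZl//; last first.
    apply: integrable_EFinD => //; last exact: iK.
    by under [X in _.-integrable _ (EFin \o X)]eq_fun do rewrite mulrC; exact: integrable_EFinZl.
  rewrite RintegralD//; [|by under [X in _.-integrable _ (EFin \o X)]eq_fun do rewrite mulrC; exact: integrable_EFinZl|exact: iK].
  by rewrite RintegralZr// normal_cst.
Qed.

End gaussian_mean.

Lemma expRN_taylor (R : realType) (t : R) : 0 <= t -> `|expR (- t) - 1 + t| <= t ^+ 2.
Proof.
move=> t0; have /andP[k1 k2] := expR_onem_bounds t0.
have k3 : t - t ^+ 2 <= t / (1 + t).
  rewrite ler_pdivlMr ?ltr_wpDr// (_ : (t - t ^+ 2) * (1 + t) = t - t ^+ 2 * t); last by ring.
  by rewrite gerBl mulr_ge0 ?sqr_ge0.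
have {k1 k3} := le_trans k3 k1; move: (expR (- t)) (t ^+ 2) k2 => e x k2 k3.
by rewrite ger0_norm; lra.
Qed.

Section flow_semigroup.
Context (R : realType) (s s1 s2 : R -> R) (K0 K1 K2 : R) (g : R -> R -> R) (w c : R).
Local Notation N := (@normal_prob R 0 1).
Hypothesis ds : forall x : R, is_derive x 1 s (s1 x).
Hypothesis ds1 : forall x : R, is_derive x 1 s1 (s2 x).
Hypothesis cs2 : continuous s2.
Hypothesis b0 : forall x, `|s x| <= K0.
Hypothesis b1 : forall x, `|s1 x| <= K1.
Hypothesis b2 : forall x, `|s2 x| <= K2.
Hypothesis gd : forall y x : R, is_derive y 1 (g ^~ x) (s (g y x)).
Hypothesis g0 : forall x, g 0 x = x.
Hypothesis c0 : c <= 0.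

Let gdist := flow_dist b0 gd g0.
Let gadd := flow_add ds b1 gd g0.
Let gcont := flow_continuous ds b1 gd g0.
Let gtcont := flow_time_continuous gd.

Lemma flow_comp_C0 y (f : C0fun R) : (fun x => f (g y x)) \in @C0 R.
Proof.
apply: C0_intro.
  by move=> x; apply: (cvg_comp (g y) f); [exact: gcont|exact: C0_continuous].
move=> e e0; have [M M0 HM] := C0_tail f e0.
exists (M + K0 * `|y|) => x xM; apply: HM.
have := ler_normB x (x - g y x); rewrite subKr => h.
have h2 := gdist y x; rewrite distrC in h2.
have h3 : `|x| <= `|g y x| + `|x - g y x|.
  by rewrite -{1}[x](subrKC (g y x)) ler_normD.
by rewrite -(lerD2r (K0 * `|y|)) (le_trans xM)// (le_trans h3)// lerD2l.
Qed.

Definition flow_op y (f : C0fun R) : C0fun R := mkC0 (fun x => f (g y x)).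

Lemma flow_opE y f x : flow_op y f x = f (g y x).
Proof. by rewrite mkC0E//; exact: flow_comp_C0. Qed.

Lemma flow_op_norm y f : `|flow_op y f| <= `|f|.
Proof. by apply: C0_norm_le => x; rewrite flow_opE C0_ler_norm. Qed.

Lemma flow_op_linear y : linear (flow_op y).
Proof. by move=> a f h; apply: C0_ext => x; rewrite !(flow_opE, C0E). Qed.

(** Uniform continuity handles small [y]; for large [y] the trivial bound 2 |f| is absorbed by C
    y^2. In this form the oscillation integrates against second moments. *)
Lemma flow_op_dist (f : C0fun R) (e : R) : 0 < e ->
  exists2 C : R, 0 <= C & forall y x : R, `|f (g y x) - f x| <= e + C * y ^+ 2.
Proof.
move=> e0; have [dl dl0 H] := C0_unif_continuous f e0.
have K00 : 0 <= K0 by rewrite (le_trans _ (b0 0)).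
pose r := dl / (K0 + 1); have r0 : 0 < r by rewrite divr_gt0// ltr_wpDl.
exists (2 * `|f| / r ^+ 2); first by apply: divr_ge0; [exact: mulr_ge0|exact: sqr_ge0].
move=> y x; have [yr|ry] := leP `|y| r.
  have h : `|f (g y x) - f x| <= e.
    apply: H; rewrite (le_trans (gdist y x))// (le_trans (ler_wpM2l K00 yr))// /r mulrCA.
    by rewrite ler_piMr ?(ltW dl0)// ler_pdivrMr ?ltr_wpDl// mul1r lerDl.
  rewrite (le_trans h)// lerDl; apply: mulr_ge0; last exact: sqr_ge0.
  by apply: divr_ge0; [exact: mulr_ge0|exact: sqr_ge0].
rewrite (@le_trans _ _ (2 * `|f|))//.
  by rewrite (le_trans (ler_normB _ _))// mulr_natl mulr2n lerD// C0_ler_norm.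
rewrite (@le_trans _ _ (2 * `|f| / r ^+ 2 * y ^+ 2)) ?lerDr ?(ltW e0)//.
rewrite mulrAC -mulrA ler_peMr ?mulr_ge0// ler_pdivlMr ?exprn_gt0// mul1r.
by rewrite -(real_normK (num_real y)) lerXn2r ?nnegrE ?(ltW r0)// ltW.
Qed.

Definition gauss_mean (u : R) (f : R -> R) (x : R) :=
  \int[N]_z f (g (Num.sqrt u * z + w * u) x).

Let cY (u x : R) (f : R -> R) : continuous f ->
  continuous (fun z => f (g (Num.sqrt u * z + w * u) x)).
Proof.
move=> cf z; apply: (cvg_comp (fun z => g (Num.sqrt u * z + w * u) x) f); last exact: cf.
apply: (cvg_comp (fun z => Num.sqrt u * z + w * u) (g ^~ x)); last exact: gtcont.
by apply: cvgD; [exact: mulrl_continuous|exact: cvg_cst].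
Qed.

Let mY (u x : R) (f : R -> R) : continuous f ->
  measurable_fun setT (fun z => f (g (Num.sqrt u * z + w * u) x)).
Proof. by move=> cf; apply: continuous_measurable_fun; exact: cY. Qed.

Let iY (u x : R) (f : C0fun R) :
  N.-integrable setT (EFin \o (fun z => f (g (Num.sqrt u * z + w * u) x))).
Proof.
apply: (@normal_integrable_bounded _ _ `|f|); last by move=> z; exact: C0_ler_norm.
by apply: mY; exact: C0_continuous.
Qed.

Definition flow_sg (u : R) (f : C0fun R) : C0fun R :=
  mix N setT (cst (expR (c * u))) (fun z => flow_op (Num.sqrt u * z + w * u) f).

Lemma flow_sgE u f x : flow_sg u f x = expR (c * u) * gauss_mean u f x.
Proof.
rewrite /flow_sg (@mixE _ _ _ N _ _ _ `|f|)//.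
- rewrite /gauss_mean -(RintegralZl (expR (c * u)) _ (iY u x f))//.
  by apply: eq_Rintegral => z _; rewrite flow_opE.
- by apply: (@normal_integrable_bounded _ _ `|expR (c * u)|).
- move=> y; rewrite (_ : (fun t => _) = (fun z => f (g (Num.sqrt u * z + w * u) y))).
    by apply: mY; exact: C0_continuous.
  by apply/funext => z; rewrite flow_opE.
- by move=> z _; exact: flow_op_norm.
Qed.

Let ecu (u : R) : 0 <= u -> 0 <= expR (c * u) <= 1.
Proof. by move=> u0; rewrite expR_ge0/= -expR0 ler_expR mulr_le0_ge0. Qed.

Let mean_le (u : R) (f : C0fun R) x : `|gauss_mean u f x| <= `|f|.
Proof. by apply: normal_le => [|z]; [exact: iY|exact: C0_ler_norm]. Qed.

Lemma flow_sg_semigroup : contraction_semigroup flow_sg.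
Proof.
split.
- move=> u _ a f h; apply: C0_ext => x; rewrite !(flow_sgE, C0E) /gauss_mean.
  under eq_Rintegral => z _ do rewrite !C0E.
  rewrite (RintegralD _ (integrable_EFinZl a measurableT (iY u x f)) (iY u x h))//.
  by rewrite (RintegralZl a _ (iY u x f))//; ring.
- move=> u f u0; apply: C0_norm_le => x; rewrite flow_sgE normrM -[leRHS]mul1r.
  by have /andP[h0 h1] := ecu u0; rewrite ler_pM// ger0_norm.
- move=> f; apply: C0_ext => x; rewrite flow_sgE mulr0 expR0 mul1r /gauss_mean sqrtr0 mulr0.
  by under eq_Rintegral => z _ do rewrite mul0r addr0 g0; rewrite normal_cst.
- move=> u t f u0 t0; apply: C0_ext => x; rewrite !flow_sgE /gauss_mean.
  under [in RHS]eq_Rintegral => z _ do rewrite flow_sgE.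
  (* By the flow property two successive means evaluate f at time sqrt(u) z + sqrt(t) y + w (u + t),
     so that only the convolution of two centred Gaussians remains. *)
  pose F r := f (g (r + w * (u + t)) x).
  have cF : continuous F.
    move=> r; apply: (cvg_comp (fun r => g (r + w * (u + t)) x) f); last exact: C0_continuous.
    apply: (cvg_comp (fun r => r + w * (u + t)) (g ^~ x)); last exact: gtcont.
    by apply: cvgD; [exact: cvg_id|exact: cvg_cst].
  have := @normal_conv _ (Num.sqrt u) (Num.sqrt t) F `|f| (sqrtr_ge0 _) (sqrtr_ge0 _) cF (fun r => C0_ler_norm _ _).
  rewrite !sqr_sqrtr// /F => E.
  rewrite -E mulrDr expRD -mulrA; congr (expR (c * u) * _).
  have im : N.-integrable setT (EFin \o (fun z => gauss_mean t f (g (Num.sqrt u * z + w * u) x))).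
    have := integrable_EFinZl (expR (- (c * t))) measurableT (iY u x (flow_sg t f)).
    congr (_.-integrable _ (EFin \o _)); apply/funext => z.
    by rewrite flow_sgE mulrA -expRD addNr expR0 mul1r.
  rewrite (RintegralZl _ _ im); last by [].
  congr (expR (c * t) * _); apply: eq_Rintegral => z _; rewrite /gauss_mean.
  by apply: eq_Rintegral => y _; rewrite -gadd; congr (f (g _ x)); ring.
- move=> f; apply/cvgrPdist_le => e e0.
  have e2 : 0 < e / 2 by rewrite divr_gt0.
  have [C C0 HC] := flow_op_dist f e2.
  (* For u <= 1 the factor e^(cu) costs at most -c u |f| and the second moment of the increment at
     most C (1 + w^2) u. *)
  pose M := - c * `|f| + C * (1 + w ^+ 2).
  have M0 : 0 <= M.
    by rewrite addr_ge0 ?mulr_ge0 ?oppr_ge0// addr_ge0// sqr_ge0.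
  have d0 : 0 < Num.min 1 (e / 2 / (M + 1)).
    by rewrite lt_min ltr01 divr_gt0// ltr_wpDl.
  near=> u.
  have u0 : 0 < u by near: u; exact: nbhs_right_gt.
  have : u < Num.min 1 (e / 2 / (M + 1)) by near: u; exact: nbhs_right_lt.
  rewrite lt_min => /andP[u1]; rewrite ltr_pdivlMr ?ltr_wpDl// => uM.
  rewrite distrC; apply: C0_norm_le => x; rewrite C0_subE flow_sgE.
  have [[_ i2 _ _ m2] _] := normal_affine_moments w (ltW u0).
  have h1 : `|gauss_mean u f x - f x| <= e / 2 + C * (u + w ^+ 2 * u ^+ 2).
    have ifx : N.-integrable setT (EFin \o cst (f x)) by apply: (@normal_integrable_bounded _ _ `|f x|).
    rewrite -{1}(normal_cst (f x)) -(RintegralB _ (iY u x f) ifx); last by [].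
    have iK : N.-integrable setT (EFin \o cst (e / 2)) by apply: (@normal_integrable_bounded _ _ `|e / 2|).
    have iB : N.-integrable setT (EFin \o (fun z => f (g (Num.sqrt u * z + w * u) x) - f x)).
      by apply: integrable_EFinB => //; exact: iY.
    rewrite (le_trans (le_normr_Rintegral _ iB))// -m2 -(normal_cst (e / 2)).
    rewrite -(RintegralZl C _ i2); last by [].
    rewrite -(RintegralD _ iK (integrable_EFinZl C measurableT i2)); last by [].
    apply: le_Rintegral => //; first exact: integrable_norm.
      by apply: integrable_EFinD => //; exact: integrable_EFinZl.

  have cu0 : 0 <= - (c * u) by rewrite -mulNr mulr_ge0 ?oppr_ge0// ltW.
  have /andP[h2 h3] := expR_onem_bounds cu0; rewrite opprK in h3.
  have h4 : `|(expR (c * u) - 1) * f x| <= - (c * u) * `|f|.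
    rewrite normrM ler_pM// ?C0_ler_norm// distrC ger0_norm//.
    by rewrite subr_ge0; have /andP[] := ecu (ltW u0).
  have h5 : `|expR (c * u) * (gauss_mean u f x - f x)| <= e / 2 + C * (u + w ^+ 2 * u ^+ 2).
    have /andP[p0 p1] := ecu (ltW u0).
    by rewrite normrM -[leRHS]mul1r ler_pM// ger0_norm.
  have h6 : w ^+ 2 * u ^+ 2 <= w ^+ 2 * u.
    by rewrite ler_wpM2l ?sqr_ge0// expr2 ler_piMr// ltW.
  have h7 : C * (u + w ^+ 2 * u ^+ 2) <= C * (u + w ^+ 2 * u) by rewrite ler_wpM2l// lerD2l.
  rewrite (_ : _ - _ = expR (c * u) * (gauss_mean u f x - f x) + (expR (c * u) - 1) * f x); last by ring.
  rewrite (le_trans (ler_normD _ _))// (le_trans (lerD h5 h4))//.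
  rewrite (@le_trans _ _ (e / 2 + u * (M + 1)))//; last by rewrite mulrC -lerBrDl; lra.
  rewrite -addrA lerD2l (le_trans (lerD h7 (lexx _)))// /M.
  rewrite [leRHS](_ : _ = C * (u + w ^+ 2 * u) + - (c * u) * `|f| + u); last by ring.
  by rewrite lerDl ltW.
Unshelve. all: by end_near. Qed.

(** * Taylor expansion along the flow *)

Section taylor.
Variables (f f1 f2 : R -> R) (q F : C0fun R).
Hypothesis df : forall x : R, is_derive x 1 f (f1 x).
Hypothesis df1 : forall x : R, is_derive x 1 f1 (f2 x).
Hypothesis Ff : forall x, F x = f x.
Let D x := s x * f1 x.
Let D2 x := s x * (s1 x * f1 x + s x * f2 x).
Hypothesis qE : forall x, q x = D2 x / 2 + w * D x.

Let dD (x : R) : is_derive x 1 D (s1 x * f1 x + s x * f2 x).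
Proof. by apply: is_derive_eq; rewrite /GRing.scale/=; ring. Qed.

Let dfg (y x : R) : is_derive y 1 (fun y => f (g y x)) (D (g y x)).
Proof. by rewrite /D mulrC; exact: (@is_derive1_comp _ f (g ^~ x)). Qed.

Let dDg (y x : R) : is_derive y 1 (fun y => D (g y x)) (D2 (g y x)).
Proof. by rewrite /D2 mulrC; exact: (@is_derive1_comp _ D (g ^~ x)). Qed.

Let fle x : `|f x| <= `|F|. Proof. by rewrite -Ff C0_ler_norm. Qed.

(* D f is bounded in terms of f and L f: d/dy (e^(2 w y) D f (g y x)) is
   2 e^(2 w y) (L f) (g y x), and D f (g y x) is small for some y in [0, 1] by
   the mean value theorem. *)
Lemma flow_deriv_bounded : exists2 K, 0 <= K & forall x, `|D x| <= K.
Proof.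
exists (expR (2 * `|w|) * (2 * `|F|) + 2 * expR (2 * `|w|) * `|q|).
  by rewrite addr_ge0// !mulr_ge0// expR_ge0.
move=> x.
have [r r01 E] := mvt 0 1 (fun y => dfg y x).
rewrite subr0 mulr1 add0r mulr1 in E.
have h1 : `|D (g r x)| <= 2 * `|F|.
  by rewrite -E (le_trans (ler_normB _ _))// mulr_natl mulr2n lerD.
have dE (y : R) : is_derive y 1 (fun y => expR (2 * w * y) * D (g y x)) (2 * expR (2 * w * y) * q (g y x)).
  have de : is_derive y 1 (fun y => expR (2 * w * y)) (expR (2 * w * y) * (2 * w)).
    apply: (@is_derive1_comp _ expR (fun y => 2 * w * y)).
    by apply: is_derive_eq; rewrite /GRing.scale/= mulr1.
  have dd := dDg y x.
  by apply: is_derive_eq; rewrite /GRing.scale/= qE; field.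
have [r' r01'] := mvt 0 r dE.
rewrite subr0 add0r mulr0 expR0 mul1r g0 => E'.
have ew (t : R) : 0 <= t <= 1 -> expR (2 * w * t) <= expR (2 * `|w|).
  move=> /andP[t0 t1]; rewrite ler_expR (le_trans (ler_norm _))// !normrM (ger0_norm t0) normr_nat.
  by rewrite ler_piMr// mulr_ge0.
have /andP[r0 r1] := r01; have /andP[r0' r1'] := r01'.
have rr : 0 <= r' * r <= 1 by rewrite mulr_ge0//= mulr_ile1.
rewrite -[D x](subKr (expR (2 * w * r) * D (g r x))) E' (le_trans (ler_normB _ _))// lerD//.
  by rewrite normrM ler_pM// ger0_norm ?expR_ge0// ew.
rewrite !normrM (ger0_norm r0) normr_nat (ger0_norm (expR_ge0 _)).
rewrite -[leRHS]mulr1 ler_pM// ?mulr_ge0 ?expR_ge0// ler_pM ?mulr_ge0 ?expR_ge0 ?C0_ler_norm//.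
by rewrite ler_wpM2l// ew.
Qed.

(** The uniform remainder comes from D2 = 2 (q - w D): [q] lies in C_oo, so [flow_op_dist] controls
    it along the flow, and [D] is Lipschitz along the flow because its derivative [D2] is
    bounded. *)
Lemma flow_taylor (e : R) : 0 < e -> exists2 C : R, 0 <= C & forall y x,
  `|f (g y x) - f x - y * D x - y ^+ 2 / 2 * D2 x| <= e * y ^+ 2 + C * y ^+ 4.
Proof.
move=> e0; have [K K_0 DK] := flow_deriv_bounded.
have D2E x : D2 x = 2 * (q x - w * D x) by rewrite qE; field.
pose KD := 2 * (`|q| + `|w| * K).
have D2K x : `|D2 x| <= KD.
  rewrite D2E normrM normr_nat ler_wpM2l// (le_trans (ler_normB _ _))//.
  by rewrite lerD ?C0_ler_norm// normrM ler_wpM2l.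
have KD0 : 0 <= KD by rewrite mulr_ge0// addr_ge0// mulr_ge0.
have e4 : 0 < e / 4 by rewrite divr_gt0.
have [C C0 HC] := flow_op_dist q e4.
(* By |y| <= e' + y^2 / e' the Lipschitz error |w| KD |y| becomes at most e / 4 plus a multiple of
   y^2. *)
pose e' := e / (4 * (`|w| * KD + 1)).
have wK0 : 0 <= `|w| * KD by rewrite mulr_ge0.
have e'0 : 0 < e' by rewrite divr_gt0// mulr_gt0// ltr_wpDl.
pose C' := 2 * C + 2 * (`|w| * KD) / e'.
have C'0 : 0 <= C'.
  by apply: addr_ge0; [exact: mulr_ge0|apply: divr_ge0; [exact: mulr_ge0|exact: ltW]].
have H2 y x : `|D2 (g y x) - D2 x| <= e + C' * y ^+ 2.
  have h1 : `|D (g y x) - D x| <= KD * `|y|.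
    have := @mvt_bound _ (fun y => D (g y x)) (fun y => D2 (g y x)) 0 y KD.
    by rewrite g0 subr0; apply.
  have y1 : `|y| <= e' + y ^+ 2 / e'.
    rewrite -(real_normK (num_real y)); have [h|h] := leP `|y| e'.
      by rewrite (le_trans h)// lerDl divr_ge0 ?sqr_ge0// ltW.
    rewrite (@le_trans _ _ (`|y| ^+ 2 / e'))// ?lerDr ?(ltW e'0)//.
    by rewrite ler_pdivlMr// expr2 ler_wpM2l// ltW.
  have h2 : `|w| * (KD * `|y|) <= e / 4 + `|w| * KD / e' * y ^+ 2.
    rewrite mulrA (le_trans (ler_wpM2l wK0 y1))// mulrDr lerD//; last first.
      by rewrite mulrA mulrAC.
    rewrite /e' invfM mulrA mulrCA mulrA -[leRHS]mulr1 -!mulrA [X in _ <= _ * X]mulr1.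
    rewrite [leLHS](_ : _ = e / 4 * (`|w| * KD / (`|w| * KD + 1))); last by rewrite -!mulrA; ring.
    by rewrite ler_piMr ?(ltW e4)// ler_pdivrMr ?ltr_wpDl// mul1r lerDl.
  have h3 := HC y x.
  have h4 : `|w * (D (g y x) - D x)| <= `|w| * (KD * `|y|) by rewrite normrM ler_wpM2l.
  rewrite !D2E (_ : _ - _ = 2 * ((q (g y x) - q x) - w * (D (g y x) - D x))); last by ring.
  rewrite normrM normr_nat.
  have h5 := ler_normB (q (g y x) - q x) (w * (D (g y x) - D x)).
  rewrite (le_trans (ler_wpM2l _ h5))//.
  rewrite /C'; move: h3 h4 h2; set z := `|w| * KD / e' * _.
  rewrite [X in _ <= e + X](_ : _ = 2 * (C * y ^+ 2) + 2 * z); last by rewrite /z; ring.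
  move: (C * y ^+ 2) (`|w| * (KD * `|y|)) => p1 p2; lra.
exists C' => // y x.
(* Two applications of the mean value theorem bound the remainder by y^2 times the oscillation of
   [D2] along the flow. *)
have dR (t : R) : is_derive t 1 (fun y => f (g y x) - f x - y * D x - y ^+ 2 / 2 * D2 x)
    (D (g t x) - D x - t * D2 x).
  by have := dfg t x => dt; apply: is_derive_eq; rewrite /GRing.scale/=; field.
have dR' (t : R) : is_derive t 1 (fun y => D (g y x) - D x - y * D2 x) (D2 (g t x) - D2 x).
  by have := dDg t x => dt; apply: is_derive_eq; rewrite /GRing.scale/=; ring.
have [r /andP[r0 r1]] := mvt 0 y dR.
rewrite g0 mul0r expr0n/= mul0r mul0r !subr0 subrr subr0 add0r => ->.
have [r' /andP[r0' r1']] := mvt 0 (r * y) dR'.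
rewrite g0 subrr mul0r !subr0 add0r => ->.
rewrite normrM normrM.
have ry : `|r * y| <= `|y| by rewrite normrM (ger0_norm r0) ler_piMl.
have rry : `|r' * (r * y)| <= `|y| by rewrite normrM (ger0_norm r0') (le_trans _ ry)// ler_piMl.
have h : `|D2 (g (r' * (r * y)) x) - D2 x| <= e + C' * y ^+ 2.
  rewrite (le_trans (H2 _ _))// lerD2l ler_wpM2l// -(real_normK (num_real y)) -(real_normK (num_real (r' * _))).
  by rewrite lerXn2r ?nnegrE.
rewrite [leRHS](_ : _ = (e + C' * y ^+ 2) * `|y| * `|y|); last first.
  by rewrite -mulrA -expr2 (real_normK (num_real y)); ring.
by rewrite ler_wpM2r// ler_pM.
Qed.

(* The means of F along the flow over increments of mean [w u], second moment
   [u + w^2 u^2] and fourth moment O(u^2) approximate the identity plus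
   [u (L + c)]. *)
Lemma flow_tangent (m : R -> R -> R) (m4 : R) : 0 <= m4 ->
  (forall u x a b e C, 0 < u -> 0 <= C ->
     (forall y, `|f (g y x) - f x - y * a - y ^+ 2 / 2 * b| <= e * y ^+ 2 + C * y ^+ 4) ->
     `|m u x - f x - w * u * a - (u + w ^+ 2 * u ^+ 2) / 2 * b| <=
        e * (u + w ^+ 2 * u ^+ 2) + C * (8 * (m4 * u ^+ 2 + w ^+ 4 * u ^+ 4))) ->
  forall e : R, 0 < e -> exists2 u0, 0 < u0 & forall u x, 0 < u -> u <= u0 ->
    `|expR (c * u) * m u x - f x - u * (q x + c * f x)| <= e * u.
Proof.
move=> m40 Hm e e0; have [K K_0 DK] := flow_deriv_bounded.
have D2E x : D2 x = 2 * (q x - w * D x) by rewrite qE; field.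
pose KD := 2 * (`|q| + `|w| * K).
have D2K x : `|D2 x| <= KD.
  rewrite D2E normrM normr_nat ler_wpM2l// (le_trans (ler_normB _ _))//.
  by rewrite lerD ?C0_ler_norm// normrM ler_wpM2l.
have KD0 : 0 <= KD by rewrite mulr_ge0// addr_ge0// mulr_ge0.
have e2 : 0 < e / 2 by rewrite divr_gt0.
have [C C0 HC] := flow_taylor e2.
have w20 : 0 <= w ^+ 2 by rewrite sqr_ge0.
have w40 : 0 <= w ^+ 4 by rewrite (_ : w ^+ 4 = (w ^+ 2) ^+ 2) ?sqr_ge0// -exprM.
(* [C1] collects the terms in u^2 of m u - f - u q, [C2] bounds |m u - f| / u, and [C3] adds the
   second-order terms of the factor e^(cu). Restricting to u <= 1 gives u^4 <= u^2 <= u. *)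
pose C1 := e / 2 * w ^+ 2 + C * (8 * (m4 + w ^+ 4)) + w ^+ 2 * KD.
have C10 : 0 <= C1.
  apply: addr_ge0; last exact: mulr_ge0.
  apply: addr_ge0; first by apply: mulr_ge0 => //; exact: ltW.
  by rewrite !mulr_ge0// addr_ge0.
pose C2 := `|q| + e / 2 + C1.
have C20 : 0 <= C2.
  by apply: addr_ge0 => //; apply: addr_ge0 => //; exact: ltW.
pose C3 := - c * C2 + C1 + c ^+ 2 * `|F|.
have C30 : 0 <= C3.
  apply: addr_ge0; last by apply: mulr_ge0 => //; exact: sqr_ge0.
  by apply: addr_ge0 => //; apply: mulr_ge0 => //; rewrite oppr_ge0.
exists (Num.min 1 (e / 2 / (C3 + 1))).
  by rewrite lt_min ltr01 divr_gt0// ltr_wpDl.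
move=> u x u0; rewrite le_min => /andP[u1]; rewrite ler_pdivlMr ?ltr_wpDl// => uC.
have u00 := ltW u0.
have uu : u ^+ 2 <= u by rewrite expr2 ler_piMr.
have u20 : 0 <= u ^+ 2 by rewrite sqr_ge0.
have u4 : u ^+ 4 <= u ^+ 2.
  rewrite (_ : u ^+ 4 = u ^+ 2 * u ^+ 2); last by rewrite -exprD.
  by rewrite ler_piMr// (le_trans uu).
have h1 : `|m u x - f x - u * q x| <= e / 2 * u + C1 * u ^+ 2.
  have := Hm u x _ _ _ _ u0 C0 (fun y => HC y x) => h.
  rewrite (_ : m u x - f x - u * q x = (m u x - f x - w * u * D x - (u + w ^+ 2 * u ^+ 2) / 2 * D2 x)
     + w ^+ 2 * u ^+ 2 / 2 * D2 x); last by rewrite qE; field.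
  rewrite (le_trans (ler_normD _ _))//.
  have h' : `|w ^+ 2 * u ^+ 2 / 2 * D2 x| <= w ^+ 2 * KD * u ^+ 2.
    have p20 : 0 <= w ^+ 2 * u ^+ 2 / 2 by apply: divr_ge0 => //; exact: mulr_ge0.
    rewrite normrM [w ^+ 2 * KD * _]mulrAC ler_pM// (ger0_norm p20).
    by move: p20; set t := w ^+ 2 * u ^+ 2; lra.
  have h8 : C * (8 * (m4 * u ^+ 2 + w ^+ 4 * u ^+ 4)) <= C * (8 * ((m4 + w ^+ 4) * u ^+ 2)).
    by rewrite ler_wpM2l// ler_wpM2l// mulrDl lerD2l ler_wpM2l.
  rewrite (le_trans (lerD h h'))// [leRHS](_ : _ = e / 2 * (u + w ^+ 2 * u ^+ 2) +
    C * (8 * ((m4 + w ^+ 4) * u ^+ 2)) + w ^+ 2 * KD * u ^+ 2); last by rewrite /C1; ring.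
  by rewrite lerD2r lerD2l.
have h2 : `|m u x - f x| <= u * C2.
  rewrite -[m u x - f x](subrK (u * q x)) (le_trans (ler_normD _ _))//.
  have h : `|u * q x| <= u * `|q| by rewrite normrM (ger0_norm u00) ler_wpM2l// C0_ler_norm.
  rewrite (le_trans (lerD h1 h))// /C2; have : C1 * u ^+ 2 <= C1 * u by rewrite ler_wpM2l.
  lra.
have cu0 : 0 <= - (c * u) by rewrite -mulNr mulr_ge0 ?oppr_ge0.
have /andP[_] := expR_onem_bounds cu0; rewrite opprK => k2.
have k3 : `|expR (c * u) - 1| <= - (c * u).
  by rewrite distrC ger0_norm// subr_ge0 -expR0 ler_expR -oppr_ge0.
have k4 : `|expR (c * u) - 1 - c * u| <= c ^+ 2 * u ^+ 2.
  by have := expRN_taylor cu0; rewrite opprK sqrrN exprMn.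
rewrite (_ : _ - _ - _ = (m u x - f x - u * q x) + (expR (c * u) - 1) * (m u x - f x)
   + (expR (c * u) - 1 - c * u) * f x); last by ring.
have n1 := ler_normD ((m u x - f x - u * q x) + (expR (c * u) - 1) * (m u x - f x)) ((expR (c * u) - 1 - c * u) * f x).
have n2 := ler_normD (m u x - f x - u * q x) ((expR (c * u) - 1) * (m u x - f x)).
have n3 : `|(expR (c * u) - 1) * (m u x - f x)| <= - (c * u) * (u * C2) by rewrite normrM ler_pM.
have n4 : `|(expR (c * u) - 1 - c * u) * f x| <= c ^+ 2 * u ^+ 2 * `|F| by rewrite normrM ler_pM.
rewrite (le_trans n1)// (le_trans (lerD n2 (lexx _)))//.
rewrite (le_trans (lerD (lerD h1 n3) n4))//.
rewrite [leLHS](_ : _ = e / 2 * u + C3 * u * u); last by rewrite /C3; ring.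
rewrite -mulrDl ler_wpM2r//.
have : C3 * u <= u * (C3 + 1) by rewrite mulrC ler_wpM2l// lerDl.
lra.
Qed.

End taylor.

(** * The operator and its core property *)

Section generation.
Hypothesis s1E : derive1 s = s1.

Let D_ (f1 : R -> R) x := s x * f1 x.
Let D2_ (f1 f2 : R -> R) x := s x * (s1 x * f1 x + s x * f2 x).

(** With D = sigma d/dx the operator is D^2 / 2 + w D: the term sigma' / 2 in the drift is what D^2
    produces. This form commutes with the flow of sigma. *)
Lemma L_graphP (f p : C0fun R) : L_graph s w c (f, p) <->
  exists f1 f2 : R -> R, exists q : C0fun R,
  [/\ forall x : R, is_derive x 1 f (f1 x), forall x : R, is_derive x 1 f1 (f2 x), continuous f2,
      forall x, q x = D2_ f1 f2 x / 2 + w * D_ f1 x & forall x, p x = q x + c * f x].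
Proof.
have LE f1 f2 x : s x ^+ 2 / 2 * f2 x + (w + 2^-1 * s1 x) * s x * f1 x = D2_ f1 f2 x / 2 + w * D_ f1 x.
  by rewrite /D2_ /D_; field.
split.
- move=> [[C2f f0 Lf] /= pE].
  have [d1 d2 cf2] := is_derive_C2 C2f.
  exists (derive1 f), (derive1n 2 f), (mkC0 (L_fun s w f)); split => //.
  + by move=> x; rewrite mkC0E// /L_fun s1E LE.
  + by move=> x; rewrite pE mkC0E.
- move=> [f1 [f2 [q [d1 d2 cf2 qE pE]]]].
  have [C2f E1 E2] := C2_is_derive d1 d2 cf2.
  have Lq : L_fun s w f = q by apply/funext => x; rewrite /L_fun E1 E2 s1E LE qE.
  split => /=; last by move=> x; rewrite pE Lq.
  by split => //; [exact: C0valP|rewrite Lq; exact: C0valP].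
Qed.

Lemma L_graph_linear (a : R) f p f' p' : L_graph s w c (f, p) -> L_graph s w c (f', p') ->
  L_graph s w c (a *: f + f', a *: p + p').
Proof.
move=> /L_graphP[f1 [f2 [q [d1 d2 cf qE pE]]]] /L_graphP[f1' [f2' [q' [d1' d2' cf' qE' pE']]]].
apply/L_graphP; exists (fun x => a * f1 x + f1' x), (fun x => a * f2 x + f2' x), (a *: q + q'); split.
- move=> x; have := d1 x; have := d1' x => h h'.
  rewrite (_ : C0val _ = (fun x => a * f x + f' x)); last by [].
  by apply: is_derive_eq; rewrite /GRing.scale/=; ring.
- move=> x; have := d2 x; have := d2' x => h h'.
  by apply: is_derive_eq; rewrite /GRing.scale/=; ring.
- by move=> x; apply: cvgD; [apply: cvgMr; exact: cf|exact: cf'].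
- by move=> x; rewrite !C0E qE qE' /D2_ /D_; field.
- by move=> x; rewrite !C0E pE pE'; ring.
Qed.

Lemma L_graph0 : L_graph s w c (0, 0).
Proof.
apply/L_graphP; exists (fun=> 0), (fun=> 0), 0; split.
- move=> x; rewrite (_ : C0val 0 = cst 0); last by [].
  exact: is_derive_cst.
- by move=> x; exact: is_derive_cst.
- by move=> x; exact: cvg_cst.
- by move=> x; rewrite C0_0E /D2_ /D_; field.
- by move=> x; rewrite C0_0E; ring.
Qed.

(* s is the derivative of the flow in y, whence J(y, x) s(x) = s(g y x) and
   the invariance of the operator under the flow. *)
Lemma L_graph_flow y f p : L_graph s w c (f, p) -> L_graph s w c (flow_op y f, flow_op y p).
Proof.
move=> /L_graphP[f1 [f2 [q [d1 d2 cf qE pE]]]]; apply/L_graphP.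
pose J := flow_jac s1 g y; pose J' := flow_jac' s1 s2 g y.
have dg (x : R) : is_derive x 1 (g y) (J x) by exact: (flow_is_derive ds b1 gd g0).
have dJ (x : R) : is_derive x 1 J (J' x) by exact: (flow_jac_is_derive ds ds1 b1 b2 gd g0).
have JE x : J x * s x = s (g y x) by exact: (flow_jacE ds b1 gd g0).
have dJ1 (x : R) : J' x * s x + J x * s1 x = s1 (g y x) * J x.
  have h1 : is_derive x 1 (fun x => J x * s x) (J' x * s x + J x * s1 x).
    by have := dJ x => h; apply: is_derive_eq; rewrite /GRing.scale/=; ring.
  have h2 : is_derive x 1 (fun x => J x * s x) (s1 (g y x) * J x).
    rewrite (_ : (fun x => _) = (fun x => s (g y x))); last by apply/funext => z; exact: JE.
    exact: (@is_derive1_comp _ s (g y)).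
  by have [_ <-] := h1; have [_ <-] := h2.
exists (fun x => f1 (g y x) * J x), (fun x => f2 (g y x) * J x * J x + f1 (g y x) * J' x), (flow_op y q); split.
- move=> x; rewrite (_ : C0val (flow_op y f) = (fun x => f (g y x))); last by apply/funext => z; rewrite flow_opE.
  exact: (@is_derive1_comp _ f (g y)).
- move=> x; have h : is_derive x 1 (fun x => f1 (g y x)) (f2 (g y x) * J x).
    exact: (@is_derive1_comp _ f1 (g y)).
  by have := dJ x => h'; apply: is_derive_eq; rewrite /GRing.scale/=; ring.
- have cg := gcont (y := y).
  have cJ : continuous J by move=> x; exact: (is_derive_continuous (dJ x)).
  have cJ' : continuous J' by exact: (flow_jac'_continuous ds ds1 cs2 b1 b2 gd g0).
  have cfg (h : R -> R) : continuous h -> continuous (fun x => h (g y x)).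
    by move=> ch x; apply: (cvg_comp (g y) h); [exact: cg|exact: ch].
  have cf1 : continuous f1 by move=> x; exact: (is_derive_continuous (d2 x)).
  move=> x; apply: cvgD; apply: cvgM; [|exact: cJ| |exact: cJ'].
    by apply: cvgM; [exact: (cfg f2)|exact: cJ].
  exact: (cfg f1).
- move=> x; rewrite flow_opE qE /D2_ /D_ -JE; have := dJ1 x => h.
  rewrite [J x * s x * _](_ : _ = s x * (s1 (g y x) * J x * f1 (g y x) + J x * J x * s x * f2 (g y x))); last by ring.
  by rewrite -h; field.
- by move=> x; rewrite !flow_opE pE.
Qed.

(** [flow_tangent] for the Gaussian mean: integrating the Taylor inequality needs only the mean, the
    second moment and a bound for the fourth moment from [normal_affine_moments]. *)
Lemma L_graph_generator : L_graph s w c `<=` generator flow_sg.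
Proof.
move=> [f p] /L_graphP[f1 [f2 [q [d1 d2 cf qE pE]]]].
pose m4 := \int[N]_z (z ^+ 4).
have m40 : 0 <= m4 by apply: Rintegral_ge0 => // z _; rewrite (_ : z ^+ 4 = (z ^+ 2) ^+ 2) ?sqr_ge0// -exprM.
have H := @flow_tangent f f1 f2 q f d1 d2 (fun=> erefl) qE (fun u x => gauss_mean u f x) m4 m40 _.
apply/cvgrPdist_le => e e0.
have [|u0 u00 Hu] := H _ e e0.
  move=> u x a b e' C ue0 C0 h; have u0 := ltW ue0.
  have [[i1 i2 i4 m1 m2] m4'] := normal_affine_moments w u0.
  have iF := iY u x f.
  have iK (K : R) : N.-integrable setT (EFin \o cst K) by apply: (@normal_integrable_bounded _ _ `|K|).
  have iB := integrable_EFinB measurableT iF (iK (f x)).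
  have i1a : N.-integrable setT (EFin \o (fun z => (Num.sqrt u * z + w * u) * a)).
    by apply: eq_integrable (integrable_EFinZl a measurableT i1) => // z _ /=; rewrite mulrC.
  have i2b : N.-integrable setT (EFin \o (fun z => (Num.sqrt u * z + w * u) ^+ 2 / 2 * b)).
    by apply: eq_integrable (integrable_EFinZl (b / 2) measurableT i2) => // z _ /=; congr EFin; field.
  have iC := integrable_EFinB measurableT iB i1a.
  have iD := integrable_EFinB measurableT iC i2b.
  have i2e := integrable_EFinZl e' measurableT i2.
  have i4C := integrable_EFinZl C measurableT i4.
  have E : gauss_mean u f x - f x - w * u * a - (u + w ^+ 2 * u ^+ 2) / 2 * b =
    \int[N]_z (f (g (Num.sqrt u * z + w * u) x) - f x - (Num.sqrt u * z + w * u) * a -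
       (Num.sqrt u * z + w * u) ^+ 2 / 2 * b).
    rewrite (RintegralB _ iC i2b); last by [].
    rewrite (RintegralB _ iB i1a); last by [].
    rewrite (RintegralB _ iF (iK _)); last by [].
    rewrite normal_cst; congr (_ - _ - _).
      transitivity (a * \int[N]_z (Num.sqrt u * z + w * u)); first by rewrite m1; ring.
      by rewrite -(RintegralZl a _ i1)//; apply: eq_Rintegral => z _; rewrite mulrC.
    transitivity (b / 2 * \int[N]_z ((Num.sqrt u * z + w * u) ^+ 2)); first by rewrite m2; field.
    by rewrite -(RintegralZl (b / 2) _ i2)//; apply: eq_Rintegral => z _; field.
  rewrite E (le_trans (le_normr_Rintegral _ iD))//.
  apply: (@le_trans _ _ (\int[N]_z (e' * (Num.sqrt u * z + w * u) ^+ 2 + C * (Num.sqrt u * z + w * u) ^+ 4))).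
    apply: le_Rintegral; [by []|exact: integrable_norm|exact: integrable_EFinD|].
    by move=> z _; exact: h.
  rewrite (RintegralD _ i2e i4C); last by [].
  rewrite (RintegralZl _ _ i2); last by [].
  rewrite (RintegralZl _ _ i4); last by [].
  by rewrite m2 lerD2l ler_wpM2l.
near=> u.
have ue : 0 < u by near: u; exact: nbhs_right_gt.
have uu0 : u < u0 by near: u; exact: nbhs_right_lt.
rewrite distrC; apply: C0_norm_le => x; rewrite !C0E flow_sgE/=.
have := Hu u x ue (ltW uu0).
rewrite -pE => h.
rewrite (_ : _ - p x = u^-1 * (expR (c * u) * gauss_mean u f x - f x - u * p x)); last first.
  by field; rewrite gt_eqF.
by rewrite normrM normfV (gtr0_norm ue) ler_pdivrMl// [u * e]mulrC.
Unshelve. all: by end_near. Qed.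

(** One step of a walk along the flow whose increment has the same mean and second moment as the
    Gaussian one. As a finite combination of flow maps it visibly preserves the graph of the
    operator. *)
Definition twopoint (u : R) (f : C0fun R) : C0fun R := (expR (c * u) / 2) *:
  (flow_op (Num.sqrt u + w * u) f + flow_op (- Num.sqrt u + w * u) f).

Lemma twopoint_norm u f : 0 <= u -> `|twopoint u f| <= `|f|.
Proof.
move=> u0; rewrite /twopoint normrZ ger0_norm ?divr_ge0 ?expR_ge0//.
have /andP[_ h] := ecu u0.
have h1 := ler_normD (flow_op (Num.sqrt u + w * u) f) (flow_op (- Num.sqrt u + w * u) f).
rewrite (le_trans (ler_wpM2l _ (le_trans h1 (lerD (flow_op_norm _ _) (flow_op_norm _ _)))))//.
rewrite (_ : expR (c * u) / 2 * (`|f| + `|f|) = expR (c * u) * `|f|); last by field.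
by rewrite ler_piMl.
Qed.

Lemma twopoint_linear u : linear (twopoint u).
Proof.
move=> a f h; rewrite /twopoint !flow_op_linear.
by apply: C0_ext => x; rewrite !C0E; ring.
Qed.

Lemma twopoint_graph u f p : L_graph s w c (f, p) -> L_graph s w c (twopoint u f, twopoint u p).
Proof.
move=> h; have h1 := L_graph_flow (Num.sqrt u + w * u) h.
have h2 := L_graph_flow (- Num.sqrt u + w * u) h.
have := L_graph_linear (expR (c * u) / 2) (L_graph_linear 1 h1 h2) L_graph0.
by rewrite !addr0 !scale1r.
Qed.

Lemma twopoint_tangent f p (e : R) : L_graph s w c (f, p) -> 0 < e ->
  exists2 u0, 0 < u0 & forall u, 0 < u -> u <= u0 -> `|twopoint u f - f - u *: p| <= e * u.
Proof.
move=> /L_graphP[f1 [f2 [q [d1 d2 cf qE pE]]]] e0.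
have H := @flow_tangent f f1 f2 q f d1 d2 (fun=> erefl) qE
  (fun u x => (f (g (Num.sqrt u + w * u) x) + f (g (- Num.sqrt u + w * u) x)) / 2) 1 ler01 _.
have [|u0 u00 Hu] := H _ e e0.
  move=> u x a b e' C ue C0 h.
  have su : Num.sqrt u ^+ 2 = u by rewrite sqr_sqrtr// ltW.
  have h1 := h (Num.sqrt u + w * u); have h2 := h (- Num.sqrt u + w * u).
  have k1 := pow4_le (Num.sqrt u) (w * u); have k2 := pow4_le (- Num.sqrt u) (w * u).
  have s4 : Num.sqrt u ^+ 4 = u ^+ 2 by rewrite -{2}su -exprM.
  have s4' : (- Num.sqrt u) ^+ 4 = u ^+ 2 by rewrite -s4; ring.
  rewrite s4 exprMn in k1; rewrite s4' exprMn in k2.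
  have E1 : (Num.sqrt u + w * u) ^+ 2 + (- Num.sqrt u + w * u) ^+ 2 = 2 * (u + w ^+ 2 * u ^+ 2).
    transitivity (2 * (Num.sqrt u ^+ 2 + (w * u) ^+ 2)); first by ring.
    by rewrite su exprMn.
  have E2 : ((f (g (Num.sqrt u + w * u) x) + f (g (- Num.sqrt u + w * u) x)) / 2 - f x - w * u * a -
     (u + w ^+ 2 * u ^+ 2) / 2 * b) =
     2^-1 * ((f (g (Num.sqrt u + w * u) x) - f x - (Num.sqrt u + w * u) * a - (Num.sqrt u + w * u) ^+ 2 / 2 * b)
     + (f (g (- Num.sqrt u + w * u) x) - f x - (- Num.sqrt u + w * u) * a - (- Num.sqrt u + w * u) ^+ 2 / 2 * b)).
    have -> : u + w ^+ 2 * u ^+ 2 = ((Num.sqrt u + w * u) ^+ 2 + (- Num.sqrt u + w * u) ^+ 2) / 2 by rewrite E1; field.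
    by field.
  rewrite E2 normrM ger0_norm ?invr_ge0//.
  set r1 := (f (g (Num.sqrt u + w * u) x) - _ - _ - _) in h1 *.
  set r2 := (f (g (- Num.sqrt u + w * u) x) - _ - _ - _) in h2 *.
  rewrite ler_pdivrMl// (le_trans (ler_normD _ _))// (le_trans (lerD h1 h2))//.
  rewrite [leLHS](_ : _ = e' * ((Num.sqrt u + w * u) ^+ 2 + (- Num.sqrt u + w * u) ^+ 2) +
    C * ((Num.sqrt u + w * u) ^+ 4 + (- Num.sqrt u + w * u) ^+ 4)); last by ring.
  rewrite E1 [leRHS](_ : _ = e' * (2 * (u + w ^+ 2 * u ^+ 2)) +
    C * (16 * (u ^+ 2 + w ^+ 4 * u ^+ 4))); last by ring.
  rewrite lerD2l ler_wpM2l// (le_trans (lerD k1 k2))//.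
  by rewrite le_eqVlt; apply/orP; left; apply/eqP; ring.
exists u0 => // u ue uu0; apply: C0_norm_le => x; have := Hu u x ue uu0.
by rewrite !C0E !flow_opE -pE (_ : expR (c * u) * (_ / 2) = expR (c * u) / 2 * (f (g (Num.sqrt u + w * u) x) + f (g (- Num.sqrt u + w * u) x)))//; ring.
Qed.

(* [u (1 + q V + q^2 V^2 + ...) f] with [q = e^(- lam u)] and [V] the two-point
   walk of step [u] is almost a solution of [(lam - L - c) phi = f]. *)
Lemma L_resolvent_approx (lam e : R) f p : 0 < lam -> 0 < e -> L_graph s w c (f, p) ->
  exists phi psi, L_graph s w c (phi, psi) /\ `|f - (lam *: phi - psi)| <= e.
Proof.
(* One step has defect at most 2 e1 u and the weights q^j sum to at most 2 / (lam u), so the defects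
   contribute 4 e1 / lam = e / 2; the remaining half is for q^J |f|. *)
move=> l0 e0 hf; pose e1 := lam * e / 8.
have e10 : 0 < e1 by rewrite divr_gt0// mulr_gt0.
have [u0 u00 Hu] := twopoint_tangent hf e10.
pose M := lam ^+ 2 * `|f| + lam * `|p|.
have M0 : 0 <= M by rewrite addr_ge0// mulr_ge0 ?sqr_ge0// ltW.
pose u := Num.min u0 (Num.min (lam^-1) (e1 / (M + 1))).
have u_gt0 : 0 < u by rewrite !lt_min u00 invr_gt0 l0/= divr_gt0// ltr_wpDl.
have uu0 : u <= u0 by rewrite ge_min lexx.
have ul : u <= lam^-1 by rewrite !ge_min lexx !orbT.
have uM : u <= e1 / (M + 1) by rewrite !ge_min lexx !orbT.
have {}uM : u * (M + 1) <= e1 by rewrite -ler_pdivlMr// ltr_wpDl.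
have {}ul : lam * u <= 1 by rewrite mulrC -ler_pdivlMr// mul1r.
have lu0 : 0 <= lam * u by rewrite mulr_ge0// ltW.
pose q := expR (- (lam * u)).
have q0 : 0 <= q by exact: expR_ge0.
have /andP[q1 q2] := expR_onem_bounds lu0.
have q3 := expRN_taylor lu0.
have qlu : lam * u / 2 <= 1 - q.
  apply: le_trans q1; rewrite ler_wpM2l// lef_pV2 ?posrE ?ltr_wpDr// -[2]/(1 + 1 : R) ?lerD2l//.
have lu_gt0 : 0 < lam * u by rewrite mulr_gt0.
have q1' : q < 1 by rewrite -subr_gt0 (lt_le_trans _ qlu)// divr_gt0.
(* The defect of one step: the first-order expansions of q = e^(-lam u) and of the walk cancel, up
   to terms below 2 e1 u. *)
pose d := f - q *: twopoint u f - u *: (lam *: f - p).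
have dle : `|d| <= 2 * e1 * u.
  have r1 := Hu u u_gt0 uu0; set r := twopoint u f - f - u *: p in r1.
  have -> : d = (1 - q - lam * u) *: f + ((1 - q) * u) *: p - q *: r.
    by apply: C0_ext => x; rewrite /d /r !C0E; ring.
  have n1 : `|(1 - q - lam * u) *: f| <= lam ^+ 2 * u ^+ 2 * `|f|.
    rewrite normrZ (_ : 1 - q - lam * u = - (q - 1 + lam * u)); last by ring.
    by rewrite normrN -exprMn ler_wpM2r.
  have n2 : `|((1 - q) * u) *: p| <= lam * u * u * `|p|.
    rewrite normrZ normrM (gtr0_norm u_gt0) ler_wpM2r// ler_wpM2r ?(ltW u_gt0)//.
    by rewrite ger0_norm// subr_ge0 ltW.
  have n3 : `|q *: r| <= e1 * u.
    by rewrite normrZ ger0_norm// (le_trans _ r1)// ler_piMl// ltW.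
  rewrite (le_trans (ler_normB _ _))// (le_trans (lerD (ler_normD _ _) n3))//.
  rewrite (le_trans (lerD (lerD n1 n2) (lexx _)))//.
  rewrite [leLHS](_ : _ = M * u * u + e1 * u); last by rewrite /M; ring.
  rewrite [leRHS](_ : _ = e1 * u + e1 * u); last by ring.
  rewrite lerD2r ler_wpM2r ?(ltW u_gt0)// (le_trans _ uM)// mulrC ler_wpM2l ?(ltW u_gt0)// lerDl//.
have [J HJ] : exists J, q ^+ J * `|f| <= e / 2.
  have e2 : 0 < e / 2 / (`|f| + 1) by rewrite divr_gt0 ?divr_gt0// ltr_wpDl.
  have qn : `|q| < 1 by rewrite ger0_norm.
  have /cvgrPdist_lt/(_ _ e2)[J _ HJ] := cvg_expr qn.
  exists J; have := HJ J (leqnn J); rewrite /= sub0r normrN (ger0_norm (exprn_ge0 _ q0)) => /ltW.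
  rewrite ler_pdivlMr ?ltr_wpDl// => h; rewrite (le_trans _ h)// ler_wpM2l ?exprn_ge0// lerDl//.
pose V j (h : C0fun R) := iter j (twopoint u) h.
have Vl j : linear (V j).
  elim: j => [|j IH] a x y //; rewrite /V !iterS -/(V j _) IH; exact: twopoint_linear.
have Vn j h : `|V j h| <= `|h|.
  by elim: j => [|j IH] //; rewrite /V iterS (le_trans (twopoint_norm _ (ltW u_gt0))).
pose phi := \sum_(j < J) (u * q ^+ j) *: V j f.
pose psi := \sum_(j < J) (u * q ^+ j) *: V j p.
have Gs : L_graph s w c (phi, psi).
  rewrite /phi /psi; elim: (J) => [|n IH]; first by rewrite !big_ord0; exact: L_graph0.
  rewrite !big_ord_recr/= addrC [\sum_(i < n) (u * q ^+ i) *: V i p + _]addrC.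
  apply: L_graph_linear => //; elim: (n) => [//|m IHm]; rewrite /V !iterS; exact: twopoint_graph.
exists phi, psi; split => //.
(* Applying q^j V^j to the definition of [d] and summing telescopes the terms f - q V f; the last
   one leaves q^J V^J f. *)
have E : f - (lam *: phi - psi) = q ^+ J *: V J f + \sum_(j < J) q ^+ j *: V j d.
  rewrite /phi /psi; elim: (J) => [|n IH].
    rewrite !big_ord0 scaler0 subrr subr0 expr0 scale1r addr0.
    reflexivity.
  rewrite !big_ord_recr/= scalerDr.
  have Vd : V n d = V n f - q *: V n.+1 f - u *: (lam *: V n f - V n p).
    rewrite /d (linear_funB _ _ (Vl n)) (linear_funB _ _ (Vl n)) (linear_funZ _ _ (Vl n)).
    rewrite (linear_funZ u (lam *: f - p) (Vl n)) (linear_funB _ _ (Vl n)) (linear_funZ lam f (Vl n)).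
    by rewrite /V iterSr.
  rewrite Vd; set B := V n.+1 f; set X := V n f in IH *; set Y := V n p.
  move: IH; set S1 := \sum_(i < n) _; set S2 := \sum_(i < n) _; set S3 := \sum_(i < n) _ => IH.
  have {}IH : f = q ^+ n *: X + S3 + (lam *: S1 - S2) by rewrite -IH subrK.
  rewrite {1}IH; apply: C0_ext => x; rewrite !C0E exprS; ring.
have nS : `|\sum_(j < J) q ^+ j *: V j d| <= e / 2.
  have h1 : `|\sum_(j < J) q ^+ j *: V j d| <= (\sum_(j < J) q ^+ j) * (2 * e1 * u).
    rewrite (le_trans (ler_norm_sum _ _ _))// mulr_suml; apply: ler_sum => j _.
    by rewrite normrZ (ger0_norm (exprn_ge0 _ q0)) ler_wpM2l ?exprn_ge0// (le_trans (Vn _ _)).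
  have h2 : (\sum_(j < J) q ^+ j) * (1 - q) <= 1.
    have -> : (\sum_(j < J) q ^+ j) * (1 - q) = 1 - q ^+ J.
      by rewrite -[RHS]opprB subrX1 mulrC -mulNr opprB.
    by rewrite gerBl exprn_ge0.
  have S0 : 0 <= \sum_(j < J) q ^+ j by apply: sumr_ge0 => j _; exact: exprn_ge0.
  have h3 : (\sum_(j < J) q ^+ j) * (lam * u) <= 2.
    have := ler_wpM2l S0 qlu; move: h2; set S := \sum_(j < J) _; lra.
  rewrite (le_trans h1)// /e1; have := ler_wpM2l (ltW e0) h3.
  set S := \sum_(j < J) _; lra.
rewrite E (le_trans (ler_normD _ _))// [leRHS](_ : _ = e / 2 + e / 2); last by field.
rewrite lerD// normrZ (ger0_norm (exprn_ge0 _ q0)) (le_trans _ HJ)// ler_wpM2l ?exprn_ge0//.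
Qed.

(** Two moving averages give a C^2 function whose derivatives are differences of translates of
    functions in C_oo; the bounded coefficients then keep its image in C_oo. *)
Lemma L_dom_dense (f : C0fun R) (e : R) : 0 < e ->
  exists h p, L_graph s w c (h, p) /\ `|f - h| <= e.
Proof.
move=> e0; have e20 : 0 < e / 2 by rewrite divr_gt0.
have [h [a [a0 dh hf]]] := box_average f e20.
have [m [b [b0' dm mh]]] := box_average h e20.
pose h1 : C0fun R := a^-1 *: (mkC0 (fun x => f (x + a)) - f).
have h1E x : h1 x = a^-1 * (f (x + a) - f x) by rewrite /h1 !C0E mkC0E//; exact: C0_shift.
pose m1 : C0fun R := b^-1 *: (mkC0 (fun x => h (x + b)) - h).
have m1E x : m1 x = b^-1 * (h (x + b) - h x) by rewrite /m1 !C0E mkC0E//; exact: C0_shift.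
pose m2 : C0fun R := b^-1 *: (mkC0 (fun x => h1 (x + b)) - h1).
have m2E x : m2 x = b^-1 * (h1 (x + b) - h1 x) by rewrite /m2 !C0E mkC0E//; exact: C0_shift.
have dm1 (x : R) : is_derive x 1 m (m1 x) by rewrite m1E.
have dm2 (x : R) : is_derive x 1 m1 (m2 x).
  have -> : (m1 : R -> R) = (fun x => b^-1 * (h (x + b) - h x)) by apply/funext => y; exact: m1E.
  have d1 := dh x; have d2 := dh (x + b).
  have d3 : is_derive x (1 : R) (fun y => h (y + b)) (h1 (x + b)).
    by rewrite h1E; exact: is_derive_shift.
  rewrite m2E; move: d3; move: (h1 (x + b)) => v d3; rewrite h1E.
  by apply: is_derive_eq; rewrite /GRing.scale/=; ring.
have cs : continuous s by move=> x; exact: is_derive_continuous (ds x).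
have cs1 : continuous s1 by move=> x; exact: is_derive_continuous (ds1 x).
pose D := mkC0 (fun x => s x * m1 x).
have DE x : D x = s x * m1 x by rewrite mkC0E//; exact: C0_mulb.
pose S1 := mkC0 (fun x => s1 x * m1 x).
have S1E x : S1 x = s1 x * m1 x by rewrite mkC0E//; exact: C0_mulb.
pose S2 := mkC0 (fun x => s x * m2 x).
have S2E x : S2 x = s x * m2 x by rewrite mkC0E//; exact: C0_mulb.
pose S3 := mkC0 (fun x => s x * (S1 + S2) x).
have S3E x : S3 x = s x * (S1 + S2) x by rewrite mkC0E//; exact: C0_mulb.
pose q : C0fun R := 2^-1 *: S3 + w *: D.
have qE x : q x = 2^-1 * (s x * (s1 x * m1 x + s x * m2 x)) + w * (s x * m1 x).
  by rewrite /q C0_addE !C0_scaleE S3E C0_addE S1E S2E DE.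
clearbody q; exists m, (q + c *: m); split.
  apply/L_graphP; exists m1, m2, q; split => //.
  - exact: C0_continuous.
  - move=> x; rewrite /D2_ /D_ qE; move: (m1 x) (m2 x) (s x) (s1 x) => y1 y2 y3 y4.
    by field.
apply: (le_trans (ler_distD h _ _)); rewrite [leRHS](_ : _ = e / 2 + e / 2); last by field.
by rewrite lerD.
Qed.

(** The resolvent equation is solved approximately for right-hand sides in the domain, and density
    extends this to all of C_oo, as [generator_core] requires. *)
Lemma flow_sg_generator : generator flow_sg = closure (L_graph s w c).
Proof.
apply: (@generator_core _ _ _ flow_sg_semigroup _ 1 ltr01 L_graph_generator) => f e e0.
have e20 : 0 < e / 2 by rewrite divr_gt0.
have [h [p [hp fh]]] := L_dom_dense f e20.
have [phi [psi [G pp]]] := L_resolvent_approx ltr01 e20 hp.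
exists phi, psi; split => //.
apply: (le_trans (ler_distD h _ _)); rewrite [leRHS](_ : _ = e / 2 + e / 2); last by field.
by rewrite lerD.
Qed.

End generation.

End flow_semigroup.

(** * Gaussian variables at independent random times *)

Section expectations.
Context d (Om : measurableType d) (R : realType) (P : probability Om R).
Implicit Types (Y Q : {RV P >-> R}).
Local Notation N := (@normal_prob R 0 1).

Definition indep_rv (Y Q : Om -> R) := forall U V, measurable U -> measurable V ->
  P (Y @^-1` U `&` Q @^-1` V) = (P (Y @^-1` U) * P (Q @^-1` V))%E.

Lemma prob_integrable (f : Om -> R) (K : R) : measurable_fun setT f ->
  (forall w, `|f w| <= K) -> P.-integrable setT (EFin \o f).
Proof.
move=> mf fK; apply: (@bounded_integrable _ _ _ P setT f K) => //.
by rewrite (le_lt_trans (probability_le1 P _))// ltry.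
Qed.

(* An independent pair has the law of the pair taken on [Om * Om]. *)
Lemma indep_ge0_integral Y Q (f : R * R -> \bar R) : indep_rv Y Q ->
  measurable_fun setT f -> (forall p, 0 <= f p)%E ->
  (\int[P]_w f (Y w, Q w) = \int[P]_v \int[P]_w f (Y w, Q v))%E /\
  measurable_fun setT (fun v => \int[P]_w f (Y w, Q v))%E.
Proof.
move=> ind mf f0.
have mYQ : measurable_fun setT (fun w => (Y w, Q w)) by exact: measurable_fun_pair.
pose M : {measure set (R * R) -> \bar R} :=
  @measure_function_pushforward__canonical__measure_function_Measure _ _ _ _ _ P _ mYQ.
have ME : forall A B, measurable A -> measurable B ->
    M (A `*` B) = (distribution P Y A * distribution P Q B)%E.
  by move=> A B mA mB; rewrite /M /= /pushforward -ind.
have mG := @measurable_fun_fubini_tonelli_G _ _ _ _ _ (distribution P Y) f mf f0.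
have inner v : (\int[P]_w f (Y w, v) = \int[distribution P Y]_y f (y, v))%E.
  rewrite ge0_integral_distribution//.
  by apply: measurableT_comp => //; exact: measurable_fun_pair.
split; last first.
  under eq_fun do rewrite inner.
  exact: measurableT_comp mG _.
transitivity (\int[M]_p f p)%E.
  by rewrite /M /= ge0_integral_pushforward.
transitivity (\int[distribution P Y \x distribution P Q]_p f p)%E.
  apply: eq_measure_integral => A mA _; symmetry.
  exact: product_measure_unique.
rewrite fubini_tonelli1// fubini_tonelli// ge0_integral_distribution//.
  by apply: eq_integral => v _ /=; rewrite inner.
by move=> y; exact: integral_ge0.
Qed.

Lemma indep_Rintegral Y Q (f : R * R -> R) (K : R) : indep_rv Y Q ->
  measurable_fun setT f -> (forall p, `|f p| <= K) ->
  \int[P]_w f (Y w, Q w) = \int[P]_v \int[P]_w f (Y w, Q v) /\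
  measurable_fun setT (fun v => \int[P]_w f (Y w, Q v)).
Proof.
move=> ind mf fK.
have shift (h : Om -> R) : measurable_fun setT h -> (forall w, `|h w| <= K) ->
    (\int[P]_w (h w + K)%:E = (\int[P]_w h w + K)%:E)%E.
  move=> mh hK; have ih := prob_integrable mh hK.
  have iK : P.-integrable setT (EFin \o cst K).
    by apply: (@prob_integrable _ `|K|) => // w.
  rewrite -[LHS]fineK; last first.
    by apply: integrable_fin_num => //; exact: integrable_EFinD.
  congr EFin; rewrite -[LHS]/(\int[P]_w (h w + K)) (RintegralD measurableT ih iK).
  by rewrite Rintegral_cst// [X in fine X](_ : _ = 1%E) ?mulr1//; exact: probability_setT.
have fK0 p : (0 <= (f p + K)%:E)%E.
  by rewrite lee_fin -[K]opprK subr_ge0 lerNl (le_trans (ler_norm _))// normrN.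
have mfK : measurable_fun setT (fun p => (f p + K)%:E).
  by apply/measurable_EFinP; exact: measurable_funD.
have [E mE] := indep_ge0_integral ind mfK fK0.
have mfw v : measurable_fun setT (fun w => f (Y w, v)).
  by apply: measurableT_comp => //; exact: measurable_fun_pair.
have inner v : (\int[P]_w (f (Y w, v) + K)%:E = (\int[P]_w f (Y w, v) + K)%:E)%E.
  exact: shift.
have mI : measurable_fun setT (fun v => \int[P]_w f (Y w, Q v)).
  have -> : (fun v => \int[P]_w f (Y w, Q v)) =
      (fun v => fine (\int[P]_w (f (Y w, Q v) + K)%:E)%E - K).
    by apply/funext => v; rewrite inner /= addrK.
  by apply: measurable_funB => //; exact: measurableT_comp.
split => //; apply: (@addIr _ K); apply: EFin_inj; rewrite -shift//; last first.
  by apply: measurableT_comp => //; exact: measurable_fun_pair.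
rewrite E -shift//; first by apply: eq_integral => v _; rewrite inner.
move=> v; have iw := prob_integrable (mfw (Q v)) (fun w => fK (Y w, Q v)).
have iK : P.-integrable setT (EFin \o cst K).
  by apply: (@prob_integrable _ `|K|) => // w.
have := @Rintegral_bound _ _ _ P setT _ K measurableT iw iK (fun w _ => fK (Y w, Q v)).
by rewrite [X in fine X](_ : _ = 1%E) ?mulr1//; exact: probability_setT.
Qed.

Lemma law_integral (Y : Om -> R) (L : {measure set (measurableTypeR R) -> \bar R})
    (f : R -> \bar R) : measurable_fun setT Y ->
  (forall U, measurable U -> P (Y @^-1` U) = L U) ->
  measurable_fun setT f -> (forall y, 0 <= f y)%E ->
  (\int[P]_w f (Y w) = \int[L]_y f y)%E.
Proof.
move=> mY YE mf f0.
pose M : {measure set (measurableTypeR R) -> \bar R} :=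
  @measure_function_pushforward__canonical__measure_function_Measure _ _ _ (measurableTypeR R) _ P Y mY.
transitivity (\int[M]_y f y)%E; first by rewrite /M /= ge0_integral_pushforward.
by apply: eq_measure_integral => U mU _; exact: YE.
Qed.

Lemma normal_law_integral (Y : Om -> R) (v : R) (f : R -> \bar R) : 0 < v ->
  measurable_fun setT Y ->
  (forall U, measurable U -> P (Y @^-1` U) = normal_prob 0 (Num.sqrt v) U) ->
  measurable_fun setT f -> (forall y, 0 <= f y)%E ->
  (\int[P]_w f (Y w) = \int[N]_z f (Num.sqrt v * z)%R)%E.
Proof.
move=> v0 mY YE mf f0; have sv : 0 < Num.sqrt v by rewrite sqrtr_gt0.
rewrite (law_integral mY YE mf f0); apply: (etrans (ge0_integral_normal_affine 0 sv mf f0)).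
by apply: eq_integral => z _; rewrite addr0.
Qed.

(** Says that, given [Q], the variable [X] has law N(0, Q), through expectations only. Test
    functions are continuous because a Brownian motion at a random time is reached by discretising
    the time, and may be unbounded because of the weight e^(w X). *)
Definition gauss_mixture (X Q : Om -> R) := forall F : R -> R -> R,
  measurable_fun setT (fun p : R * R => F p.1 p.2) ->
  continuous (fun p : R * R => F p.1 p.2) -> (forall y s, 0 <= F y s) ->
  (\int[P]_w (F (X w) (Q w))%:E = \int[P]_v \int[N]_z (F (Num.sqrt (Q v) * z) (Q v))%:E)%E.

Let mF_comp d' (T' : measurableType d') (F : R -> R -> R) (a b : T' -> R) :
  measurable_fun setT (fun p : R * R => F p.1 p.2) -> measurable_fun setT a ->
  measurable_fun setT b -> measurable_fun setT (fun w => F (a w) (b w)).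
Proof.
move=> mF ma mb.
apply: (@measurableT_comp _ _ _ _ _ _ (fun p : R * R => F p.1 p.2) _ (fun w => (a w, b w))) => //.
exact: measurable_fun_pair.
Qed.

Lemma mixture_scaled (X Y a : {RV P >-> R}) (tau : R) : 0 < tau ->
  (forall f : R -> \bar R, measurable_fun setT f -> (forall y, 0 <= f y)%E ->
    (\int[P]_w f (Y w) = \int[N]_z f (Num.sqrt tau * z)%R)%E) ->
  indep_rv Y a -> {ae P, forall w, X w = Num.sqrt (a w) * Y w} ->
  gauss_mixture X (fun w => a w * tau).
Proof.
move=> tau0 YE ind XE F mF _ F0.
have msq : measurable_fun setT (@Num.sqrt R) by apply: continuous_measurable_fun; exact: sqrt_continuous.
have mat : measurable_fun setT (fun w => a w * tau) by exact: measurable_funM.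
transitivity (\int[P]_w (F (Num.sqrt (a w) * Y w) (a w * tau))%:E)%E.
  apply: ge0_ae_eq_integral => //.
  - by apply/measurable_EFinP; apply: mF_comp.
  - apply/measurable_EFinP; apply: mF_comp => //; apply: measurable_funM => //.
    exact: measurableT_comp.
  - by move=> w _; rewrite lee_fin.
  - by move=> w _; rewrite lee_fin.
  - by apply: filterS XE => w -> _.
pose f (p : R * R) := (F (Num.sqrt p.2 * p.1) (p.2 * tau))%:E.
have mf : measurable_fun setT f.
  apply/measurable_EFinP; apply: mF_comp => //; apply: measurable_funM => //.
  exact: measurableT_comp.
have f0 p : (0 <= f p)%E by rewrite lee_fin.
have [-> _] := indep_ge0_integral ind mf f0.
apply: eq_integral => v _.
rewrite (YE (fun y => f (y, a v)))//; last first.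
  by apply: measurableT_comp => //; exact: measurable_fun_pair.
by apply: eq_integral => z _; rewrite /f/= mulrA (mulrC (a v)) sqrtrM ?(ltW tau0)// (mulrC (Num.sqrt tau)).
Qed.

Let min_cvg (a : R) : (Num.min a n%:R)%:E @[n --> \oo] --> a%:E.
Proof.
apply: cvg_near_cst; near=> n; rewrite min_l//.
by near: n; exact: nbhs_infty_ger.
Unshelve. all: by end_near. Qed.

Let integral_min d' (T' : measurableType d') (mu : {measure set T' -> \bar R}) (f : T' -> R) :
  measurable_fun setT f -> (forall x, 0 <= f x) ->
  (\int[mu]_x (Num.min (f x) n%:R)%:E @[n --> \oo] --> \int[mu]_x (f x)%:E)%E.
Proof.
move=> mf f0.
rewrite [X in _ --> X](_ : _ = (\int[mu]_x (limn (fun n => (Num.min (f x) n%:R)%:E)))%E); last first.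
  by apply: eq_integral => x _; apply/esym/cvg_lim => //; exact: min_cvg.
apply: (@cvg_monotone_convergence _ _ _ mu setT measurableT (fun n x => (Num.min (f x) n%:R)%:E)).
- by move=> n; apply/measurable_EFinP; apply: measurable_minr.
- by move=> n x _; rewrite lee_fin le_min f0 ler0n.
- by move=> x _ m n mn; rewrite lee_fin le_min !ge_min lexx/= ler_nat mn orbT.
Qed.

(** Truncation at n and monotone convergence on both sides. *)
Lemma mixture_truncate (X Q : {RV P >-> R}) :
  (forall (F : R -> R -> R) (K : R), measurable_fun setT (fun p : R * R => F p.1 p.2) ->
    continuous (fun p : R * R => F p.1 p.2) -> (forall y s, 0 <= F y s <= K) ->
    (\int[P]_w (F (X w) (Q w))%:E = \int[P]_v \int[N]_z (F (Num.sqrt (Q v) * z) (Q v))%:E)%E) ->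
  gauss_mixture X Q.
Proof.
move=> H F mF cF F0.
pose Fn (n : nat) y s := Num.min (F y s) n%:R.
have mFn n : measurable_fun setT (fun p : R * R => Fn n p.1 p.2) by apply: measurable_minr.
have Fn0 n y s : 0 <= Fn n y s <= n%:R by rewrite /Fn le_min F0 ler0n/= ge_min lexx orbT.
have cFn n : continuous (fun p : R * R => Fn n p.1 p.2).
  move=> p; apply: (@continuous_min _ _ (fun p : R * R => F p.1 p.2 : R^o) (fun=> n%:R)).
    exact: cF.
  exact: cst_continuous.
have E n := H (Fn n) n%:R (mFn n) (cFn n) (Fn0 n).
have c1 := @integral_min _ _ P (fun w => F (X w) (Q w)) (mF_comp mF (measurable_funPT X) (measurable_funPT Q)) (fun w => F0 _ _).
have msq : measurable_fun setT (@Num.sqrt R) by apply: continuous_measurable_fun; exact: sqrt_continuous.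
have mz v : measurable_fun setT (fun z => F (Num.sqrt (Q v) * z) (Q v)).
  by apply: mF_comp => //; exact: measurable_funM.
have c2 v := @integral_min _ _ N (fun z => F (Num.sqrt (Q v) * z) (Q v)) (mz v) (fun w => F0 _ _).
apply: (cvg_unique _ c1) => //.
have -> : (\int[P]_v \int[N]_z (F (Num.sqrt (Q v) * z) (Q v))%:E =
   \int[P]_v limn (fun n => \int[N]_z (Fn n (Num.sqrt (Q v) * z) (Q v))%:E))%E.
  by apply: eq_integral => v _; apply/esym/cvg_lim => //; exact: c2.
rewrite /= (_ : (fun n => \int[P]_w (Num.min (F (X w) (Q w)) n%:R)%:E)%E =
  (fun n => \int[P]_v \int[N]_z (Fn n (Num.sqrt (Q v) * z) (Q v))%:E)%E); last first.
  by apply/funext => n; exact: E.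
apply: (@cvg_monotone_convergence _ _ _ P setT measurableT
  (fun n v => \int[N]_z (Fn n (Num.sqrt (Q v) * z) (Q v))%:E)%E).
- move=> n.
  have m2 : measurable_fun setT (fun p : R * R => (Fn n (Num.sqrt p.1 * p.2) p.1)%:E).
    apply/measurable_EFinP; apply: mF_comp => //; apply: measurable_funM => //.
    exact: measurableT_comp.
  have m3 := @measurable_fun_fubini_tonelli_F _ _ _ _ _ N _ m2.
  have {}m3 := m3 (fun p => _).
  by apply: (measurableT_comp (m3 _)) => // p; rewrite lee_fin; case/andP: (Fn0 n (Num.sqrt p.1 * p.2) p.1).
- by move=> n v _; apply: integral_ge0 => z _; rewrite lee_fin; case/andP: (Fn0 n (Num.sqrt (Q v) * z) (Q v)).
- move=> v _ m n mn; apply: ge0_le_integral => //.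
  + by move=> z _; rewrite lee_fin; case/andP: (Fn0 m (Num.sqrt (Q v) * z) (Q v)).
  + by apply/measurable_EFinP; apply: (mF_comp (mFn m)) => //; exact: measurable_funM.
  + by apply/measurable_EFinP; apply: (mF_comp (mFn n)) => //; exact: measurable_funM.
  + by move=> z _; rewrite lee_fin /Fn le_min !ge_min lexx/= ler_nat mn orbT.
Qed.

(** Rounding down to the grid of mesh 1/(n + 1), cut off at n + 1, so that a discretised time takes
    finitely many values. *)
Let idx (n : nat) (x : R) : nat := minn (Num.truncn (n.+1%:R * pos x)) (n.+1 * n.+1).
Let step (n : nat) (x : R) : R := (idx n x)%:R / n.+1%:R.

Let step_cvg x : 0 <= x -> step n x @[n --> \oo] --> x.
Proof.
move=> x0.
apply: (@squeeze_cvgr _ _ _ _ (fun n => x - n.+1%:R^-1) (fun=> x)); last 2 first.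
- rewrite -[X in _ --> X]subr0; apply: cvgB; first exact: cvg_cst.
  exact: cvg_harmonic.
- exact: cvg_cst.
near=> n; have n0 : 0 < n.+1%:R :> R by [].
have nx0 : 0 <= n.+1%:R * x by rewrite mulr_ge0.
have xn : x <= n.+1%:R.
  by rewrite (@le_trans _ _ n%:R)// ?ler_nat//; near: n; exact: nbhs_infty_ger.
have /andP[h1 h2] := truncn_itv nx0.
rewrite /step; have -> : idx n x = Num.truncn (n.+1%:R * x).
  rewrite /idx pos_id//; apply/minn_idPl; rewrite -(ler_nat R) natrM (le_trans h1)//.
  by rewrite ler_wpM2l.
rewrite lerBlDr ler_pdivrMr// (mulrC x) h1 andbT.
rewrite -[X in _ <= _ + X]mul1r -mulrDl ler_pdivlMr// mulrC (le_trans (ltW h2))//.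
by rewrite -natr1.
Unshelve. all: by end_near. Qed.

Let step_ge0 n x : 0 <= step n x. Proof. by rewrite divr_ge0. Qed.

Let midx n (j : nat) : measurable_fun setT (fun x : R => (idx n x == j)%:R : R).
Proof.
have m1 : measurable_fun setT (fun x : R => (idx n x)%:R : R).
  apply: nondecreasing_measurable => // x y xy; rewrite ler_nat leq_min geq_minr andbT.
  rewrite geq_min; apply/orP; left; apply: le_truncn.
  apply: ler_wpM2l => //; rewrite {1}/pos ge_max pos_ge0/= (le_trans xy)//.
  by rewrite /pos le_max lexx orbT.
have m2 : measurable_fun setT (\1_([set j%:R : R]) : R -> R) by exact: measurable_indic.
apply: eq_measurable_fun (measurableT_comp m2 m1) => x _ /=.
have [->|ne] := eqVneq (idx n x) j; first by rewrite indicE mem_set.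
by rewrite indicE memNset//= => /eqP; rewrite eqr_nat (negbTE ne).
Qed.

Let step_sum (G : nat -> R) n x :
  \sum_(j < (n.+1 * n.+1).+1) G j * (idx n x == j)%:R = G (idx n x).
Proof.
have h : (idx n x < (n.+1 * n.+1).+1)%N by rewrite ltnS geq_minr.
rewrite (bigD1 (Ordinal h))//= eqxx mulr1 big1 ?addr0// => i /negbTE ih.
by rewrite eq_sym -val_eqE/= in ih *; rewrite ih mulr0.
Qed.

Let Rintegral_sum_ord (mu : {measure set Om -> \bar R}) n (f : nat -> Om -> R) :
  (forall j, mu.-integrable setT (EFin \o f j)) ->
  mu.-integrable setT (EFin \o (fun w => \sum_(j < n) f j w)) /\
  \int[mu]_w (\sum_(j < n) f j w) = \sum_(j < n) \int[mu]_w f j w.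
Proof.
move=> jf; elim: n => [|n [IH1 IH2]].
  rewrite big_ord0; under eq_Rintegral do rewrite big_ord0; split.
    under eq_fun do rewrite big_ord0; exact: integrable0.
  by rewrite Rintegral_cst// mul0r.
rewrite big_ord_recr/= -IH2; split.
  under eq_fun do rewrite big_ord_recr/=; exact: integrable_EFinD.
under eq_Rintegral do rewrite big_ord_recr/=; exact: RintegralD.
Qed.

(** The increment from time 0 has the Gaussian law and B 0 = 0 almost surely; time 0 is separate
    because its law is a Dirac mass. *)
Lemma brownian_law (B : R -> {RV P >-> R}) (s : R) (f : R -> \bar R) : brownian_motion B ->
  0 <= s -> measurable_fun setT f -> (forall y, 0 <= f y)%E ->
  (\int[P]_w f (B s w) = \int[N]_z f (Num.sqrt s * z)%R)%E.
Proof.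
move=> [B0 _ Binc] s0 mf f0.
have mY : measurable_fun setT (fun w => B s w - B 0 w) by exact: measurable_funB.
transitivity (\int[P]_w f (B s w - B 0 w)%R)%E.
  apply: ge0_ae_eq_integral => //; [exact: measurableT_comp..|].
  by apply: filterS B0 => w [-> _] _; rewrite subr0.
have [->|sn] := eqVneq s 0.
  under eq_integral do rewrite subrr.
  rewrite sqrtr0; under [RHS]eq_integral do rewrite mul0r.
  by rewrite !integral_cst//= !probability_setT.
apply: (@normal_law_integral (fun w => B s w - B 0 w)) => //; first by rewrite lt_def sn.
by move=> U mU; have := Binc 0 s U (lexx _) s0 mU; rewrite subr0 /gaussian_law (negbTE sn).
Qed.

Let cvg_within_seq (A : set R) (f : R -> R) (u : nat -> R) (x : R) : A x ->
  {within A, continuous f} -> (forall n, A (u n)) -> u n @[n --> \oo] --> x ->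
  f (u n) @[n --> \oo] --> f x.
Proof.
move=> Ax /subspace_continuousP/(_ x Ax) cf Au ux.
apply: (cvg_comp u f _ cf) => U /= wU.
have wU' : nbhs x [set y | A y -> U y] by exact: wU.
have {}wU' := ux _ wU'.
by apply: (@filterS _ \oo _ (fun n => A (u n) -> U (u n)) (fun n => U (u n))) wU' => n; apply.
Qed.

Lemma mixture_subordinated (X Q : {RV P >-> R}) (B : R -> {RV P >-> R}) :
  brownian_motion B -> {ae P, forall w, 0 <= Q w} ->
  (forall s, 0 <= s -> indep_rv (B s) Q) -> {ae P, forall w, X w = B (Q w) w} ->
  gauss_mixture X (@pos R \o Q).
Proof.
move=> bB Q0 ind XE; have [Bc _ _] := bB.
pose cpos := @continuous_pos R.
have mpos : measurable_fun setT (@pos R) by exact: continuous_measurable_fun.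
have mQ : measurable_fun setT (@pos R \o Q) by exact: measurableT_comp.
pose Q' : {RV P >-> R} := HB.pack (@pos R \o Q) (isMeasurableFun.Build _ _ _ _ (@pos R \o Q) mQ).
apply: (@mixture_truncate X Q') => F K mF cF F0K.
have FK y s : `|F y s| <= K by have /andP[a b] := F0K y s; rewrite ger0_norm.
have F0 y s : 0 <= F y s by have /andP[] := F0K y s.
have mFs s : measurable_fun setT (fun y => F y s) by exact: mF_comp.
pose H (s : R) := \int[N]_z F (Num.sqrt s * z) s.
have msq : measurable_fun setT (@Num.sqrt R) by apply: continuous_measurable_fun; exact: sqrt_continuous.
have iN (s : R) : N.-integrable setT (EFin \o (fun z => F (Num.sqrt s * z) s)).
  apply: (@normal_integrable_bounded _ _ K) => //.
  by apply: mF_comp => //; exact: measurable_funM.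
have HE (s : R) : (\int[N]_z (F (Num.sqrt s * z) s)%:E)%E = (H s)%:E.
  exact: esym (fineK (integrable_fin_num measurableT (iN s))).
have H0 s : 0 <= H s by apply: Rintegral_ge0.
have HK s : `|H s| <= K.
  have := @Rintegral_bound _ _ _ N setT _ K measurableT (iN s) _ (fun z _ => FK (Num.sqrt s * z) s).
  rewrite [X in fine X](_ : _ = 1%E) ?mulr1; last exact: probability_setT.
  by apply; apply: (@normal_integrable_bounded _ _ `|K|).
have cH : continuous H.
  apply: (@continuous_Rintegral _ _ _ N setT (fun s z => F (Num.sqrt s * z) s) (cst K)) => //.
  - by apply: (@normal_integrable_bounded _ _ `|K|).
  - by move=> s; apply: mF_comp => //; exact: measurable_funM.
  - move=> z _ s; apply: (@continuous_comp _ _ _ (fun s : R => (Num.sqrt s * z, s)) (fun p : R * R => F p.1 p.2)).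
      have c : Num.sqrt r * z @[r --> (s : R)] --> Num.sqrt s * z.
        by apply: cvgMr_tmp; exact: sqrt_continuous.
      exact: (cvg_pair c cvg_id).
    exact: cF.
pose f_ n (w : Om) := F (B (step n (Q w)) w) (step n (Q w)).
pose G_ n (w : Om) (j : nat) := F (B (j%:R / n.+1%:R) w) (j%:R / n.+1%:R).
pose t_ n (j : nat) (w : Om) := G_ n w j * (idx n (Q w) == j)%:R.
have f_E n : f_ n = fun w => \sum_(j < (n.+1 * n.+1).+1) t_ n j w.
  by apply/funext => w; rewrite /t_ (step_sum (G_ n w)).
have mt n j : measurable_fun setT (t_ n j).
  apply: measurable_funM; first by apply: mF_comp.
  exact: (measurableT_comp (@midx n j)).
have it n j : P.-integrable setT (EFin \o t_ n j).
  apply: (@prob_integrable _ K) => // w; rewrite normrM (le_trans _ (FK (B (j%:R / n.+1%:R) w) (j%:R / n.+1%:R)))//.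
  by rewrite ler_piMr//; case: eqP; rewrite ?normr1 ?normr0.
have mf_ n : measurable_fun setT (f_ n).
  by rewrite f_E; apply: measurable_sum => j; exact: mt.
have Hstep n : measurable_fun setT (fun w => H (step n (Q w))).
  rewrite (_ : (fun w => _) = fun w => \sum_(j < (n.+1 * n.+1).+1) (H (j%:R / n.+1%:R) * (idx n (Q w) == j)%:R)); last first.
    by apply/funext => w; rewrite (step_sum (fun j => H (j%:R / n.+1%:R))).
  apply: measurable_sum => j; apply: measurable_funM => //.
  exact: (measurableT_comp (@midx n j)).
have E n : \int[P]_w f_ n w = \int[P]_w H (step n (Q w)).
  rewrite f_E (Rintegral_sum_ord _ (it n)).2.
  have ie j : P.-integrable setT (EFin \o (fun w => H (j%:R / n.+1%:R) * (idx n (Q w) == j)%:R)).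
    apply: (@prob_integrable _ K) => [|w].
      by apply: measurable_funM => //; exact: (measurableT_comp (@midx n j)).
    rewrite normrM (le_trans _ (HK (j%:R / n.+1%:R)))//.
    by rewrite ler_piMr//; case: eqP; rewrite ?normr1 ?normr0.
  transitivity (\int[P]_w \sum_(j < (n.+1 * n.+1).+1) (H (j%:R / n.+1%:R) * (idx n (Q w) == j)%:R)); last first.
    by apply: eq_Rintegral => w _; rewrite (step_sum (fun j => H (j%:R / n.+1%:R))).
  rewrite (Rintegral_sum_ord _ ie).2; apply: eq_bigr => j _.
  set s := (nat_of_ord j)%:R / n.+1%:R.
  have s0 : 0 <= s by rewrite divr_ge0.
  (* At a fixed grid time the value of B is independent of the event that [Q] is rounded to this
     time, so the expectation factors. *)
  have := @indep_Rintegral (B s) Q (fun p => F p.1 s * (idx n p.2 == j)%:R) K (ind s s0).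
  case.
  - apply: measurable_funM; first by apply: mF_comp.
    by apply: (measurableT_comp (@midx n j)); exact: measurable_snd.
  - move=> p; rewrite normrM (le_trans _ (FK p.1 s))//.
    by rewrite ler_piMr//; case: eqP; rewrite ?normr1 ?normr0.
  move=> + _ => /= ->; apply: eq_Rintegral => v _.
  rewrite RintegralZr//; last first.
    by apply: (@prob_integrable _ K) => //; apply: mF_comp.
  congr (_ * _); rewrite /H /Rintegral; congr fine.
  have mFe : measurable_fun setT (fun y => (F y s)%:E) by exact/measurable_EFinP.
  by apply: (@brownian_law B s (fun y => (F y s)%:E) bB s0 mFe) => y; rewrite lee_fin.
have iK : P.-integrable setT (EFin \o cst K) by apply: (@prob_integrable _ `|K|).
have mX : measurable_fun setT (fun w => F (X w) (pos (Q w))) by exact: mF_comp.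
have iX : P.-integrable setT (EFin \o (fun w => F (X w) (pos (Q w)))).
  by apply: (@prob_integrable _ K).
have c1 : \int[P]_w f_ n w @[n --> \oo] --> \int[P]_w F (X w) (pos (Q w)).
  have [] := @dominated_convergence _ _ _ P setT measurableT (fun n => EFin \o f_ n)
    (EFin \o (fun w => F (X w) (pos (Q w)))) (EFin \o cst K).
  - by move=> n; exact/measurable_EFinP.
  - exact/measurable_EFinP.
  - apply: filterS3 Bc Q0 XE => w [_ Bw] Qw Xw _ /=.
    apply: cvg_EFin; first exact: nearW.
    rewrite Xw pos_id//.
    apply: (cvg_comp (fun n => (B (step n (Q w)) w, step n (Q w))) (fun p : R * R => F p.1 p.2) _ (cF (B (Q w) w, Q w))).
    have c : B (step n (Q w)) w @[n --> \oo] --> B (Q w) w.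
      apply: (@cvg_within_seq `[0, +oo[%classic (B ^~ w)); [|exact: Bw| |exact: step_cvg].
        by rewrite /= in_itv/= Qw.
      by move=> n; rewrite /= in_itv/= step_ge0.
    exact: (cvg_pair c (step_cvg Qw)).
  - exact: iK.
  - by apply: aeW => w n _ /=; rewrite lee_fin; exact: FK.
  move=> _ _ h; apply: fine_cvg; rewrite fineK; first exact: h.
  exact: integrable_fin_num.
have cs w : H (step n (Q w)) @[n --> \oo] --> H (pos (Q w)).
  apply: (cvg_comp (fun n => step n (Q w)) H _ (cH _)).
  rewrite (_ : (fun n => _) = (fun n => step n (pos (Q w)))); last by apply/funext => n; rewrite /step /idx posK.
  by apply: step_cvg; exact: pos_ge0.
have [iH c2] := @Rintegral_cvg _ _ _ P setT (fun n w => H (step n (Q w))) (fun w => H (pos (Q w))) (cst K) measurableT Hstep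
  (fun w _ => cs w) iK (fun n w _ => HK _).
transitivity (\int[P]_w (H (pos (Q w)))%:E)%E; last by apply: eq_integral => v _; rewrite -HE.
rewrite -(fineK (integrable_fin_num measurableT iX)) -(fineK (integrable_fin_num measurableT iH)).
congr EFin; apply: (cvg_unique _ c1) => //=.
by rewrite (_ : (fun n => \int[P]_w f_ n w) = (fun n => \int[P]_w H (step n (Q w)))); last exact/funext.
Qed.

End expectations.

(** * Marginal laws and the two expressions of the solution *)

Section gaussian_paths.
Context d (Om : measurableType d) (R : realType) (P : probability Om R).
Local Notation N := (@normal_prob R 0 1).

Definition mk_rv (f : Om -> R) (mf : measurable_fun setT f) : {RV P >-> R} :=
  HB.pack f (isMeasurableFun.Build _ _ _ _ f mf).

Lemma process_indep (X : R -> Om -> R) (Z : Om -> R) (h1 h2 : R -> R) (t : R) :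
  process_indep_rv P X Z -> 0 <= t -> measurable_fun setT h1 -> measurable_fun setT h2 ->
  indep_rv P (h1 \o X t) (h2 \o Z).
Proof.
move=> ind t0 m1 m2 U V mU mV; apply: ind.
  apply: sub_sigma_algebra; exists t, (h1 @^-1` U); split => //.
    by rewrite /= in_itv/= t0.
  by rewrite -[X in measurable X]setTI; exact: m1.
apply: sub_sigma_algebra; exists tt, (h2 @^-1` V); split => //.
by rewrite -[X in measurable X]setTI; exact: m2.
Qed.

(** A single time already gives a centred Gaussian law of some variance v; the covariance identifies
    v as the second moment, and v = 0 is excluded because that moment is positive. *)
Lemma fbm_law (H t : R) (B : R -> {RV P >-> R}) (U : set R) :
  fractional_brownian_motion H B -> 0 < H -> 0 < t -> measurable U ->
  P (B t @^-1` U) = normal_prob 0 (Num.sqrt (t `^ (2 * H))) U.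
Proof.
move=> [Bg Bc] H0 t0 mU.
have E2 : (\int[P]_w ((B t w) ^+ 2)%:E = (t `^ (2 * H))%:E)%E.
  have := Bc t t (ltW t0) (ltW t0); rewrite unlock.
  rewrite subrr normr0 powR0 ?mulf_neq0 ?gt_eqF// => h.
  rewrite (_ : t `^ (2 * H) = 2^-1 * (t `^ (2 * H) + t `^ (2 * H) - 0)); last by field.
  by rewrite -h; apply: eq_integral => w _; rewrite expr2.
have m2 : measurable_fun setT (fun y : R => (y ^+ 2)%:E).
  by apply/measurable_EFinP; exact: measurable_funX.
have f0 (y : R) : (0 <= (y ^+ 2)%:E)%E by rewrite lee_fin sqr_ge0.
have [v v0 hv] := Bg 1%N (fun=> t) (fun=> 1) (fun=> ltW t0).
have {}hv V : measurable V -> P (B t @^-1` V) = gaussian_law v V.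
  move=> mV; rewrite -hv//; congr (P (_ @^-1` V)).
  by apply/funext => w; rewrite big_ord_recl big_ord0 addr0 mul1r.
have p0 : 0 < t `^ (2 * H) by exact: powR_gt0.
have [v_eq0|vn] := eqVneq v 0.
  have hd V : measurable V -> P (B t @^-1` V) = \d_(0 : R) V.
    by move=> mV; rewrite hv// /gaussian_law v_eq0 eqxx.
  have := @law_integral _ _ _ P (B t) (dirac (0 : measurableTypeR R)) _ (measurable_funPT (B t)) hd m2 f0.
  rewrite integral_dirac//= diracT expr0n mule0.
  by rewrite E2 => -[] /eqP; rewrite gt_eqF.
have {}v0 : 0 < v by rewrite lt_def vn.
have hv' V : measurable V -> P (B t @^-1` V) = normal_prob 0 (Num.sqrt v) V.
  by move=> mV; rewrite hv// /gaussian_law (negbTE vn).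
suff <- : v = t `^ (2 * H) by exact: hv'.
apply: EFin_inj; rewrite -E2.
rewrite (@normal_law_integral _ _ _ P (B t) v (fun y => (y ^+ 2)%:E) v0 (measurable_funPT (B t)) hv' m2 f0).
have [_ i2 _ _ N2] := normal_moments R.
transitivity (\int[N]_z (v * z ^+ 2)%:E)%E; last first.
  by apply: eq_integral => z _; rewrite exprMn sqr_sqrtr// ltW.
rewrite (_ : (\int[N]_z (v * z ^+ 2)%:E)%E = (\int[N]_z (v * z ^+ 2))%:E); last first.
  by rewrite -(fineK (integrable_fin_num measurableT (integrable_EFinZl v measurableT i2))).
by rewrite (RintegralZl v measurableT i2) N2 mulr1.
Qed.

(** Integrability of [a1] and [a2] is inferred from that of [b1] and [b2], which permits subtracting
    the two identities. *)
Lemma integral_eqB (a1 a2 b1 b2 : Om -> R) :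
  measurable_fun setT a1 -> measurable_fun setT a2 ->
  (forall w, 0 <= a1 w) -> (forall w, 0 <= a2 w) ->
  P.-integrable setT (EFin \o b1) -> P.-integrable setT (EFin \o b2) ->
  (\int[P]_w (a1 w)%:E = \int[P]_w (b1 w)%:E)%E ->
  (\int[P]_w (a2 w)%:E = \int[P]_w (b2 w)%:E)%E ->
  (\int[P]_w (a1 w - a2 w)%:E = (\int[P]_w (b1 w - b2 w))%:E)%E.
Proof.
move=> m1 m2 p1 p2 i1 i2 E1 E2.
have H (a b : Om -> R) : measurable_fun setT a -> (forall w, 0 <= a w) ->
    P.-integrable setT (EFin \o b) -> (\int[P]_w (a w)%:E = \int[P]_w (b w)%:E)%E ->
    P.-integrable setT (EFin \o a).
  move=> ma pa ib E; apply/integrableP; split; first exact/measurable_EFinP.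
  rewrite (_ : (\int[P]_x _)%E = (\int[P]_w (a w)%:E)%E); last first.
    by apply: eq_integral => w _ /=; rewrite ger0_norm.
  by rewrite E ltey_eq (integrable_fin_num measurableT ib).
have j1 := H _ _ m1 p1 i1 E1; have j2 := H _ _ m2 p2 i2 E2.
rewrite (RintegralB measurableT i1 i2) EFinB.
rewrite (fineK (integrable_fin_num measurableT i1)) (fineK (integrable_fin_num measurableT i2)).
by rewrite -[in RHS]E1 -[in RHS]E2 -(integralB measurableT j1 j2).
Qed.

Section flow_values.
Variables (s s1 : R -> R) (K0 K1 : R) (g : R -> R -> R) (w c : R).
Hypothesis ds : forall x : R, is_derive x 1 s (s1 x).
Hypothesis b0 : forall x, `|s x| <= K0.
Hypothesis b1 : forall x, `|s1 x| <= K1.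
Hypothesis gd : forall y x : R, is_derive y 1 (g ^~ x) (s (g y x)).
Hypothesis g0 : forall x, g 0 x = x.
Hypothesis c0 : c <= 0.
Variables (X Q : {RV P >-> R}).
Hypothesis XQ : gauss_mixture P X Q.
Hypothesis Q0 : forall v, 0 <= Q v.
Local Notation T := (flow_sg g w c).

Let hT : contraction_semigroup T := flow_sg_semigroup w ds b0 b1 gd g0 c0.
Let TE := flow_sgE w c ds b0 b1 gd g0.

Section mean.
Variables (f : C0fun R) (m x : R).
Hypothesis fm : forall y, 0 <= f y + m.

Let bounded_mean (v : R) : 0 <= v ->
  (\int[N]_z (f (g (Num.sqrt v * z + w * v) x) + m)%:E = (gauss_mean g w v f x + m)%:E)%E.
Proof.
move=> v0; have mg : measurable_fun setT (fun z => f (g (Num.sqrt v * z + w * v) x)).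
  apply: continuous_measurable_fun => z.
  apply: (cvg_comp (fun z => g (Num.sqrt v * z + w * v) x) f); last exact: C0_continuous.
  apply: (cvg_comp (fun z => Num.sqrt v * z + w * v) (g ^~ x)); last exact: (flow_time_continuous gd).
  by apply: cvgD; [exact: mulrl_continuous|exact: cvg_cst].
have i1 := normal_integrable_bounded mg (fun z => C0_ler_norm f _).
have i2 : N.-integrable setT (EFin \o cst m).
  by apply: (@normal_integrable_bounded _ _ `|m|).
rewrite -[LHS](fineK (integrable_fin_num measurableT (integrable_EFinD measurableT i1 i2))).
congr EFin; apply: (etrans (RintegralD measurableT i1 i2)).
by congr (_ + _); exact: normal_cst.
Qed.

Let mg_comp d' (T' : measurableType d') (y : T' -> R) : measurable_fun setT y ->
  measurable_fun setT (fun p => f (g (y p) x) + m).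
Proof.
move=> my; apply: measurable_funD => //.
apply: (measurableT_comp (continuous_measurable_fun (@C0_continuous _ f))).
exact: (measurableT_comp (continuous_measurable_fun (@flow_time_continuous _ _ _ gd x))).
Qed.

Lemma mean_drift :
  (\int[P]_v ((f (g (X v + w * Q v) x) + m) * expR (c * Q v))%:E
   = \int[P]_v (T (Q v) f x + m * expR (c * Q v))%:E)%E.
Proof.
pose F (y s : R) := (f (g (y + w * s) x) + m) * expR (c * s).
have mF : measurable_fun setT (fun p : R * R => F p.1 p.2).
  apply: measurable_funM.
    by apply: mg_comp; apply: measurable_funD => //; exact: measurable_funM.
  by apply: measurableT_comp => //; exact: measurable_funM.
have cF : continuous (fun p : R * R => F p.1 p.2).
  move=> p; apply: cvgM; last first.
    apply: (cvg_comp (fun p : R * R => c * p.2) (@expR R)); last exact: continuous_expR.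
    by apply: cvgM; [exact: cvg_cst|exact: cvg_snd].
  apply: cvgD; last exact: cvg_cst.
  apply: (cvg_comp (fun p : R * R => g (p.1 + w * p.2) x) f); last exact: C0_continuous.
  apply: (cvg_comp (fun p : R * R => p.1 + w * p.2) (g ^~ x)); last exact: (flow_time_continuous gd).
  apply: cvgD; first exact: cvg_fst.
  by apply: cvgM; [exact: cvg_cst|exact: cvg_snd].
have F0 y u : 0 <= F y u by rewrite mulr_ge0// expR_ge0.
rewrite (XQ mF cF F0); apply: eq_integral => v _; rewrite TE.
transitivity ((expR (c * Q v))%:E * \int[N]_z (f (g (Num.sqrt (Q v) * z + w * Q v) x) + m)%:E)%E.
  rewrite -ge0_integralZl//; last 2 first.
  - apply/measurable_EFinP; apply: mg_comp; apply: measurable_funD => //; exact: measurable_funM.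
  - by move=> z _; rewrite lee_fin.
  by apply: eq_integral => z _; rewrite /F -EFinM mulrC.
by rewrite bounded_mean// -EFinM mulrDr (mulrC m).
Qed.

(* Cameron-Martin: the exponential weight shifts the Gaussian variable. *)
Lemma mean_girsanov :
  (\int[P]_v ((f (g (X v) x) + m) * expR (Q v * (c - w ^+ 2 / 2) + w * X v))%:E
   = \int[P]_v (T (Q v) f x + m * expR (c * Q v))%:E)%E.
Proof.
pose F (y s : R) := (f (g y x) + m) * expR (s * (c - w ^+ 2 / 2) + w * y).
have mF : measurable_fun setT (fun p : R * R => F p.1 p.2).
  apply: measurable_funM; first exact: mg_comp.
  by apply: measurableT_comp => //; apply: measurable_funD; exact: measurable_funM.
have cF : continuous (fun p : R * R => F p.1 p.2).
  move=> p; apply: cvgM; last first.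
    apply: (cvg_comp (fun p : R * R => p.2 * (c - w ^+ 2 / 2) + w * p.1) (@expR R)); last exact: continuous_expR.
    apply: cvgD; first by apply: cvgM; [exact: cvg_snd|exact: cvg_cst].
    by apply: cvgM; [exact: cvg_cst|exact: cvg_fst].
  apply: cvgD; last exact: cvg_cst.
  apply: (cvg_comp (fun p : R * R => g p.1 x) f); last exact: C0_continuous.
  by apply: (cvg_comp (fun p : R * R => p.1) (g ^~ x)); [exact: cvg_fst|exact: (flow_time_continuous gd)].
have F0 y u : 0 <= F y u by rewrite mulr_ge0// expR_ge0.
rewrite (XQ mF cF F0); apply: eq_integral => v _; rewrite TE.
set q := Q v; have q0 : 0 <= q by exact: Q0.
(* With this shift sqrt(q) (z + l) = sqrt(q) z + w q, and l^2 / 2 = w^2 q / 2 is the correction in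
   the weight. *)
pose l := w * Num.sqrt q; pose h (z : R) := (f (g (Num.sqrt q * z) x) + m)%:E.
have mh : measurable_fun setT h.
  by apply/measurable_EFinP; apply: mg_comp; exact: measurable_funM.
have h0 z : (0 <= h z)%E by rewrite lee_fin.
transitivity ((expR (c * q))%:E * \int[N]_z (h z * (expR (l * z - l ^+ 2 / 2))%:E))%E.
  rewrite -ge0_integralZl//; last 2 first.
  - apply: emeasurable_funM => //; apply/measurable_EFinP; apply: measurableT_comp => //.
    by apply: measurable_funB => //; exact: measurable_funM.
  - by move=> z _; rewrite mule_ge0// lee_fin expR_ge0.
  apply: eq_integral => z _; rewrite /F /h -!EFinM [in RHS]mulrCA -expRD; congr (_ * expR _)%:E.
  by rewrite /l exprMn sqr_sqrtr//; field.
rewrite ge0_integral_normal_shift// (_ : (\int[N]_z h (z + l)%R)%E =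
    (\int[N]_z (f (g (Num.sqrt q * z + w * q) x) + m)%:E)%E).
  by rewrite bounded_mean// -EFinM mulrDr (mulrC m).
apply: eq_integral => z _; rewrite /h /l mulrDr mulrCA -expr2 sqr_sqrtr//.
Qed.

End mean.

Let mT f x : measurable_fun setT (fun v => T (Q v) f x).
Proof.
rewrite (_ : (fun v => _) = (fun v => T (pos (Q v)) f x)); last by apply/funext => v; rewrite pos_id.
apply: (measurableT_comp (f := fun r => T (pos r) f x)) => //.
by apply: continuous_measurable_fun; exact: (sg_eval_continuous hT).
Qed.

Let iT f x m : P.-integrable setT (EFin \o (fun v => T (Q v) f x + m * expR (c * Q v))).
Proof.
apply: (@prob_integrable _ _ _ P _ (`|f| + `|m|)) => [|v].
  apply: measurable_funD; first exact: mT.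
  by apply: measurable_funM => //; apply: measurableT_comp => //; exact: measurable_funM.
rewrite (le_trans (ler_normD _ _))// lerD//.
  by rewrite (le_trans (C0_ler_norm _ _))//; have [_ H _ _ _] := hT; exact: H.
rewrite normrM (ger0_norm (expR_ge0 _)) ler_piMr// -expR0 ler_expR mulr_le0_ge0//.
Qed.

(** Mixture identities hold for nonnegative integrands. With m = |f| they apply to f + m and to m,
    and are subtracted; [L] stands for either of the two weighted expressions. *)
Let split_value (f : C0fun R) x (L : (R -> R) -> Om -> R) :
  (forall p q v, L p v - L q v = L (fun y => p y - q y) v) ->
  (forall (h : C0fun R) m, measurable_fun setT (L (fun y => h y + m))) ->
  (forall (h : C0fun R) m v, (forall y, 0 <= h y + m) -> 0 <= L (fun y => h y + m) v) ->
  (forall (h : C0fun R) m, (forall y, 0 <= h y + m) ->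
    (\int[P]_v (L (fun y => h y + m) v)%:E = \int[P]_v (T (Q v) h x + m * expR (c * Q v))%:E)%E) ->
  (\int[P]_v (L f v)%:E = (\int[P]_v T (Q v) f x)%:E)%E.
Proof.
move=> LB mL L0 LE; pose m := `|f|.
have fm y : 0 <= f y + m by rewrite -[m]opprK subr_ge0 lerNl (le_trans (ler_norm _))// normrN C0_ler_norm.
have zm y : 0 <= (0 : C0fun R) y + m by rewrite C0E add0r /m normr_ge0.
have := integral_eqB (mL f m) (mL 0 m) (fun v => L0 f m v fm) (fun v => L0 0 m v zm)
  (iT f x m) (iT 0 x m) (LE f m fm) (LE 0 m zm).
move=> h; transitivity (\int[P]_v (L (fun y => f y + m)%R v - L (fun y => (0 : C0fun R) y + m)%R v)%:E)%E.
  apply: eq_integral => v _; rewrite LB; congr (L _ v)%:E; apply/funext => y.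
  by rewrite C0E add0r addrK.
rewrite h; congr EFin; apply: eq_Rintegral => v _.
have T0 : T (Q v) 0 = 0.
  by rewrite -[in LHS](scale0r (0 : C0fun R)) (sg_Z hT) ?scale0r//; exact: Q0.
by rewrite T0 C0E; ring.
Qed.

Lemma value_drift (f : C0fun R) x :
  (\int[P]_v (f (g (X v + w * Q v) x) * expR (c * Q v))%:E = (\int[P]_v T (Q v) f x)%:E)%E.
Proof.
apply: (@split_value f x (fun p v => p (g (X v + w * Q v) x) * expR (c * Q v))).
- by move=> p q v; rewrite mulrBl.
- move=> h m; apply: measurable_funM.
    apply: measurable_funD => //.
    apply: (measurableT_comp (continuous_measurable_fun (@C0_continuous _ h))).
    apply: (measurableT_comp (continuous_measurable_fun (@flow_time_continuous _ _ _ gd x))).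
    by apply: measurable_funD => //; exact: measurable_funM.
  by apply: measurableT_comp => //; exact: measurable_funM.
- by move=> h m v hm; rewrite mulr_ge0// expR_ge0.
- by move=> h m hm; exact: mean_drift.
Qed.

Lemma value_girsanov (f : C0fun R) x :
  (\int[P]_v (f (g (X v) x) * expR (Q v * (c - w ^+ 2 / 2) + w * X v))%:E
   = (\int[P]_v T (Q v) f x)%:E)%E.
Proof.
apply: (@split_value f x (fun p v => p (g (X v) x) * expR (Q v * (c - w ^+ 2 / 2) + w * X v))).
- by move=> p q v; rewrite mulrBl.
- move=> h m; apply: measurable_funM.
    apply: measurable_funD => //.
    apply: (measurableT_comp (continuous_measurable_fun (@C0_continuous _ h))).
    exact: (measurableT_comp (continuous_measurable_fun (@flow_time_continuous _ _ _ gd x))).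
  by apply: measurableT_comp => //; apply: measurable_funD; exact: measurable_funM.
- by move=> h m v hm; rewrite mulr_ge0// expR_ge0.
- by move=> h m hm; exact: mean_girsanov.
Qed.

End flow_values.

End gaussian_paths.

(** * The evolution equation *)

(** Where [pos] vanishes the power function need not be differentiable, and the bound y^a <= e for y
    <= e^(1/a) is used instead. *)
Lemma continuous_pos_powR (R : realType) (a : R) : 0 < a -> continuous (fun x : R => pos x `^ a).
Proof.
move=> a0 x; have px := pos_ge0 x.
have [p0|p0] := eqVneq (pos x) 0; last first.
  have {px}px : 0 < pos x by rewrite lt_def p0.
  apply: (cvg_comp (@pos R) (fun y : R => y `^ a)); first exact: continuous_pos.
  exact: is_derive_continuous (is_derive1_powR a px).
rewrite /continuous_at p0 powR0 ?gt_eqF//; apply/cvgrPdist_le => e e0.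
have d0 : 0 < e `^ (a^-1) by exact: powR_gt0.
have /cvgrPdist_le/(_ _ d0) := @continuous_pos R x.
rewrite p0; apply: filterS => y; rewrite !sub0r !normrN !ger0_norm ?powR_ge0 ?pos_ge0// => yd.
rewrite -[leRHS]powRr1 ?(ltW e0)// -(mulVf (lt0r_neq0 a0)) powRrM.
by apply: ge0_ler_powR => //; rewrite ?nnegrE ?(ltW a0) ?pos_ge0 ?(ltW d0).
Qed.

Lemma is_bochner_ext d (T : measurableType d) (R : realType) (E : normedModType R)
    (mu : {measure set T -> \bar R}) (D : set T) (f g : T -> E) I :
  (forall x, D x -> f x = g x) -> is_bochner mu D f I -> is_bochner mu D g I.
Proof.
move=> fg [s [h1 h2 h3 h4]]; exists s; split => //.
  by apply: filterS h2 => x h Dx; rewrite -fg//; exact: h.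
apply: cvg_trans h3; apply: near_eq_cvg; apply: nearW => n.
by apply: eq_integral => x /set_mem Dx; rewrite fg.
Qed.

Section semigroup_calculus.
Context (R : realType) (T : R -> C0fun R -> C0fun R).
Hypothesis hT : contraction_semigroup T.

Let taylor (p q : C0fun R) (a b K : R) : generator T (p, q) -> 0 <= a -> a <= b ->
  (forall r, 0 <= r <= b - a -> `|T r q - q| <= K) ->
  `|T b p - T a p - (b - a) *: T a q| <= (b - a) * K.
Proof.
move=> pq a0 ab HK; have ba : 0 <= b - a by rewrite subr_ge0.
rewrite -[b in T b](subrKC a) (sg_add hT)// -(sg_B hT)// -(sg_Z hT)// -(sg_B hT)//.
exact: le_trans (sg_norm hT _ _) (generator_taylor hT ba pq HK).
Qed.

(** Quotients with a positive increment follow from the Taylor estimate started at [r]. Those with a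
    negative one start from r + u and yield T_(r+u) q, which strong continuity moves to T_r q. *)
Lemma sg_is_derive (p q : C0fun R) (x r : R) : generator T (p, q) -> 0 < r ->
  is_derive r 1 (fun t : R => T (pos t) p x) (T r q x).
Proof.
move=> pq r0; apply: is_derive_seq => u un0 u0; apply/cvgrPdist_le => e e0.
have e20 : 0 < e / 2 by rewrite divr_gt0.
have /cvgrPdist_le/(_ _ e20)/nbhs_ballP[d1 /= d10 H1] := @sg_continuous _ _ _ hT q 0.
have /cvgrPdist_le/(_ _ e20)/nbhs_ballP[d2 /= d20 H2] := @sg_continuous _ _ _ hT q r.
pose dl := Num.min r (Num.min d1 d2).
have dl0 : 0 < dl by rewrite !lt_min r0 d10.
have /cvgrPdist_lt/(_ _ dl0) := u0; apply: filterS => n.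
rewrite sub0r normrN !lt_min => /andP[ur /andP[u1 u2]].
have HK (b : R) : b < d1 -> forall t, 0 <= t <= b -> `|T t q - q| <= e / 2.
  move=> bd t /andP[t0 tb]; rewrite distrC -{1}(sg_0 hT q) -{1}(pos_id t0).
  rewrite -[X in T X q - _](pos_id (lexx 0)); apply: H1.
  by rewrite /ball /= sub0r normrN ger0_norm// (le_lt_trans tb).
have ev (h : C0fun R) (y b : R) : `|h| <= y * b -> `|h x| <= y * b.
  exact: le_trans (C0_ler_norm h x).
have ru : 0 < r + u n by move: ur; rewrite ltr_norml; lra.
rewrite !pos_id ?(ltW ru) ?(ltW r0)//.
have [up|un] := ltP 0 (u n).
  have E := @taylor p q r (r + u n) (e / 2) pq (ltW r0) _ _.
  rewrite addrAC subrr add0r lerDl (ltW up) in E.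
  have {}E := ev _ _ _ (E isT (HK _ _)).
  rewrite distrC -[X in _ - X](mulfK (un0 n)) -mulrBl normrM (gtr0_norm (_ : 0 < (u n)^-1)) ?invr_gt0//.
  rewrite ler_pdivrMr//.
  have {}E : `|T (r + u n) p x - T r p x - T r q x * u n| <= u n * (e / 2).
    move: E; rewrite !C0E (mulrC (u n)) => E; apply: E.
    by rewrite (le_lt_trans (ler_norm _)).
  by rewrite (le_trans E)// mulrC ler_wpM2r ?(ltW up)// ler_pdivrMr// ler_peMr ?(ltW e0)// ler1n.
have {}un : u n < 0 by rewrite lt_def eq_sym un0.
have un' : 0 < - u n by rewrite oppr_gt0.
have E := @taylor p q (r + u n) r (e / 2) pq (ltW ru) _ _.
rewrite opprD addNKr gerDl (ltW un) in E.
have {}E := ev _ _ _ (E isT (HK _ _)).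
have {}E : `|T r p x - T (r + u n) p x - (- u n) * T (r + u n) q x| <= (- u n) * (e / 2).
  by move: E; rewrite !C0E => E; apply: E; rewrite -(ltr0_norm un).
have F : `|T r q x - T (r + u n) q x| <= e / 2.
  have := H2 (r + u n); rewrite /ball/= opprD addNKr normrN u2 => /(_ isT).
  by rewrite !pos_id ?(ltW ru) ?(ltW r0)// => h; have := le_trans (C0_ler_norm _ x) h; rewrite !C0E.
have {}E : `|(T (r + u n) p x - T r p x) / u n - T (r + u n) q x| <= e / 2.
  rewrite -(ler_pM2l un') -{1}(gtr0_norm un') -normrM (_ : - u n * _ = T r p x - T (r + u n) p x - - u n * T (r + u n) q x)//.
  by field.
rewrite distrC (le_trans (ler_distD (T (r + u n) q x) _ _))// [leRHS](_ : _ = e / 2 + e / 2); last by field.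
by rewrite lerD// distrC.
Qed.

Lemma generator_image (U : C0fun R -> C0fun R) (p q : C0fun R) : linear U ->
  (forall h, `|U h| <= `|h|) -> (forall t h, 0 <= t -> T t (U h) = U (T t h)) ->
  generator T (p, q) -> generator T (U p, U q).
Proof.
move=> lU cU comm /= pq; apply/cvgrPdist_le => e e0.
have /cvgrPdist_le/(_ _ e0) := pq => H.
near=> h; have h0 : 0 <= h by near: h; exact: nbhs_right_ge.
rewrite comm// -(linear_funB _ _ lU) -(linear_funZ _ _ lU) -(linear_funB _ _ lU).
by rewrite (le_trans (cU _))//; near: h.
Unshelve. all: by end_near. Qed.

End semigroup_calculus.

Section subordinated_laws.
Context d (Om : measurableType d) (R : realType) (P : probability Om R).
Context (T : R -> C0fun R -> C0fun R).
Hypothesis hT : contraction_semigroup T.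
Local Notation D := (`[0, +oo[%classic : set R).

Let pfin (z : {RV P >-> R}) : (distribution P z D < +oo)%E.
Proof. by rewrite (le_lt_trans (probability_le1 _ _))// ltry. Qed.

Lemma law_Rintegral (z : {RV P >-> R}) (f : R -> R) (K : R) : (forall w, 0 <= z w) ->
  measurable_fun setT f -> (forall s, `|f s| <= K) ->
  \int[distribution P z]_(s in D) f s = \int[P]_w f (z w).
Proof.
move=> z0 mf fK; rewrite /Rintegral; congr fine.
have zD : z @^-1` D = setT by apply/seteqP; split => // w _ /=; rewrite in_itv/= z0.
rewrite /distribution (@integral_pushforward _ _ _ _ _ z (measurable_funPT z) P D (EFin \o f)) ?zD//.
  exact/measurable_EFinP.
by apply: (@prob_integrable _ _ _ P (f \o z) K (measurableT_comp mf (measurable_funPT z))) => w; exact: fK.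
Qed.

Let mev p x : measurable_fun setT (fun s : R => T (pos s) p x).
Proof. by apply: continuous_measurable_fun; exact: (sg_eval_continuous hT). Qed.

Let ble p x (s : R) : `|T (pos s) p x| <= `|p|.
Proof. by rewrite (le_trans (C0_ler_norm _ _))// (sg_norm hT)// pos_ge0. Qed.

Lemma avg_law (z : {RV P >-> R}) p x : (forall w, 0 <= z w) ->
  avg T (distribution P z) p x = \int[P]_w T (pos (z w)) p x.
Proof. by move=> z0; rewrite (avgE hT (pfin z)); exact: (law_Rintegral z0 (mev p x) (ble p x)). Qed.

Lemma avg_law_norm (z : {RV P >-> R}) p : `|avg T (distribution P z) p| <= `|p|.
Proof.
rewrite (le_trans (avg_norm hT (pfin z) p))// ler_piMl//.
rewrite -lee_fin fineK; first exact: probability_le1.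
by rewrite ge0_fin_numE//; exact: pfin.
Qed.

Lemma avg_law_linear (z : {RV P >-> R}) : linear (avg T (distribution P z)).
Proof. exact: (avg_linear hT (pfin z)). Qed.

(** The norm of the difference of two averages is at most the expectation of |T_(z r0) p - T_(z r)
    p|, which tends to 0 by dominated convergence along the continuous paths of [z]. *)
Lemma avg_law_continuous (z : R -> {RV P >-> R}) p : (forall r w, 0 <= z r w) ->
  (forall w, continuous (z ^~ w)) -> continuous (fun r => avg T (distribution P (z r)) p).
Proof.
move=> z0 cz r0.
pose G r w : C0fun R := T (pos (z r0 w)) p - T (pos (z r w)) p.
have mG r x : measurable_fun setT (fun w => G r w x).
  by apply: measurable_funB; exact: (measurableT_comp (mev p x)).
have GK r w : `|G r w| <= 2 * `|p|.
  by rewrite (le_trans (ler_normB _ _))// mulr_natl mulr2n lerD// (sg_norm hT)// pos_ge0.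
pose b r := \int[P]_w `|G r w|.
have mGn r : measurable_fun setT (fun w => `|G r w|) by apply: measurable_C0_norm.
have cb : continuous b.
  apply: (@continuous_Rintegral _ _ _ P setT (fun r w => `|G r w|) (cst (2 * `|p|))) => //.
  - by apply: (@prob_integrable _ _ _ P _ `|2 * `|p| |).
  - move=> w _ r; apply: (cvg_comp (fun r => G r w) (@Num.norm _ _)); last exact: norm_continuous.
    apply: cvgB; first exact: cvg_cst.
    by apply: (cvg_comp (z ^~ w) (fun s => T (pos s) p)); [exact: cz|exact: (sg_continuous hT)].
  - by move=> r w _; rewrite normr_id.
apply: (@C0_norm_cvg _ _ _ _ _ _ b) => [r|].
  apply: C0_norm_le => x; rewrite !C0E !avg_law//.
  have i1 r' : P.-integrable setT (EFin \o (fun w => T (pos (z r' w)) p x)).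
    apply: (@prob_integrable _ _ _ P _ `|p|) => //; exact: (measurableT_comp (mev p x)).
  rewrite -(RintegralB measurableT (i1 r0) (i1 r)).
  have iG : P.-integrable setT (EFin \o (fun w => G r w x)).
    by apply: (@prob_integrable _ _ _ P _ (2 * `|p|)) => // w; rewrite (le_trans (C0_ler_norm _ _)).
  apply: (le_trans (le_normr_Rintegral measurableT iG)); apply: le_Rintegral => //.
  - exact: integrable_norm.
  - by apply: (@prob_integrable _ _ _ P _ (2 * `|p|)) => // w; rewrite normr_id.
  - by move=> w _; exact: C0_ler_norm.
suff b0 : b r0 = 0 by have := cb r0; rewrite /continuous_at b0.
rewrite /b; under eq_Rintegral do rewrite /G subrr normr0.
by rewrite Rintegral_cst// mul0r.
Qed.

End subordinated_laws.

(** * The subordinated semigroup and the evolution equation *)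

Section evolution.
Context d (Om : measurableType d) (R : realType) (P : probability Om R).
Context (T : R -> C0fun R -> C0fun R) (gam theta : R) (k : R -> R -> R).
Context (A Z : {RV P >-> R}).
Hypothesis hT : contraction_semigroup T.
Hypothesis gam0 : 0 < gam.
Hypothesis theta0 : 0 < theta.
Hypothesis hk : admissible k.
Hypothesis kh : homogeneous (theta - 1) k.
Hypothesis A0 : forall w, 0 <= A w.
Hypothesis Z0 : forall w, 0 <= Z w.
Hypothesis AZ : indep_rv P Z A.
Hypothesis ZL : forall lam, 0 <= lam ->
  \int[P]_w expR (- (lam * Z w)) = expR (- (lam `^ gam)).
Hypothesis AL : forall lam, 0 <= lam ->
  \int[P]_w expR (- (lam * A w)) = kernel_fun k theta (- lam).
Local Notation D := (`[0, +oo[%classic : set R).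
Local Notation leb := (@lebesgue_measure R).

Let ig0 : 0 < gam^-1. Proof. by rewrite invr_gt0. Qed.

Let mstable r : measurable_fun setT (fun w => pos r `^ gam^-1 * Z w).
Proof. exact: measurable_funM. Qed.

(** By scaling, [Z] at time 1 produces the stable laws of all times on one probability space, with
    paths continuous in r; these need not be the paths of the subordinator. *)
Definition stable_rv r : {RV P >-> R} := mk_rv P (mstable r).

Definition stable_law r : probability R R := distribution P (stable_rv r).

Let S t := avg T (stable_law t).

Let stable0 r w : 0 <= stable_rv r w.
Proof. by rewrite /stable_rv /= mulr_ge0// powR_ge0. Qed.

Let mexp (lam : R) : measurable_fun setT (fun s : R => expR (- (lam * pos s))).
Proof.
apply: measurableT_comp => //; apply: measurableT_comp => //; apply: measurable_funM => //.
by apply: continuous_measurable_fun; exact: continuous_pos.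
Qed.

Let bexp (lam s : R) : 0 <= lam -> `|expR (- (lam * pos s))| <= 1.
Proof. by move=> l0; rewrite ger0_norm ?expR_ge0// expRN_le1// mulr_ge0// pos_ge0. Qed.

Let law_D (z : {RV P >-> R}) : (forall w, 0 <= z w) -> distribution P z D = 1%E.
Proof.
move=> z0; rewrite /distribution /= /pushforward (_ : _ @^-1` _ = setT) ?probability_setT//.
by apply/seteqP; split => // w _ /=; rewrite in_itv/= z0.
Qed.

Lemma stable_law_laws : stable_laws gam stable_law.
Proof.
move=> t t0; split; first exact: law_D.
move=> lam l0.
have pl : 0 <= pos t `^ gam^-1 * lam by rewrite mulr_ge0 ?powR_ge0.
have E : \int[stable_law t]_(s in D) expR (- (lam * pos s)) = expR (- (t * lam `^ gam)).
  rewrite (law_Rintegral (stable0 t) (mexp lam) (fun s => bexp s l0)).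
  transitivity (\int[P]_w expR (- ((pos t `^ gam^-1 * lam) * Z w))).
    by apply: eq_Rintegral => w _; rewrite pos_id// /stable_rv /= mulrA (mulrC lam).
  by rewrite ZL// powRM ?powR_ge0// -powRrM mulVf ?gt_eqF// powRr1 ?pos_ge0// pos_id.
rewrite -E /Rintegral fineK.
  by apply: eq_integral => s /set_mem /=; rewrite in_itv/= andbT => s0; rewrite pos_id.
apply: integrable_fin_num => //; apply: (@bounded_integrable _ _ _ _ _ _ 1) => //.
- by rewrite (le_lt_trans (probability_le1 _ _))// ltry.
- exact: measurable_funTS.
- by move=> s _; exact: bexp.
Qed.

Let avg_law0 (z : {RV P >-> R}) p : (forall w, z w = 0) -> avg T (distribution P z) p = p.
Proof.
move=> z0; apply: C0_ext => x; rewrite (avg_law hT)// => [|w]; last by rewrite z0.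
under eq_Rintegral do rewrite z0 pos_id// (sg_0 hT).
by rewrite Rintegral_cst// [X in fine X](_ : _ = 1%E) ?mulr1//; exact: probability_setT.
Qed.

(** Strong continuity comes from the paths r^(1/gam) Z, which are continuous and vanish at 0; the
    semigroup law is [subordinate_add]. *)
Lemma stable_semigroup : contraction_semigroup S.
Proof.
split.
- by move=> t _; exact: avg_law_linear.
- by move=> t p _; exact: avg_law_norm.
- move=> p; apply: avg_law0 => w.
  by rewrite /stable_rv /= pos_id// powR0 ?mul0r// gt_eqF.
- by move=> s t p s0 t0; exact: (subordinate_add hT stable_law_laws p s0 t0).
- move=> p; have cS : continuous (fun r => S r p).
    apply: (avg_law_continuous hT) => // w r; rewrite /stable_rv /=.
    by apply: cvgMr_tmp; exact: continuous_pos_powR.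
  have := cS 0; rewrite /continuous_at {2}/S avg_law0; first exact: cvg_at_right_filter.
  by move=> w; rewrite /stable_rv /= pos_id// powR0 ?mul0r// gt_eqF.
Qed.

Let mclock t : measurable_fun setT (fun w => pos t `^ (theta / gam) * (A w `^ gam^-1 * Z w)).
Proof.
apply: measurable_funM => //; apply: measurable_funM => //.
exact: (measurableT_comp (measurable_powR _)).
Qed.

Definition clock t : {RV P >-> R} := mk_rv P (mclock t).

Lemma clock_ge0 t w : 0 <= clock t w.
Proof. by rewrite /clock /= mulr_ge0 ?powR_ge0// mulr_ge0 ?powR_ge0. Qed.

Definition clock_avg t := avg T (distribution P (clock t)).

(** The clock equals (t^theta A)^(1/gam) Z: given A = a it has the stable law of time t^theta a, and
    Z is independent of A. *)
Lemma clock_avgE t p x : 0 < t ->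
  clock_avg t p x = \int[distribution P A]_(a in D) S (t `^ theta * pos a) p x.
Proof.
move=> t0; have clock0 := clock_ge0; rewrite /clock_avg (avg_law hT)//.
pose f (q : R * R) := T (pos (pos (t `^ theta * pos q.2) `^ gam^-1 * q.1)) p x.
have mpos : measurable_fun setT (@pos R) by apply: continuous_measurable_fun; exact: continuous_pos.
have mf : measurable_fun setT f.
  apply: (@measurableT_comp _ _ _ _ _ _ (fun s : R => T (pos s) p x) _
    (fun q : R * R => pos (t `^ theta * pos q.2) `^ gam^-1 * q.1)).
    by apply: continuous_measurable_fun; exact: (sg_eval_continuous hT).
  apply: measurable_funM => //; apply: (measurableT_comp (measurable_powR _)).
  apply: (measurableT_comp mpos); apply: measurable_funM => //.
  exact: (measurableT_comp mpos).
have fK q : `|f q| <= `|p|.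
  by rewrite (le_trans (C0_ler_norm _ _))// (sg_norm hT)// pos_ge0.
have [E _] := indep_Rintegral AZ mf fK.
have cS : continuous (fun r => S (pos r) p x) by exact: (sg_eval_continuous stable_semigroup).
have mS : measurable_fun setT (fun a => S (t `^ theta * pos a) p x).
  rewrite (_ : (fun a => _) = (fun a => S (pos (t `^ theta * pos a)) p x)); last first.
    by apply/funext => a; rewrite [pos (_ * _)]pos_id// mulr_ge0 ?powR_ge0// pos_ge0.
  apply: (measurableT_comp (continuous_measurable_fun cS)); apply: measurable_funM => //.
rewrite (law_Rintegral A0 mS (K := `|p|)); last first.
  by move=> a; rewrite (le_trans (C0_ler_norm _ _))//; exact: avg_law_norm.
transitivity (\int[P]_w f (Z w, A w)).
  apply: eq_Rintegral => w _; rewrite /f /clock /=; congr (T (pos _) p x).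
  rewrite !pos_id ?(ltW t0)//; last by rewrite mulr_ge0 ?powR_ge0.
  by rewrite powRM ?powR_ge0// -powRrM mulrA.
rewrite E; apply: eq_Rintegral => v _; rewrite /S (avg_law hT)//.
Qed.

Lemma clock_avg_continuous p : continuous (fun t => clock_avg t p).
Proof.
have clock0 := clock_ge0; apply: (avg_law_continuous hT) => // w r; rewrite /clock /=.
by apply: cvgMr_tmp; apply: continuous_pos_powR; rewrite divr_gt0.
Qed.

Let pfin (z : {RV P >-> R}) : (distribution P z D < +oo)%E.
Proof. by rewrite (le_lt_trans (probability_le1 _ _))// ltry. Qed.

Lemma clock_avg_generator t p q : generator S (p, q) ->
  generator S (clock_avg t p, clock_avg t q).
Proof.
move=> pq; apply: generator_image pq.
- exact: avg_law_linear.
- by move=> h; exact: avg_law_norm.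
- move=> s h s0; apply: (avg_comm hT (pfin _)).
  + exact: avg_law_linear.
  + by move=> r; exact: avg_law_norm.
  + by move=> r e r0; exact: (subordinate_comm hT stable_law).
Qed.

(** Both sides are compared at each point. [resolvent_identity] for h(r) = S_r q x turns the kernel
    integral into a mean over A of integrals of the orbit, and the fundamental theorem evaluates
    these as u0 - S_Q u0 with Q = t^theta A; the sign is that of the pair (u0, -q). *)
Lemma evolution_equation u0 q t : generator S (u0, - q) -> 0 < t ->
  exists2 I : C0fun R,
    is_bochner leb `]0, t[ (fun s => k t s *: clock_avg s q) I &
    forall x, clock_avg t u0 x = u0 x - I x.
Proof.
move=> Sq t0; have hS := stable_semigroup.
have SN r p x : S r (- p) x = - S r p x.
  have h : linear (S r) by exact: avg_law_linear.
  by rewrite -scaleN1r (linear_funZ _ _ h) !C0E mulN1r.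
have kI := kernel_integrable hk t0.
have mc x : measurable_fun `]0, t[ (fun s => clock_avg s q x).
  apply: measurable_funTS; apply: continuous_measurable_fun => s.
  by apply: C0_cvg_eval; exact: clock_avg_continuous.
have qK s : `|clock_avg s q| <= `|q| by exact: avg_law_norm.
have B := @bochner_exists _ _ R leb id `]0, t[%classic (k t) (clock_avg ^~ q) `|q|.
exists (mix leb `]0, t[ (k t) (fun s => clock_avg s q)).
  apply: B => //.
  - by move=> s /=; rewrite in_itv/= => /andP[/ltW].
  - by rewrite lebesgue_itv_fin.
  - by move=> s _; apply: cvg_at_right_filter; exact: clock_avg_continuous.
move=> x; rewrite (@mixE _ _ _ leb _ _ _ `|q|)//.
pose h (r : R) := S (pos r) q x.
have ch : continuous h by exact: (sg_eval_continuous hS).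
have bh : BC h.
  by split => //; exists `|q| => s; rewrite (le_trans (C0_ler_norm _ _))//; exact: avg_law_norm.
have hpos s : h (pos s) = h s by rewrite /h posK.
have hr (a b : R) : 0 <= a -> h (a * pos b) = S (a * pos b) q x.
  by move=> a0; rewrite /h pos_id// mulr_ge0// pos_ge0.
have alphaL lam : 0 <= lam ->
    \int[distribution P A]_(a in D) expR (- (lam * pos a)) = kernel_fun k theta (- lam).
  move=> l0; rewrite -AL// (law_Rintegral A0 (mexp lam) (fun s => bexp s l0)).
  by apply: eq_Rintegral => w _; rewrite pos_id.
have res := @resolvent_identity _ k theta theta0 hk kh (distribution P A) (law_D A0) alphaL h t t0 bh hpos.
rewrite (_ : \int[leb]_(s in `]0, t[) (k t s * clock_avg s q x) =
  \int[leb]_(s in `]0, t[) (k t s * \int[distribution P A]_(a in D) h (s `^ theta * pos a))); last first.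
  apply: eq_Rintegral => s /set_mem /=; rewrite in_itv/= => /andP[s0 _].
  apply: (congr1 (fun y => k t s * y)); apply: (etrans (clock_avgE q x s0)).
  apply: eq_Rintegral => a _; apply/esym/hr; exact: powR_ge0.
rewrite -res.
have inner (a : R) : t `^ theta * pos a * \int[leb]_(r in `[0, 1]) h (t `^ theta * pos a * r) =
    u0 x - S (t `^ theta * pos a) u0 x.
  set Q := t `^ theta * pos a.
  have Q0 : 0 <= Q by rewrite mulr_ge0 ?powR_ge0// pos_ge0.
  have [->|Qn] := eqVneq Q 0; first by rewrite mul0r (sg_0 hS) subrr.
  have {Qn}Qp : 0 < Q by rewrite lt_def Qn.
  pose f (r : R) := - S (pos (Q * r)) u0 x.
  have cQ : continuous (fun r : R => Q * r) by exact: mulrl_continuous.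
  have cf : continuous f.
    move=> r; apply: cvgN; apply: (cvg_comp (fun r => Q * r) (fun s => S (pos s) u0 x)); first exact: cQ.
    exact: (sg_eval_continuous hS).
  have chQ : continuous (fun r => h (Q * r)).
    by move=> r; apply: (cvg_comp (fun r => Q * r) h); [exact: cQ|exact: ch].
  have chQ' : continuous (fun r => Q * h (Q * r)).
    by move=> r; apply: cvgMl_tmp; exact: chQ.
  have df (r : R) : 0 < r -> r < 1 -> is_derive r 1 f (Q * h (Q * r)).
    move=> r0 _; have Qr : 0 < Q * r by rewrite mulr_gt0.
    have d1 := sg_is_derive hS x Sq Qr.
    have d2 : is_derive r (1 : R) (fun r => Q * r) Q.
      by apply: is_derive_eq; rewrite /GRing.scale/= mulr1.
    have d3 : is_derive r (1 : R) (fun r => S (pos (Q * r)) u0 x) (S (Q * r) (- q) x * Q).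
      exact: (@is_derive1_comp _ (fun s => S (pos s) u0 x) (fun r => Q * r)).
    by apply: is_derive_eq; rewrite SN /h pos_id ?(ltW Qr)//; ring.
  have := FTC01 cf chQ' df.
  rewrite /f mulr1 mulr0 (pos_id Q0) (pos_id (lexx 0)) (sg_0 hS) opprK addrC => <-.
  rewrite RintegralZl//; apply: continuous_compact_integrable; first exact: segment_compact.
  exact: continuous_subspaceT.
under eq_Rintegral do rewrite inner.
have mS : measurable_fun setT (fun a => S (t `^ theta * pos a) u0 x).
  rewrite (_ : (fun a => _) = (fun a => S (pos (t `^ theta * pos a)) u0 x)); last first.
    by apply/funext => a; rewrite [pos (_ * _)]pos_id// mulr_ge0 ?powR_ge0// pos_ge0.
  have cS : continuous (fun r => S (pos r) u0 x) by exact: (sg_eval_continuous hS).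
  apply: (measurableT_comp (continuous_measurable_fun cS)).
  apply: measurable_funM => //; apply: continuous_measurable_fun; exact: continuous_pos.
have i1 : (distribution P A).-integrable D (EFin \o (fun a => S (t `^ theta * pos a) u0 x)).
  apply: (@bounded_integrable _ _ _ _ _ _ `|u0|) => //; [exact: pfin|exact: measurable_funTS|].
  by move=> a _; rewrite (le_trans (C0_ler_norm _ _))//; exact: avg_law_norm.
have i0 : (distribution P A).-integrable D (EFin \o cst (u0 x)).
  by apply: (@bounded_integrable _ _ _ _ _ _ `|u0 x|) => //; exact: pfin.
rewrite (RintegralB _ i0 i1)// Rintegral_cst// [X in fine X](_ : _ = 1%E); last exact: law_D.
by rewrite mulr1 -(clock_avgE u0 x t0) opprB addrC subrK.
Qed.

End evolution.

Section final_laws.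
Context d (Om : measurableType d) (R : realType) (P : probability Om R).
Local Notation N := (@normal_prob R 0 1).

Lemma bounded_funP (f : R -> R) : bounded_fun f -> exists K, forall x, `|f x| <= K.
Proof.
move=> [M [Mr HM]]; exists (M + 1) => x.
by apply: (HM (M + 1)) => //; rewrite ltrDl.
Qed.

Let mpos : measurable_fun setT (@pos R).
Proof. by apply: continuous_measurable_fun; exact: continuous_pos. Qed.

Variables (C : Om -> R) (tau : R).
Hypothesis mC : measurable_fun setT C.
Hypothesis tau0 : 0 < tau.
Hypothesis C0 : {ae P, forall w, 0 <= C w}.

Let mQ : measurable_fun setT (fun w => pos (C w) * tau).
Proof. by apply: measurable_funM => //; exact: (measurableT_comp mpos). Qed.

Definition time_rv : {RV P >-> R} := mk_rv P mQ.

Lemma time_rv_ge0 w : 0 <= time_rv w.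
Proof. by rewrite /time_rv /= mulr_ge0 ?pos_ge0// ltW. Qed.

Lemma time_rvE : {ae P, forall w, C w * tau = time_rv w}.
Proof. by apply: filterS C0 => w h; rewrite /time_rv /= pos_id. Qed.

Lemma mixture_time_change (X : {RV P >-> R}) (B : R -> {RV P >-> R}) :
  brownian_motion B -> process_indep_rv P B C ->
  {ae P, forall w, X w = B (C w * tau) w} -> gauss_mixture P X time_rv.
Proof.
move=> bB ind XE.
have -> : (time_rv : Om -> R) = @pos R \o time_rv.
  by apply/funext => w; rewrite /= [in RHS]pos_id// time_rv_ge0.
apply: (mixture_subordinated bB).
- by apply: aeW => w; exact: time_rv_ge0.
- move=> s s0; have mh : measurable_fun setT (fun x : R => pos x * tau) by exact: measurable_funM.
  exact: (process_indep ind s0 (@measurable_id _ _ setT) mh).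
- by apply: filterS2 XE time_rvE => w -> ->.
Qed.

(** Only the law of B at one time [s] with variance [tau] enters: this covers Brownian motion at s =
    tau and fractional Brownian motion at s = t. *)
Lemma mixture_scale (X : {RV P >-> R}) (B : R -> {RV P >-> R}) (s : R) : 0 <= s ->
  process_indep_rv P B C ->
  (forall f : R -> \bar R, measurable_fun setT f -> (forall y, 0 <= f y)%E ->
    (\int[P]_w f (B s w) = \int[N]_z f (Num.sqrt tau * z)%R)%E) ->
  {ae P, forall w, X w = Num.sqrt (C w) * B s w} -> gauss_mixture P X time_rv.
Proof.
move=> s0 ind BE XE.
have mpC : measurable_fun setT (fun w => pos (C w)) by exact: (measurableT_comp mpos).
apply: (@mixture_scaled _ _ _ P X (B s) (mk_rv P mpC) tau tau0 BE).
  exact: (process_indep ind s0 (@measurable_id _ _ setT) mpos).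
by apply: filterS2 XE C0 => w -> h; rewrite /= pos_id.
Qed.

End final_laws.

Theorem proposition3p1 (R : realType)
    (d : measure_display) (Om : measurableType d) (P : probability Om R)
    (gamma theta : R) (k : R -> R -> R)
    (A : {RV P >-> R}) (eta : R -> {RV P >-> R})
    (w c : R) (sigma : R -> R) (u0 : C0fun R) (g : R -> R -> R)
    (X : R -> {RV P >-> R})
    (cA := fun om : Om => A om `^ gamma^-1 * eta 1 om)
    (tau := fun t : R => t `^ (theta / gamma)) :
  0 < gamma -> gamma <= 1 ->
  admissible k -> 0 < theta -> homogeneous (theta - 1) k -> cm_assumption k ->
  {ae P, forall om, 0 <= A om} ->
  (forall lam : R[i], 0 <= complex.Re lam ->
     cexpectation P (fun om => cexp (- lam * (A om)%:C%C)) = Phi k 1 (- lam)) ->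
  stable_subordinator gamma eta ->
  process_indep_rv P eta A ->
  c <= 0 ->
  C2 sigma -> bounded_fun sigma ->
  bounded_fun (derive1 sigma) -> bounded_fun (derive1n 2 sigma) ->
  L_dom sigma w u0 ->
  (forall y x : R, is_derive y (1 : R) (g ^~ x : R -> R) (sigma (g y x))) ->
  (forall x, g 0 x = x) ->
  [\/ exists B : R -> {RV P >-> R},
        [/\ brownian_motion B, process_indep_rv P B cA &
            forall t, 0 <= t ->
              {ae P, forall om, X t om = B (cA om * tau t) om}],
      exists B : R -> {RV P >-> R},
        [/\ brownian_motion B, process_indep_rv P B cA &
            forall t, 0 <= t ->
              {ae P, forall om, X t om = Num.sqrt (cA om) * B (tau t) om}] |
      0 < theta / (2 * gamma) < 1 /\
      exists B : R -> {RV P >-> R},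
        [/\ fractional_brownian_motion (theta / (2 * gamma)) B,
            process_indep_rv P B cA &
            forall t, 0 <= t ->
              {ae P, forall om, X t om = Num.sqrt (cA om) * B t om}]] ->
  exists u : R -> C0fun R,
    [/\ forall t x, 0 < t ->
          'E_P[(fun om => u0 (g (X t om + w * (cA om * tau t)) x)
                         * expR (c * (cA om * tau t)))%R]%E = (u t x)%:E,
        forall t x, 0 < t ->
          'E_P[(fun om => u0 (g (X t om) x)
                         * expR (cA om * tau t * (c - w ^+ 2 / 2) + w * X t om))%R]%E
          = (u t x)%:E &
        solves k (frac_power gamma (L_graph sigma w c)) u0 u].
Proof.
move=> gam0 gam1 hk theta0 kh _ A0 AL0 heta indA c0 sC2 sb0 sb1 sb2 Du0 gd g0 hX.
have [ds ds1 cs2] := is_derive_C2 sC2.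
have [K0 b0] := bounded_funP sb0; have [K1 b1] := bounded_funP sb1; have [K2 b2] := bounded_funP sb2.
have hT := flow_sg_semigroup w ds b0 b1 gd g0 c0.
have gT := flow_sg_generator w ds ds1 cs2 b0 b1 b2 gd g0 c0 erefl.
pose T := flow_sg g w c.
have mpos : measurable_fun setT (@pos R) by apply: continuous_measurable_fun; exact: continuous_pos.
have Z0 : {ae P, forall om, 0 <= eta 1 om}.
  have [h _ _ _] := heta; apply: filterS h => om [e0 emono _].
  by rewrite -e0; exact: emono.
have mA' : measurable_fun setT (fun om => pos (A om)) by exact: (measurableT_comp mpos).
have mZ' : measurable_fun setT (fun om => pos (eta 1 om)) by exact: (measurableT_comp mpos).
(* A and eta_1 are nonnegative almost surely only; their positive parts are nonnegative everywhere
   and have the same laws. *)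
pose A' := mk_rv P mA'; pose Z' := mk_rv P mZ'.
have A'0 om : 0 <= A' om by exact: pos_ge0.
have Z'0 om : 0 <= Z' om by exact: pos_ge0.
have AZ : indep_rv P Z' A' by exact: (process_indep indA ler01 mpos mpos).
have mexp (Y : Om -> R) (lam : R) : measurable_fun setT Y -> measurable_fun setT (fun om => (expR (- (lam * Y om)))%:E).
  move=> mY; apply/measurable_EFinP; apply: measurableT_comp => //; apply: measurableT_comp => //.
  exact: measurable_funM.
have ZL lam : 0 <= lam -> \int[P]_om expR (- (lam * Z' om)) = expR (- (lam `^ gamma)).
  move=> l0; have [_ _ _ h] := heta; have {}h := h 1 lam ler01 l0.
  rewrite unlock mul1r in h; rewrite /Rintegral (_ : (\int[P]_om _)%E = (expR (- lam `^ gamma))%:E)//.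
  rewrite -h; apply: ae_eq_integral => //; [exact: mexp|exact: mexp|].
  by apply: filterS Z0 => om h0 _; rewrite /Z' /= pos_id.
(* The complex Laplace transform is read at real [lam], where the exponent has imaginary part 0 and
   the real part of [cexp] is the real exponential. *)
have AL lam : 0 <= lam -> \int[P]_om expR (- (lam * A' om)) = kernel_fun k theta (- lam).
  move=> l0; rewrite -(Phi_real theta0 hk kh) rmorphN -AL0//= unlock /Rintegral; congr fine.
  apply: ae_eq_integral => //; first exact: mexp.
    have : measurable_fun setT (fun om => (expR (- (lam * A om)))%:E) by exact: mexp.
    by congr measurable_fun; apply/funext => om /=; rewrite !(mulr0, mul0r, oppr0, subr0, addr0) cos0 mulr1 mulNr.
  apply: filterS A0 => om h0 _.
  by rewrite /A' /= pos_id// !(mulr0, mul0r, oppr0, subr0, addr0) cos0 mulr1 mulNr.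
pose psi : C0fun R := mkC0 (L_fun sigma w u0) + c *: u0.
have Gu0 : L_graph sigma w c (u0, psi).
  split => // x; have [_ _ h] := Du0.
  by rewrite /psi /= -[(_ + _) x]/(mkC0 (L_fun sigma w u0) x + c * u0 x) mkC0E.
have gTu0 : generator T (u0, psi).
  exact: (L_graph_generator ds b0 b1 gd g0 c0 erefl Gu0).
have laws := @stable_law_laws _ _ _ P gamma Z' gam0 Z'0 ZL.
have [v' gv'] := subordinate_generator hT gam0 laws gTu0.
pose u t := clock_avg T gamma theta A' Z' t u0.
(* [frac_power] is the graph of (-L - c)^gamma, whereas the generator of the subordinate semigroup
   is its negative. *)
pose q : C0fun R := - v'.
pose v t := clock_avg T gamma theta A' Z' t q.
have mcA : measurable_fun setT cA.
  by apply: measurable_funM => //; exact: (measurableT_comp (measurable_powR _)).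
have cA0 : {ae P, forall om, 0 <= cA om}.
  by apply: filterS Z0 => om h; rewrite /cA mulr_ge0// powR_ge0.
have tau0 t : 0 < t -> 0 < tau t by move=> t0; exact: powR_gt0.
pose Q t := time_rv P (tau t) mcA.
have gm t : 0 < t -> gauss_mixture P (X t) (Q t).
  (* In the fractional case the variance t^(2 H) equals tau t, because 2 H = theta / gamma. *)
  move=> t0; case: hX => [[B [bB iB XE]]|[B [bB iB XE]]|[/andP[H0 H1] [B [bB iB XE]]]].
  - exact: (mixture_time_change mcA (tau0 t t0) cA0 bB iB (XE t (ltW t0))).
  - apply: (mixture_scale mcA (tau0 t t0) cA0 (ltW (tau0 t t0)) iB _ (XE t (ltW t0))).
    by move=> f mf f0; exact: (brownian_law bB (ltW (tau0 t t0)) mf f0).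
  - apply: (mixture_scale mcA (tau0 t t0) cA0 (ltW t0) iB _ (XE t (ltW t0))).
    move=> f mf f0; apply: (normal_law_integral (tau0 t t0) (measurable_funPT (B t)) _ mf f0).
    move=> U mU; rewrite (fbm_law bB H0 t0 mU) /tau; congr (normal_prob 0 (Num.sqrt (t `^ _)) U).
    by field; rewrite gt_eqF.
have QE t : 0 < t -> {ae P, forall om, cA om * tau t = Q t om}.
  by move=> t0; exact: time_rvE.
have Q0 t om : 0 < t -> 0 <= Q t om by move=> t0; apply: time_rv_ge0; exact: tau0.
(* Q t and the clock are two versions of cA tau(t): one takes the positive part of the product, the
   other those of the factors. They agree almost surely. *)
have uE t x : 0 < t -> (\int[P]_om T (Q t om) u0 x) = u t x.
  move=> t0; have clk0 om : 0 <= clock gamma theta A' Z' t om by exact: clock_ge0.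
  apply: (etrans _ (esym (avg_law hT u0 x clk0))).
  have mT : measurable_fun setT (fun s : R => T (pos s) u0 x).
    by apply: continuous_measurable_fun; exact: (sg_eval_continuous hT).
  have m1 : measurable_fun setT (fun om => (T (Q t om) u0 x)%:E).
    have : measurable_fun setT (fun om => (T (pos (Q t om)) u0 x)%:E).
      by apply/measurable_EFinP; exact: (measurableT_comp mT).
    by congr measurable_fun; apply/funext => om; rewrite [pos _]pos_id//; exact: Q0.
  have m2 : measurable_fun setT (fun om => (T (pos (clock gamma theta A' Z' t om)) u0 x)%:E).
    by apply/measurable_EFinP; exact: (measurableT_comp mT).
  suff E : (\int[P]_om (T (Q t om) u0 x)%:E =
      \int[P]_om (T (pos (clock gamma theta A' Z' t om)) u0 x)%:E)%E by exact: (congr1 fine E).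
  apply: ae_eq_integral; [exact: measurableT|exact: m1|exact: m2|].
  apply: filterS3 A0 Z0 cA0 => om a0 z0 h _; rewrite [pos (clock _ _ _ _ _ _)]pos_id; last exact: clk0.
  apply: (congr1 (fun r => (T r u0 x)%:E)).
  by rewrite /Q /time_rv /clock /= /cA !pos_id ?(ltW t0)// mulrC.
have mg x : measurable_fun setT (g ^~ x).
  by apply: continuous_measurable_fun; exact: (flow_time_continuous gd).
have mu0 : measurable_fun setT u0 by apply: continuous_measurable_fun; exact: C0_continuous.
exists u; split.
- move=> t x t0; rewrite unlock -(uE t x t0).
  apply: (etrans _ (value_drift w ds b0 b1 gd g0 c0 (gm t t0) (fun om => Q0 t om t0) u0 x)).
  apply: ae_eq_integral; first exact: measurableT.
  + apply/measurable_EFinP; apply: measurable_funM.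
      apply: (measurableT_comp mu0); apply: (measurableT_comp (mg x)).
      by apply: measurable_funD => //; apply: measurable_funM => //; exact: measurable_funM.
    apply: measurableT_comp => //; apply: measurable_funM => //; exact: measurable_funM.
  + apply/measurable_EFinP; apply: measurable_funM.
      apply: (measurableT_comp mu0); apply: (measurableT_comp (mg x)).
      by apply: measurable_funD => //; exact: measurable_funM.
    by apply: measurableT_comp => //; exact: measurable_funM.
  by apply: filterS (QE t t0) => om -> _.
- move=> t x t0; rewrite unlock -(uE t x t0).
  apply: (etrans _ (value_girsanov w ds b0 b1 gd g0 c0 (gm t t0) (fun om => Q0 t om t0) u0 x)).
  apply: ae_eq_integral; first exact: measurableT.
  + apply/measurable_EFinP; apply: measurable_funM.
      by apply: (measurableT_comp mu0); exact: (measurableT_comp (mg x)).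
    apply: measurableT_comp => //; apply: measurable_funD; last exact: measurable_funM.
    by apply: measurable_funM => //; exact: measurable_funM.
  + apply/measurable_EFinP; apply: measurable_funM.
      by apply: (measurableT_comp mu0); exact: (measurableT_comp (mg x)).
    by apply: measurableT_comp => //; apply: measurable_funD; exact: measurable_funM.
  by apply: filterS (QE t t0) => om -> _.
exists v; split.
- move=> t t0; exists T, (stable_law gamma Z'), (fun r => avg T (stable_law gamma Z' r)); split => //.
  + move=> r p r0; apply: (@is_bochner_ext _ _ _ _ _ _ (fun s => T (pos s) p)).
      by move=> s; rewrite /= in_itv/= andbT => s0; rewrite pos_id.
    apply: (avg_bochner hT); by rewrite (le_lt_trans (probability_le1 _ _))// ltry.
  (* Averaging over the clock commutes with S, so it maps the pair (u0, v') of the generator to the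
     pair (u t, - v t). *)
  + have vE : clock_avg T gamma theta A' Z' t v' = - v t.
      by rewrite /v /q -[- v']scaleN1r /clock_avg (linear_funZ _ _ (avg_law_linear hT _)) scaleN1r opprK.
    by rewrite /= -vE; exact: (@clock_avg_generator _ _ _ _ _ _ theta A' _ hT t _ _ gv').
- move=> t t0; have gq : generator (fun r => avg T (stable_law gamma Z' r)) (u0, - q).
    by rewrite opprK.
  exact: (evolution_equation hT gam0 theta0 hk kh A'0 Z'0 AZ ZL AL gq t0).
Qed.
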